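(* Let $k\ge1$ be an integer. Assume that the exact solution of the Einstein--scalar system described in the context satisfies $$u\in L^\infty(0,T;W^{k+1,\infty}(0,b))\quad\text{and}\quad u_t\in L^\infty(0,T;H^{k+1}(0,b)),$$ and let $(u_h,w_h,g_h,z_h)$, together with $\tilde u_h,\tilde g_h$, be given by the semidiscrete HDG solution on $[0,T]$ with boundary datum $U_b$ and initial data $u_h(0)=\Pi u(0)$. Then there exist $h_0>0$ and $C>0$, independent of $h$, such that for all $0<h\le h_0$, $$\sup_{0\le t\le T}\Bigl(\|w(t)-w_h(t)\|_{L^\infty(0,b)}+\|z(t)-z_h(t)\|_{L^\infty(0,b)}+\|g(t)-g_h(t)\|_{L^\infty(0,b)}+\|\tilde g(t)-\tilde g_h(t)\|_{L^\infty(0,b)}+\|\tilde u(t)-\tilde u_h(t)\|_{\mathcal T_h}\Bigr)\le Ch^{k+1}.$$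
   Context: Exact system. Let $b>0$, $T>0$. The exact solution $(u,w,g,z)$ on $[0,T]\times[0,b]$ satisfies $$u_t-\bigl(\tfrac12\tilde g\,u\bigr)_r=-\tfrac12\tilde g_r\,\tilde u,\qquad w_r=u,\qquad g_r=\tfrac1r\,g\,(u-\tilde u)^2,\qquad z_r=g,$$ with $\tilde u=w/r$, $\tilde g=z/r$ for $r>0$, center conditions $w(t,0)=0$, $z(t,0)=0$, and outer conditions $u(t,b)=U_b(t)$, $g(t,b)=1$. Equivalently $\tilde u(r)=\frac1r\int_0^ru\,ds$, $\tilde g(r)=\frac1r\int_0^rg\,ds$, $g(r)=\exp(-\int_r^b\frac1s(u-\tilde u)^2ds)$. Mesh and spaces. Let $0=r_0<r_1<\dots<r_N=b$ be a partition of $[0,b]$, $I_i=(r_{i-1},r_i)$, $h_i=r_i-r_{i-1}$, $h=\max_ih_i$, $\mathcal T_h=\{I_i\}_{i=1}^N$. $P^k(I_i)$ denotes polynomials of degree at most $k$ on $I_i$ and $V_h^k=\{v\in L^2(0,b):v|_{I_i}\in P^k(I_i),\ i=1,\dots,N\}$. The value $v|_{I_i}(r_j)$, $j\in\{i-1,i\}$, is taken from within $I_i$. Write $(v_1,v_2)_{I_i}=\int_{I_i}v_1v_2\,dr$, $\|v\|_{\mathcal T_h}^2=\sum_i(v,v)_{I_i}$, $\langle\psi,\eta\,n\rangle_{\partial I_i}=\psi(r_i)\eta(r_i)-\psi(r_{i-1})\eta(r_{i-1})$ with values from within $I_i$. $r$-derivatives of broken functions are taken elementwise. Projection. On each $I_i$,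 $\Pi u\in P^k(I_i)$ is the Gauss--Radau projection defined by $(\Pi u-u,v)_{I_i}=0$ for all $v\in P^{k-1}(I_i)$ and $(\Pi u)(r_{i-1})=u(r_{i-1})$. Semidiscrete HDG scheme with boundary datum $U_b$: find $u_h\in C^1([0,T];V_h^k)$ with the prescribed initial value and, for each $t$, trace values $\widehat u_h,\widehat g_h$ at $r_1,\dots,r_N$ and $\widehat w_h,\widehat z_h$ at $r_0,\dots,r_{N-1}$, such that at each $t$: (1) on each $I_i$, $w_h(r)=\widehat w_h(r_{i-1})+\int_{r_{i-1}}^ru_h\,ds$, $g_h(r)=\widehat g_h(r_i)\exp(-\int_r^{r_i}\frac1s(u_h-\tilde u_h)^2ds)$, $z_h(r)=\widehat z_h(r_{i-1})+\int_{r_{i-1}}^rg_h\,ds$, where $\tilde u_h=w_h/r$, $\tilde g_h=z_h/r$ for $r>0$, $\tilde u_h(0):=u_h(0)$, $\tilde g_h(0):=g_h(0)$; (2) for all $i$ and all $\phi_u\in P^k(I_i)$, $$\bigl((u_h)_t,\phi_u\bigr)_{I_i}+\bigl(\tfrac12\tilde g_hu_h,(\phi_u)_r\bigr)_{I_i}-\langle\widehat{\mathcal F}_{u,h},\phi_u\,n\rangle_{\partial I_i}+\bigl(\tfrac12(\tilde g_h)_r\tilde u_h,\phi_u\bigr)_{I_i}=0,$$ with flux on $I_i$: $\widehat{\mathcal F}_{u,h}(r_i)=\tfrac12\tilde g_h(r_i)\widehat u_h(r_i)$, $\widehat{\mathcal F}_{u,h}(r_{i-1})=\tfrac12\tilde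 g_h(r_{i-1})u_h(r_{i-1})$ (from within $I_i$); (3) for $i=1,\dots,N-1$, each of $\widehat{\mathcal F}_{u,h},w_h,z_h,g_h$ takes the same value at $r_i$ from $I_i$ and from $I_{i+1}$; (4) $\widehat u_h(t,b)=U_b(t)$, $\widehat g_h(t,b)=1$, $\widehat w_h(t,0)=0$, $\widehat z_h(t,0)=0$. (This scheme has a unique solution on $[0,T]$ for continuous $U_b$.) *)

(* Defs.v *)
From HB Require Import structures.
From mathcomp Require Import all_boot all_order all_algebra.
From mathcomp Require Import all_classical all_reals all_analysis.
From mathcomp Require Import ess_sup_inf.

Set Implicit Arguments.
Unset Strict Implicit.
Unset Printing Implicit Defensive.

Import Order.TTheory GRing.Theory Num.Theory.
Import numFieldNormedType.Exports.

Local Open Scope classical_set_scope.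
Local Open Scope ring_scope.

Local Notation mu := lebesgue_measure.

(** Functions on a real interval are represented by total functions [R -> R];
    values outside the interval never matter.  Elements of Lebesgue, Sobolev
    and Bochner spaces are represented by functions rather than by classes:
    all the notions below are invariant under a.e. modification. *)

(** * Lebesgue, Sobolev and Bochner spaces on bounded intervals *)

Definition Lp_norm (R : realType) (a c : R) (p : \bar R) (f : R -> R) : \bar R :=
  ('N[mu]_p[EFin \o (f \_ `]a, c[)])%E.

Definition in_Lp (R : realType) (a c : R) (p : \bar R) (f : R -> R) : Prop :=
  measurable_fun `]a, c[ f /\ (Lp_norm a c p f < +oo)%E.

Definition test_function (R : realType) (a c : R) (phi : R -> R) : Prop :=
  (forall n x, derivable (derive1n n phi) x 1) /\
  (exists a' c' : R, [/\ a < a', c' < c &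
     forall x, x \notin `[a', c'] -> phi x = 0]).

(** [v] is the [j]-th weak derivative of [f] on [(a, c)]. *)
Definition is_weak_derivative (R : realType) (a c : R) (j : nat)
    (f v : R -> R) : Prop :=
  [/\ locally_integrable `]a, c[ f, locally_integrable `]a, c[ v &
   forall phi, test_function a c phi ->
     \int[mu]_(x in `]a, c[) (f x * derive1n j phi x) =
     (-1) ^+ j * \int[mu]_(x in `]a, c[) (v x * phi x)].

(** A representative of the weak derivative, when there is one. *)
Definition weak_derivative (R : realType) (a c : R) (j : nat) (f : R -> R)
  : R -> R := get [set v | is_weak_derivative a c j f v].

(** [W^{m,p}(a, c)], and [H^m(a, c)] for [p = 2]. *)
Definition sobolev (R : realType) (a c : R) (m : nat) (p : \bar R)
  : set (R -> R) :=
  [set f | forall j, (j <= m)%N ->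
     exists2 v, is_weak_derivative a c j f v & in_Lp a c p v].

(** The sum of the [L^p] norms of the derivatives; it is equivalent to the
    other usual norms of [W^{m,p}].  Meaningful on [sobolev a c m p] only. *)
Definition sobolev_norm (R : realType) (a c : R) (m : nat) (p : \bar R)
    (f : R -> R) : \bar R :=
  (\sum_(j < m.+1) Lp_norm a c p (weak_derivative a c j f))%E.

(** Strong (Bochner) measurability of [f : (0, T) -> X], where the normed space
    [X] is a set of functions with norm [nX]: [f] is an a.e. limit, for the norm
    of [X], of simple functions [t |-> \sum_l 1_(A l)(t) x_l]. *)
Definition simple_valued (R : realType) (T : R) (X : set (R -> R))
    (s : R -> R -> R) : Prop :=
  exists (n : nat) (A : 'I_n -> set R) (x : 'I_n -> R -> R),
    [/\ forall l, measurable (A l), forall l, X (x l) &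
      forall t y, t \in `]0, T[ -> s t y = \sum_(l < n) \1_(A l) t * x l y].

Definition strongly_measurable (R : realType) (T : R) (X : set (R -> R))
    (nX : (R -> R) -> \bar R) (f : R -> R -> R) : Prop :=
  exists s : nat -> R -> R -> R,
    (forall n, simple_valued T X (s n)) /\
    {ae mu, forall t, t \in `]0, T[ ->
       (fun n => nX (s n t \- f t)) @ \oo --> 0%E}.

(** [f \in L^oo(0, T; X)] *)
Definition in_Linfty_bochner (R : realType) (T : R) (X : set (R -> R))
    (nX : (R -> R) -> \bar R) (f : R -> R -> R) : Prop :=
  [/\ {ae mu, forall t, t \in `]0, T[ -> X (f t)},
      strongly_measurable T X nX f &
      (ess_sup mu ((fun t : R => nX (f t)) \_ `]0, T[)%R < +oo)%E].

Definition in_Linfty_sobolev (R : realType) (T b : R) (m : nat) (p : \bar R)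
    (f : R -> R -> R) : Prop :=
  in_Linfty_bochner T (sobolev 0 b m p) (sobolev_norm 0 b m p) f.

(** * The exact system *)

(** Functions of time [t] and radius [x] are applied as [f t x].
    [avg w] is [w / r]: [avg w] is u-tilde and [avg z] is g-tilde. *)
Definition avg (R : realType) (w : R -> R -> R) : R -> R -> R :=
  fun t x => w t x / x.

Definition dt (R : realType) (u : R -> R -> R) : R -> R -> R :=
  fun t x => derive1 (u^~ x) t.

Definition dr (R : realType) (u : R -> R -> R) : R -> R -> R :=
  fun t x => derive1 (u t) x.

(** A classical solution: the differential equations hold at interior points
    and the unknowns are continuous up to the boundary. *)
Record exact_solution (R : realType) (b T : R) (Ub : R -> R)
    (u w g z : R -> R -> R) : Prop := ExactSolution {
  exact_u_continuous :
    {within `[0, T] `*` `[0, b], continuous (fun p : R * R => u p.1 p.2)};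
  exact_w_continuous :
    forall t, t \in `[0, T] -> {within `[0, b], continuous (w t)};
  exact_g_continuous :
    forall t, t \in `[0, T] -> {within `[0, b], continuous (g t)};
  exact_z_continuous :
    forall t, t \in `[0, T] -> {within `[0, b], continuous (z t)};
  exact_u_equation : forall t x, t \in `]0, T[ -> x \in `]0, b[ ->
    let flux := fun s y => 2^-1 * avg z s y * u s y in
    [/\ derivable (u^~ x) t 1, derivable (flux t) x 1 &
      dt u t x - dr flux t x = - (2^-1 * dr (avg z) t x * avg w t x)];
  exact_w_equation : forall t x, t \in `[0, T] -> x \in `]0, b[ ->
    is_derive x 1 (w t) (u t x);
  exact_g_equation : forall t x, t \in `[0, T] -> x \in `]0, b[ ->
    is_derive x 1 (g t) (x^-1 * g t x * (u t x - avg w t x) ^+ 2);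
  exact_z_equation : forall t x, t \in `[0, T] -> x \in `]0, b[ ->
    is_derive x 1 (z t) (g t x);
  exact_w_center : forall t, t \in `[0, T] -> w t 0 = 0;
  exact_z_center : forall t, t \in `[0, T] -> z t 0 = 0;
  exact_u_outer : forall t, t \in `[0, T] -> u t b = Ub t;
  exact_g_outer : forall t, t \in `[0, T] -> g t b = 1 }.

(** * Meshes, broken functions and the Gauss-Radau projection *)

(** The mesh has nodes [r 0 < ... < r N]; for [i < N], element [i] is
    [(r i, r i.+1)] (zero-based).  Other values of [r] are irrelevant. *)
Definition mesh (R : realType) (b : R) (N : nat) (r : nat -> R) : Prop :=
  [/\ r 0%N = 0, r N = b & forall i, (i < N)%N -> r i < r i.+1].

Definition mesh_size (R : realType) (N : nat) (r : nat -> R) : R :=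
  \big[Num.max/0]_(i < N) (r i.+1 - r i).

(** A broken function is a family [v] of functions, [v i] being its restriction
    to the closed element [i], so that values at nodes are taken from within.
    [broken_fun] is the resulting function on [(0, b)] off the interior nodes. *)
Definition broken_fun (R : realType) (N : nat) (r : nat -> R) (v : nat -> R -> R)
  : R -> R :=
  fun x => \sum_(i < N) (v i \_ `]r i, r i.+1[) x.

Definition mesh_norm (R : realType) (N : nat) (r : nat -> R)
    (v : nat -> R -> R) : \bar R :=
  sqrte (\sum_(i < N) \int[mu]_(x in `]r i, r i.+1[) (v i x ^+ 2)%:E)%E.

(** [p] is the Gauss-Radau projection of [f] onto [P^k(a, c)]; recall that
    [size p] is the degree of [p] plus one. *)
Definition gauss_radau (R : realType) (k : nat) (a c : R) (f : R -> R)
    (p : {poly R}) : Prop :=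
  [/\ (size p <= k.+1)%N,
      forall v : {poly R}, (size v <= k)%N ->
        \int[mu]_(x in `]a, c[) ((p.[x] - f x) * v.[x]) = 0 &
      p.[a] = f a].

(** * The semidiscrete HDG scheme *)

(** [uh t i] is the polynomial u_h(t) on element [i], and [uh_t] is its time
    derivative.  The traces [uhat t j], etc. are indexed by the node [r j]:
    [uhat], [ghat] are used for [1 <= j <= N], [what], [zhat] for [j < N]. *)
Record hdg_unknowns (R : realType) := HDGUnknowns {
  uh : R -> nat -> {poly R};
  uh_t : R -> nat -> {poly R};
  uhat : R -> nat -> R;
  ghat : R -> nat -> R;
  what : R -> nat -> R;
  zhat : R -> nat -> R }.

Definition wh (R : realType) (r : nat -> R) (s : hdg_unknowns R) (t : R)
    (i : nat) (x : R) : R :=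
  what s t i + \int[mu]_(y in `[r i, x]) (uh s t i).[y].

Definition utildeh (R : realType) (r : nat -> R) (s : hdg_unknowns R) (t : R)
    (i : nat) (x : R) : R :=
  if x == 0 then (uh s t i).[x] else wh r s t i x / x.

Definition gh (R : realType) (r : nat -> R) (s : hdg_unknowns R) (t : R)
    (i : nat) (x : R) : R :=
  ghat s t i.+1 *
  expR (- \int[mu]_(y in `[x, r i.+1])
            (y^-1 * ((uh s t i).[y] - utildeh r s t i y) ^+ 2)).

Definition zh (R : realType) (r : nat -> R) (s : hdg_unknowns R) (t : R)
    (i : nat) (x : R) : R :=
  zhat s t i + \int[mu]_(y in `[r i, x]) gh r s t i y.

Definition gtildeh (R : realType) (r : nat -> R) (s : hdg_unknowns R) (t : R)
    (i : nat) (x : R) : R :=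
  if x == 0 then gh r s t i x else zh r s t i x / x.

(** The numerical flux on element [i] at its left end [r i] and at its right
    end [r i.+1]. *)
Definition flux_left (R : realType) (r : nat -> R) (s : hdg_unknowns R) (t : R)
    (i : nat) : R :=
  2^-1 * gtildeh r s t i (r i) * (uh s t i).[r i].

Definition flux_right (R : realType) (r : nat -> R) (s : hdg_unknowns R) (t : R)
    (i : nat) : R :=
  2^-1 * gtildeh r s t i (r i.+1) * uhat s t i.+1.

(** [f] is C^1 on [[0, T]] with derivative [f'], one-sided at the end points. *)
Definition C1_with_derivative (R : realType) (T : R) (f f' : R -> R) : Prop :=
  [/\ {within `[0, T], continuous f}, {within `[0, T], continuous f'} &
      forall t, t \in `]0, T[ -> is_derive t 1 f (f' t)].

Record hdg_solution (R : realType) (k : nat) (b T : R) (Ub : R -> R) (N : nat)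
    (r : nat -> R) (s : hdg_unknowns R) : Prop := HDGSolution {
  hdg_degree : forall t i, t \in `[0, T] -> (i < N)%N ->
    (size (uh s t i) <= k.+1)%N /\ (size (uh_t s t i) <= k.+1)%N;
  hdg_C1 : forall i j, (i < N)%N -> (j <= k)%N ->
    C1_with_derivative T (fun t => (uh s t i)`_j) (fun t => (uh_t s t i)`_j);
  hdg_equation : forall t i (phi : {poly R}),
    t \in `[0, T] -> (i < N)%N -> (size phi <= k.+1)%N ->
    \int[mu]_(x in `]r i, r i.+1[) ((uh_t s t i).[x] * phi.[x])
    + \int[mu]_(x in `]r i, r i.+1[)
        (2^-1 * gtildeh r s t i x * (uh s t i).[x] * (deriv phi).[x])
    - (flux_right r s t i * phi.[r i.+1] - flux_left r s t i * phi.[r i])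
    + \int[mu]_(x in `]r i, r i.+1[)
        (2^-1 * derive1 (gtildeh r s t i) x * utildeh r s t i x * phi.[x])
    = 0;
  hdg_interface : forall t i, t \in `[0, T] -> (i.+1 < N)%N ->
    [/\ flux_right r s t i = flux_left r s t i.+1,
        wh r s t i (r i.+1) = wh r s t i.+1 (r i.+1),
        zh r s t i (r i.+1) = zh r s t i.+1 (r i.+1) &
        gh r s t i (r i.+1) = gh r s t i.+1 (r i.+1)];
  hdg_boundary : forall t, t \in `[0, T] ->
    [/\ uhat s t N = Ub t, ghat s t N = 1, what s t 0%N = 0 &
        zhat s t 0%N = 0] }.

Definition hdg_initial (R : realType) (k : nat) (N : nat) (r : nat -> R)
    (u : R -> R -> R) (s : hdg_unknowns R) : Prop :=
  forall i, (i < N)%N -> gauss_radau k (r i) (r i.+1) (u 0) (uh s 0 i).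

Definition hdg_error (R : realType) (b : R) (N : nat) (r : nat -> R)
    (w g z : R -> R -> R) (s : hdg_unknowns R) (t : R) : \bar R :=
  (Lp_norm 0 b +oo (w t \- broken_fun N r (wh r s t))%R
   + Lp_norm 0 b +oo (z t \- broken_fun N r (zh r s t))%R
   + Lp_norm 0 b +oo (g t \- broken_fun N r (gh r s t))%R
   + Lp_norm 0 b +oo (avg z t \- broken_fun N r (gtildeh r s t))%R
   + mesh_norm N r (fun i => (avg w t \- utildeh r s t i)%R))%E.

(* Main.v *)
(** Write [av f x = 1/x \int_0^x f], [X f = f - av f], [K f] for the L2 norm of
    [X f / x] and [gg f x = exp (- \int_x^b (X f)^2 / s)].  The exact and the
    discrete solution have the same structure: [g = gg u], [z = \int_0 gg u],
    and [gg] is Lipschitz in L2 with constant [K], so that everything reduces to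
    the estimate [|u - u_h|_{L2} <= C h^{k+1}] together with a bound of [K u_h].

    As long as [K u_h] is bounded, Gronwall's inequality for [e = Pi u - u_h]
    gives the optimal rate: the trace of [u - Pi u] vanishes at left end points,
    so that only volume terms remain.

    The mesh need not be quasi-uniform, so [K u_h] cannot be bounded by an
    inverse inequality.  A broken Hardy inequality gives [K e <= C D], where
    [D^2] sums the squared L2 norms of [e'] on the elements and the jumps squared
    divided by [h_i]; and testing the scheme with weighted copies of [e'] and with
    the jumps bounds [D] by the L2 norm of the time derivative of [P u - u_h],
    [P] being the L2 projection.  The latter is estimated by Gronwall's inequality
    for the difference quotients in time of [P u - u_h], which needs no second time
    derivative of [u].  The outcome is [D^2 <= O(h) + (1/2) sup D^2] in a norm
    weighted exponentially in time, and a continuity argument in time closes it.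

    The pointwise regularity of [u] that is needed follows from the weak Sobolev
    assumptions by du Bois-Reymond's lemma and Taylor's formula at almost every
    time, extended to all times by continuity. *)
Require Import Defs.
From HB Require Import structures.
From mathcomp Require Import all_boot all_order all_algebra.
From mathcomp Require Import all_classical all_reals all_analysis.
From mathcomp Require Import measurable_realfun ess_sup_inf ring lra.
Import Order.TTheory GRing.Theory Num.Theory.
Import numFieldNormedType.Exports.
Local Open Scope classical_set_scope.
Local Open Scope ring_scope.

(** * Integrals of bounded measurable functions *)

Local Notation mu := lebesgue_measure.

(** The two error estimates use different projections on purpose. For the rate, Gauss--Radau is
    right: its error has no upwind trace. For the time derivative it would leave the residual u_t -
    Pi u_t, whose difference in time calls for u_tt; the L2 projection makes this residual
    orthogonal to all test functions. The price is a nonzero trace at left end points, absorbed by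
    the jump dissipation at the cost of one power of h. Hence D^2 = O(h) only, which suffices,
    because only D <= 1 is needed. D enters its own estimate since the coefficient g-tilde of the
    scheme depends on u_h: its increment in time multiplies the derivative of the error. The result
    is of Volterra type, D(t)^2 <= O(h) + C times the integral of D^2, and a weight exp(lam t) with
    large lam reduces the factor to 1/2. Increments in time of the error in gg are second
    differences. They are estimated as such, since first differences would lose the factor tau or
    the factor h. Differences of the derivative of g-tilde are controlled in the sup norm only after
    multiplication by r, so each of them has to meet a function that vanishes at the centre or the
    norm K. *)

Variant bm {R : realType} (a c : R) (f : R -> R) : Prop :=
  Bm of measurable_fun (`]a, c[%classic : set R) f & exists M, forall x, a < x < c -> `|f x| <= M.

(* Locking keeps failing unifications from unfolding the Lebesgue integral. *)
Fact itg_key : unit. Proof. exact: tt. Qed.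

Definition itg {R : realType} : R -> R -> (R -> R) -> R :=
  locked_with itg_key (fun a c f => \int[mu]_(x in `]a, c[) f x).

Lemma eq_ler {d : Order.disp_t} {T : porderType d} {x y : T} : x = y -> (x <= y)%O.
Proof. by move=> ->. Qed.

Section Integral.
Context {R : realType}.
Implicit Types (a b c x y M : R) (f g : R -> R).

(** The class [bm] is stable under sums, products and restriction, so that linearity and splitting
    of [itg] only leave structural side conditions. *)
Lemma bm_integrable {a c f} : bm a c f ->
  mu.-integrable (`]a, c[%classic : set R) (EFin \o f).
Proof.
move=> [mf [M fM]]; apply: measurable_bounded_integrable => //.
  by rewrite /= lebesgue_measure_itv/=; case: ifP => _ //; rewrite -EFinB ltry.
exists `|M|; split; first exact: num_real.
move=> z Mz x /= xac; apply: (le_trans (fM x _)).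
  by move: xac; rewrite in_itv.
by apply: (le_trans (ler_norm _)); exact: ltW.
Qed.

Lemma bmS {a c} x y {f} : a <= x -> y <= c -> bm a c f -> bm x y f.
Proof.
move=> ax yc [mf [M fM]]; split.
  apply: measurable_funS mf => //.
  by apply: subset_itv; rewrite bnd_simp.
exists M => z /andP[xz zy]; apply: fM.
by rewrite (le_lt_trans ax xz) (lt_le_trans zy yc).
Qed.

Lemma bm_ext {a c} f {g} : (forall x, a < x < c -> f x = g x) -> bm a c f -> bm a c g.
Proof.
move=> fg [mf [M fM]]; split.
  apply: (eq_measurable_fun _ _ mf) => x; rewrite inE/= in_itv/= => xac.
  exact: fg.
by exists M => x xac; rewrite -fg// fM.
Qed.

Lemma bm_cst a c k : bm a c (fun _ => k).
Proof. by split; [exact: measurable_cst | exists `|k|]. Qed.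

Lemma bmD a c f g : bm a c f -> bm a c g -> bm a c (fun x => f x + g x).
Proof.
move=> [mf [M fM]] [mg [N gN]]; split; first exact: measurable_funD.
by exists (M + N) => x xac; apply: (le_trans (ler_normD _ _)); rewrite lerD ?fM ?gN.
Qed.

Lemma bmM a c f g : bm a c f -> bm a c g -> bm a c (fun x => f x * g x).
Proof.
move=> [mf [M fM]] [mg [N gN]]; split; first exact: measurable_funM.
by exists (M * N) => x xac; rewrite normrM ler_pM ?fM ?gN.
Qed.

Lemma bmN a c f : bm a c f -> bm a c (fun x => - f x).
Proof.
move=> [mf [M fM]]; split; first exact: measurableT_comp.
by exists M => x xac; rewrite normrN fM.
Qed.

Lemma bmB a c f g : bm a c f -> bm a c g -> bm a c (fun x => f x - g x).
Proof. by move=> hf hg; apply: bmD => //; exact: bmN. Qed.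

Lemma bm_norm a c f : bm a c f -> bm a c (fun x => `|f x|).
Proof.
move=> [mf [M fM]]; split; first exact: measurableT_comp.
by exists M => x xac; rewrite normr_id fM.
Qed.

Lemma bmX a c f n : bm a c f -> bm a c (fun x => f x ^+ n).
Proof.
move=> hf; elim: n => [|n ih].
  by apply: (bm_ext (fun _ => 1)); [move=> x _; rewrite expr0 | exact: bm_cst].
apply: (bm_ext (fun x => f x * f x ^+ n)); last exact: bmM.
by move=> x _; rewrite exprS.
Qed.

Lemma bm_bounded {a c f} : bm a c f ->
  exists2 M : R, 0 <= M & forall x, a < x < c -> `|f x| <= M.
Proof.
move=> [_ [M fM]]; exists `|M| => // x xac.
exact: (le_trans (fM x xac) (ler_norm _)).
Qed.

Lemma bm_cont a c f M : (forall x, a < x < c -> {for x, continuous f}) ->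
  (forall x, a < x < c -> `|f x| <= M) -> bm a c f.
Proof.
move=> cf fM; split; last by exists M.
apply: open_continuous_measurable_fun; first exact: interval_open.
by move=> x; rewrite inE/= in_itv/=; exact: cf.
Qed.

Lemma within_bounded a c f : a <= c -> {within `[a, c], continuous f} ->
  exists2 M : R, 0 <= M & forall x, a <= x <= c -> `|f x| <= M.
Proof.
move=> ac cf.
have [x1 _ h1] := EVT_max ac cf; have [x2 _ h2] := EVT_min ac cf.
exists (`|f x1| + `|f x2|); first exact: addr_ge0.
move=> x xac; have := h1 x; have := h2 x; rewrite in_itv/= xac => /(_ isT) + /(_ isT).
move=> l2 l1; rewrite ler_norml; apply/andP; split.
  rewrite lerNl; apply: (le_trans (y := - f x2)); first by rewrite lerN2.
  by apply: (le_trans (ler_norm _)); rewrite normrN lerDr.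
by apply: (le_trans l1); apply: (le_trans (ler_norm _)); rewrite lerDl.
Qed.

Lemma within_bm a c f : {within `[a, c], continuous f} -> bm a c f.
Proof.
move=> cf; have [ac|ca] := leP a c; last first.
  split; first by rewrite set_itv_ge ?bnd_simp -?leNgt ?ltW//; exact: measurable_fun_set0.
  by exists 0 => x /andP[ax xc]; have := lt_trans (lt_trans ca ax) xc; rewrite ltxx.
split.
  apply: (@measurable_funS _ _ _ _ (`[a, c]%classic : set R)) => //.
    by apply: subset_itv; rewrite bnd_simp.
  apply: subspace_continuous_measurable_fun => //.
have [M _ fM] := within_bounded _ _ _ ac cf.
by exists M => x /andP[ax xc]; rewrite fM// !ltW.
Qed.

Lemma itgE a c f : itg a c f = \int[mu]_(x in `]a, c[) f x.
Proof. by rewrite /itg unlock. Qed.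

Lemma itg_ge a c f : c <= a -> itg a c f = 0.
Proof.
by move=> ca; rewrite itgE set_itv_ge ?Rintegral_set0// bnd_simp -leNgt.
Qed.

Lemma eq_itg {a c f} g : (forall x, a < x < c -> f x = g x) -> itg a c f = itg a c g.
Proof.
move=> fg; rewrite !itgE; apply: eq_Rintegral => x; rewrite inE/= in_itv/=; exact: fg.
Qed.

Lemma itgD {a c f g} : bm a c f -> bm a c g ->
  itg a c (fun x => f x + g x) = itg a c f + itg a c g.
Proof. by move=> hf hg; rewrite !itgE; apply: RintegralD => //; [exact: (bm_integrable hf)|exact: (bm_integrable hg)]. Qed.

Lemma itgB {a c f g} : bm a c f -> bm a c g ->
  itg a c (fun x => f x - g x) = itg a c f - itg a c g.
Proof. by move=> hf hg; rewrite !itgE; apply: RintegralB => //; [exact: (bm_integrable hf)|exact: (bm_integrable hg)]. Qed.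

Lemma itgZl {a c f} k : bm a c f -> itg a c (fun x => k * f x) = k * itg a c f.
Proof. by move=> hf; rewrite !itgE; apply: RintegralZl => //; exact: bm_integrable. Qed.

Lemma itg_cst {a c} k : a <= c -> itg a c (fun _ => k) = k * (c - a).
Proof.
move=> ac; rewrite itgE Rintegral_cst//=; congr (_ * _).
rewrite /= lebesgue_measure_itv/= lte_fin; case: ltP => //= ca.
by apply/eqP; rewrite eq_sym subr_eq0 eq_le ca ac.
Qed.

Lemma itg0 a c : itg a c (fun _ => 0) = 0.
Proof.
have [ac|ca] := leP a c; first by rewrite itg_cst// mul0r.
by rewrite itg_ge// ltW.
Qed.

Lemma itg_sum {a c n} (F : 'I_n -> R -> R) : (forall i, bm a c (F i)) ->
  bm a c (fun x => \sum_(i < n) F i x) /\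
  itg a c (fun x => \sum_(i < n) F i x) = \sum_(i < n) itg a c (F i).
Proof.
elim: n F => [|n ih] F hF.
  split; first by apply: (bm_ext (fun _ => 0)); [move=> x _; rewrite big_ord0 | exact: bm_cst].
  by rewrite big_ord0 -[RHS](itg0 a c); apply: eq_itg => x _; rewrite big_ord0.
have [h1 h2] := ih (fun i => F (widen_ord (leqnSn n) i)) (fun i => hF _).
have h : forall x, a < x < c -> \sum_(i < n) F (widen_ord (leqnSn n) i) x + F ord_max x =
  \sum_(i < n.+1) F i x by move=> x _; rewrite big_ord_recr.
split; first by apply: (bm_ext _ h); exact: bmD.
by rewrite -(eq_itg _ h) itgD// h2 big_ord_recr.
Qed.

Lemma itg_ge0 {a c f} : (forall x, a < x < c -> 0 <= f x) -> 0 <= itg a c f.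
Proof. by move=> f0; rewrite itgE; apply: Rintegral_ge0 => x /=; rewrite in_itv/=; exact: f0. Qed.

Lemma itg_le {a c f g} : bm a c f -> bm a c g ->
  (forall x, a < x < c -> f x <= g x) -> itg a c f <= itg a c g.
Proof.
move=> hf hg fg; rewrite !itgE; exact: (le_Rintegral _ (bm_integrable hf) (bm_integrable hg)).
Qed.

Lemma itg_norm {a c f} : bm a c f -> `|itg a c f| <= itg a c (fun x => `|f x|).
Proof. by move=> hf; rewrite !itgE; apply: (le_normr_Rintegral _ (bm_integrable hf)). Qed.

Lemma itg_bound {a c f} M : a <= c -> bm a c f ->
  (forall x, a < x < c -> `|f x| <= M) -> `|itg a c f| <= M * (c - a).
Proof.
move=> ac hf fM; apply: (le_trans (itg_norm hf)); rewrite -itg_cst//.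
by apply: itg_le => //; [exact: bm_norm | exact: bm_cst].
Qed.

Lemma itg_split {a c f} x : a <= x <= c -> bm a c f ->
  itg a c f = itg a x f + itg x c f.
Proof.
move=> /andP[]; rewrite le_eqVlt => /predU1P[<-|ax] ; first by rewrite (itg_ge a a)// add0r.
rewrite le_eqVlt => /predU1P[->|xc] hf; first by rewrite (itg_ge c c)// addr0.
have i := bm_integrable hf.
have := @Rintegral_itvB R f (BRight a) (BLeft c) x i.
rewrite /= !bnd_simp => /(_ (ltW ax) xc) h.
rewrite !itgE -h [in X in _ = X + _]Rintegral_itv_bndo_bndc ?subrKC//.
by apply: bm_integrable; apply: bmS hf => //; exact: ltW.
Qed.

(** Links the closed intervals in the definition of the scheme to the open ones of [itg]; end points
    are null sets. *)
Lemma itg_cc {a c f} : bm a c f -> \int[mu]_(x in `[a, c]) f x = itg a c f.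
Proof.
move=> [mf _]; rewrite itgE /Rintegral integral_itv_bndoo//.
exact/measurable_EFinP.
Qed.

End Integral.

(** * Continuity, primitives and the mean value theorem on an interval *)

Section Calculus.
Context {R : realType}.
Implicit Types (a b c x y M : R) (f g F : R -> R).

Lemma cont_epsP f x : {for x, continuous f} <->
  forall e : R, 0 < e -> exists2 d : R, 0 < d & forall y, `|x - y| < d -> `|f x - f y| <= e.
Proof.
split => [/cvgrPdist_le cf e e0|h].
  have /nbhs_ballP[d /= d0 hd] := cf _ e0; by exists d.
apply/cvgrPdist_le => e e0; have [d d0 hd] := h _ e0.
by apply/nbhs_ballP; exists d.
Qed.

Lemma within_epsP {a c f} : {within `[a, c], continuous f} <->
  forall x, a <= x <= c -> forall e : R, 0 < e ->
    exists2 d : R, 0 < d & forall y, a <= y <= c -> `|x - y| < d -> `|f x - f y| <= e.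
Proof.
split => [/subspace_continuousP cf x xac e e0|h].
  have /cf : [set` `[a, c]] x by rewrite /= in_itv.
  move=> /cvgrPdist_le /(_ _ e0); rewrite near_withinE => /nbhs_ballP[d /= d0 hd].
  by exists d => // y yac xy; apply: hd => //=; rewrite in_itv.
apply/subspace_continuousP => x /=; rewrite in_itv/= => xac.
apply/cvgrPdist_le => e e0; have [d d0 hd] := h _ xac _ e0.
rewrite near_withinE; apply/nbhs_ballP; exists d => // y /= xy.
by rewrite in_itv/= => yac; exact: hd.
Qed.

Lemma withinS {a c} x y {f} : a <= x -> y <= c -> {within `[a, c], continuous f} ->
  {within `[x, y], continuous f}.
Proof.
move=> ax yc; apply: continuous_subspaceW; apply: subset_itv; rewrite bnd_simp//.
Qed.

Lemma within_cont {a c f} x : a < x < c -> {within `[a, c], continuous f} ->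
  {for x, continuous f}.
Proof.
move=> /andP[ax xc] /within_epsP cf; apply/cont_epsP => e e0.
have [|d d0 hd] := cf x _ e e0; first by rewrite !ltW.
exists (Num.min d (Num.min (x - a) (c - x))).
  by rewrite !lt_min d0 !subr_gt0 ax xc.
move=> y; rewrite !lt_min => /andP[yd /andP[ya yc]]; apply: hd => //.
move: ya yc; rewrite !ltr_norml => /andP[? ?] /andP[? ?].
by apply/andP; split; lra.
Qed.

Lemma cont_within {a c f} : (forall x, a <= x <= c -> {for x, continuous f}) ->
  {within `[a, c], continuous f}.
Proof.
move=> cf; apply/within_epsP => x xac e e0.
have /cont_epsP/(_ _ e0)[d d0 hd] := cf _ xac.
by exists d => // y _; exact: hd.
Qed.

Lemma lip_within a c f M :
  (forall x y, a <= x -> x <= y -> y <= c -> `|f y - f x| <= M * (y - x)) ->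
  {within `[a, c], continuous f}.
Proof.
move=> h; have h' x y : a <= x <= c -> a <= y <= c -> `|f x - f y| <= `|M| * `|x - y|.
  move=> /andP[ax xc] /andP[ay yc]; have [xy|yx] := leP x y.
    rewrite (distrC (f x)) (distrC x) (ger0_norm (x := y - x)) ?subr_ge0//.
    by apply: (le_trans (h _ _ ax xy yc)); rewrite ler_wpM2r ?subr_ge0// ler_norm.
  rewrite (ger0_norm (x := x - y)) ?subr_ge0 ?(ltW yx)//.
  by apply: (le_trans (h _ _ ay (ltW yx) xc)); rewrite ler_wpM2r ?subr_ge0 ?(ltW yx)// ler_norm.
apply/within_epsP => x xac e e0; have M0 : 0 < `|M| + 1 by rewrite ltr_wpDl.
exists (e / (`|M| + 1)); first exact: divr_gt0.
move=> y yac xy; apply: (le_trans (h' _ _ xac yac)).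
apply: (@le_trans _ _ ((`|M| + 1) * (e / (`|M| + 1)))); last by rewrite mulrC divfK ?gt_eqF.
by rewrite ler_pM// ?lerDl// ltW.
Qed.

Lemma prim_lip {a c f} M : bm a c f -> (forall x, a < x < c -> `|f x| <= M) ->
  forall x y, a <= x -> x <= y -> y <= c -> `|itg a y f - itg a x f| <= M * (y - x).
Proof.
move=> hf fM x y ax xy yc.
have hy : bm a y f by apply: bmS hf.
rewrite (itg_split x _ hy) ?ax ?xy// addrC addKr.
apply: itg_bound => //; first by apply: bmS hf.
by move=> z /andP[xz zy]; apply: fM; rewrite (le_lt_trans ax xz) (lt_le_trans zy yc).
Qed.

Lemma prim_within {a c f} : bm a c f -> {within `[a, c], continuous (fun x => itg a x f)}.
Proof.
move=> hf; have [M _ fM] := bm_bounded hf.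
exact: (lip_within _ _ _ _ (prim_lip _ hf fM)).
Qed.

Lemma is_derive_ext {x f} g d df : 0 < d -> (forall y, `|x - y| < d -> f y = g y) ->
  is_derive x 1 f df -> is_derive x 1 g df.
Proof.
move=> d0 fg; apply: near_eq_is_derive.
by apply/nbhs_ballP; exists d => // y xy; exact: fg.
Qed.

Lemma prim_derive {a c f} x : bm a c f -> a < x < c -> {for x, continuous f} ->
  is_derive x 1 (fun y => itg a y f) (f x).
Proof.
move=> hf /andP[ax xc] cf.
pose u := (x + c) / 2.
have xu : x < u by rewrite /u; lra.
have uc : u < c by rewrite /u; lra.
have hau : bm a u f by apply: bmS hf; rewrite ?lexx// ltW.
have iu : mu.-integrable [set` Interval (BRight a) (BRight u)] (EFin \o f).
  have := bm_integrable (bmS a u (lexx a) (ltW uc) hf); move/integrableP => [m1 m2].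
  have m3 : measurable_fun [set` Interval (BRight a) (BRight u)] (EFin \o f).
    by apply/emeasurable_fun_itv_bndo_bndcP.
  apply/integrableP; split => //.
  rewrite integral_itv_bndoo//.
  apply: measurableT_comp => //.
have ax' : (BRight a < BRight x)%O by rewrite bnd_simp.
have [dF F'] := continuous_FTC1 xu iu ax' cf.
have hF : is_derive x 1 (fun y => \int[mu]_(t in [set` Interval (BRight a) (BRight y)]) f t) (f x).
  by rewrite -F'; apply: DeriveDef; [exact: dF | rewrite derive1E].
refine (is_derive_ext _ (c - x) _ _ _ hF); first by rewrite subr_gt0.
move=> y; rewrite ltr_norml => /andP[yx _]; rewrite itgE /Rintegral integral_itv_bndoo//.
have yc : y <= c by lra.
by have [m _] := bmS a y (lexx a) yc hf; exact/measurable_EFinP.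
Qed.

Lemma MVT_oo {a c F} f : a < c -> {within `[a, c], continuous F} ->
  (forall x, a < x < c -> is_derive x 1 F (f x)) ->
  exists2 x, a < x < c & F c - F a = f x * (c - a).
Proof.
move=> ac cF dF.
have dF' x : x \in `]a, c[ -> is_derive x 1 F (f x) by rewrite in_itv; exact: dF.
have [x xac e] := MVT ac dF' cF.
by exists x => //; move: xac; rewrite in_itv.
Qed.

Lemma derive0_eq {a c F} : a <= c -> {within `[a, c], continuous F} ->
  (forall x, a < x < c -> is_derive x 1 F 0) -> F c = F a.
Proof.
rewrite le_eqVlt => /predU1P[->//|ac] cF dF.
have [x _ /eqP] := MVT_oo (fun _ => 0) ac cF dF.
by rewrite mul0r subr_eq0 => /eqP.
Qed.

Lemma derive_le0 {a c F} f : a <= c -> {within `[a, c], continuous F} ->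
  (forall x, a < x < c -> is_derive x 1 F (f x)) -> (forall x, a < x < c -> f x <= 0) ->
  F c <= F a.
Proof.
rewrite le_eqVlt => /predU1P[->//|ac] cF dF f0.
have [x xac e] := MVT_oo f ac cF dF.
by rewrite -subr_le0 e mulr_le0_ge0 ?f0// subr_ge0 ltW.
Qed.

Lemma within_sub a c f g : {within `[a, c], continuous f} -> {within `[a, c], continuous g} ->
  {within `[a, c], continuous (fun x => f x - g x)}.
Proof. by move=> cf cg x; apply: cvgB; [exact: cf|exact: cg]. Qed.

Lemma within_add a c f g : {within `[a, c], continuous f} -> {within `[a, c], continuous g} ->
  {within `[a, c], continuous (fun x => f x + g x)}.
Proof. by move=> cf cg x; apply: cvgD; [exact: cf|exact: cg]. Qed.

Lemma within_mul a c f g : {within `[a, c], continuous f} -> {within `[a, c], continuous g} ->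
  {within `[a, c], continuous (fun x => f x * g x)}.
Proof. by move=> cf cg x; apply: cvgM; [exact: cf|exact: cg]. Qed.

Lemma within_cst a c (k : R) : {within `[a, c], continuous (fun _ : R => k)}.
Proof. by move=> x; exact: cvg_cst. Qed.

(** Both sides, seen as functions of the upper end point, have the same derivative inside. Nothing
    is asked of [f] at the end points, which suits broken functions at the nodes. *)
Lemma FTC {a c F} f : a <= c -> {within `[a, c], continuous F} ->
  (forall x, a < x < c -> is_derive x 1 F (f x)) ->
  (forall x, a < x < c -> {for x, continuous f}) -> bm a c f ->
  itg a c f = F c - F a.
Proof.
move=> ac cF dF cf hf.
have /eqP : itg a c f - F c = itg a a f - F a.
  apply: (derive0_eq (F := fun x => itg a x f - F x) ac).
    exact: within_sub (prim_within hf) cF.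
  move=> x xac; rewrite -[0](subrr (f x)).
  have d1 := prim_derive x hf xac (cf _ xac); have d2 := dF _ xac.
  exact: is_deriveB.
by rewrite (itg_ge a a)// sub0r subr_eq addrC => /eqP ->.
Qed.

(** A positive value at [x] keeps [f] above [f x / 2] on an interval of length [l] to the right of
    [x], and the integral is then at least [f x / 2 * l]. *)
Lemma itg_sqr_eq0 {a c f} : (forall x, a < x < c -> {for x, continuous f}) -> bm a c f ->
  (forall x, a < x < c -> 0 <= f x) -> itg a c f = 0 -> forall x, a < x < c -> f x = 0.
Proof.
move=> cf hf f0 i0 x /andP[ax xc]; apply/eqP/negPn/negP => fx.
have fx0 : 0 < f x by rewrite lt_neqAle eq_sym fx f0// ax xc.
have /cont_epsP/(_ (f x / 2))[|d d0 hd] := cf x (introT andP (conj ax xc)).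
  by rewrite divr_gt0.
pose l := Num.min (d / 2) (c - x).
have l0 : 0 < l by rewrite lt_min divr_gt0// subr_gt0.
have xl : x + l <= c by rewrite -lerBrDl ge_min lexx orbT.
have ld : l <= d / 2 by rewrite ge_min lexx.
have : f x / 2 * l <= 0.
  rewrite -i0 (itg_split x _ hf) ?(ltW ax) ?(ltW xc)//.
  have hxc : bm x c f by apply: bmS hf => //; exact: ltW.
  rewrite (itg_split (x + l) _ hxc) ?lerDl ?(ltW l0)//.
  rewrite -[leLHS]add0r lerD//.
    by apply: itg_ge0 => y /andP[ay yx]; rewrite f0// ay (lt_trans yx).
  rewrite -[leLHS]addr0 lerD//; last first.
    by apply: itg_ge0 => y /andP[ay yx]; rewrite f0// yx (lt_trans _ ay)// ltr_wpDr// ltW.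
  have -> : f x / 2 * l = itg x (x + l) (fun _ => f x / 2).
    by rewrite itg_cst ?lerDl ?(ltW l0)// [x + l]addrC addrK.
  apply: itg_le; [exact: bm_cst|exact: bmS hxc|] => y /andP[xy yl].
  have /hd : `|x - y| < d by rewrite ltr_norml; apply/andP; split; lra.
  by rewrite ler_norml => /andP[_]; lra.
by rewrite leNgt mulr_gt0// divr_gt0.
Qed.

(** The integral of [(f + s g)^2] is a quadratic polynomial in [s], nonnegative everywhere; its
    value at the minimizer [- C / B] is the claim. If [B = 0] it is affine in [s], which forces
    [C = 0]. *)
Lemma CauchySchwarz_sq {a c f g} : bm a c f -> bm a c g ->
  itg a c (fun x => f x * g x) ^+ 2 <= itg a c (fun x => f x ^+ 2) * itg a c (fun x => g x ^+ 2).
Proof.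
move=> hf hg; set A := itg a c (fun x => f x ^+ 2); set B := itg a c (fun x => g x ^+ 2).
set C := itg a c _.
have hff := bmX _ _ _ 2 hf; have hgg := bmX _ _ _ 2 hg; have hfg := bmM _ _ _ _ hf hg.
have q s : 0 <= A + s * (2 * C) + s ^+ 2 * B.
  have h1 := bmM _ _ _ _ (bm_cst a c (2 * s)) hfg.
  have h2 := bmM _ _ _ _ (bm_cst a c (s ^+ 2)) hgg.
  have -> : A + s * (2 * C) + s ^+ 2 * B =
     itg a c (fun x => f x ^+ 2 + 2 * s * (f x * g x) + s ^+ 2 * g x ^+ 2).
    rewrite itgD ?itgD ?itgZl//; last exact: bmD.
    by rewrite -/A -/B -/C; ring.
  apply: itg_ge0 => x _.
  have -> : f x ^+ 2 + 2 * s * (f x * g x) + s ^+ 2 * g x ^+ 2 = (f x + s * g x) ^+ 2 by ring.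
  exact: sqr_ge0.
have A0 : 0 <= A by apply: itg_ge0 => x _; exact: sqr_ge0.
have B0 : 0 <= B by apply: itg_ge0 => x _; exact: sqr_ge0.
have [B00|Bn0] := eqVneq B 0.
  rewrite B00 mulr0; have := q (- C * (A + 1)).
  rewrite B00 mulr0 addr0 => h.
  have : C ^+ 2 * (2 * A + 1 + 1) <= A by move: h; rewrite -subr_ge0; nra.
  move=> h'; have [->|C0] := eqVneq C 0; first by rewrite expr0n.
  have C2 : 0 < C ^+ 2 by rewrite lt_neqAle sqr_ge0 eq_sym sqrf_eq0 C0.
  have := q (- (A + 1) / C).
  rewrite B00 mulr0 addr0 mulrA [_ * 2]mulrC -mulrA divfK//; lra.
have Bp : 0 < B by rewrite lt_neqAle eq_sym Bn0.
have := q (- C / B).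
have -> : A + - C / B * (2 * C) + (- C / B) ^+ 2 * B = A - C ^+ 2 / B by field.
by rewrite subr_ge0 ler_pdivrMr.
Qed.

End Calculus.

(** * The L2 norm on an interval *)

Definition n2 {R : realType} (a c : R) (f : R -> R) : R :=
  Num.sqrt (itg a c (fun x => f x ^+ 2)).

Section L2norm.
Context {R : realType}.
Implicit Types (a c k M : R) (f g : R -> R).

Lemma n2_ge0 a c f : 0 <= n2 a c f. Proof. exact: sqrtr_ge0. Qed.

Lemma n2_sq a c f : n2 a c f ^+ 2 = itg a c (fun x => f x ^+ 2).
Proof. by rewrite sqr_sqrtr//; apply: itg_ge0 => x _; exact: sqr_ge0. Qed.

Lemma sqr_le_le {x y : R} : 0 <= y -> x ^+ 2 <= y ^+ 2 -> x <= y.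
Proof.
move=> y0; have [x0|x0 _] := leP 0 x; first by rewrite ler_sqr.
exact: (le_trans (ltW x0)).
Qed.

Lemma CS {a c f g} : bm a c f -> bm a c g ->
  `|itg a c (fun x => f x * g x)| <= n2 a c f * n2 a c g.
Proof.
move=> hf hg; apply: sqr_le_le; first by rewrite mulr_ge0 ?n2_ge0.
by rewrite exprMn !n2_sq real_normK ?num_real//; exact: CauchySchwarz_sq.
Qed.

Lemma n2D {a c f g} : bm a c f -> bm a c g ->
  n2 a c (fun x => f x + g x) <= n2 a c f + n2 a c g.
Proof.
move=> hf hg; apply: sqr_le_le; first by rewrite addr_ge0 ?n2_ge0.
have hff := bmX _ _ _ 2 hf; have hgg := bmX _ _ _ 2 hg; have hfg := bmM _ _ _ _ hf hg.
rewrite sqrrD !n2_sq (eq_itg (fun x => f x ^+ 2 + (2 * (f x * g x)) + g x ^+ 2)); last first.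
  by move=> x _; rewrite sqrrD -mulr_natl.
have h1 := bmM _ _ _ _ (bm_cst a c 2) hfg.
rewrite itgD ?itgD ?itgZl//; last exact: bmD.
rewrite lerD2r lerD2l -[leRHS]mulr_natl ler_pM2l//.
exact: (le_trans (ler_norm _) (CS hf hg)).
Qed.

Lemma n2_le {a c f g} : bm a c f -> bm a c g ->
  (forall x, a < x < c -> `|f x| <= `|g x|) -> n2 a c f <= n2 a c g.
Proof.
move=> hf hg fg; rewrite ler_wsqrtr//; apply: itg_le; [exact: bmX..|].
move=> x xac; rewrite -[f x ^+ 2]real_normK ?num_real// -[g x ^+ 2]real_normK ?num_real//.
by rewrite ler_sqr ?nnegrE ?fg.
Qed.

Lemma n2Z {a c f} k : bm a c f -> n2 a c (fun x => k * f x) = `|k| * n2 a c f.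
Proof.
move=> hf; rewrite /n2 (eq_itg (fun x => k ^+ 2 * f x ^+ 2)); last by move=> x _; rewrite exprMn.
by rewrite itgZl; [rewrite sqrtrM ?sqr_ge0// sqrtr_sqr | exact: bmX].
Qed.

Lemma eq_n2 {a c f} g : (forall x, a < x < c -> f x = g x) -> n2 a c f = n2 a c g.
Proof. by move=> fg; rewrite /n2 (eq_itg (fun x => g x ^+ 2))// => x /fg ->. Qed.

Lemma n2B {a c f g} : bm a c f -> bm a c g ->
  n2 a c (fun x => f x - g x) <= n2 a c f + n2 a c g.
Proof.
move=> hf hg; apply: (le_trans (n2D hf (bmN _ _ _ hg))).
rewrite lerD2l (@eq_n2 a c (fun x => - g x) (fun x => (- 1) * g x)); last by move=> x _; rewrite mulN1r.
by rewrite n2Z// normrN1 mul1r.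
Qed.

Lemma n2_bound {a c f} M : a <= c -> 0 <= M -> bm a c f ->
  (forall x, a < x < c -> `|f x| <= M) -> n2 a c f <= M * Num.sqrt (c - a).
Proof.
move=> ac M0 hf fM; rewrite -[M in leRHS]ger0_norm// -sqrtr_sqr -sqrtrM ?sqr_ge0//.
apply: ler_wsqrtr; rewrite -itg_cst//; apply: itg_le; [exact: bmX|exact: bm_cst|].
by move=> x xac; rewrite -[f x ^+ 2]real_normK ?num_real// ler_sqr ?nnegrE ?fM.
Qed.

End L2norm.

(** * The nonlinear functionals of the system *)

Section Expo.
Context {R : realType}.
Implicit Types (x y M : R).

Lemma expR_lip_le x y M : x <= M -> y <= M -> `|expR x - expR y| <= expR M * `|x - y|.
Proof.
wlog xy : x y / y <= x => [h|] xM yM.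
  have [yx|xy] := leP y x; first exact: h.
  by rewrite distrC (distrC x) h// ltW.
rewrite !ger0_norm ?subr_ge0 ?ler_expR//.
have -> : expR x - expR y = expR x * (1 - expR (y - x)).
  by rewrite mulrBr mulr1 -expRD [x + (y - x)]addrC subrK.
have h1 := expR_ge1Dx (y - x).
have h2 : expR x <= expR M by rewrite ler_expR.
have h3 : expR (y - x) <= 1 by rewrite -expR0 ler_expR subr_le0.
by apply: ler_pM; [exact: expR_ge0|lra|exact: h2|lra].
Qed.

Lemma expRN_lip x y : 0 <= x -> 0 <= y -> `|expR (- x) - expR (- y)| <= `|x - y|.
Proof.
move=> x0 y0; apply: (le_trans (expR_lip_le _ _ 0 _ _)); rewrite ?oppr_le0//.
by rewrite expR0 mul1r -opprD normrN.
Qed.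

(** Factoring [expR (- x2)] and [expR (- y2)] out of the two increments leaves a difference of
    increments plus a product of two first differences. The bound is therefore small of second
    order, as the comparison of two times requires. *)
Lemma expR_four x1 x2 y1 y2 M : 0 <= x1 <= M -> 0 <= x2 <= M -> 0 <= y1 <= M -> 0 <= y2 <= M ->
  `|(expR (- x1) - expR (- x2)) - (expR (- y1) - expR (- y2))| <=
  expR M * (`|(x1 - x2) - (y1 - y2)| + `|x2 - y2| * `|x1 - x2|).
Proof.
move=> /andP[? ?] /andP[? ?] /andP[? ?] /andP[? ?].
have e1 : expR (- x1) = expR (- x2) * expR (- (x1 - x2)) by rewrite -expRD; congr expR; ring.
have e2 : expR (- y1) = expR (- y2) * expR (- (y1 - y2)) by rewrite -expRD; congr expR; ring.
have -> : (expR (- x1) - expR (- x2)) - (expR (- y1) - expR (- y2)) =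
  expR (- y2) * (expR (- (x1 - x2)) - expR (- (y1 - y2))) +
  (expR (- x2) - expR (- y2)) * (expR (- (x1 - x2)) - expR 0).
  by rewrite e1 e2 expR0; ring.
have M0 : 0 <= M by lra.
have h1 := expR_lip_le (- (x1 - x2)) (- (y1 - y2)) M ltac:(lra) ltac:(lra).
have h2 := expR_lip_le (- (x1 - x2)) 0 M ltac:(lra) M0.
have h3 := expRN_lip x2 y2 ltac:(assumption) ltac:(assumption).
have h4 : expR (- y2) <= 1 by rewrite -expR0 ler_expR; lra.
apply: (le_trans (ler_normD _ _)); rewrite !normrM (ger0_norm (expR_ge0 _)) mulrDr lerD//.
  apply: (le_trans (ler_wpM2r _ h4)); rewrite ?normr_ge0// mul1r.
  by apply: (le_trans h1); rewrite -opprD normrN.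
rewrite mulrCA; apply: ler_pM; rewrite ?normr_ge0//.
by move: h2; rewrite subr0 normrN.
Qed.

End Expo.

Lemma bm_glue {R : realType} {a m c : R} {f} : a <= m <= c -> bm a m f -> bm m c f -> bm a c f.
Proof.
move=> /andP[]; rewrite le_eqVlt => /predU1P[->//|am].
rewrite le_eqVlt => /predU1P[->//|mc] [mf [M fM]] [mg [L gL]]; split; last first.
  exists (Num.max `|f m| (Num.max M L)) => x /andP[ax xc].
  have [xm|mx|->] := ltgtP x m; rewrite !le_max ?lexx//.
    by rewrite fM ?ax ?xm ?orbT.
  by rewrite gL ?mx ?xc ?orbT.
have -> : `]a, c[%classic = (`]a, m[ `|` ([set m] `|` `]m, c[))%classic :> set R.
  apply/seteqP; split => x /=; rewrite !in_itv/=.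
    move=> /andP[ax xc]; have [xm|mx|->] := ltgtP x m; rewrite ?ax ?xc/=; auto.
  by move=> [/andP[-> xm]|[->|/andP[mx ->]]]; rewrite ?am ?mc ?(lt_trans xm mc) ?(lt_trans am mx).
apply/measurable_funU => //; first exact: measurableU.
split => //; apply/measurable_funU => //; split => //; exact: measurable_fun_set1.
Qed.

(** * The coefficients g and g-tilde as functionals of u *)

Section Functional.
Context {R : realType} (b : R) (b0 : 0 < b).
Implicit Types (f g : R -> R) (x y M : R).

Definition av f x := itg 0 x f / x.
Definition Xf f x := f x - av f x.
Definition qf f x := Xf f x / x.
Definition Kf f := n2 0 b (qf f).
Definition Af f x := itg x b (fun y => y^-1 * (Xf f y) ^+ 2).
Definition gg f x := expR (- Af f x).
(** This is g-tilde; the value chosen at the centre is its limit and agrees with the convention of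
    [gtildeh]. The next function [GG] is its derivative, by the quotient rule applied to the
    primitive of [gg f] divided by [x]. *)
Definition gt f x := if x == 0 then gg f 0 else av (gg f) x.
Definition GG f x := (gg f x - av (gg f) x) / x.

(** The linear bound at the centre makes [qf f] bounded, hence [Kf f] meaningful and the integrand
    of [Af f] bounded. *)
Definition good f := bm 0 b f /\ exists M, forall x, 0 < x < b -> `|Xf f x| <= M * x.

Let lt0 x : 0 < x < b -> x != 0. Proof. by move=> /andP[h _]; rewrite gt_eqF. Qed.

Lemma cont_av {f} x : bm 0 b f -> 0 < x < b -> {for x, continuous (av f)}.
Proof.
move=> hf xb; have c1 := within_cont _ xb (prim_within hf).
apply: cvgM; first exact: c1.
by apply: cvgV; [exact: lt0|exact: cvg_id].
Qed.

Lemma av_bound {f} M x : bm 0 b f -> 0 < x <= b -> (forall y, 0 < y < x -> `|f y| <= M) ->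
  `|av f x| <= M.
Proof.
move=> hf /andP[x0 xb] fM; rewrite /av normrM normfV (gtr0_norm x0) ler_pdivrMr//.
rewrite -[x in leRHS]subr0; apply: itg_bound => //; [exact: ltW|exact: bmS hf].
Qed.

Lemma bm_av f : bm 0 b f -> bm 0 b (av f).
Proof.
move=> hf; have [M M0 fM] := bm_bounded hf.
apply: (bm_cont _ _ _ M) => x xb; first exact: cont_av.
apply: av_bound => //; first by case/andP: xb => -> /ltW ->.
by move=> y /andP[y0 yx]; apply: fM; rewrite y0 (lt_trans yx)//; case/andP: xb.
Qed.

Lemma bm_Xf f : bm 0 b f -> bm 0 b (Xf f).
Proof. by move=> hf; apply: bmB => //; exact: bm_av. Qed.

Lemma bm_qf f : good f -> bm 0 b (qf f).
Proof.
move=> [hf [M fM]]; split; last first.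
  exists M => x xb; rewrite /qf normrM normfV; case/andP: (xb) => x0 _.
  by rewrite (gtr0_norm x0) ler_pdivrMr// fM.
apply: measurable_funM; first by have [] := bm_Xf _ hf.
apply: open_continuous_measurable_fun; first exact: interval_open.
move=> x; rewrite inE/= in_itv/= => xb.
by apply: cvgV; [exact: lt0|exact: cvg_id].
Qed.

Lemma avB {f g x} : bm 0 b f -> bm 0 b g -> x <= b ->
  av (fun y => f y - g y) x = av f x - av g x.
Proof.
by move=> hf hg xb; rewrite /av itgB ?mulrBl//; [apply: bmS hf|apply: bmS hg].
Qed.

Lemma XfB {f g x} : bm 0 b f -> bm 0 b g -> x <= b ->
  Xf (fun y => f y - g y) x = Xf f x - Xf g x.
Proof. by move=> hf hg xb; rewrite /Xf avB//; ring. Qed.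

Lemma qfB {f g x} : bm 0 b f -> bm 0 b g -> x <= b ->
  qf (fun y => f y - g y) x = qf f x - qf g x.
Proof. by move=> hf hg xb; rewrite /qf XfB// mulrBl. Qed.

Lemma good_bm {f} : good f -> bm 0 b f. Proof. by case. Qed.

Lemma goodB {f g} : good f -> good g -> good (fun y => f y - g y).
Proof.
move=> [hf [M fM]] [hg [L gL]]; split; first exact: bmB.
exists (M + L) => x xb; rewrite XfB//; last by case/andP: xb => _ /ltW.
by apply: (le_trans (ler_normB _ _)); rewrite mulrDl lerD ?fM ?gL.
Qed.

Lemma Xf_qf f x : 0 < x -> Xf f x = x * qf f x.
Proof. by move=> x0; rewrite mulrC divfK ?gt_eqF. Qed.

Lemma KfB {f g} : good f -> good g -> Kf (fun y => f y - g y) <= Kf f + Kf g.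
Proof.
move=> hf hg; apply: (le_trans _ (n2B (bm_qf _ hf) (bm_qf _ hg))).
apply: n2_le; [exact/bm_qf/goodB|by apply: bmB; exact: bm_qf|].
by move=> x /andP[_ /ltW xb]; rewrite qfB//; exact: good_bm.
Qed.

Lemma Kf_ge0 f : 0 <= Kf f. Proof. exact: n2_ge0. Qed.

Lemma bm_Af f : good f -> bm 0 b (fun y => y^-1 * (Xf f y) ^+ 2).
Proof.
move=> hf; apply: (bm_ext (fun y => qf f y * Xf f y)).
  by move=> x _; rewrite /qf; ring.
by apply: bmM; [exact: bm_qf|apply: bm_Xf; exact: good_bm].
Qed.

Lemma Af_int_ge0 f y : 0 < y -> 0 <= y^-1 * (Xf f y) ^+ 2.
Proof. by move=> y0; rewrite mulr_ge0 ?sqr_ge0// invr_ge0 ltW. Qed.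

Lemma Af_ge0 f x : 0 <= x -> 0 <= Af f x.
Proof.
move=> x0; apply: itg_ge0 => y /andP[xy _]; apply: Af_int_ge0; exact: le_lt_trans xy.
Qed.

Lemma n2_sub {f} x y : 0 <= x -> x <= y -> y <= b -> bm 0 b f -> n2 x y f <= n2 0 b f.
Proof.
move=> x0 xy yb hf; apply: ler_wsqrtr.
have hff := bmX _ _ _ 2 hf.
have g0 a c : 0 <= itg a c (fun x => f x ^+ 2) by apply: itg_ge0 => z _; exact: sqr_ge0.
rewrite (itg_split x _ hff) ?x0 ?(le_trans xy)//.
have hxb : bm x b (fun x => f x ^+ 2) by apply: bmS hff.
rewrite (itg_split y _ hxb) ?xy//.
by have := g0 0 x; have := g0 y b; lra.
Qed.

(** The integrand equals [z * qf f z ^+ 2] and [z <= y]. The gain of the factor [y] is what later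
    makes [GG] bounded at the centre. *)
Lemma Af_diff f x y : good f -> 0 <= x -> x <= y -> y <= b ->
  0 <= Af f x - Af f y <= y * Kf f ^+ 2.
Proof.
move=> hf x0 xy yb; have hA := bm_Af _ hf.
have hxb : bm x b (fun y => y^-1 * (Xf f y) ^+ 2) by apply: bmS hA.
have hxy : bm x y (fun y => y^-1 * (Xf f y) ^+ 2) by apply: bmS hA.
rewrite /Af (itg_split y _ hxb) ?xy// addrK; apply/andP; split.
  by apply: itg_ge0 => z /andP[xz _]; apply: Af_int_ge0; exact: le_lt_trans xz.
have hq2 := bmX _ _ _ 2 (bm_qf _ hf).
have hq2y : bm x y (fun z => qf f z ^+ 2) by apply: bmS hq2.
have y0 : 0 <= y by exact: le_trans xy.
apply: (@le_trans _ _ (itg x y (fun z => y * qf f z ^+ 2))).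
  apply: itg_le => //; first by apply: bmM => //; exact: bm_cst.
  move=> z /andP[xz zy]; have z0 : 0 < z by exact: le_lt_trans xz.
  rewrite Xf_qf// exprMn [z ^+ 2]expr2 -!mulrA mulKf ?gt_eqF//.
  by rewrite ler_wpM2r ?sqr_ge0// ltW.
rewrite itgZl// ler_wpM2l// -n2_sq ler_sqr ?nnegrE ?n2_ge0//.
by apply: n2_sub => //; exact: bm_qf.
Qed.

Lemma Af_le f x : good f -> 0 <= x <= b -> 0 <= Af f x <= b * Kf f ^+ 2.
Proof.
move=> hf /andP[x0 xb]; have := Af_diff f x b hf x0 xb (lexx b).
by rewrite {2 4}/Af (itg_ge b b)// subr0.
Qed.

Lemma gg_le1 f x : 0 <= x -> gg f x <= 1.
Proof. by move=> x0; rewrite -expR0 ler_expR oppr_le0 Af_ge0. Qed.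

Lemma gg_low f x : good f -> 0 <= x <= b -> expR (- (b * Kf f ^+ 2)) <= gg f x.
Proof. by move=> hf xb; rewrite ler_expR lerN2; case/andP: (Af_le _ _ hf xb). Qed.

Lemma gg_diff f x y : good f -> 0 <= x -> x <= y -> y <= b ->
  0 <= gg f y - gg f x <= y * Kf f ^+ 2.
Proof.
move=> hf x0 xy yb; have /andP[h1 h2] := Af_diff _ _ _ hf x0 xy yb.
have y0 := le_trans x0 xy.
rewrite /gg subr_ge0 ler_expR; apply/andP; split; first lra.
have := expRN_lip (Af f y) (Af f x) (Af_ge0 _ _ y0) (Af_ge0 _ _ x0).
rewrite (distrC (Af f y)) (ger0_norm h1) => h; apply: (le_trans (ler_norm _)); lra.
Qed.

Lemma gg_within f : good f -> {within `[0, b], continuous (gg f)}.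
Proof.
move=> hf; have hA := bm_Af _ hf; have [M M0 fM] := bm_bounded hA.
apply: (lip_within _ _ _ M) => x y x0 xy yb.
apply: (le_trans (expRN_lip _ _ (Af_ge0 _ _ (le_trans x0 xy)) (Af_ge0 _ _ x0))).
have hxb : bm x b (fun y => y^-1 * (Xf f y) ^+ 2) by apply: bmS hA.
rewrite distrC /Af (itg_split y _ hxb) ?xy// addrK.
apply: itg_bound => //; first by apply: bmS hA.
by move=> z /andP[xz zy]; apply: fM; rewrite (le_lt_trans x0 xz) (lt_le_trans zy yb).
Qed.

Lemma bm_gg f : good f -> bm 0 b (gg f).
Proof. by move=> hf; exact/within_bm/gg_within. Qed.

Lemma gt_av f x : 0 < x -> gt f x = av (gg f) x.
Proof. by move=> x0; rewrite /gt gt_eqF. Qed.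

Lemma av_mono f m M x : bm 0 b f -> 0 < x <= b -> (forall y, 0 < y < x -> m <= f y <= M) ->
  m <= av f x <= M.
Proof.
move=> hf /andP[x0 xb] h; have hx : bm 0 x f by apply: bmS hf.
have e k : k * x = itg 0 x (fun _ => k) by rewrite itg_cst ?subr0// ltW.
rewrite /av ler_pdivlMr// ler_pdivrMr// !e; apply/andP; split.
  by apply: itg_le => //; [exact: bm_cst|move=> y /h/andP[]].
by apply: itg_le => //; [exact: bm_cst|move=> y /h/andP[]].
Qed.

(** [gg f] is nondecreasing and grows by at most [x * Kf f ^+ 2] up to [x]; its average over []0,
    x[] inherits both bounds. *)
Lemma gg_av f x : good f -> 0 < x <= b -> 0 <= gg f x - av (gg f) x <= x * Kf f ^+ 2.
Proof.
move=> hf /andP[x0 xb].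
have /andP[h1 h2] : gg f x - x * Kf f ^+ 2 <= av (gg f) x <= gg f x.
  apply: av_mono; [exact: bm_gg|by rewrite x0|] => y /andP[y0 yx].
  have /andP[] := gg_diff _ _ _ hf (ltW y0) (ltW yx) xb; lra.
by apply/andP; split; lra.
Qed.

Lemma GG_bd f x : good f -> 0 < x <= b -> 0 <= GG f x <= Kf f ^+ 2.
Proof.
move=> hf xb; have /andP[h1 h2] := gg_av _ _ hf xb; case/andP: xb => x0 _.
by rewrite /GG divr_ge0 ?(ltW x0)//= ler_pdivrMr// mulrC.
Qed.

Lemma gt_bd f x : good f -> 0 <= x <= b -> expR (- (b * Kf f ^+ 2)) <= gt f x <= 1.
Proof.
move=> hf xb; rewrite /gt; case: eqVneq => [_|xn0].
  by rewrite gg_le1// gg_low// lexx ltW.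
case/andP: xb => x0 xb; have xp : 0 < x by rewrite lt_neqAle eq_sym xn0.
apply: av_mono; [exact: bm_gg|by rewrite xp|] => y /andP[y0 yx].
by rewrite gg_low ?gg_le1// ltW//= ltW// (lt_le_trans yx).
Qed.

Lemma gt_gt0 f x : good f -> 0 <= x <= b -> 0 < gt f x.
Proof. by move=> hf xb; case/andP: (gt_bd _ _ hf xb) => h _; apply: lt_le_trans h; exact: expR_gt0. Qed.

(** The increment is [1 / y] times the integral over []x, y[] of [gg f s - gt f x]. This integrand
    is at most [y * Kf f ^+ 2], and the factor [y] cancels, so that the constant does not degenerate
    at the centre. *)
Lemma gt_lip f x y : good f -> 0 <= x -> x <= y -> y <= b ->
  0 <= gt f y - gt f x <= Kf f ^+ 2 * (y - x).
Proof.
move=> hf x0; rewrite le_eqVlt => /predU1P[->|xy] yb; first by rewrite !subrr mulr0 lexx.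
have y0 : 0 < y by exact: le_lt_trans xy.
have hg := bm_gg _ hf.
pose m := gt f x.
have hm s : x < s < y -> 0 <= gg f s - m <= y * Kf f ^+ 2.
  move=> /andP[xs sy]; have s0 : 0 < s by exact: le_lt_trans xs.
  suff /andP[h1 h2] : gg f s - s * Kf f ^+ 2 <= m <= gg f s.
    have : s * Kf f ^+ 2 <= y * Kf f ^+ 2 by rewrite ler_wpM2r ?sqr_ge0// ltW.
    by move=> h; apply/andP; split; lra.
  have sb : s <= b by rewrite (le_trans (ltW sy)).
  rewrite /m /gt; case: eqVneq => [_|xn0].
    have /andP[] := gg_diff _ _ _ hf (lexx 0) (ltW s0) sb; lra.
  have xp : 0 < x by rewrite lt_neqAle eq_sym xn0.
  apply: av_mono => //; first by rewrite xp (le_trans (ltW xy)).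
  move=> z /andP[z0 zx].
  have /andP[] := gg_diff _ _ _ hf (ltW z0) (ltW (lt_trans zx xs)) sb; lra.
have hxy : bm x y (gg f) by apply: bmS hg.
have e : gt f y - gt f x = itg x y (fun s => gg f s - m) / y.
  rewrite gt_av// /av itgB//; last exact: bm_cst.
  rewrite itg_cst ?(ltW xy)//.
  have hy : bm 0 y (gg f) by apply: bmS hg.
  rewrite (itg_split x _ hy) ?x0 ?ltW//.
  have -> : itg 0 x (gg f) = m * x.
    rewrite /m /gt; case: eqVneq => [->|xn0]; first by rewrite mulr0 itg_ge.
    by rewrite /av divfK.
  by rewrite /m; field; rewrite gt_eqF.
have hd : bm x y (fun s => gg f s - m) by apply: bmB => //; exact: bm_cst.
rewrite e divr_ge0 ?(ltW y0)//=; last by apply: itg_ge0 => s /hm/andP[].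
rewrite ler_pdivrMr//; apply: (le_trans (ler_norm _)).
rewrite [leRHS](_ : _ = (y * Kf f ^+ 2) * (y - x)); last by ring.
apply: itg_bound => //; first exact: ltW.
by move=> s /hm/andP[h1 h2]; rewrite ger0_norm.
Qed.

Lemma gt_within f : good f -> {within `[0, b], continuous (gt f)}.
Proof.
move=> hf; apply: (lip_within _ _ _ (Kf f ^+ 2)) => x y x0 xy yb.
by have /andP[h1 h2] := gt_lip _ _ _ hf x0 xy yb; rewrite ger0_norm.
Qed.

Lemma bm_gt f : good f -> bm 0 b (gt f).
Proof. by move=> hf; exact/within_bm/gt_within. Qed.

Lemma cont_GG f x : good f -> 0 < x < b -> {for x, continuous (GG f)}.
Proof.
move=> hf xb; apply: cvgM.
  by apply: cvgB; [exact: (within_cont _ xb (gg_within _ hf))|exact: (cont_av _ (bm_gg _ hf) xb)].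
by apply: cvgV; [exact: lt0|exact: cvg_id].
Qed.

Lemma bm_GG f : good f -> bm 0 b (GG f).
Proof.
move=> hf; apply: (bm_cont _ _ _ (Kf f ^+ 2)) => x xb; first exact: cont_GG.
have /andP[h1 h2] : 0 <= GG f x <= Kf f ^+ 2.
  by apply: GG_bd => //; case/andP: xb => -> /ltW ->.
by rewrite ger0_norm.
Qed.

Lemma is_derive_av f x : bm 0 b f -> 0 < x < b -> {for x, continuous f} ->
  is_derive x 1 (av f) ((f x - av f x) / x).
Proof.
move=> hf xb cf; have d1 := prim_derive x hf xb cf.
have x0 := lt0 _ xb.
have d2 : is_derive x 1 (fun y : R => y^-1) (- x ^- 2 *: 1) by apply: is_deriveV.
rewrite (_ : av f = (fun y => itg 0 y f) * (fun y => y^-1)); last by apply/funext.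
apply: (is_derive_eq (is_deriveM d1 d2)).
rewrite /GRing.scale/= [X in f x - X](_ : _ = itg 0 x f / x)//; by field.
Qed.

Lemma is_derive_gt f x : good f -> 0 < x < b -> is_derive x 1 (gt f) (GG f x).
Proof.
move=> hf xb; have cg := within_cont _ xb (gg_within _ hf).
case/andP: (xb) => x0 _.
refine (is_derive_ext _ x _ _ _ (is_derive_av _ x (bm_gg _ hf) xb cg)) => // y.
by rewrite ltr_norml => /andP[_ h]; rewrite gt_av//; lra.
Qed.

(** The difference of squares divided by [y] factors as the product of [Xf] of [f - g] and
    [qf f + qf g]; the Cauchy--Schwarz inequality gives the two norms. *)
Lemma Af_lip f g x : good f -> good g -> 0 <= x <= b ->
  `|Af f x - Af g x| <= n2 0 b (Xf (fun y => f y - g y)) * (Kf f + Kf g).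
Proof.
move=> hf hg /andP[x0 xb].
have hfg := goodB hf hg.
have b1 := bm_qf _ hf; have b2 := bm_qf _ hg; have b3 := bm_Xf _ (good_bm hfg).
have S f' : bm 0 b f' -> bm x b f' by apply: bmS.
rewrite /Af -itgB; [|by apply: S; exact: bm_Af..].
rewrite (eq_itg (fun y => Xf (fun y => f y - g y) y * (qf f y + qf g y))); last first.
  move=> y /andP[_ /ltW yb]; rewrite XfB//; [|exact: good_bm..].
  by rewrite /qf; ring.
apply: (le_trans (CS (S _ b3) (bmD _ _ _ _ (S _ b1) (S _ b2)))).
apply: ler_pM; rewrite ?n2_ge0//; first by apply: n2_sub.
apply: (le_trans (n2D (S _ b1) (S _ b2))).
by apply: lerD; apply: n2_sub.
Qed.

Lemma gg_lip f g x : good f -> good g -> 0 <= x <= b ->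
  `|gg f x - gg g x| <= n2 0 b (Xf (fun y => f y - g y)) * (Kf f + Kf g).
Proof.
move=> hf hg xb; apply: (le_trans _ (Af_lip _ _ _ hf hg xb)).
by apply: expRN_lip; apply: Af_ge0; case/andP: xb.
Qed.

(* The increments of [A] for two pairs of functions are compared through
   X_{f1}^2 - X_{f2}^2 - (X_{g1}^2 - X_{g2}^2)
     = X_{(f1-f2)-(g1-g2)} (X_{g1} + X_{g2}) + X_{f1-f2} (X_{f1-g1} + X_{f2-g2}). *)
Lemma gg_four f1 f2 g1 g2 M x : good f1 -> good f2 -> good g1 -> good g2 -> 0 <= x <= b ->
  b * Kf f1 ^+ 2 <= M -> b * Kf f2 ^+ 2 <= M -> b * Kf g1 ^+ 2 <= M -> b * Kf g2 ^+ 2 <= M ->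
  `|(gg f1 x - gg f2 x) - (gg g1 x - gg g2 x)| <=
  expR M * (n2 0 b (Xf (fun y => (f1 y - f2 y) - (g1 y - g2 y))) * (Kf g1 + Kf g2)
    + Kf (fun y => f1 y - f2 y) * (n2 0 b (Xf (fun y => f1 y - g1 y)) + n2 0 b (Xf (fun y => f2 y - g2 y)))
    + (n2 0 b (Xf (fun y => f2 y - g2 y)) * (Kf f2 + Kf g2)) * (n2 0 b (Xf (fun y => f1 y - f2 y)) * (Kf f1 + Kf f2))).
Proof.
move=> hf1 hf2 hg1 hg2 xb M1 M2 M3 M4.
have bd f : good f -> b * Kf f ^+ 2 <= M -> 0 <= Af f x <= M.
  by move=> hf hM; case/andP: (Af_le _ _ hf xb) => -> /= h; exact: le_trans hM.
apply: (le_trans (expR_four _ _ _ _ M (bd _ hf1 M1) (bd _ hf2 M2) (bd _ hg1 M3) (bd _ hg2 M4))).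
rewrite ler_wpM2l ?expR_ge0// lerD//; last first.
  by apply: ler_pM; rewrite ?normr_ge0//; exact: Af_lip.
case/andP: xb => x0 xb.
have S f' : bm 0 b f' -> bm x b f' by apply: bmS.
have hf := goodB hf1 hf2; have hg := goodB hg1 hg2; have hfg := goodB hf hg.
have h1 := goodB hf1 hg1; have h2 := goodB hf2 hg2.
have A1 := bm_Af _ hf1; have A2 := bm_Af _ hf2; have A3 := bm_Af _ hg1; have A4 := bm_Af _ hg2.
have q1 := bm_qf _ hg1; have q2 := bm_qf _ hg2; have q3 := bm_qf _ hf.
have X1 := bm_Xf _ (good_bm hfg); have X2 := bm_Xf _ (good_bm h1); have X3 := bm_Xf _ (good_bm h2).
rewrite /Af -!itgB; [|by repeat first [exact: S|apply: bmB]..].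
rewrite (eq_itg (fun y => Xf (fun y => (f1 y - f2 y) - (g1 y - g2 y)) y * (qf g1 y + qf g2 y)
  + qf (fun y => f1 y - f2 y) y * (Xf (fun y => f1 y - g1 y) y + Xf (fun y => f2 y - g2 y) y))); last first.
  move=> y /andP[_ /ltW yb].
  have B1 := good_bm hf1; have B2 := good_bm hf2; have B3 := good_bm hg1.
  have B4 := good_bm hg2; have B5 := good_bm hf; have B6 := good_bm hg.
  by rewrite !(XfB _ _ yb, qfB _ _ yb)// /qf; ring.
have p1 := bmM _ _ _ _ X1 (bmD _ _ _ _ q1 q2); have p2 := bmM _ _ _ _ q3 (bmD _ _ _ _ X2 X3).
rewrite itgD; [|exact: S..].
apply: (le_trans (ler_normD _ _)); apply: lerD.
  apply: (le_trans (CS (S _ X1) (bmD _ _ _ _ (S _ q1) (S _ q2)))).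
  apply: ler_pM; rewrite ?n2_ge0//; first by apply: n2_sub.
  by apply: (le_trans (n2D (S _ q1) (S _ q2))); apply: lerD; apply: n2_sub.
apply: (le_trans (CS (S _ q3) (bmD _ _ _ _ (S _ X2) (S _ X3)))).
apply: ler_pM; rewrite ?n2_ge0//; first by apply: n2_sub.
by apply: (le_trans (n2D (S _ X2) (S _ X3))); apply: lerD; apply: n2_sub.
Qed.

End Functional.

(** * Broken functions and Hardy inequalities *)

Section Poly.
Context {R : realType}.
Implicit Types (p q : {poly R}) (a c x : R).

Lemma is_derive_poly p x : is_derive x 1 (fun y => p.[y]) (p^`()).[x].
Proof. by rewrite derivE; apply: DeriveDef; [exact: derivable_horner|rewrite derive1E]. Qed.

Lemma cont_poly p x : {for x, continuous (fun y => p.[y])}.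
Proof. exact: continuous_horner. Qed.

Lemma within_poly p a c : {within `[a, c], continuous (fun y => p.[y])}.
Proof. by apply: cont_within => x _; exact: cont_poly. Qed.

Lemma bm_poly p a c : bm a c (fun y => p.[y]).
Proof. exact/within_bm/within_poly. Qed.

Lemma itg_deriv p a c : a <= c -> itg a c (fun x => (p^`()).[x]) = p.[c] - p.[a].
Proof.
move=> ac; apply: (FTC (F := fun x => p.[x])) => //.
- exact: within_poly.
- by move=> x _; exact: is_derive_poly.
- by move=> x _; exact: cont_poly.
- exact: bm_poly.
Qed.

Lemma cont_id x : {for x, continuous (fun y : R => y)}.
Proof. exact: cvg_id. Qed.

Lemma bm_id a c : bm a c (fun y : R => y).
Proof. by apply: within_bm; apply: cont_within => x _; exact: cont_id. Qed.

Lemma itg_id a c : a <= c -> itg a c (fun x => x) = (c ^+ 2 - a ^+ 2) / 2.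
Proof.
move=> ac; have := itg_deriv 'X^2 a c ac.
rewrite (eq_itg (fun x => 2 * x)); last first.
  by move=> x _; rewrite derivXn hornerMn hornerXn expr1 mulr_natl.
rewrite itgZl; last exact: bm_id.
by rewrite !hornerXn => <-; field.
Qed.

End Poly.

Section Mesh.
Context {R : realType} (b : R) (N : nat) (r : nat -> R) (hm : mesh b N r).
Implicit Types (f g : R -> R) (x y M : R) (v : nat -> R -> R) (p : nat -> {poly R}).

Lemma mesh_lt i : (i < N)%N -> r i < r i.+1.
Proof. by case: hm => _ _; apply. Qed.

Lemma mesh_le i j : (i <= j)%N -> (j <= N)%N -> r i <= r j.
Proof.
elim: j => [|j ih]; first by rewrite leqn0 => /eqP ->.
rewrite leq_eqVlt => /predU1P[->//|]; rewrite ltnS => ij jN.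
by apply: (le_trans (ih ij (ltnW jN))); exact/ltW/mesh_lt.
Qed.

Lemma mesh_node i : (i <= N)%N -> 0 <= r i <= b.
Proof.
by case: (hm) => r0 rN _ iN; rewrite -{1}r0 -rN !mesh_le.
Qed.

Lemma mesh_in i x : (i < N)%N -> r i < x < r i.+1 -> 0 < x < b.
Proof.
move=> iN /andP[ix xi]; have /andP[h1 _] := mesh_node _ (ltnW iN).
by have /andP[_ h2] := mesh_node _ iN; rewrite (le_lt_trans h1) ?(lt_le_trans xi).
Qed.

Lemma mesh_h i : (i < N)%N -> r i.+1 - r i <= mesh_size N r.
Proof. by move=> iN; exact: (le_bigmax 0 (fun i : 'I_N => r i.+1 - r i) (Ordinal iN)). Qed.

Lemma mesh_N : 0 < b -> (0 < N)%N.
Proof.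
by case: (N) hm => // -[r0 rN _]; rewrite -rN r0 ltxx.
Qed.

Lemma mesh_loc x : 0 <= x < b -> exists2 i, (i < N)%N & r i <= x < r i.+1.
Proof.
case: (hm) => r0 rN _ /andP[x0]; rewrite -rN.
elim: N => [|n ih]; first by rewrite r0 ltNge x0.
move=> xn; have [xn'|nx] := ltP x (r n).
  by have [i iN hi] := ih xn'; exists i => //; exact: ltnW.
by exists n; rewrite ?nx.
Qed.

Lemma mesh_itv i j x : (i < N)%N -> (j < N)%N -> r i < x < r i.+1 ->
  r j < x < r j.+1 -> i = j.
Proof.
move=> iN jN /andP[ix xi] /andP[jx xj]; apply/eqP; rewrite eqn_leq.
apply/andP; split; rewrite leqNgt; apply/negP => h.
  by have := lt_le_trans xj (mesh_le _ _ h (ltnW iN)); rewrite ltNge (ltW ix).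
by have := lt_le_trans xi (mesh_le _ _ h (ltnW jN)); rewrite ltNge (ltW jx).
Qed.

Lemma broken_funE v i x : (i < N)%N -> r i < x < r i.+1 -> broken_fun N r v x = v i x.
Proof.
move=> iN xi; rewrite /broken_fun (bigD1 (Ordinal iN))//= big1 ?addr0.
  by rewrite patchE mem_set//= in_itv.
move=> j ji; rewrite patchE memNset//= in_itv/= => xj.
by move/eqP: ji; apply; apply/val_inj => /=; apply: mesh_itv xj xi.
Qed.

Lemma bm_mesh f : (forall i, (i < N)%N -> bm (r i) (r i.+1) f) -> bm 0 b f.
Proof.
move=> h; have [r0 rN _] := hm; rewrite -r0 -rN.
suff H n : (n <= N)%N -> bm (r 0) (r n) f by exact: H.
elim: n => [|n ih] nN.
  apply: (bm_ext (fun _ => 0)); last exact: bm_cst.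
  by move=> x /andP[h1 h2]; have := lt_trans h1 h2; rewrite ltxx.
apply: (bm_glue (m := r n)); [|exact/ih/ltnW|exact: h].
by rewrite mesh_le ?(ltnW nN)//= ltW// mesh_lt.
Qed.

Lemma itg_meshn f n : bm 0 b f -> (n <= N)%N ->
  itg 0 (r n) f = \sum_(i < n) itg (r i) (r i.+1) f.
Proof.
move=> hf; elim: n => [|n ih] nN; first by rewrite big_ord0 itg_ge//; case: hm => ->.
rewrite big_ord_recr/= -ih ?(ltnW nN)//.
have /andP[h1 h2] := mesh_node _ nN.
have /andP[h3 h4] := mesh_node _ (ltnW nN).
by rewrite (itg_split (r n))// ?h3 ?(ltW (mesh_lt _ nN))//; apply: bmS hf.
Qed.

Lemma itg_mesh f : bm 0 b f -> itg 0 b f = \sum_(i < N) itg (r i) (r i.+1) f.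
Proof. by move=> hf; rewrite -itg_meshn//; case: hm => _ ->. Qed.

Lemma bm_elt f i : (i < N)%N -> bm 0 b f -> bm (r i) (r i.+1) f.
Proof.
move=> iN; apply: bmS; first by case/andP: (mesh_node _ (ltnW iN)).
by case/andP: (mesh_node _ iN).
Qed.

Lemma itg_mesh_le f g : bm 0 b f -> bm 0 b g ->
  (forall i x, (i < N)%N -> r i < x < r i.+1 -> f x <= g x) -> itg 0 b f <= itg 0 b g.
Proof.
move=> hf hg fg; rewrite !itg_mesh//; apply: ler_sum => i _.
by apply: itg_le; [exact: bm_elt..|move=> x; exact: fg].
Qed.

Lemma eq_itg_mesh f g : bm 0 b f -> bm 0 b g ->
  (forall i x, (i < N)%N -> r i < x < r i.+1 -> f x = g x) -> itg 0 b f = itg 0 b g.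
Proof.
by move=> hf hg fg; apply/eqP; rewrite eq_le !itg_mesh_le// => i x iN xi; rewrite (fg i x iN xi).
Qed.

Lemma n2_mesh_le f g : bm 0 b f -> bm 0 b g ->
  (forall i x, (i < N)%N -> r i < x < r i.+1 -> `|f x| <= `|g x|) -> n2 0 b f <= n2 0 b g.
Proof.
move=> hf hg fg; apply: ler_wsqrtr; apply: itg_mesh_le; [exact: bmX..|].
move=> i x iN xi; rewrite -[f x ^+ 2]real_normK ?num_real// -[g x ^+ 2]real_normK ?num_real//.
by rewrite ler_sqr ?nnegrE ?(fg i).
Qed.

Definition cm f := forall i x, (i < N)%N -> r i < x < r i.+1 -> {for x, continuous f}.

Lemma cmB f g : cm f -> cm g -> cm (fun x => f x - g x).
Proof. by move=> cf cg i x iN xi; apply: cvgB; [exact: (cf i)|exact: (cg i)]. Qed.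

Lemma cont_local f g x d : 0 < d -> (forall y, `|x - y| < d -> f y = g y) ->
  {for x, continuous f} -> {for x, continuous g}.
Proof.
move=> d0 fg /cont_epsP cf; apply/cont_epsP => e e0; have [d' d'0 h] := cf _ e0.
exists (Num.min d d'); first by rewrite lt_min d0.
move=> y; rewrite lt_min => /andP[yd yd']; rewrite -!fg// ?subrr ?normr0//.
exact: h.
Qed.

Lemma broken_near i x (v : nat -> R -> R) : (i < N)%N -> r i < x < r i.+1 ->
  exists2 d : R, 0 < d & forall y, `|x - y| < d -> v i y = broken_fun N r v y.
Proof.
move=> iN /andP[ix xi]; exists (Num.min (x - r i) (r i.+1 - x)).
  by rewrite lt_min !subr_gt0 ix.
move=> y; rewrite lt_min !ltr_norml => /andP[/andP[? ?] /andP[? ?]].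
by rewrite (broken_funE _ i)//; apply/andP; split; lra.
Qed.

Lemma cm_broken v : (forall i x, (i < N)%N -> r i < x < r i.+1 -> {for x, continuous (v i)}) ->
  cm (broken_fun N r v).
Proof.
move=> h i x iN xi; have [d d0 hd] := broken_near i x v iN xi.
exact: cont_local hd (h _ _ iN xi).
Qed.

Lemma bm_broken v : (forall i, (i < N)%N -> bm (r i) (r i.+1) (v i)) -> bm 0 b (broken_fun N r v).
Proof.
move=> h; apply: bm_mesh => i iN; apply: (bm_ext (v i)); last exact: h.
by move=> x xi; rewrite (broken_funE _ i).
Qed.

Definition bf p := broken_fun N r (fun i x => (p i).[x]).

Lemma bfE p i x : (i < N)%N -> r i < x < r i.+1 -> bf p x = (p i).[x].
Proof. exact: broken_funE. Qed.

Lemma bm_bf p : bm 0 b (bf p).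
Proof. by apply: bm_broken => i _; exact: bm_poly. Qed.

Lemma cm_bf p : cm (bf p).
Proof. by apply: cm_broken => i x _ _; exact: cont_poly. Qed.

(** [Xf f x] is the average over [0 < s < x] of [f x - f s], so a Lipschitz bound near the centre
    makes it linear. For [x >= d] mere boundedness of [Xf f] yields the slope [M / d]. *)
Lemma good_of_lip f (d L : R) : 0 < d -> bm 0 b f ->
  (forall s x, 0 < s -> s <= x -> x < d -> x < b -> `|f x - f s| <= L * x) ->
  good b f /\ forall x, 0 < x -> x < d -> x < b -> `|Xf f x| <= L * x.
Proof.
move=> d0 hf hL; have H x : 0 < x -> x < d -> x < b -> `|Xf f x| <= L * x.
  move=> x0 xd xb; have hx : bm 0 x f by apply: bmS hf; rewrite ?lexx// ltW.
  have -> : Xf f x = itg 0 x (fun s => f x - f s) / x.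
    rewrite itgB//; last exact: bm_cst.
    by rewrite itg_cst ?subr0 ?(ltW x0)// /Xf /av mulrBl mulfK// gt_eqF.
  rewrite normrM normfV (gtr0_norm x0) ler_pdivrMr// -[X in _ <= _ * X]subr0.
  apply: itg_bound; [exact: ltW|by apply: bmB => //; exact: bm_cst|].
  by move=> s /andP[s0 sx]; apply: hL => //; exact: ltW.
split=> //; split=> //; have [M M0 fM] := bm_bounded (bm_Xf b f hf).
exists (`|L| + M / d) => x /andP[x0 xb]; have [xd|dx] := ltP x d.
  apply: (le_trans (H x x0 xd xb)); rewrite ler_wpM2r ?(ltW x0)//.
  by apply: (le_trans (ler_norm _)); rewrite lerDl divr_ge0// ltW.
apply: (le_trans (fM x _)); first by rewrite x0.
rewrite mulrDl -[leLHS]add0r lerD ?mulr_ge0// ?(ltW x0)//.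
by rewrite mulrAC ler_pdivlMr// ler_wpM2l.
Qed.

Lemma good_bf p : 0 < b -> good b (bf p).
Proof.
move=> b0; have N0 := mesh_N b0; have [r0 _ _] := hm.
have r1 : 0 < r 1%N by rewrite -{1}r0 mesh_lt.
have [M M0 fM] := within_bounded _ _ _ (ltW r1) (within_poly (p 0%N)^`() 0 (r 1%N)).
suff h s x : 0 < s -> s <= x -> x < r 1%N -> x < b -> `|bf p x - bf p s| <= M * x.
  exact: (good_of_lip _ (r 1%N) M r1 (bm_bf p) h).1.
move=> s0 sx xr xb.
have x0 : 0 < x by exact: lt_le_trans sx.
rewrite !(bfE _ 0%N)// ?r0 ?s0 ?x0 ?(le_lt_trans sx)//.
move: sx; rewrite le_eqVlt => /predU1P[->|sx].
  by rewrite subrr normr0 mulr_ge0// ltW.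
have [y /andP[sy yx] ->] := MVT_oo (fun x => (p 0%N)^`().[x]) sx (within_poly (p 0%N) s x) (fun y _ => is_derive_poly _ y).
rewrite normrM (gtr0_norm (x := x - s)) ?subr_gt0//; apply: ler_pM => //.
- by rewrite subr_ge0 ltW.
- by rewrite fM// ltW ?(lt_trans s0)//= ltW// (lt_trans yx).
- by rewrite lerBlDr lerDl ltW.
Qed.

(* [(W^2 / x)' = f^2 - (f - W / x)^2] where [W x] is the integral of [f] from [0] to [x]. *)
Lemma hardy f : 0 < b -> bm 0 b f -> cm f -> n2 0 b (Xf f) <= n2 0 b f.
Proof.
move=> b0 hf cf; have [r0 rN _] := hm; have [M M0 fM] := bm_bounded hf.
pose W x := itg 0 x f; pose F x := W x ^+ 2 / x.
have WM x : 0 <= x -> x <= b -> `|W x| <= M * x.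
  move=> x0 xb; rewrite -[x in leRHS]subr0; apply: itg_bound => //; first by apply: bmS hf.
  by move=> y /andP[y0 yx]; apply: fM; rewrite y0 (lt_le_trans yx).
have cW := prim_within hf.
have cF : {within `[0, b], continuous F}.
  apply/within_epsP => x /andP[x0 xb] e e0; move: x0; rewrite le_eqVlt => /predU1P[<-|x0].
    (* At the centre [F] has value 0 by the convention on division, and [F y <= M ^+ 2 * y] gives
       continuity there. *)
    exists (e / (M ^+ 2 + 1)); first by rewrite divr_gt0// ltr_wpDl// sqr_ge0.
    move=> y /andP[y0 yb]; rewrite sub0r normrN (ger0_norm y0) => ye.
    rewrite /F /W (itg_ge 0 0)// expr0n/= mul0r sub0r normrN.
    move: y0; rewrite le_eqVlt => /predU1P[<-|y0]; first by rewrite invr0 mulr0 normr0 ltW.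
    rewrite ger0_norm; last by rewrite divr_ge0 ?sqr_ge0// ltW.
    rewrite ler_pdivrMr//; have := WM y (ltW y0) yb; rewrite -ler_sqr ?nnegrE ?mulr_ge0 ?(ltW y0)//.
    rewrite real_normK ?num_real// => h; apply: (le_trans h).
    rewrite exprMn [y ^+ 2]expr2 mulrA ler_wpM2r ?(ltW y0)//.
    move: ye; rewrite ltr_pdivlMr ?ltr_wpDl ?sqr_ge0// => /ltW h'; apply: le_trans h'.
    by rewrite mulrC ler_wpM2l ?lerDl// ltW.
  have : {within `[x / 2, b], continuous F}.
    apply: within_mul.
      apply: within_mul; apply: withinS cW => //; rewrite divr_ge0// ltW//.
    apply: cont_within => y /andP[xy _]; apply: cvgV; last exact: cvg_id.
    by rewrite gt_eqF// (lt_le_trans _ xy)// divr_gt0.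
  move=> /within_epsP cF'; have xx : x / 2 <= x <= b by rewrite xb andbT; lra.
  have [d d0 hd] := cF' x xx e e0.
  exists (Num.min d (x / 2)); first by rewrite lt_min d0 divr_gt0.
  move=> y /andP[y0 yb]; rewrite lt_min => /andP[yd]; rewrite ltr_norml => /andP[? ?].
  by apply: hd => //; rewrite yb andbT; lra.
have dF i x : (i < N)%N -> r i < x < r i.+1 -> is_derive x 1 F (f x ^+ 2 - Xf f x ^+ 2).
  move=> iN xi; have /andP[x0 xb] := mesh_in _ _ iN xi.
  have x0b : 0 < x < b by rewrite x0.
  have xn0 : x != 0 by rewrite gt_eqF.
  have dW : is_derive x 1 W (f x) := prim_derive x hf x0b (cf _ _ iN xi).
  have dV : is_derive x 1 (fun y : R => y^-1) (- x ^- 2 *: 1) by apply: is_deriveV.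
  have -> : F = (W * W) * (fun y => y^-1) by apply/funext.
  apply: (is_derive_eq (is_deriveM (is_deriveM dW dW) dV)).
  by rewrite /GRing.scale/= /Xf /av [(W * W) x](_ : _ = W x * W x)// -/(W x); field.
have hX := bm_Xf b f hf.
have hd : bm 0 b (fun x => f x ^+ 2 - Xf f x ^+ 2) by apply: bmB; exact: bmX.
have : 0 <= itg 0 b (fun x => f x ^+ 2 - Xf f x ^+ 2).
  rewrite itg_mesh//; have -> : \sum_(i < N) itg (r i) (r i.+1) (fun x => f x ^+ 2 - Xf f x ^+ 2) =
    \sum_(i < N) (F (r i.+1) - F (r i)).
    apply: eq_bigr => -[i iN] _ /=; have /andP[h1 _] := mesh_node _ (ltnW iN).
    have /andP[_ h2] := mesh_node _ iN; apply: (FTC (F := F)).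
    - exact/ltW/mesh_lt.
    - exact: withinS cF.
    - by move=> x; exact: dF.
    - move=> x xi; apply: cvgB; apply: cvgM; try exact: (cf i).
        by apply: cvgB; [exact: (cf i)|apply: (cont_av b) => //; exact: mesh_in xi].
      by apply: cvgB; [exact: (cf i)|apply: (cont_av b) => //; exact: mesh_in xi].
    - exact: bm_elt.
  (* [F] is continuous across the nodes, so the element contributions telescope to [F b - F 0], with
     [F 0 = 0] and [F b >= 0]. *)
  rewrite -(big_mkord xpredT (fun i => F (r i.+1) - F (r i))) telescope_sumr// rN r0.
  by rewrite /F invr0 mulr0 subr0 divr_ge0 ?sqr_ge0// ltW.
rewrite itgB; [|exact: bmX..]; rewrite subr_ge0 => h.
exact: ler_wsqrtr.
Qed.

Lemma hardy_av f : 0 < b -> bm 0 b f -> cm f -> n2 0 b (av f) <= 2 * n2 0 b f.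
Proof.
move=> b0 hf cf; have h := hardy f b0 hf cf.
rewrite (eq_n2 (fun x => f x - Xf f x)); last by move=> x _; rewrite /Xf; ring.
by apply: (le_trans (n2B hf (bm_Xf b f hf))); lra.
Qed.

(** The outer datum is imposed exactly, so the error has trace 0 beyond the last element, whence the
    default value 0. *)
Definition jump p i := (if (i.+1 < N)%N then (p i.+1).[r i.+1] else 0) - (p i).[r i.+1].

Definition dgn p := \sum_(i < N)
  (itg (r i) (r i.+1) (fun x => (p i)^`().[x] ^+ 2) + jump p i ^+ 2 / (r i.+1 - r i)).

(* The jump of [p] at [r i.+1] is spread uniformly over the element [i], so that [dgn p]
   controls the [L^2] norm of a function playing the role of the derivative of [p]. *)
Lemma Kf_bf p : 0 < b -> Kf b (bf p) <= 6 * Num.sqrt (dgn p).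
Proof.
move=> b0; have [r0 rN _] := hm.
pose qv i x := `|(p i)^`().[x]| + 2 * `|jump p i| / (r i.+1 - r i).
pose Q := broken_fun N r qv.
have cq i x : {for x, continuous (qv i)}.
  by apply: cvgD; [apply: cvg_norm; exact: cont_poly|exact: cvg_cst].
have bq i : bm (r i) (r i.+1) (qv i).
  by apply: within_bm; apply: cont_within => x _; exact: cq.
have bQ : bm 0 b Q by apply: bm_broken.
have cQ : cm Q by apply: cm_broken => i x _ _; exact: cq.
have Q0 i x : (i < N)%N -> 0 <= qv i x.
  by move=> iN; rewrite addr_ge0 ?divr_ge0 ?mulr_ge0// ltW// subr_gt0 mesh_lt.
have bsQ : bm 0 b (fun x => x * Q x) by apply: bmM => //; exact: bm_id.
have hp := bm_bf p.
(* On element [i], [E i x] is [x * Xf (bf p) x]. It grows by the integral of [s p'(s)] inside an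
   element and by [r i.+1 * jump p i] across a node. *)
pose E i x := x * (p i).[x] - itg 0 x (bf p).
have bp' i : bm (r i) (r i.+1) (fun x => x * `|(p i)^`().[x]|).
  by apply: bmM; [exact: bm_id|apply: bm_norm; exact: bm_poly].
have stepE i x : (i < N)%N -> r i <= x <= r i.+1 ->
    `|E i x - E i (r i)| <= itg (r i) x (fun s => s * `|(p i)^`().[s]|).
  move=> iN /andP[ix xi].
  have /andP[i0 _] := mesh_node _ (ltnW iN); have /andP[_ ib] := mesh_node _ iN.
  have hpx : bm 0 x (bf p) by apply: bmS hp => //; exact: le_trans ib.
  have -> : E i x - E i (r i) = itg (r i) x (fun s => s * (p i)^`().[s]).
    have e1 : itg (r i) x (fun s => (p i).[s] + s * (p i)^`().[s]) = x * (p i).[x] - r i * (p i).[r i].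
      apply: (FTC (F := fun s => s * (p i).[s])) => //.
      - by apply: cont_within => s _; apply: cvgM; [exact: cvg_id|exact: cont_poly].
      - move=> s _; have d1 : is_derive s 1 (fun s : R => s) 1 by exact: is_derive_id.
        have d2 := is_derive_poly (p i) s.
        rewrite (_ : (fun s => _) = (fun s => s) * (fun s => (p i).[s])); last by apply/funext.
        by apply: (is_derive_eq (is_deriveM d1 d2)); rewrite /GRing.scale/=; ring.
      - move=> s _; apply: cvgD; first exact: cont_poly.
        by apply: cvgM; [exact: cvg_id|exact: cont_poly].
      - by apply: bmD; [exact: bm_poly|apply: bmM; [exact: bm_id|exact: bm_poly]].
    rewrite itgD in e1; [|exact: bm_poly|by apply: bmM; [exact: bm_id|exact: bm_poly]].
    rewrite /E (itg_split (r i) _ hpx) ?i0 ?ix//.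
    have -> : itg (r i) x (bf p) = itg (r i) x (fun s => (p i).[s]).
      apply: eq_itg => s /andP[si sx]; rewrite (bfE _ i)// si/=; exact: lt_le_trans xi.
    by move/eqP: e1; rewrite -subr_eq0 => /eqP e1; apply/eqP; rewrite -subr_eq0; apply/eqP; rewrite -[RHS]oppr0 -[in RHS]e1; ring.
  have bb : bm (r i) x (fun s => s * (p i)^`().[s]).
    by apply: bmM; [exact: bm_id|exact: bm_poly].
  apply: (le_trans (itg_norm bb)); apply: itg_le; first exact: bm_norm.
    by apply: bmM; [exact: bm_id|apply: bm_norm; exact: bm_poly].
  by move=> s /andP[si _]; rewrite normrM ger0_norm// (le_trans i0)// ltW.
have bsS y z : 0 <= y -> z <= b -> bm y z (fun x => x * Q x) by move=> ? ?; apply: bmS bsQ.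
have nodeE i : (i < N)%N -> `|E i (r i)| <= itg 0 (r i) (fun s => s * Q s).
  elim: i => [|i ih] iN.
    by rewrite r0 /E mul0r !(itg_ge 0 0)// subrr normr0.
  have iN' := ltnW iN.
  have /andP[i0 ib] := mesh_node _ (ltnW iN'); have /andP[i1 i1b] := mesh_node _ iN'.
  have ii := mesh_lt _ iN'.
  have h0 : 0 < r i.+1 - r i by rewrite subr_gt0.
  have -> : E i.+1 (r i.+1) = E i (r i) + (E i (r i.+1) - E i (r i)) + r i.+1 * jump p i.
    by rewrite /E /jump iN; ring.
  rewrite (itg_split (r i) _ (bsS _ _ (lexx 0) i1b)) ?i0 ?(ltW ii)//.
  have -> : itg (r i) (r i.+1) (fun s => s * Q s) =
     itg (r i) (r i.+1) (fun s => s * `|(p i)^`().[s]|)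
     + 2 * `|jump p i| / (r i.+1 - r i) * ((r i.+1 ^+ 2 - r i ^+ 2) / 2).
    rewrite -itg_id ?ltW//.
    rewrite -itgZl; last exact: bm_id.
    rewrite -itgD//; last by apply: bmM; [exact: bm_cst|exact: bm_id].
    by apply: eq_itg => s si; rewrite /Q (broken_funE _ i)// /qv; ring.
  rewrite [leRHS]addrA; apply: (le_trans (ler_normD _ _)); apply: lerD.
    apply: (le_trans (ler_normD _ _)); apply: lerD; first exact: ih.
    by apply: stepE => //; rewrite lexx ltW.
  rewrite normrM (ger0_norm i1).
  (* The factor 2 in [qv] undoes the 1/2 in the integral of [s] over the element; the result
     dominates the contribution [r i.+1 * jump p i] of the node. *)
  have -> : 2 * `|jump p i| / (r i.+1 - r i) * ((r i.+1 ^+ 2 - r i ^+ 2) / 2) = `|jump p i| * (r i.+1 + r i).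
    by field; rewrite gt_eqF.
  by rewrite mulrC ler_wpM2l// lerDl.
have XQ i x : (i < N)%N -> r i < x < r i.+1 -> `|qf (bf p) x| <= av Q x.
  move=> iN xi; have /andP[x0 xb] := mesh_in _ _ iN xi; case/andP: (xi) => ix xi1.
  have /andP[i0 ib] := mesh_node _ (ltnW iN).
  have hE : `|E i x| <= itg 0 x (fun s => s * Q s).
    have -> : E i x = E i (r i) + (E i x - E i (r i)) by ring.
    rewrite (itg_split (r i) _ (bsS _ _ (lexx 0) (ltW xb))) ?i0 ?(ltW ix)//.
    apply: (le_trans (ler_normD _ _)); apply: lerD; first exact: nodeE.
    apply: (le_trans (stepE _ _ iN _)); first by rewrite !ltW.
    apply: itg_le; [by apply: bmM; [exact: bm_id|apply: bm_norm; exact: bm_poly]|exact/bsS/ltW|].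
    move=> s /andP[si sx]; rewrite /Q (broken_funE _ i) ?si ?(lt_trans sx)//.
    rewrite ler_wpM2l ?(le_trans i0 (ltW si))// lerDl divr_ge0 ?mulr_ge0// ltW// subr_gt0.
    exact: mesh_lt.
  have -> : qf (bf p) x = E i x / x ^+ 2.
    by rewrite /qf /Xf (bfE _ i)// /E /av; field; rewrite gt_eqF.
  have x2 : 0 < x ^+ 2 by rewrite exprn_gt0.
  rewrite normrM normfV (gtr0_norm x2) ler_pdivrMr//; apply: (le_trans hE).
  (* Bounding [s] by [x] under the integral of [s * Q s] turns [E i x / x ^+ 2] into a plain average
     of [Q], to which Hardy's inequality applies. *)
  have -> : av Q x * x ^+ 2 = x * itg 0 x Q by rewrite /av; field; rewrite gt_eqF.
  have bQx : bm 0 x Q by apply: bmS bQ; rewrite ?lexx// ltW.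
  rewrite -itgZl//; apply: itg_le; [exact/bsS/ltW|by apply: bmM => //; exact: bm_cst|].
  move=> s /andP[s0 sx]; have [j jN /andP[js sj]] := mesh_loc s (introT andP (conj (ltW s0) (lt_trans sx xb))).
  rewrite ler_wpM2r ?(ltW sx)//; rewrite /Q /broken_fun; apply: sumr_ge0 => -[l lN] _ /=.
  by rewrite patchE; case: ifP => // _; exact: Q0.
have gp := good_bf p b0.
apply: (@le_trans _ _ (n2 0 b (av Q))).
  apply: n2_mesh_le; [exact: bm_qf|exact: bm_av|] => i x iN xi.
  by apply: (le_trans (XQ _ _ iN xi)); exact: ler_norm.
apply: (le_trans (hardy_av _ b0 bQ cQ)).
have D0 : 0 <= dgn p.
  apply: sumr_ge0 => -[i iN] _ /=; rewrite addr_ge0//.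
    by apply: itg_ge0 => x _; exact: sqr_ge0.
  by rewrite divr_ge0 ?sqr_ge0// ltW// subr_gt0 mesh_lt.
(* The constant 6 is 2 from the averages times 3 from here: (u + w)^2 <= 2 u^2 + 2 w^2 gives the
   factors 2 for the derivatives and 8 for the jumps, both at most 9. *)
suff : n2 0 b Q <= 3 * Num.sqrt (dgn p) by lra.
apply: sqr_le_le; first by rewrite mulr_ge0// sqrtr_ge0.
rewrite n2_sq exprMn sqr_sqrtr// itg_mesh; last exact: bmX.
rewrite /dgn mulr_sumr; apply: ler_sum => -[i iN] _ /=.
have h0 : 0 < r i.+1 - r i by rewrite subr_gt0 mesh_lt.
have bp2 : bm (r i) (r i.+1) (fun x => (p i)^`().[x] ^+ 2) by apply: bmX; exact: bm_poly.
apply: (@le_trans _ _ (itg (r i) (r i.+1) (fun x => 2 * (p i)^`().[x] ^+ 2 + 2 * (2 * `|jump p i| / (r i.+1 - r i)) ^+ 2))).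
  apply: itg_le.
  - by apply: bmX; exact: bm_elt.
  - by apply: bmD; [apply: bmM => //; exact: bm_cst|exact: bm_cst].
  - move=> x xi; rewrite /Q (broken_funE _ i)// /qv -[(p i)^`().[x] ^+ 2]real_normK ?num_real//.
    set u := `|_|; set w := _ / _; have := sqr_ge0 (u - w).
    have -> : (u - w) ^+ 2 = u ^+ 2 - 2 * (u * w) + w ^+ 2 by ring.
    have -> : (u + w) ^+ 2 = u ^+ 2 + 2 * (u * w) + w ^+ 2 by ring.
    by lra.
rewrite itgD; [|by apply: bmM => //; exact: bm_cst|exact: bm_cst].
rewrite itgZl// itg_cst; last exact/ltW/mesh_lt.
have -> : 2 * (2 * `|jump p i| / (r i.+1 - r i)) ^+ 2 * (r i.+1 - r i) = 8 * (jump p i ^+ 2 / (r i.+1 - r i)).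
  by rewrite -[jump p i ^+ 2]real_normK ?num_real//; field; rewrite gt_eqF.
have I0 : 0 <= itg (r i) (r i.+1) (fun x => (p i)^`().[x] ^+ 2) by apply: itg_ge0 => x _; exact: sqr_ge0.
have J0 : 0 <= jump p i ^+ 2 / (r i.+1 - r i) by rewrite divr_ge0 ?sqr_ge0// ltW.
by move: I0 J0; move: (itg _ _ _) (_ / _) => u v u0 v0; lra.
Qed.

End Mesh.

(** * Polynomials on an element *)

Lemma bm_bsum {R : realType} {a c : R} {n} (F : 'I_n -> R -> R) :
  (forall i, bm a c (F i)) -> bm a c (fun x => \sum_(i < n) F i x).
Proof. by move=> h; have [] := itg_sum F h. Qed.

Lemma itg_bsum {R : realType} {a c : R} {n} (F : 'I_n -> R -> R) :
  (forall i, bm a c (F i)) ->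
  itg a c (fun x => \sum_(i < n) F i x) = \sum_(i < n) itg a c (F i).
Proof. by move=> h; have [] := itg_sum F h. Qed.

Section PolyInt.
Context {R : realType}.
Implicit Types (p q v w : {poly R}) (a c x : R).

Lemma poly_sum n p : (size p <= n)%N -> p = \sum_(i < n) p`_i *: 'X^i.
Proof.
move=> sp; rewrite -poly_def; apply/polyP => i; rewrite coef_poly.
by case: ltnP => // ni; rewrite nth_default// (leq_trans sp).
Qed.

Lemma poly_prim p : exists q, q^`() = p.
Proof.
exists (\sum_(i < size p) (p`_i / i.+1%:R) *: 'X^(i.+1)).
rewrite [RHS](poly_sum (size p))// raddf_sum; apply: eq_bigr => i _ /=.
by rewrite derivZ derivXn/= -scalerMnr scalerMnl -mulr_natr divfK// pnatr_eq0.
Qed.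

(** The affine maps between the reference interval [[0, 1]] and [[a, c]], kept as polynomials so
    that scaling is composition in [{poly R}]. *)
Definition aff a c : {poly R} := (c - a) *: 'X + a%:P.
Definition afi a c : {poly R} := (c - a)^-1 *: ('X - a%:P).

Lemma affE a c x : (aff a c).[x] = (c - a) * x + a.
Proof. by rewrite /aff !hornerE. Qed.

Lemma afiE a c x : (afi a c).[x] = (c - a)^-1 * (x - a).
Proof. by rewrite /afi !hornerE. Qed.

Lemma aff_afi a c x : a < c -> (aff a c).[(afi a c).[x]] = x.
Proof. by move=> ac; rewrite affE afiE; field; rewrite subr_eq0 gt_eqF. Qed.

Lemma afi_aff a c x : a < c -> (afi a c).[(aff a c).[x]] = x.
Proof. by move=> ac; rewrite affE afiE; field; rewrite subr_eq0 gt_eqF. Qed.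

Lemma deriv_aff a c : (aff a c)^`() = (c - a)%:P.
Proof. by rewrite /aff derivD derivZ derivX derivC addr0 alg_polyC. Qed.

Lemma size_aff a c : a < c -> size (aff a c) = 2.
Proof.
move=> ac; rewrite /aff size_polyDl size_scale ?subr_eq0 ?gt_eqF// size_polyX//.
by rewrite (leq_ltn_trans (size_polyC_leq1 _)).
Qed.

Lemma size_afi a c : a < c -> size (afi a c) = 2.
Proof. by move=> ac; rewrite /afi size_scale ?size_XsubC// invr_eq0 subr_eq0 gt_eqF. Qed.

Lemma itg_aff p a c : a < c -> itg a c (fun x => p.[x]) = (c - a) * itg 0 1 (fun y => p.[(aff a c).[y]]).
Proof.
move=> ac; have [q qp] := poly_prim p.
rewrite -qp itg_deriv ?(ltW ac)// -itgZl; last first.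
  by apply: (bm_ext (fun y => (q^`() \Po aff a c).[y])); [move=> y _; rewrite horner_comp|exact: bm_poly].
rewrite (eq_itg (fun y => ((q \Po aff a c)^`()).[y])); last first.
  by move=> y _; rewrite deriv_comp deriv_aff hornerM horner_comp hornerC mulrC.
rewrite itg_deriv// !horner_comp !affE; congr (q.[_] - q.[_]); ring.
Qed.

Lemma poly0_oo p a c : a < c -> (forall x, a < x < c -> p.[x] = 0) -> p = 0.
Proof.
move=> ac h.
pose rs := [seq a + (c - a) / (i.+2)%:R | i <- iota 0 (size p)].
apply: (@roots_geq_poly_eq0 _ p rs); last by rewrite size_map size_iota.
  apply/allP => _ /mapP[i _ ->]; apply/rootP; apply: h.
  have i0 : 0 < (i.+2)%:R :> R by rewrite ltr0n.
  have ca : 0 < c - a by rewrite subr_gt0.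
  rewrite ltrDl divr_gt0//= -ltrBrDl ltr_pdivrMr// ltr_pMr// ltr1n//.
rewrite map_inj_uniq ?iota_uniq// => i j /addrI.
have ca : c - a != 0 by rewrite subr_eq0 gt_eqF.
by move=> /(mulfI ca)/invr_inj/eqP; rewrite eqr_nat => /eqP[].
Qed.

Lemma itg_wsq_eq0 w p a c : a < c -> (forall x, a < x < c -> 0 < w.[x]) ->
  itg a c (fun x => w.[x] * p.[x] ^+ 2) = 0 -> p = 0.
Proof.
move=> ac w0 i0; apply: (poly0_oo _ _ _ ac) => x xac.
have e y : w.[y] * p.[y] ^+ 2 = (w * p ^+ 2).[y] by rewrite hornerM horner_exp.
have h0 y : a < y < c -> 0 <= w.[y] * p.[y] ^+ 2.
  by move=> yac; rewrite mulr_ge0 ?sqr_ge0// ltW// w0.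
have hc y : a < y < c -> {for y, continuous (fun y => w.[y] * p.[y] ^+ 2)}.
  move=> _; rewrite (_ : (fun y => _) = (fun y => (w * p ^+ 2).[y])); last exact/funext.
  exact: cont_poly.
have hb : bm a c (fun y => w.[y] * p.[y] ^+ 2).
  rewrite (_ : (fun y => _) = (fun y => (w * p ^+ 2).[y])); last exact/funext.
  exact: bm_poly.
have /eqP := itg_sqr_eq0 hc hb h0 i0 x xac.
by rewrite mulf_eq0 gt_eqF ?w0//= sqrf_eq0 => /eqP.
Qed.

End PolyInt.

(** * Norm equivalence for polynomials through weighted Gram matrices *)

Section Gram.
Context {R : realType} (w : {poly R}) (n : nat).
Hypothesis w0 : forall x : R, 0 < x < 1 -> 0 < w.[x] <= 1.
Implicit Types (p q v : {poly R}) (a c x : R).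

Definition gram : 'M[R]_n := \matrix_(i, j) itg 0 1 (fun x => (w * 'X^i * 'X^j).[x]).

Lemma gramE (d e : 'rV[R]_n) :
  (d *m gram *m e^T) 0 0 =
  itg 0 1 (fun x => (w * (\sum_i d 0 i *: 'X^i) * (\sum_j e 0 j *: 'X^j)).[x]).
Proof.
rewrite mxE.
transitivity (\sum_j \sum_i itg 0 1 (fun x => d 0 i * e 0 j * (w * 'X^i * 'X^j).[x])).
  apply: eq_bigr => j _; rewrite !mxE mulr_suml; apply: eq_bigr => i _.
  by rewrite itgZl ?mxE; [ring|exact: bm_poly].
have hb i j : bm 0 1 (fun x => d 0 i * e 0 j * (w * 'X^i * 'X^j).[x]).
  by apply: bmM; [exact: bm_cst|exact: bm_poly].
transitivity (\sum_j itg 0 1 (fun x => \sum_i d 0 i * e 0 j * (w * 'X^i * 'X^j).[x])).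
  by apply: eq_bigr => j _; rewrite itg_bsum.
rewrite -itg_bsum; last by move=> j; exact: bm_bsum.
apply: eq_itg => x _; rewrite !hornerM !horner_sum mulr_sumr; apply: eq_bigr => j _.
rewrite mulr_sumr mulr_suml; apply: eq_bigr => i _.
by rewrite !hornerM !hornerZ; ring.
Qed.

Lemma gram_unit : gram \in unitmx.
Proof.
rewrite unitmxE unitfE; apply/det0P => -[v v0 vg].
have := gramE v v; rewrite vg mul0mx mxE => /esym i0.
set p := \sum_i v 0 i *: 'X^i in i0.
have p0 : p = 0.
  apply: (itg_wsq_eq0 w p 0 1) => //; first by move=> x /w0/andP[].
  by rewrite -[RHS]i0; apply: eq_itg => x _; rewrite !hornerM; ring.
case/negP: v0; apply/eqP/rowP => i; rewrite mxE.
have : p`_i = 0 by rewrite p0 coef0.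
rewrite /p coef_sum (bigD1 i)//= coefZ coefXn eqxx mulr1 big1 ?addr0// => j ji.
by rewrite coefZ coefXn; case: eqP => [e|]; rewrite ?mulr0//; case/negP: ji; apply/eqP/val_inj.
Qed.

(** The row of coefficients is its image under the Gram matrix times the inverse matrix. That image
    consists of the weighted moments of [p], each at most the weighted norm since [w ^+ 2 <= w] and
    the monomials are at most 1. *)
Lemma coef_ctrl : exists2 C : R, 0 <= C & forall p, (size p <= n)%N -> forall j : 'I_n,
  `|p`_j| <= C * Num.sqrt (itg 0 1 (fun x => w.[x] * p.[x] ^+ 2)).
Proof.
exists (\sum_(i < n) \sum_(j < n) `|invmx gram i j|).
  by apply: sumr_ge0 => i _; apply: sumr_ge0.
move=> p sp j; set S := Num.sqrt _; have S0 : 0 <= S by exact: sqrtr_ge0.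
pose d : 'rV[R]_n := \row_i p`_i.
have dp : \sum_i d 0 i *: 'X^i = p.
  by rewrite [RHS](poly_sum n)//; apply: eq_bigr => i _; rewrite mxE.
have hb i : `|(d *m gram) 0 i| <= S.
  pose e : 'rV[R]_n := delta_mx 0 i.
  have -> : (d *m gram) 0 i = (d *m gram *m e^T) 0 0.
    rewrite [RHS]mxE (bigD1 i)//= big1 ?addr0; first by rewrite !mxE !eqxx mulr1.
    by move=> l li; rewrite !mxE eqxx/= (negbTE li) mulr0.
  rewrite gramE dp.
  have -> : \sum_j e 0 j *: 'X^j = 'X^i :> {poly R}.
    rewrite (bigD1 i)//= big1 ?addr0; first by rewrite mxE !eqxx scale1r.
    by move=> l li; rewrite mxE eqxx/= (negbTE li) scale0r.
  rewrite (eq_itg (fun x => (w * p).[x] * ('X^i).[x])); last by move=> x _; rewrite !hornerM.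
  apply: (le_trans (CS (bm_poly _ _ _) (bm_poly _ _ _))).
  rewrite -[S]mulr1; apply: ler_pM; rewrite ?n2_ge0//.
    apply: ler_wsqrtr; apply: itg_le.
    - by apply: bmX; exact: bm_poly.
    - by apply: bmM; [exact: bm_poly|apply: bmX; exact: bm_poly].
    - move=> x /w0/andP[h0 h1]; rewrite hornerM exprMn ler_wpM2r ?sqr_ge0//.
      by rewrite expr2 ler_piMl// ltW.
  apply: (@le_trans _ _ (1 * Num.sqrt (1 - 0))); last by rewrite subr0 sqrtr1 mul1r.
  apply: n2_bound => //; first exact: bm_poly.
  by move=> x /andP[x0 x1]; rewrite hornerXn normrX ger0_norm ?(ltW x0)// exprn_ile1// ltW.
have -> : p`_j = \sum_i (d *m gram) 0 i * invmx gram i j.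
  have -> : p`_j = d 0 j by rewrite mxE.
  by rewrite -[d in LHS](mulmxK gram_unit) mxE.
apply: (le_trans (ler_norm_sum _ _ _)).
rewrite mulr_suml; apply: ler_sum => i _; rewrite normrM mulrC.
apply: ler_pM; rewrite ?normr_ge0//.
by rewrite (bigD1 j)//= lerDl; apply: sumr_ge0.
Qed.

Lemma poly_ctrl : exists2 C : R, 0 < C & forall p, (size p <= n)%N -> forall y, 0 <= y <= 1 ->
  `|p.[y]| <= C * Num.sqrt (itg 0 1 (fun x => w.[x] * p.[x] ^+ 2)) /\
  `|p^`().[y]| <= C * Num.sqrt (itg 0 1 (fun x => w.[x] * p.[x] ^+ 2)).
Proof.
have [C C0 hC] := coef_ctrl.
exists (n%:R * n%:R * C + n%:R * C + 1).
  by rewrite ltr_wpDl// addr_ge0// !mulr_ge0.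
move=> p sp y /andP[y0 y1]; set S := Num.sqrt _; have S0 : 0 <= S by exact: sqrtr_ge0.
have y1i i : `|y ^+ i| <= 1 by rewrite normrX ger0_norm// exprn_ile1.
have n0 : 0 <= n%:R :> R by rewrite ler0n.
have hC' i : (i < n)%N -> `|p`_i| <= C * S by move=> ni; exact: (hC _ sp (Ordinal ni)).
split.
  have -> : p.[y] = \sum_(i < n) p`_i * y ^+ i.
    rewrite {1}(poly_sum n p sp) horner_sum; apply: eq_bigr => i _.
    by rewrite hornerZ hornerXn.
  apply: (le_trans (ler_norm_sum _ _ _)).
  apply: (@le_trans _ _ (\sum_(i < n) C * S)).
    apply: ler_sum => i _; rewrite normrM -[leRHS]mulr1.
    by apply: ler_pM; rewrite ?normr_ge0// hC'.
  have -> : \sum_(i < n) C * S = n%:R * C * S by rewrite sumr_const card_ord -[LHS]mulr_natl mulrA.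
  rewrite ler_wpM2r//.
  by rewrite -addrA addrCA lerDl addr_ge0// !mulr_ge0.
have -> : p^`().[y] = \sum_(i < n) p`_i * (y ^+ i.-1 *+ i).
  rewrite {1}(poly_sum n p sp) raddf_sum horner_sum; apply: eq_bigr => i _ /=.
  by rewrite derivZ derivXn hornerZ hornerMn hornerXn.
apply: (le_trans (ler_norm_sum _ _ _)).
apply: (@le_trans _ _ (\sum_(i < n) C * S * n%:R)).
  apply: ler_sum => i _; rewrite normrM; apply: ler_pM; rewrite ?normr_ge0// ?hC'//.
  rewrite -mulr_natl normrM normr_nat -[leRHS]mulr1; apply: ler_pM => //.
  by rewrite ler_nat ltnW.
have -> : \sum_(i < n) C * S * n%:R = n%:R * n%:R * C * S.
  by rewrite sumr_const card_ord -[LHS]mulr_natl; ring.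
rewrite ler_wpM2r//.
by rewrite -addrA lerDl addr_ge0// mulr_ge0.
Qed.

End Gram.

(** * Inverse, trace and weight inequalities on an element *)

Section Element.
Context {R : realType}.
Implicit Types (p q v w : {poly R}) (a c x y M : R) (f g : R -> R).

Lemma afi_itv a c x : a < c -> a <= x <= c -> 0 <= (afi a c).[x] <= 1.
Proof.
move=> ac /andP[ax xc]; have h : 0 < c - a by rewrite subr_gt0.
rewrite afiE mulrC divr_ge0 ?subr_ge0 ?(ltW ac)//= ler_pdivrMr// mul1r; lra.
Qed.

Lemma afi_oo a c x : a < c -> a < x < c -> 0 < (afi a c).[x] < 1.
Proof.
move=> ac /andP[ax xc]; have h : 0 < c - a by rewrite subr_gt0.
rewrite afiE mulrC divr_gt0 ?subr_gt0//= ltr_pdivrMr// mul1r; lra.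
Qed.

Lemma itg_aff_w w p a c : a < c -> itg a c (fun x => w.[(afi a c).[x]] * p.[x]) =
  (c - a) * itg 0 1 (fun y => w.[y] * (p \Po aff a c).[y]).
Proof.
move=> ac; rewrite (eq_itg (fun x => ((w \Po afi a c) * p).[x])); last first.
  by move=> x _; rewrite hornerM horner_comp.
rewrite itg_aff//; congr (_ * _); apply: eq_itg => y _.
by rewrite hornerM !horner_comp afi_aff.
Qed.

Lemma deriv_aff_comp p a c x : a < c -> p^`().[x] = (c - a)^-1 * (p \Po aff a c)^`().[(afi a c).[x]].
Proof.
move=> ac; rewrite deriv_comp deriv_aff hornerM hornerC horner_comp aff_afi//.
by rewrite mulrCA mulVf ?mulr1// subr_eq0 gt_eqF.
Qed.

(** Everything is pulled back to [[0, 1]], so the constant depends on [n] alone and no mesh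
    regularity is involved. The weight 1 yields the trace and both inverse estimates. The weight
    [1 - 'X] yields the third one, which recovers the full norm from a weight vanishing at the right
    end. *)
Lemma inv_ineq n : exists2 C : R, 0 < C & forall a c p, a < c -> (size p <= n)%N ->
  [/\ forall x, a <= x <= c -> p.[x] ^+ 2 <= C / (c - a) * itg a c (fun x => p.[x] ^+ 2),
      itg a c (fun x => p^`().[x] ^+ 2) <= C / (c - a) ^+ 2 * itg a c (fun x => p.[x] ^+ 2),
      itg a c (fun x => p.[x] ^+ 2) <= C * itg a c (fun x => (c - x) / (c - a) * p.[x] ^+ 2) &
      forall M, (forall x, a < x < c -> `|p.[x]| <= M) ->
        forall x, a <= x <= c -> `|p^`().[x]| <= C * M / (c - a)].
Proof.
have w1 (x : R) : 0 < x < 1 -> 0 < (1%:P : {poly R}).[x] <= 1.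
  by move=> _; rewrite hornerC ltr01 lexx.
have w2 (x : R) : 0 < x < 1 -> 0 < (1 - 'X : {poly R}).[x] <= 1.
  by move=> /andP[h1 h2]; rewrite !hornerE; apply/andP; split; lra.
have [C1 C10 h1] := poly_ctrl _ n w1; have [C2 C20 h2] := poly_ctrl _ n w2.
exists (C1 + C1 ^+ 2 + C2 ^+ 2); first by rewrite !addr_gt0// exprn_gt0.
set C := _ + _ + _.
move=> a c p ac sp; have h0 : 0 < c - a by rewrite subr_gt0.
have hn0 : c - a != 0 by rewrite gt_eqF.
pose q := p \Po aff a c.
have sq : (size q <= n)%N by rewrite /q size_comp_poly2// size_aff.
have C1sq : C1 ^+ 2 <= C by rewrite /C -addrA addrCA lerDl addr_ge0 ?sqr_ge0// ltW.
have C2sq : C2 ^+ 2 <= C by rewrite /C lerDr addr_ge0 ?sqr_ge0// ltW.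
have C1C : C1 <= C by rewrite /C -addrA lerDl addr_ge0 ?sqr_ge0.
set I := itg a c (fun x => p.[x] ^+ 2).
have I0 : 0 <= I by apply: itg_ge0 => x _; exact: sqr_ge0.
have e1 : itg 0 1 (fun x => (1%:P : {poly R}).[x] * q.[x] ^+ 2) = I / (c - a).
  rewrite /I [in RHS](eq_itg (fun x => (p ^+ 2).[x])); last by move=> x _; rewrite horner_exp.
  rewrite itg_aff// [RHS]mulrC mulrA mulVf// mul1r; apply: eq_itg => x _.
  by rewrite hornerC mul1r horner_exp /q horner_comp.
set J := itg a c (fun x => (c - x) / (c - a) * p.[x] ^+ 2).
have J0 : 0 <= J.
  apply: itg_ge0 => x /andP[ax xc]; rewrite mulr_ge0 ?sqr_ge0// divr_ge0 ?(ltW h0)// subr_ge0 ltW//.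
have e2 : itg 0 1 (fun x => (1 - 'X : {poly R}).[x] * q.[x] ^+ 2) = J / (c - a).
  rewrite /J [in RHS](eq_itg (fun x => (1 - 'X : {poly R}).[(afi a c).[x]] * (p ^+ 2).[x])); last first.
    by move=> x _; rewrite horner_exp afiE -polyC1 !(hornerD, hornerN, hornerX, hornerC); field.
  rewrite itg_aff_w// [RHS]mulrC mulrA mulVf// mul1r; apply: eq_itg => x _.
  by rewrite -horner_exp /q rmorphXn.
have px x : p.[x] = q.[(afi a c).[x]] by rewrite /q horner_comp aff_afi.
have sqb (A B D S : R) : `|A| <= B * Num.sqrt S -> 0 <= B -> 0 <= S -> B ^+ 2 <= D -> A ^+ 2 <= D * S.
  move=> hA B0 S0 BD; rewrite -[A ^+ 2]real_normK ?num_real//.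
  apply: (@le_trans _ _ (B ^+ 2 * S)); last by rewrite ler_wpM2r.
  have -> : B ^+ 2 * S = (B * Num.sqrt S) ^+ 2 by rewrite exprMn sqr_sqrtr.
  by rewrite ler_sqr ?nnegrE ?mulr_ge0 ?sqrtr_ge0.
have IC : 0 <= I / (c - a) by rewrite divr_ge0// ltW.
have JC : 0 <= J / (c - a) by rewrite divr_ge0// ltW.
split.
- move=> x xac; have [+ _] := h1 q sq _ (afi_itv _ _ _ ac xac).
  rewrite e1 -px mulrAC -mulrA => h; exact: (sqb _ _ _ _ h (ltW C10) IC C1sq).
- apply: (@le_trans _ _ ((C / (c - a) ^+ 3 * I) * (c - a))); last first.
    by apply: eq_ler; field.
  rewrite -(itg_cst _ (ltW ac)); apply: itg_le.
  + by apply: bmX; exact: bm_poly.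
  + exact: bm_cst.
  + move=> x /andP[ax xc]; have xac : a <= x <= c by rewrite !ltW.
    have [_] := h1 q sq _ (afi_itv _ _ _ ac xac); rewrite e1 => h.
    rewrite (deriv_aff_comp _ a c)// exprMn.
    have -> : C / (c - a) ^+ 3 * I = (c - a)^-1 ^+ 2 * (C * (I / (c - a))) by field.
    by rewrite ler_wpM2l ?sqr_ge0//; exact: (sqb _ _ _ _ h (ltW C10) IC C1sq).
- apply: (@le_trans _ _ ((C * (J / (c - a))) * (c - a))); last by rewrite -mulrA divfK.
  rewrite -(itg_cst _ (ltW ac)); apply: itg_le.
  + by apply: bmX; exact: bm_poly.
  + exact: bm_cst.
  + move=> x /andP[ax xc]; have xac : a <= x <= c by rewrite !ltW.
    have [+ _] := h2 q sq _ (afi_itv _ _ _ ac xac); rewrite e2 px => h.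
    exact: (sqb _ _ _ _ h (ltW C20) JC C2sq).
- move=> M pM x xac; have M0 : 0 <= M.
    apply: le_trans (pM ((a + c) / 2) _) => //; apply/andP; split; lra.
  have [_] := h1 q sq _ (afi_itv _ _ _ ac xac); rewrite e1 => h.
  rewrite (deriv_aff_comp _ a c)// normrM normfV (gtr0_norm h0) mulrC ler_wpM2r ?invr_ge0 ?(ltW h0)//.
  apply: (le_trans h); apply: ler_pM; rewrite ?sqrtr_ge0 ?(ltW C10)//.
  rewrite -[M]ger0_norm// -sqrtr_sqr ler_wsqrtr// ler_pdivrMr//.
  rewrite -(itg_cst _ (ltW ac)); apply: itg_le; [by apply: bmX; exact: bm_poly|exact: bm_cst|].
  move=> y yac; rewrite -[_ ^+ 2]real_normK ?num_real// ler_sqr ?nnegrE ?pM//.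
Qed.

End Element.

(** * Weighted projections on an element *)

Section Projection.
Context {R : realType} (w : {poly R}) (n : nat).
Hypothesis w0 : forall x : R, 0 < x < 1 -> 0 < w.[x] <= 1.
Implicit Types (p q v : {poly R}) (a c x y M : R) (f g : R -> R).

(** The dual basis for the weighted moments on [[a, c]]: [prj] is then the polynomial whose moments
    against the weight are those of [f]. Being an explicit linear expression in the moments, it is
    easy to bound and to differentiate in time. *)
Definition bas a c (l : 'I_n) : {poly R} :=
  \sum_(j < n) ((c - a)^-1 * invmx (gram w n) l j) *: afi a c ^+ j.

Definition mom a c f (l : nat) := itg a c (fun x => f x * (afi a c).[x] ^+ l).

Definition prj a c f : {poly R} := \sum_(l < n) mom a c f l *: bas a c l.

Lemma size_prj a c f : a < c -> (size (prj a c f) <= n)%N.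
Proof.
move=> ac; rewrite (leq_trans (size_sum _ _ _))//; apply/bigmax_leqP => l _.
rewrite (leq_trans (size_scale_leq _ _))// (leq_trans (size_sum _ _ _))//.
apply/bigmax_leqP => j _; rewrite (leq_trans (size_scale_leq _ _))//.
by rewrite (leq_trans (size_poly_exp_leq _ _))// size_afi// mul1n.
Qed.

Lemma bm_mom a c f l : bm a c f -> bm a c (fun x => f x * (afi a c).[x] ^+ l).
Proof. by move=> hf; apply: bmM => //; apply: bmX; exact: bm_poly. Qed.

Lemma prjB a c f g : bm a c f -> bm a c g ->
  prj a c (fun x => f x - g x) = prj a c f - prj a c g.
Proof.
move=> hf hg; rewrite /prj -sumrB; apply: eq_bigr => l _; rewrite -scalerBl; congr (_ *: _).
rewrite /mom -itgB; [|exact: bm_mom..].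
by apply: eq_itg => x _; rewrite mulrBl.
Qed.

Lemma mom_bound a c f M l : a < c -> bm a c f -> (forall x, a < x < c -> `|f x| <= M) ->
  `|mom a c f l| <= M * (c - a).
Proof.
move=> ac hf fM; apply: itg_bound; [exact: ltW|exact: bm_mom|] => x xac.
have /andP[y0 y1] := afi_oo _ _ _ ac xac.
rewrite normrM normrX (gtr0_norm y0) -[leRHS]mulr1; apply: ler_pM => //.
  by rewrite exprn_ge0// ltW.
  exact: fM.
by rewrite exprn_ile1// ltW.
Qed.

(** Moments scale like [c - a] and the dual basis like its inverse, so the sup norm stability does
    not depend on the element. *)
Lemma prj_bound : exists2 C : R, 0 <= C & forall a c f M, a < c -> bm a c f ->
  (forall x, a < x < c -> `|f x| <= M) ->
  forall x, a <= x <= c -> `|(prj a c f).[x]| <= C * M.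
Proof.
exists (\sum_(l < n) \sum_(j < n) `|invmx (gram w n) l j|).
  by apply: sumr_ge0 => i _; apply: sumr_ge0.
move=> a c f M ac hf fM x xac; rewrite horner_sum.
have h0 : 0 < c - a by rewrite subr_gt0.
have M0 : 0 <= M by apply: le_trans (fM ((a + c) / 2) _) => //; apply/andP; split; lra.
apply: (le_trans (ler_norm_sum _ _ _)); rewrite mulr_suml; apply: ler_sum => l _.
rewrite hornerZ horner_sum normrM.
apply: (@le_trans _ _ ((M * (c - a)) * ((c - a)^-1 * \sum_(j < n) `|invmx (gram w n) l j|))).
  apply: ler_pM => //; first exact: mom_bound.
  apply: (le_trans (ler_norm_sum _ _ _)); rewrite mulr_sumr; apply: ler_sum => j _.
  rewrite hornerZ horner_exp normrM normrM normfV (gtr0_norm h0) -mulrA ler_wpM2l ?invr_ge0 ?(ltW h0)//.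
  have /andP[y0 y1] := afi_itv _ _ _ ac xac.
  by rewrite ler_piMr// normrX ger0_norm// exprn_ile1.
apply: eq_ler; field; by rewrite gt_eqF.
Qed.

Lemma itg_gram a c i j : a < c -> (i < n)%N -> (j < n)%N ->
  itg a c (fun x => w.[(afi a c).[x]] * ((afi a c).[x] ^+ i * (afi a c).[x] ^+ j)) =
  (c - a) * itg 0 1 (fun x => (w * 'X^i * 'X^j).[x]).
Proof.
move=> ac iN jN.
rewrite (eq_itg (fun x => w.[(afi a c).[x]] * (afi a c ^+ i * afi a c ^+ j).[x])); last first.
  by move=> x _; rewrite hornerM !horner_exp.
rewrite itg_aff_w//; congr (_ * _); apply: eq_itg => x _.
by rewrite horner_comp !hornerM !horner_exp afi_aff// !hornerX mulrA.
Qed.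

Lemma prj_orth a c f v : a < c -> bm a c f -> (size v <= n)%N ->
  itg a c (fun x => w.[(afi a c).[x]] * (prj a c f).[x] * v.[x]) = itg a c (fun x => f x * v.[x]).
Proof.
move=> ac hf sv; pose v' := v \Po aff a c.
have sv' : (size v' <= n)%N by rewrite /v' size_comp_poly2// size_aff.
have vE x : v.[x] = \sum_(i < n) v'`_i * (afi a c).[x] ^+ i.
  have -> : v.[x] = v'.[(afi a c).[x]] by rewrite /v' horner_comp aff_afi.
  rewrite {1}(poly_sum n v' sv') horner_sum; apply: eq_bigr => i _.
  by rewrite hornerZ hornerXn.
have h0 : c - a != 0 by rewrite gt_eqF// subr_gt0.
have wb : bm a c (fun x => w.[(afi a c).[x]]).
  by apply: (bm_ext (fun x => (w \Po afi a c).[x])); [move=> x _; rewrite horner_comp|exact: bm_poly].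
have key (i : 'I_n) : itg a c (fun x => w.[(afi a c).[x]] * (prj a c f).[x] * (afi a c).[x] ^+ i) = mom a c f i.
  pose F (l j : 'I_n) x := (mom a c f l * ((c - a)^-1 * invmx (gram w n) l j)) *
      (w.[(afi a c).[x]] * ((afi a c).[x] ^+ j * (afi a c).[x] ^+ i)).
  have bF l j : bm a c (F l j).
    apply: bmM; first exact: bm_cst.
    by apply: bmM => //; apply: bmM; apply: bmX; exact: bm_poly.
  rewrite (eq_itg (fun x => \sum_(l < n) \sum_(j < n) F l j x)); last first.
    move=> x _; rewrite /prj horner_sum mulr_sumr mulr_suml; apply: eq_bigr => l _.
    rewrite (hornerZ (mom a c f l)) /bas horner_sum !mulr_sumr mulr_suml; apply: eq_bigr => j _.
    by rewrite (hornerZ ((c - a)^-1 * _)) horner_exp /F; ring.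
  rewrite itg_bsum; last by move=> l; exact: bm_bsum.
  transitivity (\sum_(l < n) mom a c f l * (invmx (gram w n) *m gram w n) l i).
    apply: eq_bigr => l _; rewrite itg_bsum// mxE mulr_sumr; apply: eq_bigr => j _.
    rewrite /F itgZl; last by apply: bmM => //; apply: bmM; apply: bmX; exact: bm_poly.
    by rewrite itg_gram// mxE; field.
  rewrite mulVmx; last exact: gram_unit.
  rewrite (bigD1 i)//= mxE eqxx mulr1 big1 ?addr0// => l li.
  by rewrite mxE (negbTE li) mulr0.
have b1 (i : 'I_n) : bm a c (fun x => v'`_i * (w.[(afi a c).[x]] * (prj a c f).[x] * (afi a c).[x] ^+ i)).
  apply: bmM; first exact: bm_cst.
  by apply: bmM; [apply: bmM => //; exact: bm_poly|apply: bmX; exact: bm_poly].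
have b2 (i : 'I_n) : bm a c (fun x => v'`_i * (f x * (afi a c).[x] ^+ i)).
  by apply: bmM; [exact: bm_cst|exact: bm_mom].
rewrite (eq_itg (fun x => \sum_(i < n) v'`_i * (w.[(afi a c).[x]] * (prj a c f).[x] * (afi a c).[x] ^+ i))); last first.
  by move=> x _; rewrite vE mulr_sumr; apply: eq_bigr => i _; ring.
rewrite [RHS](eq_itg (fun x => \sum_(i < n) v'`_i * (f x * (afi a c).[x] ^+ i))); last first.
  by move=> x _; rewrite vE mulr_sumr; apply: eq_bigr => i _; ring.
rewrite !itg_bsum//; apply: eq_bigr => i _; rewrite !itgZl ?key//; first exact: bm_mom.
by apply: bmM; [apply: bmM => //; exact: bm_poly|apply: bmX; exact: bm_poly].
Qed.

Lemma prj_uniq a c f p : a < c -> bm a c f -> (size p <= n)%N ->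
  (forall v, (size v <= n)%N ->
    itg a c (fun x => w.[(afi a c).[x]] * p.[x] * v.[x]) = itg a c (fun x => f x * v.[x])) ->
  p = prj a c f.
Proof.
move=> ac hf sp hp; apply/eqP; rewrite -subr_eq0; apply/eqP.
set d := p - prj a c f.
have sd : (size d <= n)%N by rewrite (leq_trans (size_polyD _ _))// geq_max sp size_polyN size_prj.
apply: (itg_wsq_eq0 (w \Po afi a c) d a c ac).
  by move=> x /(afi_oo _ _ _ ac)/w0/andP[+ _]; rewrite horner_comp.
have wb : bm a c (fun x => w.[(afi a c).[x]]).
  by apply: (bm_ext (fun x => (w \Po afi a c).[x])); [move=> x _; rewrite horner_comp|exact: bm_poly].
rewrite (eq_itg (fun x => w.[(afi a c).[x]] * p.[x] * d.[x] - w.[(afi a c).[x]] * (prj a c f).[x] * d.[x])); last first.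
  move=> x _; have dx : d.[x] = p.[x] - (prj a c f).[x] by rewrite hornerD hornerN.
  by rewrite horner_comp expr2 {1}dx; ring.
have bb q : bm a c (fun x => w.[(afi a c).[x]] * q.[x] * d.[x]).
  by apply: bmM; [apply: bmM => //; exact: bm_poly|exact: bm_poly].
by rewrite itgB// hp// prj_orth// subrr.
Qed.

End Projection.

(** * The L2 and Gauss--Radau projections *)

Section ElementProjections.
Context {R : realType} (k : nat).
Implicit Types (p q v : {poly R}) (a c x y M E : R) (f g : R -> R).

Definition l2p a c f : {poly R} := prj 1 k.+1 a c f.
(** A polynomial with value [f a] at [a] is [f a] plus the affine function [afi a c] times some [q].
    Orthogonality to degree below [k] then says that [q] is the projection of [f - f a] with weight
    ['X] on the reference interval. *)
Definition radp a c f : {poly R} :=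
  (f a)%:P + afi a c * prj 'X k a c (fun x => f x - f a).

Lemma w_one (x : R) : 0 < x < 1 -> 0 < (1 : {poly R}).[x] <= 1.
Proof. by move=> _; rewrite hornerC ltr01 lexx. Qed.

Lemma w_X (x : R) : 0 < x < 1 -> 0 < ('X : {poly R}).[x] <= 1.
Proof. by move=> /andP[h1 h2]; rewrite hornerX h1 ltW. Qed.

Lemma size_l2p a c f : a < c -> (size (l2p a c f) <= k.+1)%N.
Proof. exact: size_prj. Qed.

Lemma size_radp a c f : a < c -> (size (radp a c f) <= k.+1)%N.
Proof.
move=> ac; rewrite (leq_trans (size_polyD _ _))// geq_max.
rewrite (leq_trans (size_polyC_leq1 _))//=.
rewrite (leq_trans (size_polyMleq _ _))// size_afi//= .
by rewrite ltnS; exact: size_prj.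
Qed.

Lemma l2p_orth a c f v : a < c -> bm a c f -> (size v <= k.+1)%N ->
  itg a c (fun x => (f x - (l2p a c f).[x]) * v.[x]) = 0.
Proof.
move=> ac hf sv; have h := prj_orth 1 k.+1 w_one a c f v ac hf sv.
rewrite (eq_itg (fun x => f x * v.[x] - (1 : {poly R}).[(afi a c).[x]] * (l2p a c f).[x] * v.[x])); last first.
  by move=> x _; rewrite hornerC; ring.
rewrite itgB; first by rewrite h subrr.
  by apply: bmM => //; exact: bm_poly.
apply: bmM; last exact: bm_poly.
apply: bmM; last exact: bm_poly.
by apply: (bm_ext (fun _ => 1)); [move=> x _; rewrite hornerC|exact: bm_cst].
Qed.

Lemma radp_left a c f : (radp a c f).[a] = f a.
Proof. by rewrite /radp hornerD hornerC hornerM afiE subrr mulr0 mul0r addr0. Qed.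

Lemma radp_orth a c f v : a < c -> bm a c f -> (size v <= k)%N ->
  itg a c (fun x => (f x - (radp a c f).[x]) * v.[x]) = 0.
Proof.
move=> ac hf sv; have hfa : bm a c (fun x => f x - f a) by apply: bmB => //; exact: bm_cst.
have h := prj_orth 'X k w_X a c _ v ac hfa sv.
have bX : bm a c (fun x => ('X : {poly R}).[(afi a c).[x]]).
  by apply: (bm_ext (fun x => (afi a c).[x])); [move=> x _; rewrite hornerX|exact: bm_poly].
rewrite (eq_itg (fun x => (f x - f a) * v.[x] - ('X : {poly R}).[(afi a c).[x]] * (prj 'X k a c (fun x => f x - f a)).[x] * v.[x])); last first.
  by move=> x _; rewrite /radp hornerD hornerC hornerM hornerX; ring.
rewrite itgB; first by rewrite h subrr.
  by apply: bmM => //; exact: bm_poly.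
by apply: bmM; [apply: bmM => //; exact: bm_poly|exact: bm_poly].
Qed.

Lemma l2p_uniq a c f p : a < c -> bm a c f -> (size p <= k.+1)%N ->
  (forall v, (size v <= k.+1)%N -> itg a c (fun x => p.[x] * v.[x]) = itg a c (fun x => f x * v.[x])) ->
  p = l2p a c f.
Proof.
move=> ac hf sp h; apply: prj_uniq => //; first exact: w_one.
by move=> v sv; rewrite -h//; apply: eq_itg => x _; rewrite hornerC mul1r.
Qed.

Lemma radp_uniq a c f p : a < c -> bm a c f -> (size p <= k.+1)%N -> p.[a] = f a ->
  (forall v, (size v <= k)%N -> itg a c (fun x => (p.[x] - f x) * v.[x]) = 0) ->
  p = radp a c f.
Proof.
move=> ac hf sp pa h.
have [q pq] : exists q, p = (f a)%:P + afi a c * q.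
  have /factor_theorem[q e] : root (p - (f a)%:P) a.
    by apply/rootP; rewrite hornerD hornerN hornerC pa subrr.
  exists ((c - a) *: q); rewrite -[p in LHS](subrK (f a)%:P) e addrC; congr (_ + _).
  rewrite /afi -scalerAl -scalerAr scalerA mulVf ?scale1r 1?mulrC//.
  by rewrite subr_eq0 gt_eqF.
have hfa : bm a c (fun x => f x - f a) by apply: bmB => //; exact: bm_cst.
rewrite pq /radp; congr (_ + _ * _); apply: prj_uniq => //; first exact: w_X.
  have [->|q0] := eqVneq q 0; first by rewrite size_poly0.
  have : (size (afi a c * q)%R <= k.+1)%N.
    have -> : afi a c * q = p - (f a)%:P by rewrite pq addrC addKr.
    rewrite (leq_trans (size_polyD _ _))// geq_max sp size_polyN.
    by rewrite (leq_trans (size_polyC_leq1 _)).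
  by rewrite size_mul ?size_afi// -size_poly_eq0 size_afi.
move=> v sv; have := h v sv.
rewrite (eq_itg (fun x => ('X : {poly R}).[(afi a c).[x]] * q.[x] * v.[x] - (f x - f a) * v.[x])); last first.
  by move=> x _; rewrite pq hornerD hornerC hornerM hornerX; ring.
rewrite itgB; [by move/eqP; rewrite subr_eq0 => /eqP| |by apply: bmM => //; exact: bm_poly].
apply: bmM; [apply: bmM; last exact: bm_poly|exact: bm_poly].
by apply: (bm_ext (fun x => (afi a c).[x])); [move=> x _; rewrite hornerX|exact: bm_poly].
Qed.

Lemma l2p_poly a c p : a < c -> (size p <= k.+1)%N -> l2p a c (fun x => p.[x]) = p.
Proof. by move=> ac sp; apply/esym; apply: l2p_uniq => //; exact: bm_poly. Qed.

Lemma radp_poly a c p : a < c -> (size p <= k.+1)%N -> radp a c (fun x => p.[x]) = p.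
Proof.
move=> ac sp; apply/esym; apply: radp_uniq => //; first exact: bm_poly.
by move=> v _; rewrite -[RHS](itg0 a c); apply: eq_itg => x _; rewrite subrr mul0r.
Qed.

Lemma l2pB a c f g : bm a c f -> bm a c g ->
  l2p a c (fun x => f x - g x) = l2p a c f - l2p a c g.
Proof. exact: prjB. Qed.

Lemma radpB a c f g : bm a c f -> bm a c g ->
  radp a c (fun x => f x - g x) = radp a c f - radp a c g.
Proof.
move=> hf hg; rewrite /radp.
have b1 : bm a c (fun x => f x - f a) by apply: bmB => //; exact: bm_cst.
have b2 : bm a c (fun x => g x - g a) by apply: bmB => //; exact: bm_cst.
have -> : (fun x => f x - g x - (f a - g a)) = (fun x => (f x - f a) - (g x - g a)).
  by apply/funext => x; ring.
rewrite prjB// polyCB; ring.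
Qed.

Lemma proj_bound : exists2 C : R, 0 < C & forall a c f M, a < c -> bm a c f ->
  (forall x, a <= x <= c -> `|f x| <= M) ->
  forall x, a <= x <= c ->
  [/\ `|(l2p a c f).[x]| <= C * M, `|(radp a c f).[x]| <= C * M,
      `|(l2p a c f)^`().[x]| <= C * M / (c - a) & `|(radp a c f)^`().[x]| <= C * M / (c - a)].
Proof.
have [C1 C10 h1] := prj_bound (R := R) 1 k.+1; have [C2 C20 h2] := prj_bound (R := R) 'X k.
have [C3 C30 h3] := inv_ineq (R := R) k.+1.
pose D := 1 + C1 + 2 * C2.
have D0 : 0 < D by rewrite /D addrAC ltr_wpDr// ltr_wpDr// mulr_ge0.
exists (D + C3 * D); first by rewrite addr_gt0// mulr_gt0.
move=> a c f M ac hf fM x xac; have M0 : 0 <= M.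
  by apply: le_trans (fM x xac).
have h0 : 0 < c - a by rewrite subr_gt0.
have hfa : bm a c (fun x => f x - f a) by apply: bmB => //; exact: bm_cst.
have aa : a <= a <= c by rewrite lexx ltW.
have b1 y : a <= y <= c -> `|(l2p a c f).[y]| <= D * M.
  move=> yac; apply: (le_trans (h1 a c f M ac hf _ y yac)).
    by move=> z /andP[? ?]; rewrite fM// !ltW.
  by rewrite ler_wpM2r// /D -addrA addrCA lerDl addr_ge0// mulr_ge0.
have b2 y : a <= y <= c -> `|(radp a c f).[y]| <= D * M.
  move=> yac; rewrite /radp hornerD hornerC hornerM.
  apply: (le_trans (ler_normD _ _)); apply: (@le_trans _ _ (M + C2 * (M + M))).
    apply: lerD; first exact: fM.
    have /andP[y0 y1] := afi_itv _ _ _ ac yac.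
    rewrite normrM (ger0_norm y0) -[leRHS]mul1r; apply: ler_pM => //.
    apply: (h2 a c _ (M + M) ac hfa _ y yac) => z /andP[? ?].
    by apply: (le_trans (ler_normB _ _)); apply: lerD; apply: fM => //; rewrite !ltW.
  have : 0 <= C1 * M by rewrite mulr_ge0.
  by rewrite /D; lra.
have s1 := size_l2p a c f ac; have s2 := size_radp a c f ac.
have DM : 0 <= D * M by rewrite mulr_ge0// ltW.
have CDM : 0 <= C3 * (D * M) by rewrite mulr_ge0// ltW.
have c1 : `|(l2p a c f)^`().[x]| <= C3 * (D * M) / (c - a).
  have [_ _ _ h] := h3 a c _ ac s1; apply: h => // y /andP[? ?].
  by apply: b1; rewrite !ltW.
have c2 : `|(radp a c f)^`().[x]| <= C3 * (D * M) / (c - a).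
  have [_ _ _ h] := h3 a c _ ac s2; apply: h => // y /andP[? ?].
  by apply: b2; rewrite !ltW.
have eD : (D + C3 * D) * M = D * M + C3 * (D * M) by ring.
have le1 : D * M <= (D + C3 * D) * M by rewrite eD lerDl.
have le2 : C3 * (D * M) / (c - a) <= (D + C3 * D) * M / (c - a).
  by rewrite ler_wpM2r ?invr_ge0 ?(ltW h0)// eD lerDr.
split.
- exact: le_trans (b1 x xac) le1.
- exact: le_trans (b2 x xac) le1.
- exact: le_trans c1 le2.
- exact: le_trans c2 le2.
Qed.

Lemma poly_lip p a c M x y : (forall z, a <= z <= c -> `|p^`().[z]| <= M) ->
  a <= x <= c -> a <= y <= c -> `|p.[x] - p.[y]| <= M * `|x - y|.
Proof.
wlog xy : x y / y <= x => [h|] pM xac yac.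
  have [yx|xy] := leP y x; first exact: h.
  by rewrite distrC (distrC x) h// ltW.
move: xy; rewrite le_eqVlt => /predU1P[->|yx]; first by rewrite !subrr normr0 mulr0.
have [z /andP[yz zx] ->] := MVT_oo (fun z => p^`().[z]) yx (within_poly p y x) (fun z _ => is_derive_poly p z).
rewrite normrM ler_wpM2r// pM//; case/andP: xac => _ xc; case/andP: yac => ay _.
by rewrite (le_trans ay (ltW yz)) (le_trans (ltW zx) xc).
Qed.

(** Both projections reproduce [p], so their error on [f] is that of [f - p], and stability applies.
    For increments, the inverse inequality bounds the slope of the projection of [f - p] by a
    multiple of [E / (c - a)]. *)
Lemma proj_approx : exists2 C : R, 0 < C & forall a c f p E, a < c -> bm a c f -> (size p <= k.+1)%N ->
  (forall x, a <= x <= c -> `|f x - p.[x]| <= E) ->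
  (forall x, a <= x <= c -> `|f x - (l2p a c f).[x]| <= C * E /\ `|f x - (radp a c f).[x]| <= C * E) /\
  ((forall x y, a <= x <= c -> a <= y <= c -> `|(f x - p.[x]) - (f y - p.[y])| <= E / (c - a) * `|x - y|) ->
   forall x y, a <= x <= c -> a <= y <= c ->
     `|(f x - (l2p a c f).[x]) - (f y - (l2p a c f).[y])| <= C * E / (c - a) * `|x - y| /\
     `|(f x - (radp a c f).[x]) - (f y - (radp a c f).[y])| <= C * E / (c - a) * `|x - y|).
Proof.
have [C C0 hC] := proj_bound.
exists (1 + C); first by rewrite addr_gt0.
move=> a c f p E ac hf sp fE.
have hp := bm_poly p a c.
have hg : bm a c (fun x => f x - p.[x]) by apply: bmB.
have B x : a <= x <= c -> _ := fun xac => hC a c _ E ac hg fE x xac.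
have e1 : l2p a c f = l2p a c (fun x => f x - p.[x]) + p by rewrite l2pB// l2p_poly// subrK.
have e2 : radp a c f = radp a c (fun x => f x - p.[x]) + p by rewrite radpB// radp_poly// subrK.
rewrite e1 e2; set P1 := l2p _ _ _ in B e1 *; set P2 := radp _ _ _ in B e2 *.
split.
  move=> x xac; have [B1 B2 _ _] := B x xac.
  rewrite (hornerD P1) (hornerD P2) [(1 + C) * E]mulrDl mul1r; split.
    have -> : f x - (P1.[x] + p.[x]) = (f x - p.[x]) - P1.[x] by ring.
    by apply: (le_trans (ler_normB _ _)); apply: lerD => //; exact: fE.
  have -> : f x - (P2.[x] + p.[x]) = (f x - p.[x]) - P2.[x] by ring.
  by apply: (le_trans (ler_normB _ _)); apply: lerD => //; exact: fE.
move=> lip x y xac yac.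
have l1 := poly_lip P1 a c _ x y (fun z zac => let: And4 _ _ h _ := B z zac in h) xac yac.
have l2 := poly_lip P2 a c _ x y (fun z zac => let: And4 _ _ _ h := B z zac in h) xac yac.
have l0 := lip x y xac yac.
have eq : (1 + C) * E / (c - a) * `|x - y| = E / (c - a) * `|x - y| + C * E / (c - a) * `|x - y| by ring.
rewrite !(hornerD P1) !(hornerD P2) eq; split.
  have -> : (f x - (P1.[x] + p.[x])) - (f y - (P1.[y] + p.[y])) =
    ((f x - p.[x]) - (f y - p.[y])) - (P1.[x] - P1.[y]) by ring.
  by apply: (le_trans (ler_normB _ _)); apply: lerD.
have -> : (f x - (P2.[x] + p.[x])) - (f y - (P2.[y] + p.[y])) =
  ((f x - p.[x]) - (f y - p.[y])) - (P2.[x] - P2.[y]) by ring.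
by apply: (le_trans (ler_normB _ _)); apply: lerD.
Qed.

End ElementProjections.

(** * The convection form *)

Definition inverse_ineq {R : realType} (n : nat) (C : R) := forall (x y : R) (q : {poly R}),
  x < y -> (size q <= n)%N ->
  itg x y (fun s => q^`().[s] ^+ 2) <= C / (y - x) ^+ 2 * itg x y (fun s => q.[s] ^+ 2).

Definition trace_ineq {R : realType} (n : nat) (C : R) := forall (x y : R) (q : {poly R}),
  x < y -> (size q <= n)%N -> forall z, x <= z <= y ->
  q.[z] ^+ 2 <= C / (y - x) * itg x y (fun s => q.[s] ^+ 2).

Definition weight_ineq {R : realType} (n : nat) (C : R) := forall (x y : R) (q : {poly R}),
  x < y -> (size q <= n)%N ->
  itg x y (fun s => q.[s] ^+ 2) <= C * itg x y (fun s => (y - s) / (y - x) * q.[s] ^+ 2).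

Section BilinearForm.
Context {R : realType} (b : R) (b0 : 0 < b) (N : nat) (r : nat -> R) (hm : mesh b N r).
Implicit Types (f g a : R -> R) (x y M A : R) (p e phi : nat -> {poly R}).

Let h i := r i.+1 - r i.

Let hgt0 i : (i < N)%N -> 0 < h i.
Proof. by move=> iN; rewrite subr_gt0 (mesh_lt b N r hm). Qed.

(** Information travels inwards, so the upwind value at a node is taken from the element on its
    right; at the outer boundary the error has trace 0. *)
Definition rv e i := if (i < N)%N then (e i).[r i] else 0.

(** The weak form of [- (a f / 2)_r] tested with [phi]. The node values [zp] form a separate
    argument because the numerical trace is not the value of [f] from within at right ends. *)
Definition Bf a f (zp : nat -> R) phi :=
  itg 0 b (fun x => 2^-1 * a x * f x * bf N r (fun i => (phi i)^`()) x)
  - \sum_(i < N) (2^-1 * a (r i.+1) * zp i.+1 * (phi i).[r i.+1]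
                  - 2^-1 * a (r i) * zp i * (phi i).[r i]).

Definition coefA a a' := [/\ {within `[0, b], continuous a},
  forall x, 0 < x < b -> is_derive x 1 a (a' x),
  forall x, 0 < x < b -> {for x, continuous a'} & bm 0 b a'].

Lemma coefA_bm a a' : coefA a a' -> bm 0 b a.
Proof. by case=> ca _ _ _; exact: within_bm. Qed.

Lemma coefAB a a' c c' : coefA a a' -> coefA c c' ->
  coefA (fun x => a x - c x) (fun x => a' x - c' x).
Proof.
move=> [a1 a2 a3 a4] [c1 c2 c3 c4]; split.
- exact: within_sub.
- move=> x xb; have d1 := a2 x xb; have d2 := c2 x xb.
  exact: is_deriveB.
- by move=> x xb; apply: cvgB; [exact: a3|exact: c3].
- exact: bmB.
Qed.

Lemma coefA_gt f : good b f -> coefA (gt b f) (GG b f).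
Proof.
move=> gf; split.
- exact: gt_within.
- by move=> x xb; exact: is_derive_gt.
- by move=> x xb; exact: cont_GG gf xb.
- exact: bm_GG.
Qed.

Lemma elt_parts a a' p i : coefA a a' -> (i < N)%N ->
  itg (r i) (r i.+1) (fun x => a' x * (p i).[x] + a x * (p i)^`().[x]) =
  a (r i.+1) * (p i).[r i.+1] - a (r i) * (p i).[r i].
Proof.
move=> [ca da ca' ba'] iN; have /andP[i0 _] := mesh_node b N r hm _ (ltnW iN).
have /andP[_ ib] := mesh_node b N r hm _ iN.
have inn x : r i < x < r i.+1 -> 0 < x < b := mesh_in b N r hm i x iN.
apply: (FTC (F := fun x => a x * (p i).[x])).
- exact/ltW/(mesh_lt b N r hm).
- by apply: within_mul; [exact: withinS ca|exact: within_poly].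
- move=> x xi; have d1 := da _ (inn _ xi); have d2 := is_derive_poly (p i) x.
  rewrite (_ : (fun x => _) = a * (fun x => (p i).[x])); last by apply/funext.
  by apply: (is_derive_eq (is_deriveM d1 d2)); rewrite /GRing.scale/=; ring.
- move=> x xi; have cax := within_cont x (inn _ xi) ca.
  apply: cvgD; apply: cvgM; try exact: cont_poly; last exact: cax.
  exact: ca' (inn _ xi).
- have ba := within_bm _ _ _ ca.
  have be f := bm_elt b N r hm f i iN.
  by apply: bmD; apply: bmM; try exact: bm_poly; exact: be.
Qed.

Lemma itg_bf (G : R -> R) (F : nat -> R -> R) : bm 0 b G ->
  (forall i x, (i < N)%N -> r i < x < r i.+1 -> G x = F i x) ->
  itg 0 b G = \sum_(i < N) itg (r i) (r i.+1) (F i).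
Proof.
move=> hG GF; rewrite (itg_mesh b N r hm _ hG); apply: eq_bigr => -[i iN] _ /=.
by apply: eq_itg => x xi; exact: GF.
Qed.

Lemma bmbf p : bm 0 b (bf N r p).
Proof. exact: bm_bf. Qed.

(** Integrating by parts back on each element cancels the boundary terms at left ends, where the
    upwind trace is the value from within; at right ends only the jump survives. *)
Lemma B_parts a a' e phi : coefA a a' ->
  Bf a (bf N r e) (rv e) phi =
  - itg 0 b (fun x => 2^-1 * a x * bf N r (fun i => (e i)^`()) x * bf N r phi x)
  - itg 0 b (fun x => 2^-1 * a' x * bf N r e x * bf N r phi x)
  - \sum_(i < N) 2^-1 * a (r i.+1) * jump N r e i * (phi i).[r i.+1].
Proof.
move=> hA; have ba := coefA_bm _ _ hA; have ba' : bm 0 b a' by case: hA.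
have be := bmbf e; have bp := bmbf phi; have be' := bmbf (fun i => (e i)^`()).
have bp' := bmbf (fun i => (phi i)^`()).
have c2 := bm_cst 0 b (2^-1 : R).
have k1 : bm 0 b (fun x => 2^-1 * a x * bf N r e x * bf N r (fun i => (phi i)^`()) x).
  by do !apply: bmM.
have k2 : bm 0 b (fun x => 2^-1 * a x * bf N r (fun i => (e i)^`()) x * bf N r phi x).
  by do !apply: bmM.
have k3 : bm 0 b (fun x => 2^-1 * a' x * bf N r e x * bf N r phi x) by do !apply: bmM.
have : itg 0 b (fun x => 2^-1 * a x * bf N r e x * bf N r (fun i => (phi i)^`()) x)
  + (itg 0 b (fun x => 2^-1 * a x * bf N r (fun i => (e i)^`()) x * bf N r phi x)
  + itg 0 b (fun x => 2^-1 * a' x * bf N r e x * bf N r phi x))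
  = \sum_(i < N) (2^-1 * a (r i.+1) * (e i).[r i.+1] * (phi i).[r i.+1]
       - 2^-1 * a (r i) * (e i).[r i] * (phi i).[r i]).
  rewrite -!itgD//; last exact: bmD.
  rewrite (itg_bf _ (fun i x => 2^-1 * (a' x * ((e i * phi i).[x]) + a x * (e i * phi i)^`().[x]))).
  - apply: eq_bigr => -[i iN] _ /=; rewrite itgZl; last first.
      have hb f := bm_elt b N r hm f i iN.
      by apply: bmD; apply: bmM; try exact: bm_poly; exact: hb.
    by rewrite (elt_parts a a' (fun i => e i * phi i)%R i hA iN) !hornerM; ring.
  - by apply: bmD => //; exact: bmD.
  - move=> i x iN xi; rewrite !(bfE _ _ _ hm _ i x iN xi) derivM hornerD !hornerM.
    by ring.
rewrite /Bf => h1.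
set I1 := itg 0 b _ in h1 *; set I2 := itg 0 b _ in h1 *; set I3 := itg 0 b _ in h1 *.
have -> : I1 = \sum_(i < N) (2^-1 * a (r i.+1) * (e i).[r i.+1] * (phi i).[r i.+1]
       - 2^-1 * a (r i) * (e i).[r i] * (phi i).[r i]) - (I2 + I3) by rewrite -h1 addrK.
set S1 := \sum_(i < N) _; set S2 := \sum_(i < N) _; set S3 := \sum_(i < N) _.
suff e12 : S1 - S2 = - S3 by rewrite -[RHS]addrA -[X in _ = _ + (_ + X)]e12; ring.
rewrite /S1 /S2 /S3 -sumrB -sumrN; apply: eq_bigr => -[i iN] _ /=.
by rewrite /jump /rv iN; case: ifP => _; ring.
Qed.

(** [a e e'] is half the derivative of [a e^2] minus [a' e^2 / 2]. After a shift of index the node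
    terms complete to squares of jumps, the dissipation of upwinding, plus a square at the
    centre. *)
Lemma B_energy a a' e : coefA a a' ->
  Bf a (bf N r e) (rv e) e =
  4^-1 * \sum_(i < N) a (r i.+1) * jump N r e i ^+ 2 + 4^-1 * (a 0 * rv e 0 ^+ 2)
  - 4^-1 * itg 0 b (fun x => a' x * bf N r e x ^+ 2).
Proof.
move=> hA; have ba := coefA_bm _ _ hA; have ba' : bm 0 b a' by case: hA.
rewrite (B_parts _ _ _ _ hA).
have be := bmbf e; have be' := bmbf (fun i => (e i)^`()).
have c2 := bm_cst 0 b (2^-1 : R).
have k1 : bm 0 b (fun x => a' x * bf N r e x ^+ 2) by apply: bmM => //; exact: bmX.
have k2 : bm 0 b (fun x => 2^-1 * a x * bf N r (fun i => (e i)^`()) x * bf N r e x) by do !apply: bmM.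
have -> : itg 0 b (fun x => 2^-1 * a' x * bf N r e x * bf N r e x) =
  2^-1 * itg 0 b (fun x => a' x * bf N r e x ^+ 2).
  by rewrite -itgZl//; apply: eq_itg => x _; ring.
have : 4 * itg 0 b (fun x => 2^-1 * a x * bf N r (fun i => (e i)^`()) x * bf N r e x) +
  itg 0 b (fun x => a' x * bf N r e x ^+ 2) =
  \sum_(i < N) (a (r i.+1) * (e i).[r i.+1] ^+ 2 - a (r i) * (e i).[r i] ^+ 2).
  have c4 := bm_cst 0 b (4 : R).
  rewrite -itgZl// -itgD//; last exact: bmM.
  rewrite (itg_bf _ (fun i x => a' x * ((e i * e i).[x]) + a x * (e i * e i)^`().[x])).
  - apply: eq_bigr => -[i iN] _ /=.
    by rewrite (elt_parts a a' (fun i => e i * e i)%R i hA iN) !hornerM; ring.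
  - by apply: bmD => //; exact: bmM.
  - move=> i x iN xi; rewrite !(bfE _ _ _ hm _ i x iN xi) derivM hornerD !hornerM.
    by field.
set I1 := itg _ _ _; set I2 := itg _ _ _ => h1.
have h2 : \sum_(i < N) a (r i) * rv e i ^+ 2 = a 0 * rv e 0 ^+ 2 + \sum_(i < N) a (r i.+1) * rv e i.+1 ^+ 2.
  have [r0 _ _] := hm.
  have -> : a 0 * rv e 0 ^+ 2 + \sum_(i < N) a (r i.+1) * rv e i.+1 ^+ 2 = \sum_(i < N.+1) a (r i) * rv e i ^+ 2.
    by rewrite big_ord_recl/= r0.
  by rewrite big_ord_recr/= /rv ltnn expr0n mulr0 addr0.
have -> : I1 = 4^-1 * (\sum_(i < N) (a (r i.+1) * (e i).[r i.+1] ^+ 2 - a (r i) * (e i).[r i] ^+ 2) - I2).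
  by rewrite -h1; field.
have -> : a 0 * rv e 0 ^+ 2 = \sum_(i < N) (a (r i) * rv e i ^+ 2 - a (r i.+1) * rv e i.+1 ^+ 2).
  by rewrite sumrB h2 addrK.
set S1 := \sum_(i < N) _; set S2 := \sum_(i < N) _; set S3 := \sum_(i < N) _; set S4 := \sum_(i < N) _.
suff e12 : - (4^-1 * S1) - S2 = 4^-1 * S3 + 4^-1 * S4 by rewrite -e12; field.
rewrite /S1 /S2 /S3 /S4 !mulr_sumr -sumrN -sumrB -big_split/=; apply: eq_bigr => -[i iN] _ /=.
by rewrite /jump /rv iN; case: ifP => _; field.
Qed.

Lemma n2_bf_sq p : n2 0 b (bf N r p) ^+ 2 = \sum_(i < N) itg (r i) (r i.+1) (fun x => (p i).[x] ^+ 2).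
Proof.
rewrite n2_sq; apply: (itg_bf _ (fun i x => (p i).[x] ^+ 2)); first by apply: bmX; exact: bmbf.
by move=> i x iN xi; rewrite (bfE _ _ _ hm _ i x iN xi).
Qed.

Lemma n2_bf_deriv n (C : R) phi : 0 <= C -> (forall i, (i < N)%N -> (size (phi i) <= n)%N) ->
  inverse_ineq n C ->
  n2 0 b (bf N r (fun i => h i *: (phi i)^`())) <= Num.sqrt C * n2 0 b (bf N r phi).
Proof.
move=> C0 sp hC; apply: sqr_le_le; first by rewrite mulr_ge0 ?sqrtr_ge0 ?n2_ge0.
rewrite exprMn (sqr_sqrtr C0) !n2_bf_sq mulr_sumr; apply: ler_sum => -[i iN] _ /=.
have h0 := hgt0 _ iN.
rewrite (eq_itg (fun x => h i ^+ 2 * (phi i)^`().[x] ^+ 2)); last by move=> x _; rewrite hornerZ exprMn.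
rewrite itgZl; last by apply: bmX; exact: bm_poly.
have := hC _ _ _ (mesh_lt b N r hm _ iN) (sp _ iN).
rewrite -/(h i); set I1 := itg _ _ _; set I2 := itg _ _ _ => H.
have -> : C * I2 = h i ^+ 2 * (C / h i ^+ 2 * I2) by field; rewrite gt_eqF.
by rewrite ler_wpM2l// sqr_ge0.
Qed.

Lemma sq_b_bound F M : bm 0 b F -> 0 <= M -> (forall i x, (i < N)%N -> r i < x < r i.+1 -> `|F x| <= M) ->
  n2 0 b F <= M * Num.sqrt b.
Proof.
move=> hF M0 FM; apply: (@le_trans _ _ (n2 0 b (fun _ => M))).
  apply: (n2_mesh_le b N r hm) => //; first exact: bm_cst.
  by move=> i x iN xi; rewrite (ger0_norm M0) (FM i).
have := n2_bound M (ltW b0) M0 (bm_cst 0 b M); rewrite subr0; apply.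
by move=> x _; rewrite ger0_norm.
Qed.

(** The factor [h i] in the bound of [F] pays for the inverse inequality on the same element, so no
    comparison between element sizes is needed. *)
Lemma inv_term n (C : R) phi F M : 0 <= C -> (forall i, (i < N)%N -> (size (phi i) <= n)%N) ->
  inverse_ineq n C ->
  bm 0 b F -> 0 <= M -> (forall i x, (i < N)%N -> r i < x < r i.+1 -> `|F x| <= M * h i) ->
  `|itg 0 b (fun x => F x * bf N r (fun i => (phi i)^`()) x)| <=
    M * Num.sqrt b * (Num.sqrt C * n2 0 b (bf N r phi)).
Proof.
move=> C0 sp hC hF M0 FM.
pose G := broken_fun N r (fun i x => F x / h i).
have hG : bm 0 b G.
  apply: (bm_broken b N r hm) => i iN; apply: bmM; last exact: bm_cst.
  exact: (bm_elt b N r hm).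
have -> : itg 0 b (fun x => F x * bf N r (fun i => (phi i)^`()) x) =
  itg 0 b (fun x => G x * bf N r (fun i => h i *: (phi i)^`()) x).
  apply: (eq_itg_mesh b N r hm); [by apply: bmM => //; exact: bmbf..|].
  move=> i x iN xi; rewrite !(bfE _ _ _ hm _ i x iN xi) /G (broken_funE b N r hm _ i x iN xi).
  by rewrite hornerZ mulrA divfK// gt_eqF ?hgt0.
apply: (le_trans (CS hG (bmbf _))); apply: ler_pM; rewrite ?n2_ge0//.
  apply: sq_b_bound => // i x iN xi; rewrite /G (broken_funE b N r hm _ i x iN xi).
  rewrite normrM normfV (gtr0_norm (hgt0 _ iN)) ler_pdivrMr ?hgt0//; exact: FM xi.
exact: n2_bf_deriv hC.
Qed.

(** Since the derivatives of [phi] have degree below [k], orthogonality allows [a] to be replaced by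
    [a - a (r i)] on each element. This gains the factor [h i] that [inv_term] asks for. *)
Lemma orth_term k (C : R) phi a eta A M : 0 <= C -> (forall i, (i < N)%N -> (size (phi i) <= k.+1)%N) ->
  inverse_ineq k.+1 C ->
  bm 0 b a -> bm 0 b eta -> 0 <= M -> 0 <= A ->
  (forall i (v : {poly R}), (i < N)%N -> (size v <= k)%N -> itg (r i) (r i.+1) (fun x => eta x * v.[x]) = 0) ->
  (forall i x, (i < N)%N -> r i < x < r i.+1 -> `|a x - a (r i)| <= A * h i) ->
  (forall i x, (i < N)%N -> r i < x < r i.+1 -> `|eta x| <= M) ->
  `|itg 0 b (fun x => a x * eta x * bf N r (fun i => (phi i)^`()) x)| <=
    A * M * Num.sqrt b * (Num.sqrt C * n2 0 b (bf N r phi)).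
Proof.
move=> C0 sp hC ba beta M0 A0 orth ha heta.
pose ab := broken_fun N r (fun i _ => a (r i)).
have bab : bm 0 b ab by apply: (bm_broken b N r hm) => i iN; exact: bm_cst.
have bp' := bmbf (fun i => (phi i)^`()).
have -> : itg 0 b (fun x => a x * eta x * bf N r (fun i => (phi i)^`()) x) =
  itg 0 b (fun x => (a x - ab x) * eta x * bf N r (fun i => (phi i)^`()) x).
  have e0 : itg 0 b (fun x => ab x * eta x * bf N r (fun i => (phi i)^`()) x) = 0.
    rewrite (itg_bf _ (fun i x => a (r i) * (eta x * ((phi i)^`()).[x]))).
    - rewrite big1// => -[i iN] _ /=; rewrite itgZl ?orth ?mulr0//.
        have := sp _ iN; have [->|p0] := eqVneq (phi i) 0; first by rewrite deriv0 size_poly0.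
        by move=> hs; rewrite -ltnS; apply: leq_trans hs; exact: lt_size_deriv.
      by apply: bmM; [exact: (bm_elt b N r hm)|exact: bm_poly].
    - by do !apply: bmM.
    - move=> i x iN xi; rewrite !(bfE _ _ _ hm _ i x iN xi) /ab (broken_funE b N r hm _ i x iN xi).
      by rewrite mulrA.
  have k1 : bm 0 b (fun x => (a x - ab x) * eta x * bf N r (fun i => (phi i)^`()) x).
    by apply: bmM => //; apply: bmM => //; exact: bmB.
  have k2 : bm 0 b (fun x => ab x * eta x * bf N r (fun i => (phi i)^`()) x) by do !apply: bmM.
  rewrite -[RHS]addr0 -[X in _ = _ + X]e0 -itgD//.
  by apply: eq_itg => x _; ring.
apply: (inv_term k.+1 C phi (fun x => (a x - ab x) * eta x) (A * M) C0 sp hC).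
- by apply: bmM => //; exact: bmB.
- exact: mulr_ge0.
- move=> i x iN xi; rewrite /ab (broken_funE b N r hm _ i x iN xi) normrM mulrAC.
  by apply: ler_pM => //; [exact: ha|exact: heta iN xi].
Qed.

End BilinearForm.

(** * Time derivatives of broken norms and Gronwall's inequality *)

Section TimeDerivative.
Context {R : realType} (b : R) (N : nat) (r : nat -> R) (hm : mesh b N r) (n : nat).
Implicit Types (E : R -> nat -> {poly R}) (e phi : nat -> {poly R}) (t : R).

Lemma itg_pq (a c : R) (p q : {poly R}) : (size p <= n)%N -> (size q <= n)%N ->
  itg a c (fun x => p.[x] * q.[x]) =
  \sum_(i < n) \sum_(j < n) p`_i * q`_j * itg a c (fun x => x ^+ i * x ^+ j).
Proof.
move=> sp sq.
have bx (i : 'I_n) (j : 'I_n) : bm a c (fun x => x ^+ i * x ^+ j).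
  by apply: bmM; apply: bmX; exact: bm_id.
have bb (i j : 'I_n) : bm a c (fun x => p`_i * q`_j * (x ^+ i * x ^+ j)).
  by apply: bmM => //; exact: bm_cst.
rewrite (eq_itg (fun x => \sum_(i < n) \sum_(j < n) p`_i * q`_j * (x ^+ i * x ^+ j))).
  rewrite itg_bsum; last by move=> i; exact: bm_bsum.
  apply: eq_bigr => i _; rewrite itg_bsum//; apply: eq_bigr => j _.
  by rewrite itgZl.
move=> x _; rewrite {1}(poly_sum n p sp) {1}(poly_sum n q sq) !horner_sum mulr_suml.
apply: eq_bigr => i _; rewrite mulr_sumr; apply: eq_bigr => j _.
by rewrite !hornerZ !hornerXn; ring.
Qed.

Lemma is_derive_bsum m (F : 'I_m -> R -> R) (F' : 'I_m -> R) t :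
  (forall i, is_derive t 1 (F i) (F' i)) ->
  is_derive t 1 (fun s => \sum_(i < m) F i s) (\sum_(i < m) F' i).
Proof.
move=> h; have := @is_derive_sum R R R m F t 1 F' h.
by rewrite (_ : (fun s => _) = \sum_(i < m) F i)//; apply/funext => s; rewrite fct_sumE.
Qed.

(** In the coefficients, the squared norm is a quadratic form whose entries do not depend on time,
    so the product rule on finite sums suffices. *)
Lemma is_derive_n2sq E e t :
  (exists2 d : R, 0 < d & forall s, `|t - s| < d -> forall i, (i < N)%N -> (size (E s i) <= n)%N) ->
  (forall i, (i < N)%N -> (size (e i) <= n)%N) ->
  (forall i j, (i < N)%N -> (j < n)%N -> is_derive t 1 (fun s => (E s i)`_j) (e i)`_j) ->
  is_derive t 1 (fun s => n2 0 b (bf N r (E s)) ^+ 2)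
    (2 * itg 0 b (fun x => bf N r e x * bf N r (E t) x)).
Proof.
move=> [d d0 sE] se dE.
have sEt : forall i, (i < N)%N -> (size (E t i) <= n)%N by apply: sE; rewrite subrr normr0.
have bbf p := bm_bf b N r hm p.
refine (is_derive_ext _ d _ d0 _ (_ : is_derive t 1 (fun s => \sum_(l < N) \sum_(i < n) \sum_(j < n)
   (E s l)`_i * (E s l)`_j * itg (r l) (r l.+1) (fun x => x ^+ i * x ^+ j)) _)).
  move=> s /sE sEs; rewrite (n2_bf_sq b N r hm); apply: eq_bigr => -[l lN] _ /=.
  by rewrite -itg_pq ?sEs//; apply: eq_itg => x _; rewrite expr2.
have -> : 2 * itg 0 b (fun x => bf N r e x * bf N r (E t) x) =
  \sum_(l < N) \sum_(i < n) \sum_(j < n)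
   ((e l)`_i * (E t l)`_j + (E t l)`_i * (e l)`_j) * itg (r l) (r l.+1) (fun x => x ^+ i * x ^+ j).
  rewrite (itg_bf b N r hm _ (fun i x => (e i).[x] * (E t i).[x])).
  - rewrite mulr_sumr; apply: eq_bigr => -[l lN] _ /=.
    rewrite mulr_natl mulr2n {1}(eq_itg (fun x => (E t l).[x] * (e l).[x])); last by move=> x _; rewrite mulrC.
    rewrite !itg_pq ?sEt ?se// -big_split/=; apply: eq_bigr => i _.
    by rewrite -big_split/=; apply: eq_bigr => j _; ring.
  - exact: bmM.
  - by move=> i x iN xi; rewrite !(bfE _ _ _ hm _ i x iN xi).
apply: is_derive_bsum => -[l lN]; apply: is_derive_bsum => i; apply: is_derive_bsum => j /=.
have d1 := dE l i lN (ltn_ord i); have d2 := dE l j lN (ltn_ord j).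
set m := itg _ _ _.
have d3 := is_deriveM d1 d2.
have dm : is_derive t 1 (fun _ : R => m) 0 by exact: is_derive_cst.
have d4 := is_deriveM d3 dm.
rewrite (_ : (fun s => (E s l)`_i * (E s l)`_j * m) = ((fun s => (E s l)`_i) * (fun s => (E s l)`_j)) * (fun _ => m)); last by apply/funext.
apply: (is_derive_eq d4); rewrite /GRing.scale/= mulr0 add0r; ring.
Qed.

(** An exponential forcing with rate [lam > C] is integrated exactly. The factor [1 / (lam - C)] can
    be made small by raising [lam], and this is what closes the continuity argument. *)
Lemma gronwall (f f' : R -> R) (C Q lam t0 t1 : R) : t0 <= t1 -> C < lam ->
  {within `[t0, t1], continuous f} ->
  (forall t, t0 < t < t1 -> is_derive t 1 f (f' t)) ->
  (forall t, t0 < t < t1 -> f' t <= C * f t + Q * expR (lam * t)) ->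
  f t1 <= expR (C * (t1 - t0)) * f t0 + Q / (lam - C) * (expR (lam * t1) - expR (C * (t1 - t0)) * expR (lam * t0)).
Proof.
move=> t01 Cl cf df hf.
have lC : 0 < lam - C by rewrite subr_gt0.
(* Integrating factor [expR (- C * t)], minus a primitive of the forcing after the same
   multiplication; [F] is then nonincreasing. *)
pose F t := f t * expR (- C * t) - Q / (lam - C) * expR ((lam - C) * t).
have dexp (c t : R) : is_derive t 1 (fun s => expR (c * s)) (c * expR (c * t)).
  have d1 : is_derive t 1 (fun s : R => c * s) c.
    have := @is_deriveZ R R R id c t 1 1 (is_derive_id _ _).
    by rewrite (_ : c \*: id = (fun s => c * s))// /GRing.scale/= mulr1.
  have d2 : is_derive (c * t) 1 (@expR R) (expR (c * t)) by exact: is_derive_expR.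
  by apply: (is_derive_eq (is_derive1_comp d2 d1)); rewrite mulrC.
have cexp (c : R) : {within `[t0, t1], continuous (fun s => expR (c * s))}.
  apply: cont_within => t _.
  have := dexp c t; case=> dd _; apply: differentiable_continuous; exact/derivable1_diffP.
have : F t1 <= F t0.
  apply: (derive_le0 (F := F) (fun t => f' t * expR (- C * t) + f t * (- C * expR (- C * t))
      - Q / (lam - C) * ((lam - C) * expR ((lam - C) * t)))) => //.
  - apply: within_sub; apply: within_mul => //; exact: within_cst.
  - move=> t tt; have d1 := df t tt; have d2 := dexp (- C) t; have d3 := dexp (lam - C) t.
    have dm : is_derive t 1 (fun _ : R => Q / (lam - C)) 0 by exact: is_derive_cst.
    rewrite (_ : F = (f * (fun s => expR (- C * s))) - (fun _ => Q / (lam - C)) * (fun s => expR ((lam - C) * s))); last by apply/funext.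
    apply: (is_derive_eq (is_deriveB (is_deriveM d1 d2) (is_deriveM dm d3))).
    by rewrite /GRing.scale/=; ring.
  - move=> t tt; have := hf t tt; rewrite -subr_ge0 => h0.
    have -> : f' t * expR (- C * t) + f t * (- C * expR (- C * t))
      - Q / (lam - C) * ((lam - C) * expR ((lam - C) * t)) =
      - (expR (- C * t) * (C * f t + Q * expR (lam * t) - f' t)).
      have -> : expR ((lam - C) * t) = expR (- C * t) * expR (lam * t).
        by rewrite -expRD; congr expR; ring.
      by field; rewrite gt_eqF.
    by rewrite oppr_le0 mulr_ge0// expR_ge0.
have e1 : expR (- C * t1) != 0 by rewrite gt_eqF// expR_gt0.
rewrite -(ler_pM2l (expR_gt0 (C * t1))) /F !mulrBr.
have -> : expR (C * t1) * (f t1 * expR (- C * t1)) = f t1.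
  by rewrite mulrCA -expRD -mulrDl subrr mul0r expR0 mulr1.
have -> : expR (C * t1) * (f t0 * expR (- C * t0)) = expR (C * (t1 - t0)) * f t0.
  by rewrite mulrCA -expRD mulrC; congr (expR _ * _); ring.
have -> : expR (C * t1) * (Q / (lam - C) * expR ((lam - C) * t1)) = Q / (lam - C) * expR (lam * t1).
  by rewrite mulrCA -expRD; congr (_ * expR _); ring.
have -> : expR (C * t1) * (Q / (lam - C) * expR ((lam - C) * t0)) = Q / (lam - C) * (expR (C * (t1 - t0)) * expR (lam * t0)).
  by rewrite mulrCA -!expRD; congr (_ * expR _); ring.
rewrite lerBlDr => /le_trans; apply.
by apply: eq_ler; rewrite [C * (t1 - t0)]mulrBr; ring.
Qed.

End TimeDerivative.

(** * Error identity *)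

(** The facts on the exact solution at one time that the error analysis uses. The equation is in
    nonconservative form: expanding [(g~ u / 2)_r] leaves [g~ u_r / 2] and [g~_r (u - u~) / 2]. *)
Record exact_at {R : realType} (b L : R) (U V Ut : R -> R) : Prop := ExactAt {
  ea_bound : forall x, 0 <= x <= b -> `|U x| <= L;
  ea_lip : forall x y, 0 <= x <= b -> 0 <= y <= b -> `|U x - U y| <= L * `|x - y|;
  ea_der : forall x, 0 < x < b -> is_derive x 1 U (V x);
  ea_cont : forall x, 0 < x < b -> {for x, continuous V};
  ea_dbound : forall x, 0 < x < b -> `|V x| <= L;
  ea_pde : forall x, 0 < x < b ->
    Ut x = 2^-1 * (gt b U x * V x + GG b U x * Xf U x) }.

Lemma lip_good {R : realType} (b L : R) (U : R -> R) : 0 < b ->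
  (forall x y, 0 <= x <= b -> 0 <= y <= b -> `|U x - U y| <= L * `|x - y|) ->
  [/\ {within `[0, b], continuous U}, good b U & forall x, 0 < x < b -> `|Xf U x| <= L * x].
Proof.
move=> b0 hL; have cU : {within `[0, b], continuous U}.
  apply: (lip_within _ _ _ L) => x y x0 xy yb.
  rewrite -[X in L * X]ger0_norm ?subr_ge0//; apply: hL; rewrite ?x0 ?yb ?(le_trans x0) ?(le_trans xy)//.
have bU := within_bm _ _ _ cU.
have bound s x : 0 < s -> s <= x -> x < b -> x < b -> `|U x - U s| <= L * x.
  move=> s0 sx xb _; have x0 : 0 < x by exact: lt_le_trans sx.
  have L0 : 0 <= L.
    have := hL 0 b; rewrite !lexx (ltW b0) => /(_ isT isT); rewrite sub0r normrN (gtr0_norm b0) => h.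
    by rewrite -(pmulr_lge0 _ b0); exact: le_trans h.
  apply: (le_trans (hL _ _ _ _)); rewrite ?(ltW x0) ?(ltW xb) ?(ltW s0) ?(le_trans sx (ltW xb))//.
  by rewrite ler_wpM2l// ger0_norm ?subr_ge0// lerBlDr lerDl ltW.
have [gU hX] := good_of_lip b U b L b0 bU bound.
by split=> // x /andP[x0 xb]; apply: hX.
Qed.

Lemma bmM4 {R : realType} (a c : R) (f1 f2 f3 f4 : R -> R) :
  bm a c f1 -> bm a c f2 -> bm a c f3 -> bm a c f4 -> bm a c (fun x => f1 x * f2 x * f3 x * f4 x).
Proof. by move=> h1 h2 h3 h4; apply: bmM => //; apply: bmM => //; exact: bmM. Qed.

(** * The discrete unknowns as functionals of u_h, and the error identity *)

Section Scheme.
Context {R : realType} (k : nat) (b T : R) (Ub : R -> R) (N : nat) (r : nat -> R)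
  (s : hdg_unknowns R).
Hypotheses (b0 : 0 < b) (hm : mesh b N r) (hs : hdg_solution k b T Ub N r s).
Variable t : R.
Hypothesis tT : t \in `[0, T].

Let f := bf N r (uh s t).

Let gf : good b f. Proof. exact: (good_bf b N r hm). Qed.
Let bmf : bm 0 b f. Proof. exact: good_bm gf. Qed.

Let node i : (i <= N)%N -> 0 <= r i <= b := mesh_node b N r hm i.
Let mlt i : (i < N)%N -> r i < r i.+1 := mesh_lt b N r hm i.

(** The interface conditions glue the primitives on the elements from the centre outwards, starting
    from [what s t 0 = 0]. *)
Lemma wh_itg i x : (i < N)%N -> r i <= x <= r i.+1 -> wh r s t i x = itg 0 x f.
Proof.
move=> iN xi.
suff H : what s t i = itg 0 (r i) f.
  case/andP: xi => ix xi; have /andP[i0 _] := node _ (ltnW iN); have /andP[_ i1] := node _ iN.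
  rewrite /wh H itg_cc; last exact: bm_poly.
  rewrite (itg_split (a := 0) (c := x) (r i)) ?i0//; last by apply: bmS bmf => //; exact: le_trans i1.
  congr (_ + _); apply: eq_itg => y /andP[iy yx]; rewrite /f (bfE b N r hm _ i)// iy.
  exact: lt_le_trans xi.
elim: i iN {xi} => [|i ih] iN.
  by have [_ _ -> _] := hdg_boundary hs tT; rewrite itg_ge//; case: hm => ->.
have [_ e _ _] := hdg_interface hs tT iN.
have iN' := ltnW iN; have := ih iN'; move: e.
have /andP[i0 _] := node _ (ltnW iN'); have /andP[_ i1] := node _ iN'.
rewrite /wh !itg_cc; [|exact: bm_poly..].
rewrite (itg_ge (r i.+1))// addr0 => <- ->.
rewrite [RHS](itg_split (r i)) ?i0 ?(ltW (mlt _ iN'))//; last exact: bmS bmf.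
congr (_ + _); apply: eq_itg => y iy; by rewrite /f (bfE b N r hm _ i).
Qed.

Lemma utildeh_av i x : (i < N)%N -> r i <= x <= r i.+1 -> 0 < x -> utildeh r s t i x = av f x.
Proof. by move=> iN xi x0; rewrite /utildeh gt_eqF// (wh_itg i). Qed.

(** Here data propagate inwards from [ghat s t N = 1], so the induction runs over the number [m] of
    elements further out. *)
Lemma gh_gg i x : (i < N)%N -> r i <= x <= r i.+1 -> gh r s t i x = gg b f x.
Proof.
have key j y : (j < N)%N -> ghat s t j.+1 = gg b f (r j.+1) -> r j <= y <= r j.+1 -> gh r s t j y = gg b f y.
  move=> jN e /andP[jy yj]; have /andP[j0 _] := node _ (ltnW jN); have /andP[_ j1] := node _ jN.
  have y0 : 0 <= y by exact: le_trans jy.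
  have bA := bm_Af b f gf.
  have eA z : y < z < r j.+1 -> z^-1 * (Xf f z) ^+ 2 = z^-1 * ((uh s t j).[z] - utildeh r s t j z) ^+ 2.
    move=> /andP[yz zj]; rewrite (utildeh_av j) ?(le_lt_trans y0)//; last first.
      by rewrite (le_trans jy (ltW yz)) ltW.
    by rewrite /Xf {1}/f (bfE b N r hm _ j)// (le_lt_trans jy yz).
  have bA' : bm y (r j.+1) (fun z => z^-1 * (Xf f z) ^+ 2) by apply: bmS bA.
  rewrite /gh e itg_cc; last exact: bm_ext eA bA'.
  rewrite -(eq_itg _ eA) /gg -expRD; congr expR; rewrite /Af.
  rewrite [in RHS](itg_split (r j.+1)) ?yj//; last exact: bmS bA.
  by rewrite opprD addrC.
move=> iN xi; suff H m j : (j + m.+1 = N)%N -> ghat s t j.+1 = gg b f (r j.+1).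
  by apply: key => //; apply: (H (N - i.+1)%N); rewrite addnS -addSn subnKC.
elim: m j => [|m ih] j jN.
  have [_ eg _ _] := hdg_boundary hs tT.
  have jN' : j.+1 = N by rewrite -jN addn1.
  have [_ rN _] := hm; rewrite jN' eg rN /gg /Af itg_ge// oppr0 expR0//.
have jN' : (j.+1 < N)%N by rewrite -jN addnS ltnS addnS ltnS leq_addr.
have [_ _ _] := hdg_interface hs tT jN'.
rewrite (key j.+1)//; last by rewrite lexx ltW// mlt.
  rewrite /gh itg_cc; last first.
    apply: (bm_ext (fun _ => 0)); last exact: bm_cst.
    by move=> y /andP[h1 h2]; have := lt_trans h1 h2; rewrite ltxx.
  by rewrite (itg_ge (r j.+1))// oppr0 expR0 mulr1.
by apply: ih; rewrite -jN addSnnS.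
Qed.

Lemma zh_itg i x : (i < N)%N -> r i <= x <= r i.+1 -> zh r s t i x = itg 0 x (gg b f).
Proof.
have bg := bm_gg b f gf.
have bgh j y : (j < N)%N -> r j <= y <= r j.+1 -> bm (r j) y (gh r s t j) /\
   itg (r j) y (gh r s t j) = itg (r j) y (gg b f).
  move=> jN /andP[jy yj]; have /andP[j0 _] := node _ (ltnW jN); have /andP[_ j1] := node _ jN.
  have e z : r j < z < y -> gg b f z = gh r s t j z.
    by move=> /andP[jz zy]; rewrite (gh_gg j)// (ltW jz) (ltW (lt_le_trans zy yj)).
  split; last by apply/esym; exact: eq_itg.
  by apply: bm_ext e _; apply: bmS bg => //; exact: le_trans j1.
move=> iN xi.
suff H : zhat s t i = itg 0 (r i) (gg b f).
  case/andP: (xi) => ix xi'; have /andP[i0 _] := node _ (ltnW iN); have /andP[_ i1] := node _ iN.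
  have [h1 h2] := bgh i x iN xi.
  rewrite /zh H (itg_cc h1) h2 -(itg_split (r i)) ?i0//.
  by apply: bmS bg => //; exact: le_trans i1.
elim: i iN {xi} => [|i ih] iN.
  by have [_ _ _ ->] := hdg_boundary hs tT; rewrite itg_ge//; case: hm => ->.
have [_ _ e _] := hdg_interface hs tT iN.
have iN' := ltnW iN; have := ih iN'; move: e.
have /andP[i0 _] := node _ (ltnW iN'); have /andP[_ i1] := node _ iN'.
have [h1 h2] := bgh i (r i.+1) iN' (introT andP (conj (ltW (mlt _ iN')) (lexx _))).
have [h3 h4] := bgh i.+1 (r i.+1) iN (introT andP (conj (lexx _) (ltW (mlt _ iN)))).
rewrite /zh (itg_cc h1) (itg_cc h3) h2 h4 (itg_ge (r i.+1))// addr0 => <- ->.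
rewrite -(itg_split (r i)) ?i0 ?(ltW (mlt _ iN'))//; exact: bmS bg.
Qed.

Lemma gtildeh_gt i x : (i < N)%N -> r i <= x <= r i.+1 -> gtildeh r s t i x = gt b f x.
Proof.
move=> iN xi; rewrite /gtildeh /gt; case: eqVneq => [x0|xn0].
  by rewrite (gh_gg i x iN xi) x0.
by rewrite (zh_itg i x iN xi).
Qed.

Lemma derive1_gtildeh i x : (i < N)%N -> r i < x < r i.+1 ->
  derive1 (gtildeh r s t i) x = GG b f x.
Proof.
move=> iN xi; have xb := mesh_in b N r hm i x iN xi.
case/andP: xi => ix xi; pose d := Num.min (x - r i) (r i.+1 - x).
have d0 : 0 < d by rewrite lt_min !subr_gt0 ix.
have := is_derive_ext (gtildeh r s t i) d _ d0 _ (is_derive_gt b f x gf xb).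
move=> h; rewrite derive1E; apply: (@derive_val R R R); apply: h => y.
rewrite lt_min !ltr_norml => /andP[/andP[? ?] /andP[? ?]].
by rewrite (gtildeh_gt i)//; apply/andP; split; lra.
Qed.

Definition upr i := if (i < N)%N then (uh s t i).[r i] else Ub t.

(** Flux continuity identifies the product of coefficient and [uhat] with the upwind product, so
    [uhat] itself never has to be solved for. *)
Lemma flux_rightE i : (i < N)%N -> flux_right r s t i = 2^-1 * gt b f (r i.+1) * upr i.+1.
Proof.
move=> iN; have xi : r i <= r i.+1 <= r i.+1 by rewrite lexx ltW// mlt.
rewrite /upr; case: ifP => [i1N|/negbT]; last first.
  rewrite -leqNgt => Ni; have e : i.+1 = N by apply/eqP; rewrite eqn_leq iN Ni.
  rewrite /flux_right (gtildeh_gt i)//; congr (_ * _); rewrite e.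
  by have [-> _ _ _] := hdg_boundary hs tT.
have [-> _ _ _] := hdg_interface hs tT i1N.
by rewrite /flux_left (gtildeh_gt i.+1)// lexx ltW// mlt.
Qed.

Lemma scheme_elt i (phi : {poly R}) : (i < N)%N -> (size phi <= k.+1)%N ->
  itg (r i) (r i.+1) (fun x => (uh_t s t i).[x] * phi.[x]) =
  - itg (r i) (r i.+1) (fun x => 2^-1 * gt b f x * f x * phi^`().[x])
  + (2^-1 * gt b f (r i.+1) * upr i.+1 * phi.[r i.+1]
     - 2^-1 * gt b f (r i) * upr i * phi.[r i])
  - itg (r i) (r i.+1) (fun x => 2^-1 * GG b f x * av f x * phi.[x]).
Proof.
move=> iN sp; have := hdg_equation hs tT iN sp.
rewrite flux_rightE// /flux_left (gtildeh_gt i) ?lexx ?(ltW (mlt _ iN))//.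
have xin x : r i < x < r i.+1 -> r i <= x <= r i.+1 by move=> /andP[h1 h2]; rewrite !ltW.
have x0 x : r i < x < r i.+1 -> 0 < x by move=> xi; case/andP: (mesh_in b N r hm i x iN xi).
have ui : upr i = (uh s t i).[r i] by rewrite /upr iN.
rewrite -!itgE.
rewrite (@eq_itg _ _ _ (fun x => 2^-1 * gtildeh r s t i x * (uh s t i).[x] * phi^`().[x])
   (fun x => 2^-1 * gt b f x * f x * phi^`().[x])); last first.
  by move=> x xi; rewrite (gtildeh_gt i) ?xin// {3}/f (bfE b N r hm _ i).
rewrite (@eq_itg _ _ _ (fun x => 2^-1 * derive1 (gtildeh r s t i) x * utildeh r s t i x * phi.[x])
   (fun x => 2^-1 * GG b f x * av f x * phi.[x])); last first.
  by move=> x xi; rewrite derive1_gtildeh// (utildeh_av i) ?xin// x0.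
rewrite ui => h; apply/eqP; rewrite -subr_eq0; apply/eqP; rewrite -[RHS]h; ring.
Qed.

Variables (L : R) (U V Ut : R -> R).
Hypotheses (hU : exact_at b L U V Ut) (Ubt : U b = Ub t).

Let cU : {within `[0, b], continuous U}.
Proof. by have [] := lip_good b L U b0 (ea_lip _ _ _ _ _ hU). Qed.
Let gU : good b U.
Proof. by have [] := lip_good b L U b0 (ea_lip _ _ _ _ _ hU). Qed.

(** Twice what is left of the difference of the two equations once the convection of [U - f] by the
    discrete coefficient [gt b f] has been split off. Derivatives fall on the exact solution
    only. *)
Definition Sf x := (GG b U x - GG b f x) * Xf U x + (gt b U x - gt b f x) * V x
  - GG b f x * (av U x - av f x).

Lemma bm_V : bm 0 b V.
Proof. by apply: (bm_cont _ _ _ L) => x xb; [exact: ea_cont hU x xb|exact: ea_dbound hU x xb]. Qed.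

Lemma bm_Sf : bm 0 b Sf.
Proof.
have hV := bm_V; have [bU _] := gU.
have g1 := bm_GG b U gU; have g2 := bm_GG b f gf; have g3 := bm_gt b U gU; have g4 := bm_gt b f gf.
have g5 := bm_Xf b U bU; have g6 := bm_av b U bU; have g7 := bm_av b f bmf.
by apply: bmB; [apply: bmD|]; apply: bmM => //; exact: bmB.
Qed.

Lemma bm_Ut : bm 0 b Ut.
Proof.
have hV := bm_V; have [bU _] := gU.
have g1 := bm_GG b U gU; have g3 := bm_gt b U gU; have g5 := bm_Xf b U bU.
apply: (bm_ext (fun x => 2^-1 * (gt b U x * V x + GG b U x * Xf U x))).
  by move=> x xb; rewrite (ea_pde _ _ _ _ _ hU).
by apply: bmM; [exact: bm_cst|apply: bmD; exact: bmM].
Qed.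

Definition zet x := U x - f x.
Definition zpt i := if (i < N)%N then U (r i) - (uh s t i).[r i] else 0.

Lemma error_identity (phi : nat -> {poly R}) : (forall i, (i < N)%N -> (size (phi i) <= k.+1)%N) ->
  \sum_(i < N) itg (r i) (r i.+1) (fun x => (Ut x - (uh_t s t i).[x]) * (phi i).[x]) =
  - Bf b N r (gt b f) zet zpt phi + 2^-1 * itg 0 b (fun x => Sf x * bf N r phi x).
Proof.
move=> sp; have [bU _] := gU; have hV := bm_V.
have g1 := bm_GG b U gU; have g2 := bm_GG b f gf; have g3 := bm_gt b U gU; have g4 := bm_gt b f gf.
have g5 := bm_Xf b U bU; have g6 := bm_av b U bU; have g7 := bm_av b f bmf.
have hS := bm_Sf; have hUt := bm_Ut.
have bz : bm 0 b zet by apply: bmB.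
have bp := bm_bf b N r hm phi; have bp' := bm_bf b N r hm (fun i => (phi i)^`()).
have c2 := bm_cst 0 b (2^-1 : R).
rewrite /Bf opprB.
rewrite (itg_bf b N r hm _ (fun i x => 2^-1 * gt b f x * zet x * (phi i)^`().[x])); [|exact: (bmM4 _ _ _ _ _ _ c2 g4 bz bp')|]; last first.
  by move=> i x iN xi; rewrite (bfE b N r hm _ i).
rewrite (itg_bf b N r hm _ (fun i x => Sf x * (phi i).[x])); [|exact: (bmM _ _ _ _ hS bp)|]; last first.
  by move=> i x iN xi; rewrite (bfE b N r hm _ i).
rewrite mulr_sumr -sumrB -big_split/=; apply: eq_bigr => -[i iN] _ /=.
have E := fun h => bm_elt b N r hm h i iN.
have e2 := E _ g2; have e4 := E _ g4; have eU := E _ bU; have eV := E _ hV; have e7 := E _ g7.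
have ez := E _ bz; have eS := E _ hS; have et := E _ hUt; have ef := E _ bmf.
have xin x : r i < x < r i.+1 -> 0 < x < b := mesh_in b N r hm i x iN.
have bq := bm_poly (phi i) (r i) (r i.+1); have bq' := bm_poly (phi i)^`() (r i) (r i.+1).
have c2' := bm_cst (r i) (r i.+1) (2^-1 : R).
have /andP[i0 _] := node _ (ltnW iN); have /andP[_ i1] := node _ iN.
(* The exact solution satisfies the element equation up to a source, provided it is convected by the
   discrete coefficient; this is the divergence theorem for that product. *)
have ftc : itg (r i) (r i.+1) (fun x => 2^-1 * (GG b f x * U x + gt b f x * V x) * (phi i).[x]
    + 2^-1 * gt b f x * U x * (phi i)^`().[x]) =
  2^-1 * gt b f (r i.+1) * U (r i.+1) * (phi i).[r i.+1] - 2^-1 * gt b f (r i) * U (r i) * (phi i).[r i].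
  apply: (FTC (F := fun x => 2^-1 * gt b f x * U x * (phi i).[x])).
  - exact/ltW/mlt.
  - apply: within_mul; last exact: within_poly.
    apply: within_mul; last exact: withinS cU.
    apply: within_mul; first exact: within_cst.
    by apply: withinS (gt_within b f gf).
  - move=> x xi; have d1 := is_derive_gt b f x gf (xin _ xi).
    have d2 := ea_der _ _ _ _ _ hU x (xin _ xi); have d3 := is_derive_poly (phi i) x.
    have d0 : is_derive x 1 (fun _ : R => 2^-1 : R) 0 by exact: is_derive_cst.
    rewrite (_ : (fun x => 2^-1 * gt b f x * U x * (phi i).[x]) =
      (((fun _ : R => 2^-1) * gt b f) * U) * (fun x => (phi i).[x])); last by apply/funext.
    apply: (is_derive_eq (is_deriveM (is_deriveM (is_deriveM d0 d1) d2) d3)).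
    rewrite /GRing.scale/= [((fun _ => 2^-1) * gt b f * U) x](_ : _ = 2^-1 * gt b f x * U x)//.
    rewrite [((fun _ => 2^-1) * gt b f) x](_ : _ = 2^-1 * gt b f x)//; ring.
  - move=> x xi; have xb := xin _ xi.
    have c1 := cont_GG b f x gf xb; have c3 := within_cont x xb (gt_within b f gf).
    have c4 := within_cont x xb cU; have c5 := ea_cont _ _ _ _ _ hU x xb.
    apply: cvgD; apply: cvgM; try exact: cont_poly.
      by apply: cvgM; [exact: cvg_cst|apply: cvgD; apply: cvgM].
    by apply: cvgM => //; apply: cvgM => //; exact: cvg_cst.
  - exact: (bmD _ _ _ _ (bmM _ _ _ _ (bmM _ _ _ _ c2' (bmD _ _ _ _ (bmM _ _ _ _ e2 eU)
      (bmM _ _ _ _ e4 eV))) bq) (bmM4 _ _ _ _ _ _ c2' e4 eU bq')).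
have zi : U (r i) - upr i = zpt i by rewrite /upr /zpt iN.
have zi1 : U (r i.+1) - upr i.+1 = zpt i.+1.
  rewrite /upr /zpt; case: ifP => // /negbT; rewrite -leqNgt => Ni.
  have e : i.+1 = N by apply/eqP; rewrite eqn_leq iN Ni.
  by have [_ rN _] := hm; rewrite e rN Ubt subrr.
have k1 := bmM _ _ _ _ et bq.
have k2 := bmM _ _ _ _ (bm_poly (uh_t s t i) (r i) (r i.+1)) bq.
have k3 := bmM4 _ _ _ _ _ _ c2' e4 ef bq'.
have k4 := bmM4 _ _ _ _ _ _ c2' e2 e7 bq.
have k5 := bmM4 _ _ _ _ _ _ c2' e4 ez bq'.
have k7 := bmM _ _ _ _ eS bq.
have k6 := bmM _ _ _ _ c2' k7.
have -> : itg (r i) (r i.+1) (fun x => (Ut x - (uh_t s t i).[x]) * (phi i).[x]) =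
  itg (r i) (r i.+1) (fun x => Ut x * (phi i).[x]) - itg (r i) (r i.+1) (fun x => (uh_t s t i).[x] * (phi i).[x]).
  rewrite -(itgB k1 k2); apply: eq_itg => x _; exact: mulrBl.
rewrite scheme_elt ?sp// -zi -zi1.
rewrite -(itgZl _ k7).
set I1 := itg _ _ _; set I2 := itg _ _ _; set I3 := itg _ _ _; set I4 := itg _ _ _; set I5 := itg _ _ _.
have : I1 + I2 + I3 + I4 - I5 = 2^-1 * gt b f (r i.+1) * U (r i.+1) * (phi i).[r i.+1] - 2^-1 * gt b f (r i) * U (r i) * (phi i).[r i].
  rewrite -ftc /I1 /I2 /I3 /I4 /I5.
  have k12 := bmD _ _ _ _ k1 k3; have k123 := bmD _ _ _ _ k12 k4; have k1234 := bmD _ _ _ _ k123 k5.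
  rewrite -(itgD k1 k3) -(itgD k12 k4) -(itgD k123 k5) -(itgB k1234 k6).
  apply: eq_itg => x xi; rewrite (ea_pde _ _ _ _ _ hU x (xin _ xi)) /Sf /zet /Xf.
  move: (gt b U x) (gt b f x) (GG b U x) (GG b f x) (U x) (f x) (av U x) (av f x) (V x).
  move: ((phi i).[x]) ((phi i)^`().[x]) => p p' gu gf' Gu Gf u f' au af v.
  by field.
move=> e; apply/eqP; rewrite -subr_eq0; apply/eqP.
move/eqP: e; rewrite -subr_eq0 => /eqP e; rewrite -[RHS]e; ring.
Qed.

End Scheme.

Lemma GGE {R : realType} (b : R) f x : GG b f x = (gg b f x - av (gg b f) x) / x.
Proof. by []. Qed.

Lemma gtE {R : realType} (b : R) f x : gt b f x = if x == 0 then gg b f 0 else av (gg b f) x.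
Proof. by []. Qed.

Lemma XfE {R : realType} (f : R -> R) x : Xf f x = f x - av f x.
Proof. by []. Qed.

Lemma SfE {R : realType} (b : R) N r s t (U V : R -> R) x : Sf b N r s t U V x =
  (GG b U x - GG b (bf N r (uh s t)) x) * Xf U x + (gt b U x - gt b (bf N r (uh s t)) x) * V x
  - GG b (bf N r (uh s t)) x * (av U x - av (bf N r (uh s t)) x).
Proof. by []. Qed.

(** * Bounds of coefficient differences and of the source *)

Section GammaBounds.
Context {R : realType} (b : R) (N : nat) (r : nat -> R).
Hypotheses (b0 : 0 < b) (hm : mesh b N r).
Implicit Types (f g U V : R -> R) (x M K L G : R).

Definition pgood f := good b f /\ cm N r f.

Lemma pgoodB f g : pgood f -> pgood g -> pgood (fun x => f x - g x).
Proof. by move=> [h1 h2] [h3 h4]; split; [exact: goodB|exact: cmB]. Qed.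

Lemma n2_Xf f : pgood f -> n2 0 b (Xf f) <= n2 0 b f.
Proof. by move=> [h1 h2]; exact: (hardy b N r hm f b0 (good_bm b h1) h2). Qed.

Lemma n2_av f : pgood f -> n2 0 b (av f) <= 2 * n2 0 b f.
Proof. by move=> [h1 h2]; exact: (hardy_av b N r hm f b0 (good_bm b h1) h2). Qed.

Lemma gg_sup f g K x : pgood f -> pgood g -> Kf b f <= K -> Kf b g <= K -> 0 <= x <= b ->
  `|gg b f x - gg b g x| <= 2 * K * n2 0 b (fun y => f y - g y).
Proof.
move=> hf hg Kf_ Kg xb; apply: (le_trans (gg_lip b f g x hf.1 hg.1 xb)).
rewrite mulrC; apply: ler_pM; rewrite ?n2_ge0 ?addr_ge0 ?Kf_ge0//.
  have -> : 2 * K = K + K by ring.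
  exact: lerD.
exact: n2_Xf (pgoodB _ _ hf hg).
Qed.

Lemma av_sup D G x : bm 0 b D -> (forall y, 0 <= y <= b -> `|D y| <= G) -> 0 < x <= b -> `|av D x| <= G.
Proof.
move=> hD DG xb; apply: (av_bound b) => // y /andP[y0 yx]; apply: DG.
by rewrite (ltW y0) (le_trans (ltW yx))//; case/andP: xb.
Qed.

Lemma gt_sup f g G x : good b f -> good b g ->
  (forall y, 0 <= y <= b -> `|gg b f y - gg b g y| <= G) -> 0 <= x <= b ->
  `|gt b f x - gt b g x| <= G.
Proof.
move=> hf hg hG xb; rewrite !gtE; case: eqVneq => [x0|xn0]; first by apply: hG; rewrite lexx ltW.
case/andP: (xb) => x0 xb'.
rewrite -(avB b (bm_gg b f hf) (bm_gg b g hg) xb').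
apply: (av_sup (fun y => gg b f y - gg b g y)) => //.
  by apply: bmB; exact: bm_gg.
by rewrite xb' andbT lt_neqAle eq_sym xn0.
Qed.

(** Dividing by [x] destroys a sup bound of the difference of [gg], so the estimate keeps the weight
    [x]. Its users supply a factor vanishing linearly at the centre. *)
Lemma GG_sup f g G x : good b f -> good b g ->
  (forall y, 0 <= y <= b -> `|gg b f y - gg b g y| <= G) -> 0 < x < b ->
  `|GG b f x - GG b g x| * x <= 2 * G.
Proof.
move=> hf hg hG /andP[x0 xb].
have h1 := hG x (introT andP (conj (ltW x0) (ltW xb))).
have h2 : `|av (gg b f) x - av (gg b g) x| <= G.
  rewrite -(avB b (bm_gg b f hf) (bm_gg b g hg) (ltW xb)).
  apply: (av_sup (fun y => gg b f y - gg b g y)) => //; last by rewrite x0 ltW.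
  by apply: bmB; exact: bm_gg.
have -> : `|GG b f x - GG b g x| * x = `|(gg b f x - gg b g x) - (av (gg b f) x - av (gg b g) x)|.
  rewrite -[X in _ * X](gtr0_norm x0) -normrM !GGE; congr `|_|.
  move: (gg b f x) (gg b g x) (av (gg b f) x) (av (gg b g) x) => p q p' q'.
  by field; rewrite gt_eqF.
by apply: (le_trans (ler_normB _ _)); lra.
Qed.

Lemma gt_sup4 f1 f2 g1 g2 G x : good b f1 -> good b f2 -> good b g1 -> good b g2 ->
  (forall y, 0 <= y <= b -> `|(gg b f1 y - gg b f2 y) - (gg b g1 y - gg b g2 y)| <= G) ->
  0 <= x <= b -> `|(gt b f1 x - gt b f2 x) - (gt b g1 x - gt b g2 x)| <= G.
Proof.
move=> h1 h2 h3 h4 hG xb; rewrite !gtE; case: eqVneq => [x0|xn0]; first by apply: hG; rewrite lexx ltW.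
case/andP: (xb) => x0 xb'.
have [b1 b2] := (bm_gg b f1 h1, bm_gg b f2 h2); have [b3 b4] := (bm_gg b g1 h3, bm_gg b g2 h4).
rewrite -(avB b b1 b2 xb') -(avB b b3 b4 xb') -(avB b (bmB _ _ _ _ b1 b2) (bmB _ _ _ _ b3 b4) xb').
apply: (av_sup (fun y => (gg b f1 y - gg b f2 y) - (gg b g1 y - gg b g2 y))) => //.
  by apply: bmB; exact: bmB.
by rewrite xb' andbT lt_neqAle eq_sym xn0.
Qed.

Lemma GG_sup4 f1 f2 g1 g2 G x : good b f1 -> good b f2 -> good b g1 -> good b g2 ->
  (forall y, 0 <= y <= b -> `|(gg b f1 y - gg b f2 y) - (gg b g1 y - gg b g2 y)| <= G) ->
  0 < x < b -> `|(GG b f1 x - GG b f2 x) - (GG b g1 x - GG b g2 x)| * x <= 2 * G.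
Proof.
move=> h1 h2 h3 h4 hG /andP[x0 xb].
have hx := hG x (introT andP (conj (ltW x0) (ltW xb))).
have [b1 b2] := (bm_gg b f1 h1, bm_gg b f2 h2); have [b3 b4] := (bm_gg b g1 h3, bm_gg b g2 h4).
have h : `|(av (gg b f1) x - av (gg b f2) x) - (av (gg b g1) x - av (gg b g2) x)| <= G.
  rewrite -(avB b b1 b2 (ltW xb)) -(avB b b3 b4 (ltW xb)) -(avB b (bmB _ _ _ _ b1 b2) (bmB _ _ _ _ b3 b4) (ltW xb)).
  apply: (av_sup (fun y => (gg b f1 y - gg b f2 y) - (gg b g1 y - gg b g2 y))) => //; last by rewrite x0 ltW.
  by apply: bmB; exact: bmB.
have -> : `|(GG b f1 x - GG b f2 x) - (GG b g1 x - GG b g2 x)| * x =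
  `|((gg b f1 x - gg b f2 x) - (gg b g1 x - gg b g2 x)) -
    ((av (gg b f1) x - av (gg b f2) x) - (av (gg b g1) x - av (gg b g2) x))|.
  rewrite -[X in _ * X](gtr0_norm x0) -normrM !GGE; congr `|_|.
  move: (gg b f1 x) (gg b f2 x) (gg b g1 x) (gg b g2 x) (av (gg b f1) x) (av (gg b f2) x) (av (gg b g1) x) (av (gg b g2) x).
  by move=> p1 p2 p3 p4 q1 q2 q3 q4; field; rewrite gt_eqF.
by apply: (le_trans (ler_normB _ _)); lra.
Qed.

Lemma pgood_bf p : pgood (bf N r p).
Proof. by split; [exact: (good_bf b N r hm)|exact: (cm_bf b N r hm)]. Qed.

Lemma n2_sup F M : bm 0 b F -> 0 <= M -> (forall x, 0 < x < b -> `|F x| <= M) -> n2 0 b F <= M * Num.sqrt b.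
Proof.
by move=> hF M0 FM; have := n2_bound M (ltW b0) M0 hF FM; rewrite subr0.
Qed.

Lemma cm_cont f : {within `[0, b], continuous f} -> cm N r f.
Proof. by move=> cf i x iN xi; exact: (within_cont x (mesh_in b N r hm i x iN xi) cf). Qed.

Section OneTime.
Variables (L K : R) (U V Ut f : R -> R).
Hypotheses (hU : exact_at b L U V Ut) (hf : pgood f) (KU : Kf b U <= K) (Kf_ : Kf b f <= K).

Let lg := lip_good b L U b0 (ea_lip _ _ _ _ _ hU).

Lemma exact_cont : {within `[0, b], continuous U}. Proof. by have [] := lg. Qed.
Lemma exact_good : good b U. Proof. by have [] := lg. Qed.
Lemma exact_pgood : pgood U. Proof. by split; [exact: exact_good|apply: cm_cont exact_cont]. Qed.
Lemma exact_Xf x : 0 < x < b -> `|Xf U x| <= L * x. Proof. by have [_ _] := lg; apply. Qed.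

Lemma exact_L0 : 0 <= L.
Proof. by apply: le_trans (ea_bound _ _ _ _ _ hU 0 _) => //; rewrite lexx ltW. Qed.

Lemma K_ge0 : 0 <= K. Proof. by apply: le_trans KU; exact: Kf_ge0. Qed.

Lemma GGf_bd x : 0 < x < b -> 0 <= GG b f x <= K ^+ 2.
Proof.
move=> xb; have /andP[x0 xb'] := xb.
have /andP[h1 h2] := GG_bd b f x hf.1 (introT andP (conj x0 (ltW xb'))).
by rewrite h1 (le_trans h2)// ler_sqr ?nnegrE ?Kf_ge0 ?K_ge0.
Qed.

(** The singular difference of [GG] meets [|Xf U x| <= L * x], and the last term is controlled by
    Hardy's inequality for averages. The constants are 6 = 3 * 2, from three products with a [gg]
    difference of size [2 * K * Z], and 2 from averaging. *)
Lemma Sf_bound :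
  n2 0 b (fun x => (GG b U x - GG b f x) * Xf U x + (gt b U x - gt b f x) * V x
    - GG b f x * (av U x - av f x)) <= (6 * L * K * Num.sqrt b + 2 * K ^+ 2) * n2 0 b (fun x => U x - f x).
Proof.
have hV := bm_V b L U V Ut hU; have gU := exact_good; have L0 := exact_L0; have K0 := K_ge0.
have bU := good_bm b gU; have bf_ := good_bm b hf.1.
have g1 := bm_GG b U gU; have g2 := bm_GG b f hf.1; have g3 := bm_gt b U gU; have g4 := bm_gt b f hf.1.
have g5 := bm_Xf b U bU; have g6 := bm_av b U bU; have g7 := bm_av b f bf_.
set Z := n2 0 b (fun x => U x - f x); have Z0 : 0 <= Z by exact: n2_ge0.
pose G := 2 * K * Z; have G0 : 0 <= G by rewrite !mulr_ge0.
have hG y : 0 <= y <= b -> `|gg b U y - gg b f y| <= G := gg_sup U f K y exact_pgood hf KU Kf_.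
pose F1 x := (GG b U x - GG b f x) * Xf U x + (gt b U x - gt b f x) * V x.
have bF1 : bm 0 b F1.
  exact: (bmD _ _ _ _ (bmM _ _ _ _ (bmB _ _ _ _ g1 g2) g5) (bmM _ _ _ _ (bmB _ _ _ _ g3 g4) hV)).
have F1b : n2 0 b F1 <= (2 * G * L + G * L) * Num.sqrt b.
  apply: n2_sup => //; first by rewrite addr_ge0 ?mulr_ge0.
  move=> x xb; apply: (le_trans (ler_normD _ _)); apply: lerD; rewrite normrM.
    have h1 := GG_sup U f G x gU hf.1 hG xb; have h2 := exact_Xf x xb.
    have x0 : 0 < x by case/andP: xb.
    apply: (@le_trans _ _ (`|GG b U x - GG b f x| * (L * x))); first by rewrite ler_wpM2l.
    by rewrite mulrCA mulrC ler_wpM2r.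
  apply: ler_pM => //; last exact: ea_dbound hU x xb.
  apply: (gt_sup U f G x gU hf.1 hG); by case/andP: xb => h1 h2; rewrite !ltW.
pose F2 x := GG b f x * (av U x - av f x).
have bF2 : bm 0 b F2 by exact: (bmM _ _ _ _ g2 (bmB _ _ _ _ g6 g7)).
have F2b : n2 0 b F2 <= K ^+ 2 * (2 * Z).
  have hz := pgoodB _ _ exact_pgood hf.
  have bz := bm_av b _ (good_bm b hz.1).
  apply: (@le_trans _ _ (n2 0 b (fun x => K ^+ 2 * av (fun y => U y - f y) x))).
    apply: n2_le => //; first by apply: bmM => //; exact: bm_cst.
    move=> x xb; rewrite /F2 -(avB b bU bf_); last by case/andP: xb => _ /ltW.
    have /andP[h1 h2] := GGf_bd x xb.
    rewrite [leLHS]normrM [leRHS]normrM; apply: ler_pM; [exact: normr_ge0|exact: normr_ge0| |exact: lexx].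
    by rewrite (ger0_norm h1) (ger0_norm (sqr_ge0 K)).
  rewrite (n2Z _ bz) (ger0_norm (sqr_ge0 _)) ler_wpM2l ?sqr_ge0//.
  exact: n2_av hz.
apply: (le_trans (n2B bF1 bF2)).
have -> : (6 * L * K * Num.sqrt b + 2 * K ^+ 2) * Z = (2 * G * L + G * L) * Num.sqrt b + K ^+ 2 * (2 * Z).
  by rewrite /G; ring.
exact: lerD.
Qed.

End OneTime.

End GammaBounds.

Section BfLinear.
Context {R : realType} (b : R) (b0 : 0 < b) (N : nat) (r : nat -> R) (hm : mesh b N r).
Implicit Types (a f g : R -> R) (zp : nat -> R) (phi : nat -> {poly R}).

Lemma Bf_addl a f g zp zq phi : bm 0 b a -> bm 0 b f -> bm 0 b g ->
  Bf b N r a (fun x => f x + g x) (fun i => zp i + zq i) phi = Bf b N r a f zp phi + Bf b N r a g zq phi.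
Proof.
move=> ha hf hg; have bp := bm_bf b N r hm (fun i => (phi i)^`()); have c2 := bm_cst 0 b (2^-1 : R).
rewrite /Bf addrACA -opprD -big_split/=; congr (_ - _).
  rewrite -(itgD (bmM4 _ _ _ _ _ _ c2 ha hf bp) (bmM4 _ _ _ _ _ _ c2 ha hg bp)).
  by apply: eq_itg => x _; ring.
by apply: eq_bigr => i _; ring.
Qed.

Lemma Bf_subr a c f zp phi : bm 0 b a -> bm 0 b c -> bm 0 b f ->
  Bf b N r (fun x => a x - c x) f zp phi = Bf b N r a f zp phi - Bf b N r c f zp phi.
Proof.
move=> ha hc hf; have bp := bm_bf b N r hm (fun i => (phi i)^`()); have c2 := bm_cst 0 b (2^-1 : R).
have e1 : itg 0 b (fun x => 2^-1 * (a x - c x) * f x * bf N r (fun i => (phi i)^`()) x) =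
  itg 0 b (fun x => 2^-1 * a x * f x * bf N r (fun i => (phi i)^`()) x) -
  itg 0 b (fun x => 2^-1 * c x * f x * bf N r (fun i => (phi i)^`()) x).
  rewrite -(itgB (bmM4 _ _ _ _ _ _ c2 ha hf bp) (bmM4 _ _ _ _ _ _ c2 hc hf bp)).
  by apply: eq_itg => x _; ring.
have e2 : \sum_(i < N) (2^-1 * (a (r i.+1) - c (r i.+1)) * zp i.+1 * (phi i).[r i.+1]
                  - 2^-1 * (a (r i) - c (r i)) * zp i * (phi i).[r i]) =
  \sum_(i < N) (2^-1 * a (r i.+1) * zp i.+1 * (phi i).[r i.+1] - 2^-1 * a (r i) * zp i * (phi i).[r i]) -
  \sum_(i < N) (2^-1 * c (r i.+1) * zp i.+1 * (phi i).[r i.+1] - 2^-1 * c (r i) * zp i * (phi i).[r i]).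
  by rewrite -sumrB; apply: eq_bigr => i _; ring.
by rewrite /Bf e1 e2; ring.
Qed.

Lemma Bf_subl a f g zp zq phi : bm 0 b a -> bm 0 b f -> bm 0 b g ->
  Bf b N r a (fun x => f x - g x) (fun i => zp i - zq i) phi = Bf b N r a f zp phi - Bf b N r a g zq phi.
Proof.
move=> ha hf hg; have := Bf_addl a (fun x => f x - g x) g (fun i => zp i - zq i) zq phi ha (bmB _ _ _ _ hf hg) hg.
rewrite (_ : (fun x => f x - g x + g x) = f); last by apply/funext => x; rewrite subrK.
rewrite (_ : (fun i => zp i - zq i + zq i) = zp); last by apply/funext => x; rewrite subrK.
by move=> ->; rewrite addrK.
Qed.

Lemma Bf_0 a f phi : Bf b N r a f (fun _ => 0) phi =
  itg 0 b (fun x => 2^-1 * a x * f x * bf N r (fun i => (phi i)^`()) x).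
Proof. by rewrite /Bf big1 ?subr0// => i _; rewrite !mulr0 !mul0r subrr. Qed.

End BfLinear.

(** * Estimates at one time *)

Lemma bfB {R : realType} N r (p q : nat -> {poly R}) x :
  bf N r (fun i => p i - q i) x = bf N r p x - bf N r q x.
Proof.
rewrite /bf /broken_fun -sumrB; apply: eq_bigr => i _; rewrite !patchE.
by case: ifP => _; rewrite ?subr0// hornerD hornerN.
Qed.

Section OneTimeEstimates.
Context {R : realType} (k : nat) (b T : R) (Ub : R -> R) (N : nat) (r : nat -> R)
  (s : hdg_unknowns R).
Hypotheses (b0 : 0 < b) (hm : mesh b N r) (hs : hdg_solution k b T Ub N r s).
Implicit Types (phi e : nat -> {poly R}) (v : {poly R}) (x : R).
Variables (t L K C : R) (U V Ut : R -> R).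
Hypotheses (tT : t \in `[0, T]) (hU : exact_at b L U V Ut) (Ubt : U b = Ub t).
Hypotheses (C0 : 0 < C) (invC : inverse_ineq k.+1 C)
  (traceC : trace_ineq k.+1 C)
  (weightC : weight_ineq k.+1 C).

Let f := bf N r (uh s t).
Let h i := r i.+1 - r i.
Let H := mesh_size N r.
Let a := gt b f.

Hypotheses (KU : Kf b U <= K) (KK : Kf b f <= K).

Definition pR i := radp k (r i) (r i.+1) U.
Definition eR i := pR i - uh s t i.
Definition etaR x := U x - bf N r pR x.

Hypotheses (etaR_bd : forall i x, (i < N)%N -> r i <= x <= r i.+1 ->
  `|U x - (pR i).[x]| <= L * H ^+ k.+1).

Let hgt0 i : (i < N)%N -> 0 < h i.
Proof. by move=> iN; rewrite subr_gt0 (mesh_lt b N r hm). Qed.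
Let gf : good b f. Proof. exact: (good_bf b N r hm). Qed.
Let pf : pgood b N r f. Proof. exact: (pgood_bf b N r b0 hm). Qed.
Let gU : good b U. Proof. exact: (exact_good b b0 L U V Ut hU). Qed.
Let cU : {within `[0, b], continuous U}. Proof. exact: (exact_cont b b0 L U V Ut hU). Qed.
Let L0 : 0 <= L. Proof. exact: (exact_L0 b b0 L U V Ut hU). Qed.
Let K0 : 0 <= K. Proof. by apply: le_trans KU; exact: Kf_ge0. Qed.
Let H0 : 0 <= H.
Proof.
apply: le_trans (mesh_h N r 0 (mesh_N b N r hm b0)).
by rewrite subr_ge0 (mesh_le b N r hm)// (mesh_N b N r hm b0).
Qed.
Let hH i : (i < N)%N -> h i <= H. Proof. exact: mesh_h. Qed.
Let bf_bm p : bm 0 b (bf N r p) := bm_bf b N r hm p.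
Let sq0 : 0 <= Num.sqrt b. Proof. exact: sqrtr_ge0. Qed.

Lemma cU_elt i : (i < N)%N -> bm (r i) (r i.+1) U.
Proof. by move=> iN; apply: (bm_elt b N r hm) => //; exact: within_bm cU. Qed.

Lemma size_eR i : (i < N)%N -> (size (eR i) <= k.+1)%N.
Proof.
move=> iN; rewrite (leq_trans (size_polyD _ _))// geq_max size_polyN.
rewrite size_radp ?(mesh_lt b N r hm)//.
by have [-> _] := hdg_degree hs tT iN.
Qed.

Lemma bm_etaR : bm 0 b etaR.
Proof. by apply: bmB; [exact: within_bm cU|exact: bf_bm]. Qed.

Lemma zet_split : zet N r s t U = (fun x => bf N r eR x + etaR x).
Proof. by apply/funext => x; rewrite /zet /etaR /eR bfB; ring. Qed.

(** The upwind trace is taken at left end points, exactly where the Gauss--Radau projection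
    interpolates; the trace of [U - Pi U] is the explicit 0, written so that [Bf_addl] applies. *)
Lemma zpt_rv : zpt N r s t U = (fun i => rv N r eR i + 0).
Proof.
apply/funext => i; rewrite addr0 /zpt /rv; case: ifP => // iN.
by rewrite /eR hornerD hornerN radp_left.
Qed.

Lemma etaR_in i x : (i < N)%N -> r i < x < r i.+1 -> `|etaR x| <= L * H ^+ k.+1.
Proof.
move=> iN xi; rewrite /etaR (bfE b N r hm _ i x iN xi); apply: etaR_bd => //.
by case/andP: xi => h1 h2; rewrite !ltW.
Qed.

Let LH0 : 0 <= L * H ^+ k.+1. Proof. by rewrite mulr_ge0// exprn_ge0. Qed.

Lemma n2_etaR : n2 0 b etaR <= L * H ^+ k.+1 * Num.sqrt b.
Proof. exact: (sq_b_bound b b0 N r hm _ _ bm_etaR LH0 etaR_in). Qed.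

Lemma n2_zet : n2 0 b (fun x => U x - f x) <= n2 0 b (bf N r eR) + L * H ^+ k.+1 * Num.sqrt b.
Proof.
have -> : (fun x => U x - f x) = (fun x => bf N r eR x + etaR x) by rewrite -zet_split.
apply: (le_trans (n2D (bf_bm _) bm_etaR)); rewrite lerD2l; exact: n2_etaR.
Qed.

Lemma coefA_a : coefA b a (GG b f). Proof. exact: coefA_gt gf. Qed.

Lemma a_lip i x : (i < N)%N -> r i < x < r i.+1 -> `|2^-1 * a x - 2^-1 * a (r i)| <= 2^-1 * K ^+ 2 * h i.
Proof.
move=> iN /andP[ix xi]; have /andP[i0 _] := mesh_node b N r hm _ (ltnW iN).
have /andP[_ i1] := mesh_node b N r hm _ iN.
have /andP[h1 h2] := gt_lip b f (r i) x gf i0 (ltW ix) (le_trans (ltW xi) i1).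
rewrite -mulrBr ger0_norm ?mulr_ge0// -mulrA ler_wpM2l//.
apply: (le_trans h2); apply: ler_pM; rewrite ?sqr_ge0 ?subr_ge0 ?(ltW ix)//.
  by rewrite ler_sqr ?nnegrE ?Kf_ge0.
by rewrite lerB// ltW.
Qed.

Lemma a_bd x : 0 <= x <= b -> expR (- (b * K ^+ 2)) <= a x <= 1.
Proof.
move=> xb; have /andP[h1 h2] := gt_bd b b0 f x gf xb; rewrite h2 andbT.
apply: le_trans h1; rewrite ler_expR lerN2 ler_wpM2l ?(ltW b0)//.
by rewrite ler_sqr ?nnegrE ?Kf_ge0.
Qed.

Lemma node_b i : (i <= N)%N -> 0 <= r i <= b. Proof. exact: (mesh_node b N r hm). Qed.

Lemma etaR_term phi : (forall i, (i < N)%N -> (size (phi i) <= k.+1)%N) ->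
  `|Bf b N r a etaR (fun _ => 0) phi| <=
  2^-1 * K ^+ 2 * (L * H ^+ k.+1) * Num.sqrt b * (Num.sqrt C * n2 0 b (bf N r phi)).
Proof.
move=> sp; rewrite Bf_0.
have ba := coefA_bm b _ _ coefA_a.
apply: (orth_term b b0 N r hm k C phi (fun x => 2^-1 * a x) etaR (2^-1 * K ^+ 2) _ (ltW C0) sp invC).
- by apply: bmM => //; exact: bm_cst.
- exact: bm_etaR.
- exact: LH0.
- by rewrite mulr_ge0 ?sqr_ge0.
- move=> i v iN sv.
  rewrite (eq_itg (fun x => (U x - (radp k (r i) (r i.+1) U).[x]) * v.[x])).
    by apply: radp_orth => //; [exact: (mesh_lt b N r hm)|exact: cU_elt].
  by move=> x xi; rewrite /etaR (bfE b N r hm _ i x iN xi).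
- exact: a_lip.
- exact: etaR_in.
Qed.

Definition cS := 6 * L * K * Num.sqrt b + 2 * K ^+ 2.

Lemma cS_ge0 : 0 <= cS. Proof. by rewrite addr_ge0 ?mulr_ge0 ?sqr_ge0. Qed.

Lemma Sf_term phi : `|2^-1 * itg 0 b (fun x => Sf b N r s t U V x * bf N r phi x)| <=
  2^-1 * (cS * (n2 0 b (bf N r eR) + L * H ^+ k.+1 * Num.sqrt b)) * n2 0 b (bf N r phi).
Proof.
have bS := bm_Sf b N r s b0 hm t L U V Ut hU.
rewrite normrM gtr0_norm// -mulrA ler_wpM2l//.
apply: (le_trans (CS bS (bf_bm phi))); rewrite ler_wpM2r ?n2_ge0//.
apply: (le_trans (Sf_bound b N r b0 hm L K U V Ut f hU pf KU KK)).
by rewrite ler_wpM2l ?cS_ge0//; exact: n2_zet.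
Qed.

Lemma eR_identity phi : (forall i, (i < N)%N -> (size (phi i) <= k.+1)%N) ->
  \sum_(i < N) itg (r i) (r i.+1) (fun x => (Ut x - (uh_t s t i).[x]) * (phi i).[x]) =
  - Bf b N r a (bf N r eR) (rv N r eR) phi - Bf b N r a etaR (fun _ => 0) phi
  + 2^-1 * itg 0 b (fun x => Sf b N r s t U V x * bf N r phi x).
Proof.
move=> sp.
rewrite (error_identity k b T Ub N r s b0 hm hs t tT L U V Ut hU Ubt phi sp) zet_split zpt_rv.
have ba := coefA_bm b _ _ coefA_a.
by rewrite (Bf_addl b N r hm a _ _ _ _ phi ba (bf_bm _) bm_etaR) opprD.
Qed.

(** The jump and centre terms of [B_energy] have a good sign because [gt b f] is positive; only the
    term with [GG b f <= K ^+ 2] remains. *)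
Lemma energy_lower e : - Bf b N r a (bf N r e) (rv N r e) e <= 4^-1 * K ^+ 2 * n2 0 b (bf N r e) ^+ 2.
Proof.
rewrite (B_energy b N r hm a (GG b f) e coefA_a).
have s1 : 0 <= \sum_(i < N) a (r i.+1) * jump N r e i ^+ 2.
  apply: sumr_ge0 => -[i iN] _ /=; rewrite mulr_ge0 ?sqr_ge0//.
  by apply: ltW; apply: gt_gt0 => //; exact: node_b.
have s2 : 0 <= a 0 * rv N r e 0 ^+ 2.
  by rewrite mulr_ge0 ?sqr_ge0// ltW// gt_gt0// lexx ltW.
have b2 : bm 0 b (fun x => bf N r e x ^+ 2) := bmX _ _ _ 2 (bf_bm e).
have s3 : itg 0 b (fun x => GG b f x * bf N r e x ^+ 2) <= K ^+ 2 * n2 0 b (bf N r e) ^+ 2.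
  rewrite n2_sq -itgZl//; apply: itg_le.
  - by apply: bmM => //; exact: bm_GG.
  - by apply: bmM => //; exact: bm_cst.
  - move=> x xb; rewrite ler_wpM2r ?sqr_ge0//.
    by have /andP[_] := GGf_bd b N r K U f pf KU KK x xb.
rewrite -mulrA.
move: s1 s2 s3; move: (\sum_(i < N) _) (a 0 * _) (itg _ _ _) (K ^+ 2 * _) => u1 u2 u3 u4; lra.
Qed.

Definition C1 := K ^+ 2 + K ^+ 2 * L * Num.sqrt b * Num.sqrt C + cS * (1 + L * Num.sqrt b) + L + 1.

Hypothesis etaR_t : forall phi : nat -> {poly R}, (forall i, (i < N)%N -> (size (phi i) <= k.+1)%N) ->
  `|\sum_(i < N) itg (r i) (r i.+1) (fun x => (Ut x - (radp k (r i) (r i.+1) Ut).[x]) * (phi i).[x])| <=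
  L * H ^+ k.+1 * n2 0 b (bf N r phi).

Definition eRt i := radp k (r i) (r i.+1) Ut - uh_t s t i.

(** The energy inequality behind the optimal rate. Mixed products of the error norm and [H ^+ k.+1]
    are split by Young's inequality, and [C1] collects all coefficients. *)
Lemma level1 : 2 * itg 0 b (fun x => bf N r eRt x * bf N r eR x) <=
  2 * C1 * (n2 0 b (bf N r eR) ^+ 2 + (H ^+ k.+1) ^+ 2).
Proof.
have hUt := bm_Ut b b0 L U V Ut hU.
have sp := size_eR.
have e1 : itg 0 b (fun x => bf N r eRt x * bf N r eR x) =
  \sum_(i < N) itg (r i) (r i.+1) (fun x => (Ut x - (uh_t s t i).[x]) * (eR i).[x]) -
  \sum_(i < N) itg (r i) (r i.+1) (fun x => (Ut x - (radp k (r i) (r i.+1) Ut).[x]) * (eR i).[x]).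
  rewrite (itg_bf b N r hm _ (fun i x => (eRt i).[x] * (eR i).[x])).
  - rewrite -sumrB; apply: eq_bigr => -[i iN] _ /=.
    have bi := bm_elt b N r hm _ i iN hUt; have bp p := bm_poly p (r i) (r i.+1).
    rewrite -(itgB (bmM _ _ _ _ (bmB _ _ _ _ bi (bp _)) (bp _)) (bmM _ _ _ _ (bmB _ _ _ _ bi (bp _)) (bp _))).
    by apply: eq_itg => x _; rewrite /eRt hornerD hornerN; ring.
  - exact: bmM.
  - by move=> i x iN xi; rewrite !(bfE b N r hm _ i x iN xi).
rewrite e1 (eR_identity eR sp).
have h1 := energy_lower eR; have h2 := etaR_term eR sp; have h3 := Sf_term eR; have h4 := etaR_t eR sp.
set E := n2 0 b (bf N r eR) in h1 h2 h3 h4 *; set hk := H ^+ k.+1 in h2 h3 h4 *.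
have E0 : 0 <= E by exact: n2_ge0.
have hk0 : 0 <= hk by exact: exprn_ge0.
have am : E * hk <= E ^+ 2 + hk ^+ 2 by have := sqr_ge0 (E - hk); have := sqr_ge0 (E + hk); nra.
move: h1 h2 h3 h4; rewrite !ler_norml; move: (Bf _ _ _ _ _ _ _) (Bf _ _ _ _ _ _ _) (2^-1 * itg _ _ _) (\sum_(i < N) _).
move=> u2 u1 u3 u4 h1 /andP[h2 _] /andP[_ h3] /andP[h4 _].
have SC0 : 0 <= Num.sqrt C by exact: sqrtr_ge0.
have CS0 := cS_ge0.
rewrite -mulrA ler_pM2l// /C1.
set q1 := K ^+ 2 * L * Num.sqrt b * Num.sqrt C.
have q10 : 0 <= q1 by rewrite !mulr_ge0 ?sqr_ge0.
have h2' : - u2 <= 2^-1 * q1 * (E * hk).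
  have -> : 2^-1 * q1 * (E * hk) = 2^-1 * K ^+ 2 * (L * hk) * Num.sqrt b * (Num.sqrt C * E) by rewrite /q1; ring.
  rewrite lerNl. exact: h2.
have K2 : 0 <= K ^+ 2 by exact: sqr_ge0.
set q2 := L * Num.sqrt b; have q20 : 0 <= q2 by rewrite mulr_ge0.
have h3' : u3 <= 2^-1 * cS * E ^+ 2 + 2^-1 * cS * q2 * (E * hk).
  by apply: (le_trans h3); apply: eq_ler; rewrite /q2; ring.
have h4' : - u4 <= L * (E * hk) by rewrite lerNl; apply: le_trans h4; apply: eq_ler; ring.
have E2 : 0 <= E ^+ 2 by exact: sqr_ge0.
have k2 : 0 <= hk ^+ 2 by exact: sqr_ge0.
have Ehk : 0 <= E * hk by rewrite mulr_ge0.
move: (E ^+ 2) (hk ^+ 2) (E * hk) (K ^+ 2) am h1 h2' h3' h4' E2 k2 Ehk K2 => X Y W K' am h1 h2' h3' h4' X0 Y0 W0 K2.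
have m1 : 0 <= q1 * (X + Y - W) by rewrite mulr_ge0// subr_ge0.
have m2 : 0 <= cS * q2 * (X + Y - W) by rewrite !mulr_ge0// subr_ge0.
have m3 : 0 <= L * (X + Y - W) by rewrite mulr_ge0// subr_ge0.
have m4 : 0 <= K' * X by rewrite mulr_ge0.
have m5 : 0 <= K' * Y by rewrite mulr_ge0.
have m6 : 0 <= cS * X by rewrite mulr_ge0.
have m7 : 0 <= cS * Y by rewrite mulr_ge0.
have m8 : 0 <= q1 * (X + Y) by rewrite mulr_ge0// addr_ge0.
have m9 : 0 <= cS * q2 * (X + Y) by rewrite !mulr_ge0// addr_ge0.
have m10 : 0 <= cS * W by rewrite mulr_ge0.
rewrite -/q1 -/q2 (_ : (K' + q1 + cS * (1 + q2) + L + 1) * (X + Y) = K' * X + K' * Y + q1 * (X + Y) + cS * X + cS * Y + cS * q2 * (X + Y) + L * (X + Y) + X + Y); last by ring.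
move: m1 m2 m3; rewrite !mulrBr => m1 m2 m3.
lra.
Qed.

(** Against polynomials of degree at most [k], [Ut] and its L2 projection are the same, so [eT]
    represents the time residual exactly. *)
Definition eT i := l2p k (r i) (r i.+1) Ut - uh_t s t i.
Definition eD i := (eR i)^`().
(** The jump spread as a constant over its element: the squared L2 norm is then [jump ^+ 2 / h i],
    the second part of [dgn]. *)
Definition jq i : {poly R} := (jump N r eR i / h i)%:P.
Definition right_val phi i : {poly R} := ((phi i).[r i.+1])%:P.

Lemma size_eT i : (i < N)%N -> (size (eT i) <= k.+1)%N.
Proof.
move=> iN; rewrite (leq_trans (size_polyD _ _))// geq_max size_polyN.
rewrite size_l2p ?(mesh_lt b N r hm)//.
by have [_ ->] := hdg_degree hs tT iN.
Qed.

Lemma dgn_n2 : dgn N r eR = n2 0 b (bf N r eD) ^+ 2 + n2 0 b (bf N r jq) ^+ 2.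
Proof.
rewrite !(n2_bf_sq b N r hm) -big_split/=; apply: eq_bigr => -[i iN] _ /=.
congr (_ + _); rewrite (eq_itg (fun=> (jump N r eR i / h i) ^+ 2)); last by move=> x _; rewrite hornerC.
rewrite itg_cst ?(ltW (mesh_lt b N r hm _ iN))// -/(h i).
by field; rewrite gt_eqF ?hgt0.
Qed.

(** The principal part of [- Bf] after integration by parts: the derivative of the error and its
    jumps, without the term carrying the derivative of the coefficient. *)
Definition Mf phi := itg 0 b (fun x => 2^-1 * a x * bf N r eD x * bf N r phi x)
  + \sum_(i < N) 2^-1 * a (r i.+1) * jump N r eR i * (phi i).[r i.+1].

Definition cM := K ^+ 2 + K ^+ 2 * L * Num.sqrt b * Num.sqrt C + cS * (1 + L * Num.sqrt b).

Lemma cM_ge0 : 0 <= cM.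
Proof.
have h1 := cS_ge0; have h2 := sqrtr_ge0 C; have h3 : 0 <= K ^+ 2 by exact: sqr_ge0.
have h4 : 0 <= 1 + L * Num.sqrt b by rewrite addr_ge0// mulr_ge0.
by apply: addr_ge0; [apply: addr_ge0 => //; rewrite !mulr_ge0|exact: mulr_ge0].
Qed.

Lemma sum_eT phi : (forall i, (i < N)%N -> (size (phi i) <= k.+1)%N) ->
  \sum_(i < N) itg (r i) (r i.+1) (fun x => (Ut x - (uh_t s t i).[x]) * (phi i).[x]) =
  itg 0 b (fun x => bf N r eT x * bf N r phi x).
Proof.
move=> sp; have hUt := bm_Ut b b0 L U V Ut hU.
rewrite (itg_bf b N r hm _ (fun i x => (eT i).[x] * (phi i).[x])).
- apply: eq_bigr => -[i iN] _ /=.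
  have bi := bm_elt b N r hm _ i iN hUt; have bp p := bm_poly p (r i) (r i.+1).
  rewrite -[RHS]addr0 -(l2p_orth k _ _ _ _ (mesh_lt b N r hm _ iN) bi (sp i iN)).
  rewrite -(itgD (bmM _ _ _ _ (bp _) (bp _)) (bmM _ _ _ _ (bmB _ _ _ _ bi (bp _)) (bp _))).
  by apply: eq_itg => x _; rewrite /eT hornerD hornerN; ring.
- exact: (bmM _ _ _ _ (bf_bm _) (bf_bm _)).
- by move=> i x iN xi; rewrite !(bfE b N r hm _ i x iN xi).
Qed.

(** At a frozen time the scheme balances [eT] against the discrete spatial derivative [Mf]. All
    other terms contain the error without derivatives, or the projection error. *)
Lemma static_bound phi : (forall i, (i < N)%N -> (size (phi i) <= k.+1)%N) ->
  `|itg 0 b (fun x => bf N r eT x * bf N r phi x) - Mf phi| <=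
  cM * (n2 0 b (bf N r eR) + H ^+ k.+1) * n2 0 b (bf N r phi).
Proof.
move=> sp; rewrite -(sum_eT phi sp) (eR_identity phi sp).
rewrite (B_parts b N r hm a _ eR phi coefA_a) /Mf /eD.
have h2 := etaR_term phi sp; have h3 := Sf_term phi.
have h1 : `|itg 0 b (fun x => 2^-1 * GG b f x * bf N r eR x * bf N r phi x)| <=
    2^-1 * K ^+ 2 * n2 0 b (bf N r eR) * n2 0 b (bf N r phi).
  have bG : bm 0 b (fun x => 2^-1 * GG b f x) by apply: bmM; [exact: bm_cst|exact: bm_GG].
  have bGe := bmM _ _ _ _ bG (bf_bm eR).
  apply: (le_trans (CS bGe (bf_bm phi))); rewrite ler_wpM2r ?n2_ge0//.
  have -> : 2^-1 * K ^+ 2 * n2 0 b (bf N r eR) = n2 0 b (fun x => 2^-1 * K ^+ 2 * bf N r eR x).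
    by rewrite n2Z ?ger0_norm ?mulr_ge0 ?sqr_ge0//; exact: bf_bm.
  apply: n2_le => //; first by apply: bmM; [exact: bm_cst|exact: bf_bm].
  move=> x xb; have := GGf_bd b N r K U f pf KU KK x xb.
  move: (GG b f x) (bf N r eR x) (K ^+ 2) => G v K2 /andP[g1 g2].
  rewrite !normrM ler_wpM2r// ler_wpM2l//.
  by rewrite (ger0_norm g1) (ger0_norm (le_trans g1 g2)).
move: h1 h2 h3.
set E := n2 0 b (bf N r eR); set hk := H ^+ k.+1; set F := n2 0 b (bf N r phi).
have E0 : 0 <= E by exact: n2_ge0.
have F0 : 0 <= F by exact: n2_ge0.
have hk0 : 0 <= hk by exact: exprn_ge0.
set u1 := itg 0 b (fun x => 2^-1 * GG b f x * _ * _); set u2 := Bf _ _ _ _ _ _ _.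
set u3 := 2^-1 * itg _ _ _; set u4 := itg 0 b _; set u5 := \sum_(i < N) _.
move=> h1 h2 h3.
have -> : - (- u4 - u1 - u5) - u2 + u3 - (u4 + u5) = u1 - u2 + u3 by ring.
apply: (le_trans (ler_normD _ _)); apply: (le_trans (lerD (ler_normB _ _) (lexx _))).
apply: (le_trans (lerD (lerD h1 h2) h3)).
have SC0 : 0 <= Num.sqrt C by exact: sqrtr_ge0.
have CS0 := cS_ge0; have K2 : 0 <= K ^+ 2 by exact: sqr_ge0.
rewrite -subr_ge0 /cM.
rewrite (_ : _ - _ = 2^-1 * (K ^+ 2 * E * F) + K ^+ 2 * hk * F
   + K ^+ 2 * L * Num.sqrt b * Num.sqrt C * E * F
   + 2^-1 * (K ^+ 2 * L * Num.sqrt b * Num.sqrt C * hk * F)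
   + 2^-1 * (cS * E * F) + cS * hk * F + cS * (L * Num.sqrt b) * E * F
   + 2^-1 * (cS * (L * Num.sqrt b) * hk * F)); last by field.
by rewrite !addr_ge0// !mulr_ge0.
Qed.

Definition am := expR (- (b * K ^+ 2)).

Lemma n2_right phi : (forall i, (i < N)%N -> (size (phi i) <= k.+1)%N) ->
  n2 0 b (bf N r (right_val phi)) <= Num.sqrt C * n2 0 b (bf N r phi).
Proof.
move=> sp; apply: sqr_le_le; first by rewrite mulr_ge0 ?n2_ge0 ?sqrtr_ge0.
rewrite exprMn (sqr_sqrtr (ltW C0)) !(n2_bf_sq b N r hm) mulr_sumr.
apply: ler_sum => -[i iN] _ /=; have h0 := hgt0 i iN.
rewrite (eq_itg (fun=> (phi i).[r i.+1] ^+ 2)); last by move=> x _; rewrite hornerC.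
rewrite itg_cst ?(ltW (mesh_lt b N r hm _ iN))// -/(h i).
have := traceC _ _ _ (mesh_lt b N r hm _ iN) (sp _ iN) (r i.+1).
rewrite lexx (ltW (mesh_lt b N r hm _ iN)) => /(_ isT).
rewrite -/(h i); set I := itg _ _ _ => H1.
have e : C * I = C / h i * I * h i by field; rewrite gt_eqF.
by rewrite e ler_wpM2r// ltW.
Qed.

Lemma sum_right phi : \sum_(i < N) 2^-1 * a (r i.+1) * jump N r eR i * (phi i).[r i.+1] =
  itg 0 b (fun x => bf N r (fun i => (2^-1 * a (r i.+1))%:P) x * bf N r jq x * bf N r (right_val phi) x).
Proof.
rewrite (itg_bf b N r hm _ (fun i x => 2^-1 * a (r i.+1) * (jump N r eR i / h i) * (phi i).[r i.+1])).
- apply: eq_bigr => -[i iN] _ /=.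
  rewrite itg_cst ?(ltW (mesh_lt b N r hm _ iN))// -/(h i).
  by field; rewrite gt_eqF ?hgt0.
- exact: (bmM _ _ _ _ (bmM _ _ _ _ (bf_bm _) (bf_bm _)) (bf_bm _)).
- by move=> i x iN xi; rewrite !(bfE b N r hm _ i x iN xi) !hornerC.
Qed.

Lemma a_half x : 0 <= x <= b -> `|2^-1 * a x| <= 2^-1.
Proof.
move=> xb; have /andP[h1 h2] := a_bd x xb.
have a0 : 0 <= a x by apply: le_trans h1; exact: expR_ge0.
by rewrite normrM (ger0_norm a0) ger0_norm// ler_piMr.
Qed.

Lemma vol_term phi : `|itg 0 b (fun x => 2^-1 * a x * bf N r eD x * bf N r phi x)| <=
  2^-1 * n2 0 b (bf N r eD) * n2 0 b (bf N r phi).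
Proof.
have ba := coefA_bm b _ _ coefA_a.
have b1 := bmM _ _ _ _ (bmM _ _ _ _ (bm_cst 0 b 2^-1) ba) (bf_bm eD).
apply: (le_trans (CS b1 (bf_bm phi))); rewrite ler_wpM2r ?n2_ge0//.
have -> : 2^-1 * n2 0 b (bf N r eD) = n2 0 b (fun x => 2^-1 * bf N r eD x).
  by rewrite n2Z ?ger0_norm//; exact: bf_bm.
apply: (n2_le b1); first exact: (bmM _ _ _ _ (bm_cst 0 b 2^-1) (bf_bm eD)).
move=> x /andP[x0 xb]; rewrite !normrM ler_wpM2r// -normrM.
by rewrite [X in _ <= X]ger0_norm// a_half// !ltW.
Qed.

Lemma right_term phi : (forall i, (i < N)%N -> (size (phi i) <= k.+1)%N) ->
  `|\sum_(i < N) 2^-1 * a (r i.+1) * jump N r eR i * (phi i).[r i.+1]| <=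
  2^-1 * n2 0 b (bf N r jq) * (Num.sqrt C * n2 0 b (bf N r phi)).
Proof.
move=> sp; rewrite sum_right.
have b1 := bmM _ _ _ _ (bf_bm (fun i => (2^-1 * a (r i.+1))%:P)) (bf_bm jq).
apply: (le_trans (CS b1 (bf_bm _))); apply: ler_pM; rewrite ?n2_ge0//; last exact: n2_right.
have -> : 2^-1 * n2 0 b (bf N r jq) = n2 0 b (fun x => 2^-1 * bf N r jq x).
  by rewrite n2Z ?ger0_norm//; exact: bf_bm.
apply: (n2_mesh_le b N r hm _ _ b1); first exact: (bmM _ _ _ _ (bm_cst 0 b 2^-1) (bf_bm jq)).
move=> i x iN xi; rewrite !normrM ler_wpM2r// (bfE b N r hm _ i x iN xi) hornerC.
by rewrite [X in _ <= X]ger0_norm// a_half//; exact: node_b.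
Qed.

(** Testing with [eT] bounds the time derivative by the spatial one. This direction serves to start
    the evolution near time 0, where [dgn] is small. *)
Lemma converse : n2 0 b (bf N r eT) <=
  2^-1 * n2 0 b (bf N r eD) + 2^-1 * Num.sqrt C * n2 0 b (bf N r jq)
  + cM * (n2 0 b (bf N r eR) + H ^+ k.+1).
Proof.
have h1 := static_bound eT size_eT; have h2 := vol_term eT; have h3 := right_term eT size_eT.
have e : itg 0 b (fun x => bf N r eT x * bf N r eT x) = n2 0 b (bf N r eT) ^+ 2.
  by rewrite n2_sq; apply: eq_itg => x _; rewrite expr2.
move: h1; rewrite e /Mf; have := n2_ge0 0 b (bf N r eT); set Y := n2 0 b (bf N r eT) in h2 h3 *.
(* The inequality is quadratic in [Y] and gets divided by [Y], so [Y = 0] is treated apart. *)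
rewrite le_eqVlt => /orP[/eqP <- _|Y0].
  have := cM_ge0; have := n2_ge0 0 b (bf N r eD); have := n2_ge0 0 b (bf N r jq).
  have := n2_ge0 0 b (bf N r eR); have := exprn_ge0 k.+1 H0; have := sqrtr_ge0 C => *.
  by rewrite !addr_ge0// !mulr_ge0// addr_ge0.
move=> h1; rewrite -(ler_pM2r Y0) -expr2.
move: h1 h2 h3; rewrite !ler_norml; move: (itg 0 b _) (\sum_(i < N) _) => I1 I2.
move=> /andP[_ h1] /andP[_ h2] /andP[_ h3].
move: h1 h2 h3; move: (cM * _) (n2 0 b (bf N r eD)) (n2 0 b (bf N r jq)) => c P Q h1 h2 h3.
rewrite (_ : _ * Y = 2^-1 * P * Y + 2^-1 * Q * (Num.sqrt C * Y) + c * Y); last by ring.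
move: h1 h2 h3; move: (2^-1 * P * Y) (2^-1 * Q * _) (c * Y) => u1 u2 u3; lra.
Qed.

Definition rho := n2 0 b (bf N r eT) + cM * (n2 0 b (bf N r eR) + H ^+ k.+1).

Lemma Mf_le phi : (forall i, (i < N)%N -> (size (phi i) <= k.+1)%N) ->
  Mf phi <= rho * n2 0 b (bf N r phi).
Proof.
move=> sp; have := static_bound phi sp; rewrite ler_norml => /andP[h1 _].
have := CS (bf_bm eT) (bf_bm phi); rewrite ler_norml => /andP[_ h2].
move: h1 h2; rewrite /rho (mulrDl (n2 0 b (bf N r eT))).
move: (itg 0 b _) (Mf phi) (n2 0 b (bf N r eT) * n2 _ _ _) (cM * _ * _) => u1 u2 u3 u4; lra.
Qed.

(** The derivative of the error times a weight that falls from 1 to 0 across the element. Vanishing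
    at right ends, it removes the jumps from [Mf]; the degree stays at most [k], since
    differentiation lowered it. *)
Definition phiD i := ((h i)^-1 *: ((r i.+1)%:P - 'X)) * eD i.

Lemma size_phiD i : (i < N)%N -> (size (phiD i) <= k.+1)%N.
Proof.
move=> iN; rewrite /phiD (leq_trans (size_polyMleq _ _))//.
have s1 : (size ((h i)^-1 *: ((r i.+1)%:P - 'X)) <= 2)%N.
  rewrite (leq_trans (size_scale_leq _ _))// (leq_trans (size_polyD _ _))// geq_max size_polyN size_polyX.
  by rewrite (leq_trans (size_polyC_leq1 _)).
have s2 : (size (eD i) <= k)%N.
  rewrite /eD; have := size_eR i iN; case: (eqVneq (eR i) 0) => [->|e0]; first by rewrite deriv0 size_poly0.
  by move=> sk; rewrite -ltnS (leq_trans _ sk)// lt_size_deriv.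
by rewrite -subn1 leq_subLR add1n (leq_trans (leq_add s1 s2)).
Qed.

(** With [phiD] as test function [Mf] is a weighted square of the derivative. The coefficient is at
    least [am], and [weight_ineq] restores the unweighted norm. *)
Lemma elliptic_vol : am * n2 0 b (bf N r eD) <= 2 * C * rho.
Proof.
set P := n2 0 b (bf N r eD).
have P0 : 0 <= P by exact: n2_ge0.
have rho0 : 0 <= rho.
  by rewrite addr_ge0 ?n2_ge0// mulr_ge0 ?cM_ge0// addr_ge0 ?n2_ge0// exprn_ge0.
move: P0; rewrite le_eqVlt => /orP[/eqP <-|P0]; first by rewrite mulr0 !mulr_ge0// ltW.
have sp := size_phiD.
have wx i x : (i < N)%N -> r i < x < r i.+1 -> 0 <= (h i)^-1 * (r i.+1 - x) <= 1.
  move=> iN /andP[x1 x2]; have h0 := hgt0 i iN.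
  have w0 : 0 <= r i.+1 - x by rewrite subr_ge0 ltW.
  have -> /= : 0 <= (h i)^-1 * (r i.+1 - x) by apply: mulr_ge0 => //; rewrite invr_ge0 ltW.
  by rewrite ler_pdivrMl// mulr1 lerB// ltW.
have pE : forall (j : nat) x, (phiD j).[x] = (h j)^-1 * (r j.+1 - x) * (eD j).[x].
  by move=> j x; rewrite /phiD hornerM hornerZ hornerD hornerN hornerC hornerX.
have nphi : n2 0 b (bf N r phiD) <= P.
  apply: (n2_mesh_le b N r hm) => // i x iN xi; rewrite !(bfE b N r hm _ i x iN xi) pE normrM.
  by have /andP[w1 w2] := wx i x iN xi; rewrite (ger0_norm w1) ler_piMl.
have h1 := le_trans (Mf_le phiD sp) (ler_wpM2l rho0 nphi).
have ba := coefA_bm b _ _ coefA_a.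
have h2 : am * P ^+ 2 <= 2 * C * Mf phiD.
  rewrite /Mf (_ : \sum_(i < N) _ = 0) ?addr0; last first.
    by apply: big1 => -[i iN] _ /=; rewrite pE subrr mulr0 mul0r mulr0.
  have b1 : bm 0 b (fun x => 2^-1 * a x * bf N r eD x * bf N r phiD x).
    exact: (bmM _ _ _ _ (bmM _ _ _ _ (bmM _ _ _ _ (bm_cst 0 b 2^-1) ba) (bf_bm eD)) (bf_bm _)).
  rewrite (itg_mesh b N r hm _ b1) (n2_bf_sq b N r hm) !mulr_sumr; apply: ler_sum => -[i iN] _ /=.
  have xyl := mesh_lt b N r hm _ iN.
  have s2 : (size (eD i) <= k.+1)%N.
    by rewrite (leq_trans (size_poly _ _))// (leq_trans (leq_pred _))// size_eR.
  have h3 := ler_wpM2l (ltW (expR_gt0 (- (b * K ^+ 2)))) (weightC _ _ (eD i) xyl s2).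
  apply: (le_trans h3); rewrite mulrCA -mulrA (mulrCA 2) ler_pM2l//.
  have bw : bm (r i) (r i.+1) (fun s0 => (r i.+1 - s0) / (r i.+1 - r i) * (eD i).[s0] ^+ 2).
    apply: bmM; last by apply: bmX; exact: bm_poly.
    apply: bmM; last exact: bm_cst.
    by apply: bmB; [exact: bm_cst|exact: bm_id].
  have be := bm_elt b N r hm _ i iN b1.
  rewrite -itgZl// -itgZl//; apply: itg_le.
  - by apply: bmM => //; exact: bm_cst.
  - by apply: bmM; [exact: bm_cst|exact: be].
  - move=> x xi; rewrite !(bfE b N r hm _ i x iN xi) pE -/(h i).
    have /andP[w1 w2] := wx i x iN xi.
    have xb : 0 <= x <= b.
      have /andP[i0 _] := node_b i (ltnW iN); have /andP[_ i1] := node_b i.+1 iN.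
      by case/andP: xi => x1 x2; rewrite (le_trans i0 (ltW x1)) (le_trans (ltW x2) i1).
    have /andP[a1 _] := a_bd x xb.
    have -> : 2 * (2^-1 * a x * (eD i).[x] * ((h i)^-1 * (r i.+1 - x) * (eD i).[x])) =
       a x * ((r i.+1 - x) / h i * (eD i).[x] ^+ 2) by field; rewrite gt_eqF ?hgt0.
    by rewrite ler_wpM2r// mulr_ge0 ?sqr_ge0// mulrC.
rewrite -(ler_pM2r P0) (_ : am * P * P = am * P ^+ 2); last by ring.
apply: (le_trans h2); rewrite -[X in _ <= X]mulrA ler_wpM2l//.
by rewrite mulr_ge0// ltW.
Qed.

(** With the piecewise constant [jq] as test function the jump part of [Mf] becomes a square. The
    volume part is bounded by the derivative norm, already controlled by [elliptic_vol]. *)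
Lemma elliptic_jump : am * n2 0 b (bf N r jq) <= 2 * rho + n2 0 b (bf N r eD).
Proof.
set Q := n2 0 b (bf N r jq); set P := n2 0 b (bf N r eD).
have P0 : 0 <= P by exact: n2_ge0.
have rho0 : 0 <= rho.
  by rewrite addr_ge0 ?n2_ge0// mulr_ge0 ?cM_ge0// addr_ge0 ?n2_ge0// exprn_ge0.
have : 0 <= Q by exact: n2_ge0.
rewrite le_eqVlt => /orP[/eqP <-|Q0]; first by rewrite mulr0 addr_ge0// mulr_ge0.
have sp i : (i < N)%N -> (size (jq i) <= k.+1)%N by move=> _; rewrite (leq_trans (size_polyC_leq1 _)).
have h1 := Mf_le jq sp; have := vol_term jq; rewrite ler_norml => /andP[h2 _].
have h3 : am * Q ^+ 2 <= 2 * \sum_(i < N) 2^-1 * a (r i.+1) * jump N r eR i * (jq i).[r i.+1].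
  rewrite /Q (n2_bf_sq b N r hm) !mulr_sumr; apply: ler_sum => -[i iN] _ /=.
  rewrite (eq_itg (fun=> (jump N r eR i / h i) ^+ 2)); last by move=> x _; rewrite hornerC.
  rewrite itg_cst ?(ltW (mesh_lt b N r hm _ iN))// -/(h i) hornerC.
  have h0 := hgt0 i iN.
  have -> : 2 * (2^-1 * a (r i.+1) * jump N r eR i * (jump N r eR i / h i)) =
     a (r i.+1) * ((jump N r eR i / h i) ^+ 2 * h i) by field; rewrite gt_eqF.
  have /andP[a1 _] := a_bd _ (node_b i.+1 iN).
  by apply: ler_wpM2r => //; apply: mulr_ge0; [exact: sqr_ge0|exact: ltW].
rewrite -(ler_pM2r Q0) (_ : am * Q * Q = am * Q ^+ 2); last by ring.
rewrite [X in _ <= X]mulrDl.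
move: h1 h2 h3; rewrite /Mf -/P -/Q; move: (itg 0 b _) (\sum_(i < N) _) => I1 I2.
have -> : 2^-1 * P * Q = 2^-1 * (P * Q) by ring.
have -> : 2 * rho * Q = 2 * (rho * Q) by ring.
move: (am * _) (P * Q) (rho * Q) => u1 u2 u3; lra.
Qed.

End OneTimeEstimates.

(** * Estimates for two times *)

Section AverageBound.
Context {R : realType} (b : R) (b0 : 0 < b) (N : nat) (r : nat -> R) (hm : mesh b N r).
Implicit Types (f g D : R -> R) (x y M : R).

Lemma broken_off (v : nat -> R -> R) x :
  (forall i, (i < N)%N -> ~~ (r i < x < r i.+1)) -> broken_fun N r v x = 0.
Proof.
move=> xr; rewrite /broken_fun; apply: big1 => -[i iN] _ /=; rewrite patchE.
by case: ifPn => //; rewrite inE/= in_itv/= => xi; have := xr i iN; rewrite xi.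
Qed.

Lemma eq_itg_sub f g x : bm 0 b f -> bm 0 b g -> 0 <= x <= b ->
  (forall i y, (i < N)%N -> r i < y < r i.+1 -> f y = g y) -> itg 0 x f = itg 0 x g.
Proof.
move=> hf hg /andP[x0]; rewrite le_eqVlt => /orP[/eqP ->|xb] fg; first exact: (eq_itg_mesh b N r hm).
have [i iN /andP[ix xi]] : exists2 i, (i < N)%N & r i <= x < r i.+1.
  by apply: (mesh_loc b N r hm); rewrite x0.
have hx : bm 0 x f by apply: bmS hf => //; exact: ltW.
have hxg : bm 0 x g by apply: bmS hg => //; exact: ltW.
have ri : 0 <= r i <= x by rewrite ix andbT; case/andP: (mesh_node b N r hm _ (ltnW iN)).
rewrite (itg_split (r i) ri hx) (itg_split (r i) ri hxg); congr (_ + _).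
  rewrite (itg_meshn b N r hm _ _ hf (ltnW iN)) (itg_meshn b N r hm _ _ hg (ltnW iN)).
  apply: eq_bigr => -[j ji] _ /=; apply: eq_itg => y yj; apply: (fg j) => //.
  exact: ltn_trans ji iN.
apply: eq_itg => y /andP[y1 y2]; apply: (fg i) => //.
by rewrite y1 (lt_trans y2).
Qed.

(** Bounds are known off the nodes only; [D] is replaced by a broken copy that vanishes at the nodes
    and has the same integrals. *)
Lemma av_mesh_bound D M x : bm 0 b D -> 0 <= M ->
  (forall i y, (i < N)%N -> r i < y < r i.+1 -> y < x -> `|D y| <= M) -> 0 < x <= b ->
  `|av D x| <= M.
Proof.
move=> hD M0 DM /andP[x0 xb].
pose D' := broken_fun N r (fun _ => D).
have hD' : bm 0 b D' by apply: (bm_broken b N r hm) => i iN; exact: (bm_elt b N r hm).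
have -> : av D x = av D' x.
  congr (_ / _); apply: eq_itg_sub => //; first by rewrite (ltW x0).
  by move=> i y iN yi; rewrite /D' (broken_funE b N r hm _ _ _ iN yi).
apply: (av_bound b M x hD'); first by rewrite x0.
move=> y /andP[y0 yx].
have [[i iN yi]|no] := pselect (exists2 i, (i < N)%N & r i < y < r i.+1).
  by rewrite /D' (broken_funE b N r hm _ _ _ iN yi); exact: (DM i).
rewrite /D' broken_off ?normr0// => i iN; apply/negP => yi; apply: no; by exists i.
Qed.

End AverageBound.

Section TwoTimes.
Context {R : realType} (k : nat) (b T : R) (Ub : R -> R) (N : nat) (r : nat -> R)
  (s : hdg_unknowns R).
Hypotheses (b0 : 0 < b) (hm : mesh b N r) (hs : hdg_solution k b T Ub N r s).
Implicit Types (phi e : nat -> {poly R}) (v : {poly R}) (x : R).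
Variables (t1 t2 tau L K C : R) (U1 V1 W1 U2 V2 W2 : R -> R).
Hypotheses (tT1 : t1 \in `[0, T]) (hU1 : exact_at b L U1 V1 W1) (Ub1 : U1 b = Ub t1).
Hypotheses (tT2 : t2 \in `[0, T]) (hU2 : exact_at b L U2 V2 W2) (Ub2 : U2 b = Ub t2).
Hypotheses (tau0 : 0 <= tau) (C0 : 0 < C) (invC : inverse_ineq k.+1 C)
  (traceC : trace_ineq k.+1 C).

Let f1 := bf N r (uh s t1).
Let f2 := bf N r (uh s t2).
Let h i := r i.+1 - r i.
Let H := mesh_size N r.
Let dU x := U1 x - U2 x.
Let lp i := l2p k (r i) (r i.+1) dU.

(** The increment from [t2] to [t1] of P u - u_h, P being the L2 projection. The hypotheses below
    bound the increments of the exact solution by multiples of [tau]. *)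
Definition dP i := lp i - (uh s t1 i - uh s t2 i).
Let X := n2 0 b (bf N r dP).
Let e2 := eR k r s t2 U2.

Hypotheses (KU1 : Kf b U1 <= K) (KU2 : Kf b U2 <= K) (K1 : Kf b f1 <= K) (K2 : Kf b f2 <= K).
Hypotheses (dU_bd : forall x, 0 <= x <= b -> `|dU x| <= L * tau)
  (dU_lip : forall x y, 0 <= x <= b -> 0 <= y <= b -> `|dU x - dU y| <= L * tau * `|x - y|)
  (dV_bd : forall x, 0 < x < b -> `|V1 x - V2 x| <= L * tau)
  (dU_l2p : forall i x, (i < N)%N -> r i <= x <= r i.+1 -> `|dU x - (lp i).[x]| <= L * tau * h i)
  (etaR_bd : forall i x, (i < N)%N -> r i <= x <= r i.+1 ->
     `|U2 x - (pR k r U2 i).[x]| <= L * H * (x - r i))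
  (z1_bd : n2 0 b (fun x => U1 x - f1 x) <= L * H)
  (z2_bd : n2 0 b (fun x => U2 x - f2 x) <= L * H).
Variable D : R.
Hypotheses (D01 : 0 <= D <= 1) (dgnD : dgn N r e2 <= D ^+ 2).

Let hgt0 i : (i < N)%N -> 0 < h i.
Proof. by move=> iN; rewrite subr_gt0 (mesh_lt b N r hm). Qed.
Let g1 : good b f1. Proof. exact: (good_bf b N r hm). Qed.
Let g2 : good b f2. Proof. exact: (good_bf b N r hm). Qed.
Let p1 : pgood b N r f1. Proof. exact: (pgood_bf b N r b0 hm). Qed.
Let p2 : pgood b N r f2. Proof. exact: (pgood_bf b N r b0 hm). Qed.
Let gU1 : good b U1 := exact_good b b0 L U1 V1 W1 hU1.
Let gU2 : good b U2 := exact_good b b0 L U2 V2 W2 hU2.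
Let pU1 : pgood b N r U1 := exact_pgood b N r b0 hm L U1 V1 W1 hU1.
Let pU2 : pgood b N r U2 := exact_pgood b N r b0 hm L U2 V2 W2 hU2.
Let bU1 : bm 0 b U1 := good_bm b gU1.
Let bU2 : bm 0 b U2 := good_bm b gU2.
Let bf1 : bm 0 b f1 := good_bm b g1.
Let bf2 : bm 0 b f2 := good_bm b g2.
Let bdU : bm 0 b dU := bmB _ _ _ _ bU1 bU2.
Let bf_bm p : bm 0 b (bf N r p) := bm_bf b N r hm p.
Let L0 : 0 <= L := exact_L0 b b0 L U1 V1 W1 hU1.
Let K0 : 0 <= K. Proof. by apply: le_trans KU1; exact: Kf_ge0. Qed.
Let H0 : 0 <= H.
Proof.
apply: le_trans (mesh_h N r 0 (mesh_N b N r hm b0)).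
by rewrite subr_ge0 (mesh_le b N r hm)// (mesh_N b N r hm b0).
Qed.
Let hH i : (i < N)%N -> h i <= H. Proof. exact: mesh_h. Qed.
Let sq0 : 0 <= Num.sqrt b. Proof. exact: sqrtr_ge0. Qed.
Let node_b i : (i <= N)%N -> 0 <= r i <= b. Proof. exact: (mesh_node b N r hm). Qed.
Let X0 : 0 <= X := n2_ge0 0 b _.
Let D0 : 0 <= D. Proof. by case/andP: D01. Qed.

Definition etaP x := dU x - bf N r lp x.
(** The upwind trace of the L2 projection error. Unlike for Gauss--Radau it does not vanish, and it
    has to be absorbed by the jumps. *)
Definition etaQ i := if (i < N)%N then dU (r i) - (lp i).[r i] else 0.

Lemma bm_etaP : bm 0 b etaP. Proof. exact: (bmB _ _ _ _ bdU (bf_bm _)). Qed.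

Lemma zet_diff : (fun x => zet N r s t1 U1 x - zet N r s t2 U2 x) = (fun x => bf N r dP x + etaP x).
Proof. by apply/funext => x; rewrite /zet /etaP /dP !bfB /dU; ring. Qed.

Lemma zpt_diff : (fun i => zpt N r s t1 U1 i - zpt N r s t2 U2 i) = (fun i => rv N r dP i + etaQ i).
Proof.
apply/funext => i; rewrite /zpt /rv /etaQ /dP; case: ifP => iN; last by rewrite subrr addr0.
by rewrite !hornerD !hornerN !hornerD !hornerN /dU; ring.
Qed.

Lemma etaP_in i x : (i < N)%N -> r i < x < r i.+1 -> `|etaP x| <= L * tau * H.
Proof.
move=> iN xi; rewrite /etaP (bfE b N r hm _ i x iN xi).
apply: (@le_trans _ _ (L * tau * h i)); last by rewrite ler_wpM2l ?mulr_ge0// hH.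
by apply: dU_l2p => //; case/andP: xi => y1 y2; rewrite !ltW.
Qed.

Let LtH0 : 0 <= L * tau * H. Proof. by rewrite !mulr_ge0. Qed.
Let q := L * Num.sqrt b.
Let q0 : 0 <= q. Proof. exact: mulr_ge0. Qed.

Lemma n2_dzeta : n2 0 b (fun x => (U1 x - f1 x) - (U2 x - f2 x)) <= X + q * (tau * H).
Proof.
have -> : (fun x => (U1 x - f1 x) - (U2 x - f2 x)) = (fun x => bf N r dP x + etaP x) by rewrite -zet_diff.
apply: (le_trans (n2D (bf_bm _) bm_etaP)); rewrite lerD2l.
have -> : q * (tau * H) = L * tau * H * Num.sqrt b by rewrite /q; ring.
exact: (sq_b_bound b b0 N r hm _ _ bm_etaP LtH0 etaP_in).
Qed.

Let Lt0 : 0 <= L * tau. Proof. exact: mulr_ge0. Qed.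

Lemma n2_dU : n2 0 b dU <= q * tau.
Proof.
have -> : q * tau = L * tau * Num.sqrt b by rewrite /q; ring.
apply: (n2_sup b b0 _ _ bdU Lt0) => x /andP[x1 x2]; apply: dU_bd; by rewrite !ltW.
Qed.

Let lgd := lip_good b (L * tau) dU b0 dU_lip.

Lemma Kf_dU : Kf b dU <= q * tau.
Proof.
have [_ gd Xd] := lgd.
have -> : q * tau = L * tau * Num.sqrt b by rewrite /q; ring.
apply: (n2_sup b b0 _ _ (bm_qf b _ gd) Lt0) => x xb; have /andP[x1 x2] := xb.
by rewrite /qf normrM normfV (gtr0_norm x1) ler_pdivrMr// Xd.
Qed.

Lemma n2_df : n2 0 b (fun x => f1 x - f2 x) <= X + q * tau + q * (tau * H).
Proof.
rewrite (eq_n2 (fun x => dU x - ((U1 x - f1 x) - (U2 x - f2 x)))); last by move=> x _; rewrite /dU; ring.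
have bz := bmB _ _ _ _ (bmB _ _ _ _ bU1 bf1) (bmB _ _ _ _ bU2 bf2).
apply: (le_trans (n2B bdU bz)).
have h1 := n2_dU; have h2 := n2_dzeta; move: h1 h2; move: (n2 0 b dU) (n2 0 b _) => u1 u2; lra.
Qed.

(** Sup bounds for differences of [gg]: [Gf] between the two discrete solutions, [G2] between exact
    and discrete at [t2], and [G4] for the second difference, in which every term carries [X] or the
    product [tau * H]. *)
Definition Gf := 2 * K * (X + q * tau + q * (tau * H)).
Definition G2 := 2 * K * (L * H).
Definition G4 := expR (b * K ^+ 2) * (2 * K * (X + q * (tau * H)) + 2 * q * L * (tau * H)
  + 4 * K ^+ 2 * q * L * (tau * H)).

Lemma Gf0 : 0 <= Gf. Proof. by rewrite /Gf !(mulr_ge0, addr_ge0). Qed.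
Lemma G20 : 0 <= G2. Proof. by rewrite /G2 !mulr_ge0. Qed.
Lemma G40 : 0 <= G4.
Proof.
have hq : 0 <= q * (tau * H) by rewrite !mulr_ge0.
have hK : 0 <= K ^+ 2 by exact: sqr_ge0.
apply: mulr_ge0; first exact: expR_ge0.
by rewrite !addr_ge0// !mulr_ge0// addr_ge0.
Qed.

Lemma gf_bd y : 0 <= y <= b -> `|gg b f1 y - gg b f2 y| <= Gf.
Proof.
move=> yb; apply: (le_trans (gg_sup b N r b0 hm f1 f2 K y p1 p2 K1 K2 yb)).
by rewrite /Gf ler_wpM2l ?mulr_ge0//; exact: n2_df.
Qed.

Lemma g2_bd y : 0 <= y <= b -> `|gg b U2 y - gg b f2 y| <= G2.
Proof.
move=> yb; apply: (le_trans (gg_sup b N r b0 hm U2 f2 K y pU2 p2 KU2 K2 yb)).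
by rewrite /G2 ler_wpM2l ?mulr_ge0.
Qed.

Lemma g4_bd y : 0 <= y <= b ->
  `|(gg b U1 y - gg b f1 y) - (gg b U2 y - gg b f2 y)| <= G4.
Proof.
move=> yb.
have -> : (gg b U1 y - gg b f1 y) - (gg b U2 y - gg b f2 y) =
  (gg b U1 y - gg b U2 y) - (gg b f1 y - gg b f2 y) by ring.
have kk f : Kf b f <= K -> b * Kf b f ^+ 2 <= b * K ^+ 2.
  by move=> fK; rewrite ler_wpM2l ?(ltW b0)// ler_sqr ?nnegrE ?Kf_ge0.
apply: (le_trans (gg_four b U1 U2 f1 f2 _ y gU1 gU2 g1 g2 yb (kk _ KU1) (kk _ KU2) (kk _ K1) (kk _ K2))).
rewrite /G4 ler_wpM2l ?expR_ge0//.
have nX f g : pgood b N r f -> pgood b N r g -> n2 0 b (Xf (fun y => f y - g y)) <= n2 0 b (fun y => f y - g y).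
  by move=> pf pg; exact: (n2_Xf b N r b0 hm _ (pgoodB b N r _ _ pf pg)).
have x1 := le_trans (nX _ _ pU1 p1) z1_bd; have x2 := le_trans (nX _ _ pU2 p2) z2_bd.
have x3 := le_trans (nX _ _ pU1 pU2) n2_dU.
have x4 : n2 0 b (Xf (fun y => U1 y - U2 y - (f1 y - f2 y))) <= X + q * (tau * H).
  apply: (le_trans (nX _ _ (pgoodB b N r _ _ pU1 pU2) (pgoodB b N r _ _ p1 p2))).
  apply: le_trans n2_dzeta; apply: eq_ler; apply: eq_n2 => x _; ring.
have x5 := Kf_dU.
have hq : 0 <= q * (tau * H) by rewrite !mulr_ge0.
have hX : 0 <= X + q * (tau * H) by exact: addr_ge0.
have hqt : 0 <= q * tau by exact: mulr_ge0.
have LH : 0 <= L * H by exact: mulr_ge0.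
apply: lerD; [apply: lerD|].
- apply: (le_trans (ler_pM (n2_ge0 _ _ _) (addr_ge0 (Kf_ge0 _ _) (Kf_ge0 _ _)) x4 (lerD K1 K2))).
  by apply: eq_ler; ring.
- apply: (le_trans (ler_pM (Kf_ge0 _ _) (addr_ge0 (n2_ge0 _ _ _) (n2_ge0 _ _ _)) x5 (lerD x1 x2))).
  by apply: eq_ler; ring.
- have k1 := addr_ge0 (Kf_ge0 b U2) (Kf_ge0 b f2); have k2 := addr_ge0 (Kf_ge0 b U1) (Kf_ge0 b U2).
  have k3 := addr_ge0 (Kf_ge0 b U1) (Kf_ge0 b f1).
  have m1 := ler_pM (n2_ge0 _ _ _) k1 x2 (lerD KU2 K2).
  have m2 := ler_pM (n2_ge0 _ _ _) k2 x3 (lerD KU1 KU2).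
  apply: (le_trans (ler_pM (mulr_ge0 (n2_ge0 _ _ _) k1) (mulr_ge0 (n2_ge0 _ _ _) k2) m1 m2)).
  by apply: eq_ler; ring.
Qed.

Lemma bm_etaR2 : bm 0 b (etaR k N r U2).
Proof. exact: (bmB _ _ _ _ bU2 (bf_bm _)). Qed.

Lemma size_dP i : (i < N)%N -> (size (dP i) <= k.+1)%N.
Proof.
move=> iN; have [s1 _] := hdg_degree hs tT1 iN; have [s2 _] := hdg_degree hs tT2 iN.
rewrite /dP (leq_trans (size_polyD _ _))// geq_max size_polyN size_l2p ?(mesh_lt b N r hm)//=.
by rewrite (leq_trans (size_polyD _ _))// geq_max size_polyN s1.
Qed.

Lemma mesh_size_le : H <= b.
Proof.
apply: bigmax_le => [|[i iN] _ /=]; first exact: ltW.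
have /andP[h1 _] := node_b i (ltnW iN); have /andP[_ h2] := node_b i.+1 iN.
by rewrite lerBlDr (le_trans h2)// lerDl.
Qed.

Lemma etaQ_bd i : `|etaQ i| <= L * tau * (if (i < N)%N then h i else 0).
Proof.
rewrite /etaQ; case: ifP => iN; last by rewrite normr0 mulr0.
by apply: dU_l2p => //; rewrite lexx ltW// (mesh_lt b N r hm).
Qed.

Lemma sum_h : \sum_(i < N) h i = b.
Proof.
have [r0 rN _] := hm.
have := telescope_sumr r (leq0n N); rewrite big_mkord r0 rN subr0 => <-.
by apply: eq_bigr.
Qed.

(** [|etaQ i| <= L * tau * h i] and the [h i] sum to [b], so only one factor [h i] is left to be
    bounded by [H]. This is one power less than for volume terms, and the reason why [dgn] is only
    O(h) in the end. *)
Lemma sum_etaQ : \sum_(i < N.+1) etaQ i ^+ 2 <= L ^+ 2 * b * (tau * (tau * H)).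
Proof.
rewrite big_ord_recr/= {2}/etaQ ltnn expr0n addr0.
have -> : L ^+ 2 * b * (tau * (tau * H)) = (L * tau) ^+ 2 * H * b by ring.
rewrite -[b in X in _ <= X]sum_h mulr_sumr; apply: ler_sum => -[i iN] _ /=.
have h1 := etaQ_bd i; rewrite iN in h1.
have hi0 : 0 <= h i by rewrite ltW// hgt0.
rewrite -[etaQ i ^+ 2]real_normK ?num_real//.
apply: (@le_trans _ _ ((L * tau * h i) ^+ 2)).
  by rewrite ler_sqr ?nnegrE// mulr_ge0.
rewrite exprMn -mulrA ler_wpM2l ?sqr_ge0// expr2 ler_wpM2r//; exact: hH.
Qed.

Let a1 := gt b f1.
Let ca1 : coefA b a1 (GG b f1) := coefA_gt b f1 g1.
Let ca2 : coefA b (gt b f2) (GG b f2) := coefA_gt b f2 g2.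
Let ba1 : bm 0 b a1 := coefA_bm b _ _ ca1.
Let ba2 : bm 0 b (gt b f2) := coefA_bm b _ _ ca2.
Let d0 := rv N r dP.

(** Summation by parts moves the node differences onto [phi], producing its jumps, against which the
    dissipation of [B_energy] can act. *)
Lemma sum_trace phi : \sum_(i < N) (2^-1 * a1 (r i.+1) * etaQ i.+1 * (phi i).[r i.+1]
     - 2^-1 * a1 (r i) * etaQ i * (phi i).[r i]) =
  - \sum_(i < N) 2^-1 * a1 (r i.+1) * etaQ i.+1 * jump N r phi i
  - 2^-1 * a1 0 * etaQ 0 * rv N r phi 0.
Proof.
pose F i := 2^-1 * a1 (r i) * etaQ i * rv N r phi i.
have [r0 _ _] := hm.
have FN : F N = 0 by rewrite /F /rv ltnn mulr0.
have := telescope_sumr F (leq0n N); rewrite big_mkord FN sub0r => h1.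
have -> : 2^-1 * a1 0 * etaQ 0 * rv N r phi 0 = F 0%N by rewrite /F r0.
rewrite -h1 -sumrN -big_split/=.
by apply: eq_bigr => -[i iN] _ /=; rewrite /F /jump /rv iN; case: ifP => _; ring.
Qed.

Lemma a1_bd x : 0 <= x <= b -> 0 <= a1 x <= 1.
Proof.
move=> xb; have /andP[h1 ->] := gt_bd b b0 f1 x g1 xb; rewrite andbT.
by apply: le_trans h1; exact: expR_ge0.
Qed.

Lemma term_main : - Bf b N r a1 (fun x => bf N r dP x + etaP x) (fun i => d0 i + etaQ i) dP <=
  4^-1 * K ^+ 2 * (X * X) + 4^-1 * L ^+ 2 * b * (tau * (tau * H))
  + 2^-1 * K ^+ 2 * q * Num.sqrt C * (X * (tau * H)).
Proof.
rewrite (Bf_addl b N r hm a1 _ _ _ _ dP ba1 (bf_bm _) bm_etaP) opprD.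
rewrite (B_energy b N r hm a1 (GG b f1) dP ca1) [Bf _ _ _ _ etaP _ _]/Bf sum_trace.
have o1 : `|itg 0 b (fun x => 2^-1 * a1 x * etaP x * bf N r (fun i => (dP i)^`()) x)| <=
    2^-1 * K ^+ 2 * q * Num.sqrt C * (X * (tau * H)).
  have -> : 2^-1 * K ^+ 2 * q * Num.sqrt C * (X * (tau * H)) =
    2^-1 * K ^+ 2 * (L * tau * H) * Num.sqrt b * (Num.sqrt C * X) by rewrite /q; ring.
  apply: (orth_term b b0 N r hm k C dP (fun x => 2^-1 * a1 x) etaP (2^-1 * K ^+ 2) _ (ltW C0) size_dP invC).
  - exact: (bmM _ _ _ _ (bm_cst 0 b 2^-1) ba1).
  - exact: bm_etaP.
  - exact: LtH0.
  - by rewrite mulr_ge0 ?sqr_ge0.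
  - move=> i v iN sv.
    rewrite (eq_itg (fun x => (dU x - (lp i).[x]) * v.[x])).
      by apply: l2p_orth; [exact: (mesh_lt b N r hm)|exact: (bm_elt b N r hm)|exact: leq_trans sv _].
    by move=> x xi; rewrite /etaP (bfE b N r hm _ i x iN xi).
  - by move=> i x iN xi; apply: (a_lip b N r s b0 hm t1 K U1 KU1 K1 i x iN xi).
  - exact: etaP_in.
have o2 : itg 0 b (fun x => GG b f1 x * bf N r dP x ^+ 2) <= K ^+ 2 * (X * X).
  have b2 : bm 0 b (fun x => bf N r dP x ^+ 2) := bmX _ _ _ 2 (bf_bm dP).
  rewrite -expr2 /X n2_sq -itgZl//; apply: itg_le.
  - exact: (bmM _ _ _ _ (bm_GG b f1 g1) b2).
  - exact: (bmM _ _ _ _ (bm_cst 0 b _) b2).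
  - move=> x xb; rewrite ler_wpM2r ?sqr_ge0//.
    by have /andP[_] := GGf_bd b N r K U1 f1 p1 KU1 K1 x xb.
have o3 : - (4^-1 * \sum_(i < N) a1 (r i.+1) * jump N r dP i ^+ 2 + 4^-1 * (a1 0 * d0 0 ^+ 2))
    + (- \sum_(i < N) 2^-1 * a1 (r i.+1) * etaQ i.+1 * jump N r dP i - 2^-1 * a1 0 * etaQ 0 * d0 0)
    <= 4^-1 * (L ^+ 2 * b * (tau * (tau * H))).
  apply: (@le_trans _ _ (4^-1 * \sum_(i < N.+1) etaQ i ^+ 2)); last by rewrite ler_wpM2l// sum_etaQ.
  (* Completing the square: [a * (e + j) ^+ 2 >= 0] with [a <= 1] lets the dissipation absorb the
     trace term at the cost of [e ^+ 2 / 4]. The centre counts as one more jump. *)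
  have sq_le (a e j : R) : 0 <= a <= 1 -> - (4^-1 * (a * j ^+ 2)) - 2^-1 * a * e * j <= 4^-1 * e ^+ 2.
    move=> /andP[a0 a1']; have := mulr_ge0 a0 (sqr_ge0 (e + j)).
    have : 0 <= (1 - a) * e ^+ 2 by rewrite mulr_ge0 ?sqr_ge0// subr_ge0.
    rewrite sqrrD mulrBl mul1r 2!mulrDr.
    have -> : 2^-1 * a * e * j = 4^-1 * (a * (e * j *+ 2)) by field.
    move: (e ^+ 2) (a * e ^+ 2) (a * j ^+ 2) (a * (e * j *+ 2)) => *; lra.
  have [r0 _ _] := hm.
  have z0 : 0 <= (0 : R) <= b by rewrite lexx ltW.
  rewrite big_ord_recl/= mulrDr.
  apply: (@le_trans _ _ ((- (4^-1 * (a1 0 * d0 0 ^+ 2)) - 2^-1 * a1 0 * etaQ 0 * d0 0) +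
     \sum_(i < N) (- (4^-1 * (a1 (r i.+1) * jump N r dP i ^+ 2)) - 2^-1 * a1 (r i.+1) * etaQ i.+1 * jump N r dP i))).
    rewrite sumrB sumrN -mulr_sumr; apply: eq_ler; ring.
  apply: lerD; first by apply: sq_le; exact: a1_bd.
  rewrite mulr_sumr; apply: ler_sum => -[i iN] _ /=.
  by apply: sq_le; apply: a1_bd; exact: node_b.
move: o1; rewrite ler_norml => /andP[ho1 _]; move: ho1 o2 o3.
rewrite -/d0; move: (itg 0 b _) (itg 0 b _) (\sum_(i < N) _) (\sum_(i < N) _) => i1 i2 s1 s2.
have -> : 4^-1 * L ^+ 2 * b * (tau * (tau * H)) = 4^-1 * (L ^+ 2 * b * (tau * (tau * H))) by ring.
have -> : 4^-1 * K ^+ 2 * (X * X) = 4^-1 * (K ^+ 2 * (X * X)) by ring.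
move: (L ^+ 2 * b * _) (K ^+ 2 * (X * X)) (2^-1 * K ^+ 2 * q * _ * _) (a1 0 * d0 0 ^+ 2) (2^-1 * a1 0 * _ * _).
move=> *; lra.
Qed.

Let a x := a1 x - gt b f2 x.
Let a' x := GG b f1 x - GG b f2 x.
Let ca : coefA b a a' := coefAB b _ _ _ _ ca1 ca2.
Let ba : bm 0 b a := coefA_bm b _ _ ca.
Let P := n2 0 b (bf N r (eD k r s t2 U2)).
Let Q := n2 0 b (bf N r (jq k N r s t2 U2)).

Lemma PQ_le : P <= D /\ Q <= D.
Proof.
have := dgnD; rewrite /e2 (dgn_n2 k b N r s hm t2 U2) -/P -/Q => h1.
have hP := sqr_ge0 P; have hQ := sqr_ge0 Q.
split; apply: sqr_le_le => //; apply: le_trans h1; [by rewrite lerDl|by rewrite lerDr].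
Qed.

Lemma a_gt_bd x : 0 <= x <= b -> `|2^-1 * a x| <= 2^-1 * Gf.
Proof.
move=> xb; rewrite normrM gtr0_norm// ler_wpM2l//.
exact: (gt_sup b b0 f1 f2 Gf x g1 g2 gf_bd xb).
Qed.

Let hGf0 : 0 <= 2^-1 * Gf. Proof. by rewrite mulr_ge0// Gf0. Qed.

(** The coefficient of the scheme also changes between the two times. Its increment, of size [Gf],
    meets the full derivative of [e2], and this is how [D] enters. *)
Lemma diff_vol : `|itg 0 b (fun x => 2^-1 * a x * bf N r (fun i => (e2 i)^`()) x * bf N r dP x)| <=
  2^-1 * Gf * D * X.
Proof.
have b1 := bmM _ _ _ _ (bmM _ _ _ _ (bm_cst 0 b 2^-1) ba) (bf_bm (eD k r s t2 U2)).
apply: (le_trans (CS b1 (bf_bm dP))); rewrite ler_wpM2r//.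
apply: (@le_trans _ _ (2^-1 * Gf * P)); last by rewrite ler_wpM2l//; case: PQ_le.
have -> : 2^-1 * Gf * P = n2 0 b (fun x => 2^-1 * Gf * bf N r (eD k r s t2 U2) x).
  by rewrite (n2Z _ (bf_bm _)) (ger0_norm hGf0).
apply: (n2_le b1); first exact: (bmM _ _ _ _ (bm_cst 0 b _) (bf_bm _)).
move=> x /andP[x0 xb]; rewrite [`|2^-1 * a x * _|]normrM [X in _ <= X]normrM ler_wpM2r//.
by rewrite (ger0_norm hGf0) a_gt_bd// !ltW.
Qed.

Lemma diff_jump : `|\sum_(i < N) 2^-1 * a (r i.+1) * jump N r e2 i * (dP i).[r i.+1]| <=
  2^-1 * Gf * D * (Num.sqrt C * X).
Proof.
have -> : \sum_(i < N) 2^-1 * a (r i.+1) * jump N r e2 i * (dP i).[r i.+1] =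
  itg 0 b (fun x => bf N r (fun i => (2^-1 * a (r i.+1))%:P) x * bf N r (jq k N r s t2 U2) x * bf N r (right_val r dP) x).
  rewrite (itg_bf b N r hm _ (fun i x => 2^-1 * a (r i.+1) * (jump N r e2 i / h i) * (dP i).[r i.+1])).
  - apply: eq_bigr => -[i iN] _ /=.
    rewrite itg_cst ?(ltW (mesh_lt b N r hm _ iN))// -/(h i).
    by field; rewrite gt_eqF ?hgt0.
  - exact: (bmM _ _ _ _ (bmM _ _ _ _ (bf_bm _) (bf_bm _)) (bf_bm _)).
  - by move=> i x iN xi; rewrite !(bfE b N r hm _ i x iN xi) !hornerC.
have b1 := bmM _ _ _ _ (bf_bm (fun i => (2^-1 * a (r i.+1))%:P)) (bf_bm (jq k N r s t2 U2)).
apply: (le_trans (CS b1 (bf_bm _))); apply: ler_pM; rewrite ?n2_ge0//.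
  apply: (@le_trans _ _ (2^-1 * Gf * Q)); last by rewrite ler_wpM2l//; case: PQ_le.
  have -> : 2^-1 * Gf * Q = n2 0 b (fun x => 2^-1 * Gf * bf N r (jq k N r s t2 U2) x).
    by rewrite (n2Z _ (bf_bm _)) (ger0_norm hGf0).
  apply: (n2_mesh_le b N r hm _ _ b1); first exact: (bmM _ _ _ _ (bm_cst 0 b _) (bf_bm _)).
  move=> i x iN xi; rewrite [`|bf N r _ x * _|]normrM [X in _ <= X]normrM ler_wpM2r//.
  by rewrite (bfE b N r hm _ i x iN xi) hornerC (ger0_norm hGf0) a_gt_bd// node_b.
exact: (n2_right k b N r hm C C0 traceC dP size_dP).
Qed.

Lemma etaR2_in i x : (i < N)%N -> r i < x < r i.+1 -> `|etaR k N r U2 x| <= L * H * (x - r i).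
Proof.
move=> iN xi; rewrite /etaR (bfE b N r hm _ i x iN xi); apply: etaR_bd => //.
by case/andP: xi => h1 h2; rewrite !ltW.
Qed.

(** [U2 - Pi U2] vanishes at left ends and is at most [L * H * (x - r i)]; the factor
    [x - r i <= h i] pays for the inverse inequality. *)
Lemma diff_eta : `|itg 0 b (fun x => 2^-1 * a x * etaR k N r U2 x * bf N r (fun i => (dP i)^`()) x)| <=
  2^-1 * Gf * q * Num.sqrt C * (H * X).
Proof.
have -> : 2^-1 * Gf * q * Num.sqrt C * (H * X) =
  2^-1 * Gf * (L * H) * Num.sqrt b * (Num.sqrt C * X) by rewrite /q; ring.
have LH : 0 <= L * H by exact: mulr_ge0.
apply: (inv_term b b0 N r hm k.+1 C dP (fun x => 2^-1 * a x * etaR k N r U2 x) _ (ltW C0) size_dP invC).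
- exact: (bmM _ _ _ _ (bmM _ _ _ _ (bm_cst 0 b _) ba) bm_etaR2).
- exact: mulr_ge0.
- move=> i x iN xi; rewrite [`|2^-1 * a x * _|]normrM -[X in _ <= X]mulrA; apply: ler_pM => //.
    by apply: a_gt_bd; have /andP[y1 y2] := mesh_in b N r hm i x iN xi; rewrite !ltW.
  apply: (le_trans (etaR2_in i x iN xi)); rewrite ler_wpM2l// lerB//.
  by case/andP: xi => _ y2; exact: ltW.
Qed.

Let Wf x := Sf b N r s t1 U1 V1 x - Sf b N r s t2 U2 V2 x + a' x * bf N r e2 x.

(** The term [a' e2] left by integration by parts joins the average of [e2] hidden in the difference
    of sources, so that [a'], singular at the centre, multiplies [Xf] of [e2] and not [e2] itself.
    The other differences of [GG] meet [Xf] of smooth functions. *)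
Lemma Wf_split x : 0 < x < b -> Wf x =
  ((((GG b U1 x - GG b f1 x) - (GG b U2 x - GG b f2 x)) * Xf U1 x
  + (GG b U2 x - GG b f2 x) * Xf dU x
  + ((gt b U1 x - gt b f1 x) - (gt b U2 x - gt b f2 x)) * V1 x
  + (gt b U2 x - gt b f2 x) * (V1 x - V2 x))
  - GG b f1 x * av (fun y => (U1 y - f1 y) - (U2 y - f2 y)) x
  + a' x * Xf (bf N r e2) x) - a' x * av (etaR k N r U2) x.
Proof.
move=> /andP[x0 xb]; have xb' := ltW xb.
have bz1 := bmB _ _ _ _ bU1 bf1; have bz2 := bmB _ _ _ _ bU2 bf2.
rewrite (avB b bz1 bz2 xb') (avB b bU1 bf1 xb') (avB b bU2 bf2 xb').
rewrite /dU (XfB b bU1 bU2 xb') (XfE (bf N r e2)).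
have -> : av (etaR k N r U2) x = av U2 x - av f2 x - av (bf N r e2) x.
  rewrite -(avB b bU2 bf2 xb') -(avB b bz2 (bf_bm e2) xb'); congr (_ / _); apply: eq_itg => y _.
  have := congr1 (fun F => F y) (zet_split k N r s t2 U2); rewrite /zet => ->; ring.
rewrite /Wf !SfE -/f1 -/f2 /a' !XfE; ring.
Qed.

(** In the third term [|a' x| * x <= 2 * Gf] leaves [qf] of [e2], whose norm is at most [6 * D] by
    the broken Hardy inequality: hence 12. In the fourth the average of the Gauss--Radau error is at
    most [L * H * x], which compensates the singularity of [a']. *)
Lemma n2_Wf : n2 0 b Wf <= 3 * q * (G4 + G2 * tau) + 2 * K ^+ 2 * (X + q * (tau * H))
  + 12 * Gf * D + 2 * Gf * q * H.
Proof.
have bz := bmB _ _ _ _ (bmB _ _ _ _ bU1 bf1) (bmB _ _ _ _ bU2 bf2).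
have bV1 := bm_V b L U1 V1 W1 hU1; have bV2 := bm_V b L U2 V2 W2 hU2.
have bG f : good b f -> bm 0 b (GG b f) := bm_GG b f.
have bg f : good b f -> bm 0 b (gt b f) by move=> gf; exact: (coefA_bm b _ _ (coefA_gt b f gf)).
have ba' : bm 0 b a' := bmB _ _ _ _ (bG _ g1) (bG _ g2).
have [_ gd Xd] := lgd.
pose F1 x := ((GG b U1 x - GG b f1 x) - (GG b U2 x - GG b f2 x)) * Xf U1 x
  + (GG b U2 x - GG b f2 x) * Xf dU x
  + ((gt b U1 x - gt b f1 x) - (gt b U2 x - gt b f2 x)) * V1 x
  + (gt b U2 x - gt b f2 x) * (V1 x - V2 x).
pose F2 x := GG b f1 x * av (fun y => (U1 y - f1 y) - (U2 y - f2 y)) x.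
pose F3 x := a' x * Xf (bf N r e2) x.
pose F4 x := a' x * av (etaR k N r U2) x.
have bF1 : bm 0 b F1.
  apply: bmD; [apply: bmD; [apply: bmD|]|].
  - exact: (bmM _ _ _ _ (bmB _ _ _ _ (bmB _ _ _ _ (bG _ gU1) (bG _ g1)) (bmB _ _ _ _ (bG _ gU2) (bG _ g2))) (bm_Xf b _ bU1)).
  - exact: (bmM _ _ _ _ (bmB _ _ _ _ (bG _ gU2) (bG _ g2)) (bm_Xf b _ bdU)).
  - exact: (bmM _ _ _ _ (bmB _ _ _ _ (bmB _ _ _ _ (bg _ gU1) (bg _ g1)) (bmB _ _ _ _ (bg _ gU2) (bg _ g2))) bV1).
  - exact: (bmM _ _ _ _ (bmB _ _ _ _ (bg _ gU2) (bg _ g2)) (bmB _ _ _ _ bV1 bV2)).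
have bF2 : bm 0 b F2 := bmM _ _ _ _ (bG _ g1) (bm_av b _ bz).
have bF3 : bm 0 b F3 := bmM _ _ _ _ ba' (bm_Xf b _ (bf_bm e2)).
have bF4 : bm 0 b F4 := bmM _ _ _ _ ba' (bm_av b _ bm_etaR2).
rewrite (eq_n2 (fun x => F1 x - F2 x + F3 x - F4 x)); last first.
  by move=> x xb; rewrite Wf_split.
have G0 : 0 <= G4 + G2 * tau by rewrite addr_ge0 ?G40// mulr_ge0 ?G20.
have GG0 : 0 <= 2 * Gf by apply: mulr_ge0 => //; exact: Gf0.
have a'_bd x : 0 < x < b -> `|a' x| * x <= 2 * Gf.
  by move=> xb; exact: (GG_sup b f1 f2 Gf x g1 g2 gf_bd xb).
have n1 : n2 0 b F1 <= 3 * q * (G4 + G2 * tau).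
  have -> : 3 * q * (G4 + G2 * tau) = 3 * L * (G4 + G2 * tau) * Num.sqrt b by rewrite /q; ring.
  apply: (n2_sup b b0 _ _ bF1); first by rewrite !mulr_ge0.
  move=> x xb; have /andP[x0 xb'] := xb.
  have xbb : 0 <= x <= b by rewrite !ltW.
  have y1 := GG_sup4 b U1 f1 U2 f2 G4 x gU1 g1 gU2 g2 g4_bd xb.
  have y2 := GG_sup b U2 f2 G2 x gU2 g2 g2_bd xb.
  have y3 := gt_sup4 b b0 U1 f1 U2 f2 G4 x gU1 g1 gU2 g2 g4_bd xbb.
  have y4 := gt_sup b b0 U2 f2 G2 x gU2 g2 g2_bd xbb.
  have v1 := exact_Xf b b0 L U1 V1 W1 hU1 x xb; have v2 := Xd x xb.
  have v3 := ea_dbound _ _ _ _ _ hU1 x xb; have v4 := dV_bd x xb.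
  rewrite /F1; move: y1 y2 y3 y4 v1 v2 v3 v4.
  move: (GG b U1 x) (GG b f1 x) (GG b U2 x) (GG b f2 x) (gt b U1 x) (gt b f1 x) (gt b U2 x) (gt b f2 x) => c1 c2 c3 c4 c5 c6 c7 c8.
  move: (Xf U1 x) (Xf dU x) (V1 x) (V1 x - V2 x) => B1 B2 B3 B4.
  move: (c7 - c8) (c5 - c6 - (c7 - c8)) (c3 - c4) (c1 - c2 - (c3 - c4)) => A4 A3 A2 A1 y1 y2 y3 y4 v1 v2 v3 v4.
  have pr (A B Mx c x' : R) : 0 <= c -> 0 < x' -> `|A| * x' <= Mx -> `|B| <= c * x' -> `|A * B| <= c * Mx.
    move=> c0 x'0 u1 u2; rewrite normrM; apply: (le_trans (ler_wpM2l (normr_ge0 A) u2)).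
    by rewrite mulrCA ler_wpM2l.
  have w1 := pr _ _ _ _ _ L0 x0 y1 v1; have w2 := pr _ _ _ _ _ Lt0 x0 y2 v2.
  have w3 : `|A3 * B3| <= G4 * L by rewrite normrM; apply: ler_pM.
  have w4 : `|A4 * B4| <= G2 * (L * tau) by rewrite normrM; apply: ler_pM.
  apply: (le_trans (ler_normD _ _)); apply: (le_trans (lerD (ler_normD _ _) (lexx _))).
  apply: (le_trans (lerD (lerD (ler_normD _ _) (lexx _)) (lexx _))).
  apply: (le_trans (lerD (lerD (lerD w1 w2) w3) w4)).
  by apply: eq_ler; ring.
have n2' : n2 0 b F2 <= 2 * K ^+ 2 * (X + q * (tau * H)).
  apply: (@le_trans _ _ (n2 0 b (fun x => K ^+ 2 * av (fun y => (U1 y - f1 y) - (U2 y - f2 y)) x))).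
    apply: (n2_le bF2); first exact: (bmM _ _ _ _ (bm_cst 0 b _) (bm_av b _ bz)).
    move=> x xb; have /andP[u1 u2] := GGf_bd b N r K U1 f1 p1 KU1 K1 x xb.
    rewrite /F2; move: (GG b f1 x) (av _ x) (K ^+ 2) u1 u2 => G v K' u1 u2.
    by rewrite !normrM ler_wpM2r// (ger0_norm u1) (ger0_norm (le_trans u1 u2)).
  rewrite (n2Z _ (bm_av b _ bz)) (ger0_norm (sqr_ge0 K)) (mulrC 2) -[X in _ <= X]mulrA ler_wpM2l ?sqr_ge0//.
  apply: (le_trans (n2_av b N r b0 hm _ (pgoodB b N r _ _ (pgoodB b N r _ _ pU1 p1) (pgoodB b N r _ _ pU2 p2)))).
  by rewrite ler_wpM2l// n2_dzeta.
have n3 : n2 0 b F3 <= 12 * Gf * D.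
  have ge : good b (bf N r e2) := good_bf b N r hm e2 b0.
  apply: (@le_trans _ _ (n2 0 b (fun x => 2 * Gf * qf (bf N r e2) x))).
    apply: (n2_le bF3); first exact: (bmM _ _ _ _ (bm_cst 0 b _) (bm_qf b _ ge)).
    move=> x xb; have /andP[x0 _] := xb; have := a'_bd x xb.
    rewrite /F3 (Xf_qf _ _ x0); move: (a' x) (qf _ x) => A B u1.
    rewrite mulrA [X in X <= _]normrM [X in _ <= X]normrM ler_wpM2r//.
    by rewrite (ger0_norm GG0) normrM (gtr0_norm x0).
  rewrite (n2Z _ (bm_qf b _ ge)) (ger0_norm GG0) -/(Kf b (bf N r e2)).
  have kb := Kf_bf b N r hm e2 b0.
  have sD : Num.sqrt (dgn N r e2) <= D by rewrite -(ger0_norm D0) -sqrtr_sqr ler_wsqrtr.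
  apply: (@le_trans _ _ (2 * Gf * (6 * D))); last by apply: eq_ler; ring.
  rewrite (ler_wpM2l GG0)//; apply: (le_trans kb); by rewrite ler_wpM2l.
have n4 : n2 0 b F4 <= 2 * Gf * q * H.
  have -> : 2 * Gf * q * H = 2 * Gf * (L * H) * Num.sqrt b by rewrite /q; ring.
  have LH : 0 <= L * H by exact: mulr_ge0.
  apply: (n2_sup b b0 _ _ bF4); first exact: mulr_ge0.
  move=> x xb; have /andP[x0 xb'] := xb; have u1 := a'_bd x xb.
  have u2 : `|av (etaR k N r U2) x| <= L * H * x.
    apply: (av_mesh_bound b N r hm _ _ _ bm_etaR2); first by rewrite mulr_ge0// ltW.
      move=> i y iN yi yx; apply: (le_trans (etaR2_in i y iN yi)); rewrite ler_wpM2l//.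
      have /andP[r0 _] := node_b i (ltnW iN).
      by rewrite lerBlDr (le_trans (ltW yx))// lerDl.
    by rewrite x0 ltW.
  rewrite /F4; move: (a' x) (av _ x) u1 u2 => A B u1 u2.
  rewrite normrM; apply: (le_trans (ler_wpM2l (normr_ge0 A) u2)).
  by rewrite mulrCA mulrC ler_wpM2r.
have bF12 := bmB _ _ _ _ bF1 bF2; have bF123 := bmD _ _ _ _ bF12 bF3.
apply: (le_trans (n2B bF123 bF4)); apply: lerD => //.
apply: (le_trans (n2D bF12 bF3)); apply: lerD => //.
by apply: (le_trans (n2B bF1 bF2)); apply: lerD.
Qed.

Definition dT i := eT k r s t1 W1 i - eT k r s t2 W2 i.

(** In the difference of the two error identities, the convection terms are split into [a1] acting
    on the increment and the increment of the coefficient acting on the error at [t2]. Only the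
    polynomial part of the latter is integrated by parts. *)
Lemma two_times_identity : itg 0 b (fun x => bf N r dT x * bf N r dP x) =
  - Bf b N r a1 (fun x => bf N r dP x + etaP x) (fun i => d0 i + etaQ i) dP
  + itg 0 b (fun x => 2^-1 * a x * bf N r (fun i => (e2 i)^`()) x * bf N r dP x)
  + \sum_(i < N) 2^-1 * a (r i.+1) * jump N r e2 i * (dP i).[r i.+1]
  - itg 0 b (fun x => 2^-1 * a x * etaR k N r U2 x * bf N r (fun i => (dP i)^`()) x)
  + 2^-1 * itg 0 b (fun x => Wf x * bf N r dP x).
Proof.
have sp := size_dP.
have bS1 := bm_Sf b N r s b0 hm t1 L U1 V1 W1 hU1; have bS2 := bm_Sf b N r s b0 hm t2 L U2 V2 W2 hU2.
have bd := bf_bm dP.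
have bb t := bmM _ _ _ _ (bf_bm (eT k r s t (if t == t1 then W1 else W2))) bd.
have -> : itg 0 b (fun x => bf N r dT x * bf N r dP x) =
    itg 0 b (fun x => bf N r (eT k r s t1 W1) x * bf N r dP x)
    - itg 0 b (fun x => bf N r (eT k r s t2 W2) x * bf N r dP x).
  rewrite -(itgB (bmM _ _ _ _ (bf_bm _) bd) (bmM _ _ _ _ (bf_bm _) bd)).
  by apply: eq_itg => x _; rewrite /dT bfB mulrBl.
rewrite -(sum_eT k b N r s b0 hm t1 L U1 V1 W1 hU1 dP sp) -(sum_eT k b N r s b0 hm t2 L U2 V2 W2 hU2 dP sp).
rewrite (error_identity k b T Ub N r s b0 hm hs t1 tT1 L U1 V1 W1 hU1 Ub1 dP sp).
rewrite (error_identity k b T Ub N r s b0 hm hs t2 tT2 L U2 V2 W2 hU2 Ub2 dP sp).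
rewrite -/f1 -/f2 -/a1.
have bz1 : bm 0 b (zet N r s t1 U1) := bmB _ _ _ _ bU1 bf1.
have bz2 : bm 0 b (zet N r s t2 U2) := bmB _ _ _ _ bU2 bf2.
have e1 := Bf_subl b N r hm a1 _ _ (zpt N r s t1 U1) (zpt N r s t2 U2) dP ba1 bz1 bz2.
rewrite zet_diff zpt_diff in e1.
have e3 := Bf_subr b N r hm a1 _ _ (zpt N r s t2 U2) dP ba1 ba2 bz2.
have e4 : Bf b N r a (zet N r s t2 U2) (zpt N r s t2 U2) dP =
   Bf b N r a (bf N r e2) (rv N r e2) dP + Bf b N r a (etaR k N r U2) (fun=> 0) dP.
  rewrite (zet_split k) (zpt_rv k N r s t2 U2) -/e2.
  exact: (Bf_addl b N r hm a _ _ _ _ dP ba (bf_bm _) bm_etaR2).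
have e5 := B_parts b N r hm a a' e2 dP ca.
rewrite Bf_0 in e4.
have ba' : bm 0 b a' := bmB _ _ _ _ (bm_GG b _ g1) (bm_GG b _ g2).
have e6 : itg 0 b (fun x => Wf x * bf N r dP x) =
  itg 0 b (fun x => Sf b N r s t1 U1 V1 x * bf N r dP x) - itg 0 b (fun x => Sf b N r s t2 U2 V2 x * bf N r dP x)
  + 2 * itg 0 b (fun x => 2^-1 * a' x * bf N r e2 x * bf N r dP x).
  have c1 := bmM _ _ _ _ bS1 bd; have c2 := bmM _ _ _ _ bS2 bd.
  have c3 := bmM4 0 b _ _ _ _ (bm_cst 0 b 2^-1) ba' (bf_bm e2) bd.
  rewrite -(itgB c1 c2) -(itgZl 2 c3) -(itgD (bmB _ _ _ _ c1 c2) (bmM _ _ _ _ (bm_cst 0 b 2) c3)).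
  by apply: eq_itg => x _; rewrite /Wf; field.
move: e1 e3 e4 e5 e6; rewrite -/a.
move: (Bf _ _ _ a1 (zet N r s t1 U1) _ _) (Bf _ _ _ a1 (zet N r s t2 U2) _ _) (Bf _ _ _ a1 _ _ _).
move: (Bf _ _ _ a (zet _ _ _ _ _) _ _) (Bf _ _ _ a (bf _ _ _) _ _) (Bf _ _ _ (gt b f2) _ _ _).
move: (\sum_(i < N) _) (itg 0 b (fun x => Wf x * bf N r dP x)).
move: (itg 0 b (fun x => Sf b N r s t1 U1 V1 x * bf N r dP x)) (itg 0 b (fun x => Sf b N r s t2 U2 V2 x * bf N r dP x)).
move: (itg 0 b (fun x => 2^-1 * a x * etaR k N r U2 x * bf N r (fun i => (dP i)^`()) x)) (itg 0 b (fun x => 2^-1 * a' x * bf N r e2 x * bf N r dP x)) (itg 0 b _).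
move=> *; lra.
Qed.

Definition C4 := 2 * (4^-1 * K ^+ 2 + 4^-1 * L ^+ 2 * b + 2^-1 * K ^+ 2 * q * Num.sqrt C * (1 + b)
  + (2^-1 * (1 + Num.sqrt C) + 6) * (2 * K * (1 + q + q * (1 + b)))
  + (2^-1 * q * Num.sqrt C + q) * (2 * K * (b + q * (1 + b) + q * b * (1 + b)))
  + 3 / 2 * q * (expR (b * K ^+ 2) * (2 * K * (1 + q * (1 + b)) + (2 * q * L + 4 * K ^+ 2 * q * L) * (1 + b))
     + 2 * K * L * (1 + b))
  + K ^+ 2 * (1 + q * (1 + b))).

(** Divided by [tau ^+ 2], with [tau] tending to 0, this plays the role of the energy inequality for
    the time derivative of the error, although no second time derivative of [u] exists. The constant
    [C4] collects the Young inequalities below. *)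
Lemma level2 : 2 * itg 0 b (fun x => bf N r dT x * bf N r dP x) <=
  C4 * (X ^+ 2 + tau ^+ 2 * (D ^+ 2 + H)).
Proof.
rewrite two_times_identity /C4 -[X in _ <= X]mulrA ler_pM2l//.
have := diff_vol; rewrite ler_norml => /andP[_ h1].
have := diff_jump; rewrite ler_norml => /andP[_ h2].
have := diff_eta; rewrite ler_norml => /andP[h3 _].
have h0 := term_main.
have bW : bm 0 b Wf.
  apply: bmD; last exact: (bmM _ _ _ _ (bmB _ _ _ _ (bm_GG b _ g1) (bm_GG b _ g2)) (bf_bm _)).
  exact: (bmB _ _ _ _ (bm_Sf b N r s b0 hm t1 L U1 V1 W1 hU1) (bm_Sf b N r s b0 hm t2 L U2 V2 W2 hU2)).
have := CS bW (bf_bm dP); rewrite ler_norml => /andP[_].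
move/le_trans => /(_ _ (ler_wpM2r X0 n2_Wf)) h4.
move: h0 h1 h2 h3 h4.
move: (- Bf _ _ _ _ _ _ _) (itg 0 b (fun x => 2^-1 * a x * bf N r (fun i => (e2 i)^`()) x * bf N r dP x)) (\sum_(i < N) _) (itg 0 b (fun x => 2^-1 * a x * etaR k N r U2 x * bf N r (fun i => (dP i)^`()) x)) (itg 0 b (fun x => Wf x * bf N r dP x)).
move=> u0 u1 u2 u3 u4 h0 h1 h2 h3 h4.
have HB := mesh_size_le; have sC : 0 <= Num.sqrt C by exact: sqrtr_ge0.
have bb : 0 <= b by exact: ltW.
have D1 : D <= 1 by case/andP: D01.
set Y := X ^+ 2 + tau ^+ 2 * (D ^+ 2 + H).
have D2 : 0 <= D ^+ 2 by exact: sqr_ge0.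
have X2 : 0 <= X ^+ 2 by exact: sqr_ge0.
have T2 : 0 <= tau ^+ 2 by exact: sqr_ge0.
have XX : X * X <= Y by rewrite /Y -expr2 lerDl mulr_ge0// addr_ge0.
have ttH : tau * (tau * H) <= Y.
  by rewrite mulrA -expr2 /Y mulrDr addrA lerDr addr_ge0// mulr_ge0.
have Y0 : 0 <= Y by apply: le_trans XX; exact: mulr_ge0.
have XtD : X * (tau * D) <= Y.
  have : 0 <= (X - tau * D) ^+ 2 + X ^+ 2 + (tau * D) ^+ 2 + 2 * (tau ^+ 2 * H).
    by rewrite !addr_ge0 ?sqr_ge0// !mulr_ge0.
  have -> : Y = 2^-1 * ((X - tau * D) ^+ 2 + X ^+ 2 + (tau * D) ^+ 2 + 2 * (tau ^+ 2 * H)) + X * (tau * D).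
    by rewrite /Y; field.
  by move=> ?; rewrite lerDr mulr_ge0.
have XtH : X * (tau * H) <= (1 + b) * Y.
  apply: (@le_trans _ _ (X ^+ 2 + (tau * H) ^+ 2)).
    have : 0 <= (X - tau * H) ^+ 2 + X ^+ 2 + (tau * H) ^+ 2 by rewrite !addr_ge0 ?sqr_ge0.
    have -> : X ^+ 2 + (tau * H) ^+ 2 = 2^-1 * ((X - tau * H) ^+ 2 + X ^+ 2 + (tau * H) ^+ 2) + X * (tau * H) by field.
    by move=> ?; rewrite lerDr mulr_ge0.
  rewrite mulrDl mul1r; apply: lerD; first by rewrite expr2.
  have -> : (tau * H) ^+ 2 = H * (tau * (tau * H)) by ring.
  by apply: ler_pM => //; rewrite !mulr_ge0.
have GD : Gf * D * X <= 2 * K * (1 + q + q * (1 + b)) * Y.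
  have -> : Gf * D * X = 2 * K * (X * X * D + q * (X * (tau * D)) + q * (X * (tau * H) * D)) by rewrite /Gf; ring.
  rewrite -[X in _ <= X]mulrA ler_wpM2l ?mulr_ge0// !mulrDl mul1r; apply: lerD; [apply: lerD|].
  - by apply: le_trans XX; rewrite ler_piMr// mulr_ge0.
  - by rewrite ler_wpM2l.
  - rewrite -[X in _ <= X]mulrA ler_wpM2l//; apply: le_trans XtH.
    by rewrite ler_piMr// !mulr_ge0.
have GH : Gf * H * X <= 2 * K * (b + q * (1 + b) + q * b * (1 + b)) * Y.
  have -> : Gf * H * X = 2 * K * (H * (X * X) + q * (X * (tau * H)) + q * (H * (X * (tau * H)))) by rewrite /Gf; ring.
  rewrite -[X in _ <= X]mulrA ler_wpM2l ?mulr_ge0// !mulrDl; apply: lerD; [apply: lerD|].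
  - by apply: ler_pM; rewrite ?mulr_ge0.
  - by rewrite -[X in _ <= X]mulrA ler_wpM2l.
  - have -> : q * b * (1 + b) * Y = q * (b * ((1 + b) * Y)) by ring.
    by rewrite ler_wpM2l//; apply: ler_pM => //; rewrite !mulr_ge0.
have G4X : G4 * X <= expR (b * K ^+ 2) * (2 * K * (1 + q * (1 + b)) + (2 * q * L + 4 * K ^+ 2 * q * L) * (1 + b)) * Y.
  have -> : G4 * X = expR (b * K ^+ 2) * (2 * K * (X * X + q * (X * (tau * H)))
    + (2 * q * L + 4 * K ^+ 2 * q * L) * (X * (tau * H))) by rewrite /G4; ring.
  rewrite -[X in _ <= X]mulrA ler_wpM2l ?expR_ge0// [X in _ <= X]mulrDl; apply: lerD.
    rewrite -[X in _ <= X]mulrA ler_wpM2l ?mulr_ge0// [X in _ <= X]mulrDl mul1r; apply: lerD => //.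
    by rewrite -[X in _ <= X]mulrA ler_wpM2l.
  rewrite -[X in _ <= X]mulrA ler_wpM2l// addr_ge0// !mulr_ge0//; exact: sqr_ge0.
have G2X : G2 * tau * X <= 2 * K * L * (1 + b) * Y.
  have -> : G2 * tau * X = 2 * K * L * (X * (tau * H)) by rewrite /G2; ring.
  by rewrite -[X in _ <= X]mulrA ler_wpM2l ?mulr_ge0.
have c0 : 0 <= K ^+ 2 by exact: sqr_ge0.
have c0' : 0 <= L ^+ 2 by exact: sqr_ge0.
have h0' : u0 <= 4^-1 * K ^+ 2 * Y + 4^-1 * L ^+ 2 * b * Y + 2^-1 * K ^+ 2 * q * Num.sqrt C * (1 + b) * Y.
  apply: (le_trans h0); apply: lerD; [apply: lerD|]; rewrite -?[2^-1 * _ * _ * _ * (1 + b) * Y]mulrA ler_wpM2l// !mulr_ge0//.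
have h12 : u1 + u2 <= 2^-1 * (1 + Num.sqrt C) * (2 * K * (1 + q + q * (1 + b)) * Y).
  apply: (le_trans (lerD h1 h2)).
  have -> : 2^-1 * Gf * D * X + 2^-1 * Gf * D * (Num.sqrt C * X) = 2^-1 * (1 + Num.sqrt C) * (Gf * D * X) by ring.
  by rewrite ler_wpM2l// mulr_ge0// addr_ge0.
have h3' : - u3 <= 2^-1 * q * Num.sqrt C * (2 * K * (b + q * (1 + b) + q * b * (1 + b)) * Y).
  rewrite lerNl; apply: le_trans h3; rewrite lerN2.
  have -> : 2^-1 * Gf * q * Num.sqrt C * (H * X) = 2^-1 * q * Num.sqrt C * (Gf * H * X) by ring.
  by rewrite ler_wpM2l// !mulr_ge0.
have h4' : 2^-1 * u4 <= 3 / 2 * q * (expR (b * K ^+ 2) * (2 * K * (1 + q * (1 + b)) + (2 * q * L + 4 * K ^+ 2 * q * L) * (1 + b)) * Y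
     + 2 * K * L * (1 + b) * Y) + K ^+ 2 * (1 + q * (1 + b)) * Y + 6 * (2 * K * (1 + q + q * (1 + b)) * Y)
     + q * (2 * K * (b + q * (1 + b) + q * b * (1 + b)) * Y).
  apply: (@le_trans _ _ (3 / 2 * q * (G4 * X + G2 * tau * X) + K ^+ 2 * (X * X + q * (X * (tau * H)))
     + 6 * (Gf * D * X) + q * (Gf * H * X))).
    apply: (@le_trans _ _ (2^-1 * ((3 * q * (G4 + G2 * tau) + 2 * K ^+ 2 * (X + q * (tau * H))
      + 12 * Gf * D + 2 * Gf * q * H) * X))); first by rewrite ler_wpM2l.
    by apply: eq_ler; field.
  apply: lerD; [apply: lerD; [apply: lerD|]|].
  - by rewrite ler_wpM2l ?mulr_ge0//; exact: lerD.
  - rewrite -[X in _ <= X]mulrA ler_wpM2l// [X in _ <= X]mulrDl mul1r; apply: lerD => //.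
    by rewrite -[X in _ <= X]mulrA ler_wpM2l.
  - by rewrite ler_wpM2l.
  - by rewrite ler_wpM2l.
rewrite (_ : u0 + u1 + u2 - u3 + 2^-1 * u4 = u0 + (u1 + u2) - u3 + 2^-1 * u4); last by ring.
apply: (le_trans (lerD (lerD (lerD h0' h12) h3') h4')).
by apply: eq_ler; field.
Qed.

End TwoTimes.

(** * Weak derivatives *)

Section BumpFunctions.
Context {R : realType}.
Implicit Types (x y a c : R) (f g : R -> R).

(** The functions y^(-m) exp(-1/y), extended by 0; their linear span is stable under
    differentiation. *)
Definition bmp m y : R := if 0 < y then y^-1 ^+ m * expR (- y^-1) else 0.

(** The exponential of [1 / y] exceeds the power [m.+2] of [1 / (m.+2 * y)], which beats [y^(-m)]
    with [y ^+ 2] to spare. Quadratic decay gives the zero derivative at 0. *)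
Lemma bmp_le m : exists2 C : R, 0 <= C & forall y, `|bmp m y| <= C * y ^+ 2.
Proof.
exists (m.+2%:R ^+ m.+2); first by rewrite exprn_ge0.
move=> y; rewrite /bmp; case: ifPn => [y0|_]; last by rewrite normr0 mulr_ge0 ?sqr_ge0 ?exprn_ge0.
have i0 : 0 < y^-1 by rewrite invr_gt0.
have p0 : 0 <= y^-1 ^+ m * expR (- y^-1) by rewrite mulr_ge0 ?expR_ge0// exprn_ge0// ltW.
rewrite (ger0_norm p0).
have n0 : (0 : R) < m.+2%:R by rewrite ltr0n.
have h1 : (y^-1 / m.+2%:R) ^+ m.+2 <= expR (y^-1).
  have e1 : m.+2%:R * (y^-1 / m.+2%:R) = y^-1 by rewrite mulrCA mulfV ?mulr1// gt_eqF.
  rewrite -{2}e1 expRM_natl; apply: lerXn2r.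
  - by rewrite nnegrE divr_ge0// ltW.
  - by rewrite nnegrE expR_ge0.
  - by apply: le_trans (expR_ge1Dx _); rewrite lerDr.
rewrite expRN ler_pdivrMr ?expR_gt0//.
apply: (@le_trans _ _ (m.+2%:R ^+ m.+2 * y ^+ 2 * (y^-1 / m.+2%:R) ^+ m.+2)); last first.
  by rewrite ler_wpM2l// mulr_ge0 ?sqr_ge0 ?exprn_ge0.
apply: eq_ler.
move: (m.+2%:R : R) n0 => n n0.
have -> : (y^-1 / n) ^+ m.+2 = y^-1 ^+ m * y^-1 ^+ 2 * (n ^+ m.+2)^-1.
  by rewrite exprMn [n^-1 ^+ _]exprVn -exprD addn2.
by field; rewrite (gt_eqF y0) expf_neq0 ?gt_eqF.
Qed.

Lemma is_derive_sq0 f (C : R) : 0 <= C -> (forall y, `|f y| <= C * y ^+ 2) -> is_derive (0 : R) 1 f 0.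
Proof.
move=> C0 fC; have f0 : f 0 = 0.
  by apply/eqP; rewrite -normr_le0; have := fC 0; rewrite expr0n mulr0.
have h : h^-1 *: (f (h *: 1 + 0) - f 0) @[h --> (0 : R)^'] --> (0 : R).
  apply/cvgrPdist_le => e e0; near=> h.
  rewrite f0 subr0 addr0 sub0r normrN /GRing.scale/= mulr1 normrM normfV.
  have h0 : 0 < `|h| by rewrite normr_gt0; near: h; exact: nbhs_dnbhs_neq.
  rewrite ler_pdivrMl//; apply: (le_trans (fC h)).
  rewrite -real_normK ?num_real// expr2 mulrA mulrC ler_wpM2l//.
  apply: (@le_trans _ _ ((C + 1) * `|h|)); first by rewrite ler_wpM2r// lerDl.
  rewrite -ler_pdivlMl ?ltr_wpDl//.
  near: h; apply: dnbhs0_le; by rewrite mulr_gt0 ?invr_gt0 ?ltr_wpDl.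
apply: DeriveDef; first by apply/cvg_ex; exists 0.
exact: cvg_lim.
Unshelve. all: by end_near. Qed.

Lemma is_derive_bmp m y : is_derive y 1 (bmp m) (- m%:R * bmp m.+1 y + bmp m.+2 y).
Proof.
have [y0|y0|<-] := ltgtP 0 y.
- apply: (@is_derive_ext _ _ (fun z => z^-1 ^+ m * expR (- z^-1)) _ y) => //.
    by move=> z yz; rewrite /bmp ifT//; move: yz; rewrite ltr_norml; lra.
  have d1 : is_derive y 1 (fun z : R => z^-1) (- y ^- 2).
    have y1 : y != 0 by rewrite gt_eqF.
    have h := is_deriveV (f := id) (x := y) (v := 1) y1 (is_derive_id _ _).
    by apply: (is_derive_eq h); rewrite /GRing.scale/= mulr1.
  have d2 : is_derive y^-1 1 (fun s : R => s ^+ m * expR (- s))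
     (m%:R * y^-1 ^+ m.-1 * expR (- y^-1) - y^-1 ^+ m * expR (- y^-1)).
    have e1 : is_derive y^-1 1 (fun s : R => s ^+ m) ('X^m)^`().[y^-1].
      rewrite (_ : (fun s : R => s ^+ m) = (fun s => ('X^m : {poly R}).[s])); first exact: is_derive_poly.
      by apply/funext => s; rewrite hornerXn.
    have e3 : is_derive y^-1 1 (fun s : R => - s) (-1) by apply: is_deriveN.
    have e2 := is_derive1_comp (f := @expR R) (g := fun s : R => - s) (x := y^-1) (is_derive_expR _) e3.
    rewrite (_ : (fun s => _) = (fun s : R => s ^+ m) * (@expR R \o (fun s : R => - s))) //.
    by apply: (is_derive_eq (is_deriveM e1 e2)); rewrite /GRing.scale/= derivXn hornerMn hornerXn -mulr_natl; ring.
  have := is_derive1_comp (f := fun s : R => s ^+ m * expR (- s)) (g := fun z : R => z^-1) (x := y) d2 d1.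
  move=> h; apply: (is_derive_eq h); rewrite /bmp y0.
  by case: m {d2 h} => [|m]; rewrite ?mul0r ?oppr0 ?mul0r/= ?exprS; field; rewrite gt_eqF.
- apply: (@is_derive_ext _ _ (fun z => 0) _ (- y)); first by rewrite oppr_gt0.
    by move=> z yz; rewrite /bmp ifF//; apply/negbTE; rewrite -leNgt; move: yz; rewrite ltr_norml; lra.
  by rewrite /bmp !ifF ?mulr0 ?addr0; [exact: is_derive_cst|apply/negbTE; rewrite -leNgt ltW..].
- have [C C0 h] := bmp_le m; rewrite /bmp ltxx mulr0 addr0; exact: is_derive_sq0 h.
Qed.

(** A class containing its own derivatives: membership alone yields smoothness of every order,
    without formulas for higher derivatives. *)
Inductive bumps a c : (R -> R) -> Prop :=
| bump_base m n : bumps a c (fun x => bmp m (x - a) * bmp n (c - x))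
| bump_comb k f g : bumps a c f -> bumps a c g -> bumps a c (fun x => k * f x + g x).

Lemma bumps_derive a c f : bumps a c f ->
  exists2 g, bumps a c g & forall x, is_derive x 1 f (g x).
Proof.
elim=> [m n|k f1 f2 _ [g1 s1 d1] _ [g2 s2 d2]]; last first.
  exists (fun x => k * g1 x + g2 x); first exact: bump_comb.
  move=> x; have e1 := d1 x; have e2 := d2 x.
  have -> : (fun x => k * f1 x + f2 x) = (fun x => k *: f1 x) + f2 by [].
  exact: is_deriveD.
exists (fun x => (- m%:R) * (bmp m.+1 (x - a) * bmp n (c - x)) + (1 * (bmp m.+2 (x - a) * bmp n (c - x))
   + (n%:R * (bmp m (x - a) * bmp n.+1 (c - x)) + ((-1) * (bmp m (x - a) * bmp n.+2 (c - x))
   + 0 * (bmp 0 (x - a) * bmp 0 (c - x)) + (0 * (bmp 0 (x - a) * bmp 0 (c - x)) + bmp 0 (x - a) * bmp 0 (c - x) - bmp 0 (x - a) * bmp 0 (c - x)))))).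
  (* The chain of [bump_comb] must end with a member of the class; the zero function is one,
     obtained as a bump minus itself. *)
  have z : bumps a c (fun x => 0 * (bmp 0 (x - a) * bmp 0 (c - x)) + bmp 0 (x - a) * bmp 0 (c - x) - bmp 0 (x - a) * bmp 0 (c - x)).
    have -> : (fun x => 0 * (bmp 0 (x - a) * bmp 0 (c - x)) + bmp 0 (x - a) * bmp 0 (c - x) - bmp 0 (x - a) * bmp 0 (c - x))
      = (fun x => (-1) * (bmp 0 (x - a) * bmp 0 (c - x)) + bmp 0 (x - a) * bmp 0 (c - x)) by apply/funext => x; ring.
    by apply: bump_comb; exact: bump_base.
  have -> : (fun x => (- m%:R) * (bmp m.+1 (x - a) * bmp n (c - x)) + (1 * (bmp m.+2 (x - a) * bmp n (c - x))
   + (n%:R * (bmp m (x - a) * bmp n.+1 (c - x)) + ((-1) * (bmp m (x - a) * bmp n.+2 (c - x))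
   + 0 * (bmp 0 (x - a) * bmp 0 (c - x)) + (0 * (bmp 0 (x - a) * bmp 0 (c - x)) + bmp 0 (x - a) * bmp 0 (c - x) - bmp 0 (x - a) * bmp 0 (c - x)))))) =
   (fun x => (- m%:R) * (bmp m.+1 (x - a) * bmp n (c - x)) + (1 * (bmp m.+2 (x - a) * bmp n (c - x))
   + (n%:R * (bmp m (x - a) * bmp n.+1 (c - x)) + ((-1) * (bmp m (x - a) * bmp n.+2 (c - x))
   + (0 * (bmp 0 (x - a) * bmp 0 (c - x)) + bmp 0 (x - a) * bmp 0 (c - x) - bmp 0 (x - a) * bmp 0 (c - x)))))) by apply/funext => x; ring.
  by do 4 (apply: bump_comb; first exact: bump_base).
move=> x.
have d1 : is_derive x 1 (fun x => bmp m (x - a)) (- m%:R * bmp m.+1 (x - a) + bmp m.+2 (x - a)).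
  have e1 : is_derive x 1 (fun x : R => x - a) 1 by apply: is_derive_eq; ring.
  have := is_derive1_comp (f := bmp m) (g := fun x : R => x - a) (x := x) (is_derive_bmp m (x - a)) e1.
  by rewrite mulr1.
have d2 : is_derive x 1 (fun x => bmp n (c - x)) (- (- n%:R * bmp n.+1 (c - x) + bmp n.+2 (c - x))).
  have e1 : is_derive x 1 (fun x : R => c - x) (-1) by apply: is_derive_eq; ring.
  have := is_derive1_comp (f := bmp n) (g := fun x : R => c - x) (x := x) (is_derive_bmp n (c - x)) e1.
  by rewrite mulrN1.
have -> : (fun x => bmp m (x - a) * bmp n (c - x)) = (fun x => bmp m (x - a)) * (fun x => bmp n (c - x)) by [].
by apply: (is_derive_eq (is_deriveM d1 d2)); rewrite /GRing.scale/=; ring.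
Qed.

Lemma bumps_derive1n a c f n : bumps a c f -> bumps a c (derive1n n f).
Proof.
elim: n f => [|n IH] f hf //; rewrite derive1nS.
have [g hg d] := bumps_derive _ _ _ (IH f hf).
suff -> : derive1 (derive1n n f) = g by [].
by apply/funext => x; rewrite derive1E; have e := d x; exact: derive_val.
Qed.

Definition smooth f := forall n x, derivable (derive1n n f) x 1.

Lemma bumps_smooth a c f : bumps a c f -> smooth f.
Proof.
move=> hf n x; have [g _ d] := bumps_derive _ _ _ (bumps_derive1n _ _ _ n hf).
by have e := d x; exact: ex_derive.
Qed.

Lemma smooth_is_derive f n x : smooth f -> is_derive x 1 (derive1n n f) (derive1n n.+1 f x).
Proof. by move=> sf; rewrite derive1nS derive1E; apply: DeriveDef => //; exact: sf. Qed.

Lemma smooth_lin f g k : smooth f -> smooth g ->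
  (forall n, derive1n n (fun x => f x - k * g x) = (fun x => derive1n n f x - k * derive1n n g x))
  /\ smooth (fun x => f x - k * g x).
Proof.
move=> sf sg.
have dl n x : is_derive x 1 (fun x => derive1n n f x - k * derive1n n g x) (derive1n n.+1 f x - k * derive1n n.+1 g x).
  have d1 := smooth_is_derive f n x sf; have d2 := smooth_is_derive g n x sg.
  rewrite (_ : (fun x => _) = derive1n n f - (fun x => k *: derive1n n g x))//.
  exact: is_deriveB.
have e n : derive1n n (fun x => f x - k * g x) = (fun x => derive1n n f x - k * derive1n n g x).
  elim: n => [//|n IH]; rewrite derive1nS IH; apply/funext => x; rewrite derive1E.
  by have h := dl n x; exact: derive_val.
by split=> // n x; rewrite e; have h := dl n x; exact: ex_derive.
Qed.

End BumpFunctions.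

(** * Test functions and du Bois-Reymond's lemma *)

Section TestFunctions.
Context {R : realType} (b : R) (b0 : 0 < b).
Implicit Types (x y a c : R) (f g phi psi D : R -> R).

Let test phi := test_function 0 b phi.

Lemma test_supp phi : test phi -> smooth phi /\ exists a c, [/\ 0 < a, a <= c, c < b &
  forall x, x < a \/ c < x -> phi x = 0].
Proof.
move=> [sp [a [c [a0 cb h]]]]; split=> //.
exists (Num.min a (b / 2)), (Num.max c (b / 2)); split.
- by rewrite lt_min a0 divr_gt0.
- by rewrite ge_min !le_max lexx !orbT.
- by rewrite gt_max cb/= ltr_pdivrMr// ltr_pMr// ltr1n.
- move=> x hx; apply: h; rewrite in_itv/= negb_and -!ltNge.
  by case: hx => [|]; rewrite ?lt_min ?gt_max => /andP[-> _]; rewrite ?orbT.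
Qed.

Lemma test_intro phi a c : smooth phi -> 0 < a -> c < b ->
  (forall x, x < a \/ c < x -> phi x = 0) -> test phi.
Proof.
move=> sp a0 cb h; split=> //; exists a, c; split=> // x.
by rewrite in_itv/= negb_and -!ltNge => /orP[h1|h1]; apply: h; [left|right].
Qed.

Lemma test_derive1n n phi : test phi -> test (derive1n n phi).
Proof.
move=> /test_supp[sp [a [c [a0 ac cb h]]]].
elim: n => [|n IH]; first exact: (test_intro _ a c).
have sp' : smooth (derive1n n.+1 phi).
  move=> m x; have -> : derive1n m (derive1n n.+1 phi) = derive1n (m + n.+1) phi.
    by elim: m => [//|m IHm]; rewrite derive1nS IHm addSn derive1nS.
  exact: sp.
apply: (test_intro _ a c sp' a0 cb).
elim: n {IH sp'} => [|n IH] x hx.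
  have d0 : is_derive x 1 phi 0.
    case: hx => hx.
      apply: (@is_derive_ext _ _ (fun=> 0) _ (a - x)); rewrite ?subr_gt0//.
        by move=> y hy; rewrite h//; left; move: hy; rewrite ltr_norml; lra.
    apply: (@is_derive_ext _ _ (fun=> 0) _ (x - c)); rewrite ?subr_gt0//.
    by move=> y hy; rewrite h//; right; move: hy; rewrite ltr_norml; lra.
  by rewrite derive1nS derive1E; exact: derive_val.
have d0 : is_derive x 1 (derive1n n.+1 phi) 0.
  case: hx => hx.
    apply: (@is_derive_ext _ _ (fun=> 0) _ (a - x)); rewrite ?subr_gt0//.
    by move=> y hy; rewrite IH//; left; move: hy; rewrite ltr_norml; lra.
  apply: (@is_derive_ext _ _ (fun=> 0) _ (x - c)); rewrite ?subr_gt0//.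
  by move=> y hy; rewrite IH//; right; move: hy; rewrite ltr_norml; lra.
by rewrite derive1nS derive1E; exact: derive_val.
Qed.

Lemma test_cont phi x : test phi -> {for x, continuous phi}.
Proof.
move=> [sp _]; apply: differentiable_continuous; apply/derivable1_diffP; exact: (sp 0%N x).
Qed.

Lemma test_within phi a c : test phi -> {within `[a, c], continuous phi}.
Proof. by move=> tp; apply: cont_within => x _; exact: test_cont. Qed.

Lemma test_bm phi a c : test phi -> bm a c phi.
Proof. by move=> tp; apply: within_bm; exact: test_within. Qed.

Lemma bump_test a c : 0 < a -> c < b -> test (fun x => bmp 0 (x - a) * bmp 0 (c - x)).
Proof.
move=> a0 cb; apply: (test_intro _ a c) => //.
  by apply: (@bumps_smooth _ a c); exact: bump_base.
move=> x [hx|hx]; rewrite /bmp.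
  by rewrite ifF ?mul0r//; apply/negbTE; rewrite -leNgt subr_le0 ltW.
by rewrite [X in _ * X]ifF ?mulr0//; apply/negbTE; rewrite -leNgt subr_le0 ltW.
Qed.

Lemma bump_ge0 a c x : 0 <= bmp 0 (x - a) * bmp 0 (c - x).
Proof.
by rewrite /bmp; case: ifP => h1; case: ifP => h2; rewrite ?mul0r ?mulr0// !expr0 !mul1r mulr_ge0// expR_ge0.
Qed.

Lemma bump_gt0 a c x : a < x < c -> 0 < bmp 0 (x - a) * bmp 0 (c - x).
Proof.
by move=> /andP[h1 h2]; rewrite /bmp !subr_gt0 h1 h2 !expr0 !mul1r mulr_gt0// expR_gt0.
Qed.

Lemma test_lin phi psi k : test phi -> test psi -> test (fun x => phi x - k * psi x).
Proof.
move=> /test_supp[s1 [a1 [c1 [a10 ac1 cb1 h1]]]] /test_supp[s2 [a2 [c2 [a20 ac2 cb2 h2]]]].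
apply: (test_intro _ (Num.min a1 a2) (Num.max c1 c2)).
- by have [_] := smooth_lin _ _ k s1 s2.
- by rewrite lt_min a10.
- by rewrite gt_max cb1.
- move=> x hx; rewrite h1 ?h2 ?mulr0 ?subr0//.
    by case: hx; rewrite ?lt_min ?gt_max => /andP[u1 u2]; [left|right].
  by case: hx; rewrite ?lt_min ?gt_max => /andP[u1 u2]; [left|right].
Qed.

(** The primitive from 0 is constant to the right of the support, and this constant is the mean;
    hence it has compact support as well. *)
Lemma test_prim phi : test phi -> itg 0 b phi = 0 -> exists2 chi, test chi & derive1 chi = phi.
Proof.
move=> tp i0; have [sp [a [c [a0 ac cb h]]]] := test_supp _ tp.
pose chi x := itg 0 x phi.
have c0 : 0 <= c by apply: le_trans ac; exact: ltW.
have hl x : x < a -> chi x = 0.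
  move=> xa; rewrite /chi (eq_itg (fun=> 0)) ?itg0// => y /andP[_ yx]; rewrite h//; left.
  exact: lt_trans xa.
have hr x : c < x -> chi x = itg 0 c phi.
  move=> cx; rewrite /chi (itg_split c) ?c0 ?ltW//; last exact: test_bm.
  rewrite [X in _ + X](eq_itg (fun=> 0)) ?itg0 ?addr0// => y /andP[cy _]; rewrite h//; by right.
have i1 : itg 0 c phi = 0 by rewrite -(hr b cb).
have d x : is_derive x 1 chi (phi x).
  have [xa|xa] := ltP x a.
    rewrite h; last by left.
    apply: (@is_derive_ext _ _ (fun=> 0) _ (a - x)); rewrite ?subr_gt0//.
    by move=> y hy; rewrite hl//; move: hy; rewrite ltr_norml; lra.
  apply: (@prim_derive _ 0 (x + 1)); first exact: test_bm.
    by rewrite (lt_le_trans a0 xa)/= ltrDl.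
  exact: test_cont.
have e1 : derive1 chi = phi by apply/funext => x; rewrite derive1E; have := d x => ?; exact: derive_val.
exists chi => //; apply: (test_intro _ a c) => //.
  case=> [|n] x; first by have := d x => ?; exact: ex_derive.
  by rewrite derive1Sn e1; exact: sp.
by move=> x [hx|hx]; [exact: hl|rewrite hr].
Qed.

Lemma ibp F f phi : {within `[0, b], continuous F} -> (forall x, 0 < x < b -> is_derive x 1 F (f x)) ->
  (forall x, 0 < x < b -> {for x, continuous f}) -> bm 0 b f -> test phi ->
  itg 0 b (fun x => F x * derive1 phi x) = - itg 0 b (fun x => f x * phi x).
Proof.
move=> cF dF cf bf tp; have [sp [a [c [a0 ac cb h]]]] := test_supp _ tp.
have tp1 := test_derive1n 1 _ tp.
have k1 := bmM _ _ _ _ bf (test_bm _ 0 b tp).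
have k2 := bmM _ _ _ _ (within_bm _ _ _ cF) (test_bm _ 0 b tp1).
apply/eqP; rewrite -subr_eq0 opprK addrC -(itgD k1 k2); apply/eqP.
have h1 : {within `[0, b], continuous (fun x => F x * phi x)} by apply: within_mul => //; exact: test_within.
have h2 x : 0 < x < b -> is_derive x 1 (fun x => F x * phi x) (f x * phi x + F x * derive1 phi x).
  move=> xb; have d1 := dF x xb; have d2 := smooth_is_derive phi 0 x sp.
  rewrite (_ : (fun x => F x * phi x) = F * phi) //.
  by apply: (is_derive_eq (is_deriveM d1 d2)); rewrite /GRing.scale/=; ring.
have h3 x : 0 < x < b -> {for x, continuous (fun x => f x * phi x + F x * derive1 phi x)}.
  move=> xb; apply: cvgD; apply: cvgM.
  + exact: cf.
  + exact: test_cont tp.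
  + exact: (within_cont x xb cF).
  + exact: test_cont tp1.
rewrite (FTC _ (ltW b0) h1 h2 h3 (bmD _ _ _ _ k1 k2)).
rewrite (h b) ?(h 0) ?mulr0 ?subrr//; [by left|by right].
Qed.

Lemma itg_monom m phi : test phi ->
  itg 0 b (fun x => x ^+ m * derive1n m phi x) = (-1) ^+ m * m`!%:R * itg 0 b phi.
Proof.
elim: m phi => [|m IH] phi tp.
  by rewrite expr0 fact0 !mul1r; apply: eq_itg => x _; rewrite expr0 mul1r.
have cm n x : {for x, continuous (fun y : R => y ^+ n)} by exact: exprn_continuous.
rewrite (eq_itg (fun x => x ^+ m.+1 * derive1 (derive1n m phi) x)); last by move=> x _; rewrite -derive1nS.
have h1 : {within `[0, b], continuous (fun x : R => x ^+ m.+1)} by apply: cont_within => x _; exact: cm.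
have h2 x : 0 < x < b -> is_derive x 1 (fun x : R => x ^+ m.+1) (m.+1%:R * x ^+ m).
  move=> _; rewrite (_ : (fun x : R => x ^+ m.+1) = (fun s => ('X^(m.+1) : {poly R}).[s])).
    apply: (is_derive_eq (is_derive_poly _ _)).
    by rewrite derivXn hornerMn hornerXn -[in LHS]mulr_natl.
  by apply/funext => s; rewrite hornerXn.
have h3 x : 0 < x < b -> {for x, continuous (fun x : R => m.+1%:R * x ^+ m)}.
  by move=> _; apply: cvgM; [exact: cvg_cst|exact: cm].
have h4 : bm 0 b (fun x : R => m.+1%:R * x ^+ m) by apply: bmM; [exact: bm_cst|apply: bmX; exact: bm_id].
rewrite (ibp _ _ _ h1 h2 h3 h4 (test_derive1n m _ tp)).
have bx : bm 0 b (fun x => x ^+ m * derive1n m phi x).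
  by apply: bmM; [apply: bmX; exact: bm_id|exact: (test_bm _ 0 b (test_derive1n m _ tp))].
rewrite (eq_itg (fun x => m.+1%:R * (x ^+ m * derive1n m phi x))); last by move=> x _; rewrite mulrA.
by rewrite (itgZl _ bx) IH// exprS factS natrM; ring.
Qed.

(* du Bois-Reymond *)
Lemma weak_poly m D : (forall x, 0 < x < b -> {for x, continuous D}) -> bm 0 b D ->
  (forall phi, test phi -> itg 0 b (fun x => D x * derive1n m phi x) = 0) ->
  exists2 p : {poly R}, (size p <= m)%N & forall x, 0 < x < b -> D x = p.[x].
Proof.
elim: m D => [|m IH] D cD bD h.
  exists 0; rewrite ?size_poly0// => x xb; rewrite horner0.
  apply/eqP; apply/negPn/negP => Dx.
  have e0 : 0 < `|D x| / 2 by rewrite divr_gt0// normr_gt0.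
  have /cont_epsP/(_ _ e0)[d d0 hd] := cD x xb.
  have /andP[x0 xb'] := xb.
  (* A bump supported within [del] of [x], where [D] keeps the sign of [D x], would have a nonzero
     integral against [D]. *)
  pose del := Num.min d (Num.min x (b - x)) / 2.
  have del0 : 0 < del by rewrite divr_gt0// !lt_min d0 x0 subr_gt0.
  have [l1 l2 l3] : [/\ del < d, del < x & del < b - x].
    have m1 : Num.min d (Num.min x (b - x)) <= d by rewrite ge_min lexx.
    have m2 : Num.min d (Num.min x (b - x)) <= x by rewrite !ge_min lexx orbT.
    have m3 : Num.min d (Num.min x (b - x)) <= b - x by rewrite !ge_min lexx !orbT.
    have := del0; rewrite /del; split; lra.
  pose phi y := bmp 0 (y - (x - del)) * bmp 0 (x + del - y).
  have tp : test phi by apply: bump_test; lra.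
  have := h phi tp; rewrite (eq_itg (fun y => D y * phi y)) // => i0.
  have bp := test_bm _ 0 b tp.
  have pos y : 0 < y < b -> 0 <= D x * (D y * phi y).
    move=> yb; have [yd|yd] := ltP `|x - y| del; last first.
      rewrite /phi /bmp; case: ifPn => u1; case: ifPn => u2; rewrite ?mul0r ?mulr0//.
      exfalso; move: yd; rewrite leNgt => /negP; apply; rewrite ltr_norml.
      move: u1 u2; rewrite !subr_gt0 => u1 u2; apply/andP; split; lra.
    rewrite mulrA mulr_ge0 ?bump_ge0//.
    have := hd y (lt_trans yd l1); rewrite ler_norml => /andP[w1 w2].
    have [Dp|Dn] := ltP 0 (D x).
      by rewrite mulr_ge0 ?(ltW Dp)//; move: w1 w2; rewrite (gtr0_norm Dp); lra.
    have Dn' : D x < 0 by rewrite lt_neqAle Dx.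
    rewrite -mulrNN mulr_ge0 ?oppr_ge0//; move: w1 w2; rewrite (ltr0_norm Dn'); lra.
  have := itg_sqr_eq0 (f := fun y => D x * (D y * phi y)) _ _ pos.
  have cc y : 0 < y < b -> {for y, continuous (fun y => D x * (D y * phi y))}.
    move=> yb; apply: cvgM; first exact: cvg_cst.
    by apply: cvgM; [exact: cD|exact: test_cont].
  have bb := bmM _ _ _ _ bD bp.
  move=> /(_ cc (bmM _ _ _ _ (bm_cst 0 b _) bb)); rewrite itgZl// i0 mulr0 => /(_ erefl x xb)/eqP.
  have pg : 0 < phi x by apply: (bump_gt0 (x - del) (x + del) x); apply/andP; split; lra.
  by apply/negP; apply: mulf_neq0 => //; apply: mulf_neq0 => //; rewrite gt_eqF.
have q4 : 0 < b / 4 by rewrite divr_gt0.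
pose psi0 y := bmp 0 (y - b / 4) * bmp 0 (b / 2 - y).
have tp0 : test psi0 by apply: bump_test; lra.
have i0 : itg 0 b psi0 != 0.
  apply/eqP => i0.
  have := itg_sqr_eq0 (f := psi0) (fun y _ => test_cont _ y tp0) (test_bm _ 0 b tp0) (fun y _ => bump_ge0 _ _ _) i0.
  move=> /(_ (b / 3)) hh; have e0 : psi0 (b / 3) = 0 by apply: hh; apply/andP; split; lra.
  have : 0 < psi0 (b / 3) by apply: (bump_gt0 (b / 4) (b / 2) (b / 3)); apply/andP; split; lra.
  by rewrite e0 ltxx.
pose c0 := itg 0 b (fun x => D x * derive1n m psi0 x) / itg 0 b psi0.
(* By [itg_monom], the monomial [cc * x ^+ m] induces the functional [c0 * itg 0 b phi] on [m]-th
   derivatives of test functions; subtracting it lowers the order by one. *)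
pose cc := c0 * (-1) ^+ m / m`!%:R.
have f0 : m`!%:R != 0 :> R by rewrite pnatr_eq0 -lt0n fact_gt0.
have bDm phi : test phi -> bm 0 b (fun x => D x * derive1n m phi x).
  by move=> tp; exact: (bmM _ _ _ _ bD (test_bm _ 0 b (test_derive1n m _ tp))).
have key phi : test phi -> itg 0 b (fun x => D x * derive1n m phi x) = c0 * itg 0 b phi.
  (* [phi - k * psi0] has mean zero, hence is the derivative of a test function, to which the
     hypothesis of order [m.+1] applies. *)
  move=> tp; pose k := itg 0 b phi / itg 0 b psi0.
  have t1 := test_lin _ _ k tp tp0.
  have z1 : itg 0 b (fun x => phi x - k * psi0 x) = 0.
    have bk := bmM _ _ _ _ (bm_cst 0 b k) (test_bm _ 0 b tp0).
    by rewrite (itgB (test_bm _ 0 b tp) bk) (itgZl k (test_bm _ 0 b tp0)) /k divfK// subrr.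
  have [chi tc ec] := test_prim _ t1 z1.
  have [[s1 _] [s2 _]] := (test_supp _ tp, test_supp _ tp0).
  have [e _] := smooth_lin _ _ k s1 s2.
  have := h chi tc; rewrite (eq_itg (fun x => D x * derive1n m phi x - k * (D x * derive1n m psi0 x))); last first.
    by move=> x _; rewrite derive1Sn ec e; ring.
  rewrite (itgB (bDm _ tp) (bmM _ _ _ _ (bm_cst 0 b k) (bDm _ tp0))) (itgZl k (bDm _ tp0)) => /eqP.
  by rewrite subr_eq0 => /eqP ->; rewrite /c0 /k; field.
have [] := IH (fun x => D x - cc * x ^+ m).
- by move=> x xb; apply: cvgB; [exact: cD|apply: cvgM; [exact: cvg_cst|exact: exprn_continuous]].
- by apply: bmB => //; apply: bmM; [exact: bm_cst|apply: bmX; exact: bm_id].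
- move=> phi tp.
  have bx : bm 0 b (fun x => x ^+ m * derive1n m phi x).
    by apply: bmM; [apply: bmX; exact: bm_id|exact: (test_bm _ 0 b (test_derive1n m _ tp))].
  rewrite (eq_itg (fun x => D x * derive1n m phi x - cc * (x ^+ m * derive1n m phi x))); last by move=> x _; ring.
  rewrite (itgB (bDm _ tp) (bmM _ _ _ _ (bm_cst 0 b cc) bx)) (itgZl cc bx) itg_monom// key// /cc.
  have -> : c0 * (-1) ^+ m / m`!%:R * ((-1) ^+ m * m`!%:R * itg 0 b phi) =
     ((-1) ^+ m * (-1) ^+ m) * (c0 * itg 0 b phi) by field.
  by rewrite -expr2 sqrr_sign mul1r subrr.
- move=> p sp hp; exists (p + cc *: 'X^m).
    rewrite (leq_trans (size_polyD _ _))// geq_max (leq_trans sp)//=.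
    by rewrite (leq_trans (size_scale_leq _ _))// size_polyXn.
  move=> x xb; rewrite hornerD hornerZ hornerXn -(hp x xb); ring.
Qed.

End TestFunctions.

(** * Iterated primitives of integrable functions *)

Section IntegrablePrimitives.
Context {R : realType} (b : R) (b0 : 0 < b).
Implicit Types (x y a c M e : R) (f g v w phi : R -> R).

(** Weak derivatives are merely integrable, so [bm] has to be replaced by this larger class. *)
Definition li a c f := mu.-integrable (`]a, c[%classic : set R) (EFin \o f).

Lemma liS {a c} x y {f} : a <= x -> y <= c -> li a c f -> li x y f.
Proof.
move=> ax yc; apply: integrableS => //; by apply: subset_itv; rewrite bnd_simp.
Qed.

Lemma liB {a c f g} : li a c f -> li a c g -> li a c (fun x => f x - g x).
Proof. by move=> hf hg; apply: (integrableB _ hf hg). Qed.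

Lemma li_norm {a c f} : li a c f -> li a c (fun x => `|f x|).
Proof.
by move=> hf; rewrite /li (_ : EFin \o _ = abse \o (EFin \o f)); [exact: integrable_abse|].
Qed.

Lemma li_bmM {a c f phi} : li a c f -> bm a c phi -> li a c (fun x => f x * phi x).
Proof.
move=> hf [mp [M pM]]; apply: (integrableMl _ hf mp) => //.
exists `|M|; split; first exact: num_real.
move=> z Mz x /= xac; apply: (le_trans (pM x _)); first by move: xac; rewrite in_itv.
by apply: (le_trans (ler_norm _)); exact: ltW.
Qed.

Lemma itg_liB {a c f g} : li a c f -> li a c g -> itg a c (fun x => f x - g x) = itg a c f - itg a c g.
Proof. by move=> hf hg; rewrite !itgE; exact: RintegralB. Qed.

Lemma itg_li_norm {a c f} : li a c f -> `|itg a c f| <= itg a c (fun x => `|f x|).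
Proof. by move=> hf; rewrite !itgE; exact: le_normr_Rintegral. Qed.

Lemma itg_li_le {a c f g} : li a c f -> li a c g -> (forall x, a < x < c -> f x <= g x) ->
  itg a c f <= itg a c g.
Proof. by move=> hf hg fg; rewrite !itgE; exact: (le_Rintegral _ hf hg). Qed.

Lemma itg_li_split {a c f} x : a <= x <= c -> li a c f -> itg a c f = itg a x f + itg x c f.
Proof.
move=> /andP[]; rewrite le_eqVlt => /predU1P[<-|ax] ; first by rewrite (itg_ge a a)// add0r.
rewrite le_eqVlt => /predU1P[->|xc] i; first by rewrite (itg_ge c c)// addr0.
have := @Rintegral_itvB R f (BRight a) (BLeft c) x i.
rewrite /= !bnd_simp => /(_ (ltW ax) xc) h.
rewrite !itgE -h [in X in _ = X + _]Rintegral_itv_bndo_bndc ?subrKC//.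
by apply: liS i => //; exact: ltW.
Qed.

Lemma itg_liZ {a c f} k : li a c f -> itg a c (fun x => k * f x) = k * itg a c f.
Proof. by move=> hf; rewrite !itgE; exact: RintegralZl. Qed.

Lemma itg_li_sub {a c f} x y : a <= x -> x <= y -> y <= c -> li a c f ->
  itg a y f - itg a x f = itg x y f.
Proof.
move=> ax xy yc hf; rewrite (@itg_li_split a y f x) ?ax ?xy//; last exact: (liS a y) hf.
by ring.
Qed.

Lemma itg_li_mono {a c f} x y : a <= x -> x <= y -> y <= c -> li a c f ->
  itg x y (fun z => `|f z|) <= itg a c (fun z => `|f z|).
Proof.
move=> ax xy yc hf; have hn := li_norm hf.
have yac : a <= y <= c by rewrite yc (le_trans ax).
have xay : a <= x <= y by rewrite ax.
rewrite (itg_li_split y yac hn) (itg_li_split x xay (liS a y (lexx a) yc hn)).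
have h1 : 0 <= itg a x (fun z => `|f z|) by apply: itg_ge0.
have h2 : 0 <= itg y c (fun z => `|f z|) by apply: itg_ge0.
move: h1 h2; move: (itg a x _) (itg y c _) (itg x y _) => u1 u2 u3; lra.
Qed.

Lemma li_approx v e : li 0 b v -> 0 < e -> exists g,
  [/\ forall x, {for x, continuous g}, bm 0 b g & itg 0 b (fun x => `|v x - g x|) <= e].
Proof.
move=> hv e0.
have fin : (mu (`]0%R, b[%classic : set R) < +oo)%E.
  by rewrite /= lebesgue_measure_itv/=; case: ifP => _ //; rewrite -EFinB ltry.
have [g_ [cg ig cv]] := approximation_continuous_integrable (measurable_itv _) fin hv.
move/fine_cvgP : cv => [_ /cvgrPdist_le/(_ e e0)[n _ /(_ n (leqnn n))]].
rewrite sub0r normrN /= => h; exists (g_ n); split.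
- by move=> x; exact: cg.
- by apply: within_bm; apply: cont_within => x _; exact: cg.
- apply: le_trans h; apply: le_trans (ler_norm _).
  by rewrite itgE /Rintegral.
Qed.

(** The primitive vanishing at [a], written with integrals from 0 so that it makes sense on both
    sides of [a]. *)
Definition J a w x := itg 0 x w - itg 0 a w.

Lemma J_sub a v x y : li 0 b v -> 0 <= x -> x <= y -> y <= b -> J a v y - J a v x = itg x y v.
Proof.
by move=> hv x0 xy yb; rewrite /J -(itg_li_sub x y x0 xy yb hv); ring.
Qed.

Lemma J_near a v g e x : li 0 b v -> bm 0 b g -> itg 0 b (fun x => `|v x - g x|) <= e ->
  0 <= a <= b -> 0 <= x <= b -> `|J a v x - J a g x| <= 2 * e.
Proof.
move=> hv bg he ab xb; have hg : li 0 b g := bm_integrable bg.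
have key y : 0 <= y <= b -> `|itg 0 y v - itg 0 y g| <= e.
  move=> /andP[y0 yb].
  have hv' : li 0 y v := liS 0 y (lexx 0) yb hv; have hg' : li 0 y g := liS 0 y (lexx 0) yb hg.
  rewrite -(itg_liB hv' hg'); apply: (le_trans (itg_li_norm (liB hv' hg'))).
  by apply: le_trans he; exact: (itg_li_mono 0 y (lexx 0) y0 yb (liB hv hg)).
rewrite /J (_ : _ - _ = (itg 0 x v - itg 0 x g) - (itg 0 a v - itg 0 a g)); last by ring.
apply: (le_trans (ler_normB _ _)); rewrite mulrDl mul1r; apply: lerD; exact: key.
Qed.

Lemma J_bm_within a w : bm 0 b w -> {within `[0, b], continuous (J a w)}.
Proof. by move=> bw; apply: within_sub; [exact: prim_within|exact: within_cst]. Qed.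

Lemma J_within a v : 0 <= a <= b -> li 0 b v -> {within `[0, b], continuous (J a v)}.
Proof.
move=> ab hv; apply/within_epsP => x xb e e0.
have e5 : 0 < e / 5 by rewrite divr_gt0.
have [g [cg bg hg]] := li_approx _ _ hv e5.
have /within_epsP/(_ x xb (e / 5) e5)[d d0 hd] := J_bm_within a g bg.
exists d => // y yb xy; have h1 := J_near a v g _ x hv bg hg ab xb.
have h2 := J_near a v g _ y hv bg hg ab yb; have h3 := hd y yb xy.
move: h1 h2 h3; rewrite !ler_norml => /andP[? ?] /andP[? ?] /andP[? ?].
by apply/andP; split; lra.
Qed.

(** For continuous [g] this is ordinary integration by parts. An L1 approximation of [v] by such a
    [g] changes the primitives uniformly, and the constant [M] adds up the three resulting
    errors. *)
Lemma J_weak a v phi : 0 <= a <= b -> li 0 b v -> test_function 0 b phi ->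
  itg 0 b (fun x => J a v x * derive1 phi x) = - itg 0 b (fun x => v x * phi x).
Proof.
move=> ab hv tp; have tp1 := test_derive1n b b0 1 phi tp.
have bp := test_bm b phi 0 b tp; have bp1 : bm 0 b (derive1 phi) := test_bm b _ 0 b tp1.
have [M1 M10 hM1] := bm_bounded bp; have [M2 M20 hM2] := bm_bounded bp1.
have bJ := within_bm _ _ _ (J_within a v ab hv).
apply/eqP; rewrite -subr_eq0 opprK -normr_le0; apply/ler_addgt0Pr => e e0; rewrite add0r.
pose M := 2 * M2 * b + M1 + 1.
have M0 : 0 < M by rewrite /M ltr_wpDl// addr_ge0// !mulr_ge0// ltW.
have e' : 0 < e / M by rewrite divr_gt0.
have [g [cg bg hg]] := li_approx _ _ hv e'.
have hgl : li 0 b g := bm_integrable bg.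
have ig : itg 0 b (fun x => J a g x * derive1 phi x) = - itg 0 b (fun x => g x * phi x).
  apply: (ibp b b0 _ _ _ (J_bm_within a g bg)) => //.
  move=> x xb; have d1 := prim_derive x bg xb (cg x).
  apply: is_derive_eq; ring.
have bJg := within_bm _ _ _ (J_bm_within a g bg).
have -> : itg 0 b (fun x => J a v x * derive1 phi x) + itg 0 b (fun x => v x * phi x) =
  itg 0 b (fun x => (J a v x - J a g x) * derive1 phi x) + itg 0 b (fun x => (v x - g x) * phi x).
  have -> : itg 0 b (fun x => (J a v x - J a g x) * derive1 phi x) =
      itg 0 b (fun x => J a v x * derive1 phi x) - itg 0 b (fun x => J a g x * derive1 phi x).
    rewrite -(itgB (bmM _ _ _ _ bJ bp1) (bmM _ _ _ _ bJg bp1)); apply: eq_itg => x _; ring.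
  have -> : itg 0 b (fun x => (v x - g x) * phi x) =
      itg 0 b (fun x => v x * phi x) - itg 0 b (fun x => g x * phi x).
    rewrite -(itg_liB (li_bmM hv bp) (li_bmM hgl bp)); apply: eq_itg => x _; ring.
  by rewrite ig; ring.
apply: (le_trans (ler_normD _ _)).
have -> : e = 2 * (e / M) * M2 * b + M1 * (e / M) + e / M by rewrite /M; field; rewrite -/M gt_eqF.
rewrite -addrA; apply: lerD.
  have -> : 2 * (e / M) * M2 * b = 2 * (e / M) * M2 * (b - 0) by rewrite subr0.
  apply: (itg_bound _ (ltW b0) (bmM _ _ _ _ (bmB _ _ _ _ bJ bJg) bp1)) => x xb.
  rewrite normrM; apply: ler_pM => //; last exact: hM2.
  apply: (J_near a v g _ x hv bg hg ab); by case/andP: xb => x0 x1; rewrite !ltW.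
apply: (@le_trans _ _ (M1 * (e / M))); last by rewrite lerDl ltW.
have hvg := liB hv hgl.
apply: (le_trans (itg_li_norm (li_bmM hvg bp))).
apply: (@le_trans _ _ (itg 0 b (fun x => M1 * `|v x - g x|))).
  apply: itg_li_le; first exact: (li_norm (li_bmM hvg bp)).
    have bM1 := bm_cst 0 b M1; have := li_bmM (li_norm hvg) bM1.
    by rewrite /li (_ : EFin \o (fun x => M1 * _) = EFin \o (fun x => `|v x - g x| * M1))//; apply/funext => x /=; rewrite mulrC.
  by move=> x xb; rewrite normrM mulrC ler_wpM2r// hM1.
by rewrite (itg_liZ _ (li_norm hvg)) ler_wpM2l.
Qed.

Definition Jn a v n := iter n (J a) v.

Lemma Jn_within a v n : 0 <= a <= b -> li 0 b v -> {within `[0, b], continuous (Jn a v n.+1)}.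
Proof.
move=> ab hv; elim: n => [|n IH]; first exact: J_within.
by apply: J_bm_within; exact: within_bm.
Qed.

Lemma Jn_derive a v n x : 0 <= a <= b -> li 0 b v -> 0 < x < b ->
  is_derive x 1 (Jn a v n.+2) (Jn a v n.+1 x).
Proof.
move=> ab hv xb; have h := Jn_within a v n ab hv.
have d1 := prim_derive x (within_bm _ _ _ h) xb (within_cont x xb h).
have -> : Jn a v n.+2 = (fun y => itg 0 y (Jn a v n.+1) - itg 0 a (Jn a v n.+1)) by [].
by apply: is_derive_eq; ring.
Qed.

Lemma Jn_weak a v n phi : 0 <= a <= b -> li 0 b v -> test_function 0 b phi ->
  itg 0 b (fun x => Jn a v n.+1 x * derive1n n.+1 phi x) = (-1) ^+ n.+1 * itg 0 b (fun x => v x * phi x).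
Proof.
move=> ab hv tp; elim: n => [|n IH]; first by rewrite expr1 mulN1r -(J_weak a v phi ab hv tp).
rewrite exprS -mulrA -IH mulN1r.
rewrite (eq_itg (fun x => Jn a v n.+2 x * derive1 (derive1n n.+1 phi) x)); last by move=> x _; rewrite -derive1nS.
apply: (ibp b b0); last exact: test_derive1n.
- exact: Jn_within.
- by move=> x xb; exact: Jn_derive.
- by move=> x xb; apply: (within_cont x xb); exact: Jn_within.
- by apply: within_bm; exact: Jn_within.
Qed.

(** The first primitive is bounded by the L1 norm of [v] on []a, c[]; each further one gains a
    factor [c - a]. *)
Lemma Jn_bound a c v n x : 0 <= a -> a <= c -> c <= b -> li 0 b v -> a <= x <= c ->
  `|Jn a v n.+1 x| <= (c - a) ^+ n * itg a c (fun z => `|v z|).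
Proof.
move=> a0 ac cb hv /andP[ax xc].
have I0 : 0 <= itg a c (fun z => `|v z|) by apply: itg_ge0.
have ab : 0 <= a <= b by rewrite a0 (le_trans ac).
have J0 w : J a w a = 0 by rewrite /J subrr.
elim: n x ax xc => [|n IH] x ax xc.
  rewrite expr0 mul1r; have := J_sub a v a x hv a0 ax (le_trans xc cb); rewrite J0 subr0 => e1; rewrite [Jn _ _ _ _]e1.
  have hax : li a x v by apply: liS hv => //; exact: le_trans cb.
  apply: (le_trans (itg_li_norm hax)).
  by apply: (itg_li_mono a x) => //; exact: (liS a c) hv.
have bJ : bm 0 b (Jn a v n.+1) := within_bm _ _ _ (Jn_within a v n ab hv).
have := J_sub a (Jn a v n.+1) a x (bm_integrable bJ) a0 ax (le_trans xc cb); rewrite J0 subr0 => e1.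
rewrite [Jn _ _ _ _]e1.
apply: (@le_trans _ _ ((c - a) ^+ n * itg a c (fun z => `|v z|) * (x - a))).
  apply: (itg_bound _ ax); first by apply: bmS bJ => //; exact: le_trans cb.
  by move=> y /andP[ay yx]; apply: IH; [exact: ltW|rewrite ltW// (lt_le_trans yx)].
rewrite exprSr mulrAC ler_wpM2r// ler_wpM2l ?exprn_ge0 ?subr_ge0//.
by rewrite lerB.
Qed.

Lemma Jn_lip a c v n x y : 0 <= a -> a <= c -> c <= b -> li 0 b v -> a <= x -> x <= y -> y <= c ->
  `|Jn a v n.+2 y - Jn a v n.+2 x| <= (c - a) ^+ n * itg a c (fun z => `|v z|) * (y - x).
Proof.
move=> a0 ac cb hv ax xy yc; have ab : 0 <= a <= b by rewrite a0 (le_trans ac).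
have bJ : bm 0 b (Jn a v n.+1) := within_bm _ _ _ (Jn_within a v n ab hv).
have x0 : 0 <= x by exact: le_trans ax.
rewrite [_ - _](J_sub a (Jn a v n.+1) x y (bm_integrable bJ) x0 xy (le_trans yc cb)).
apply: (itg_bound _ xy); first by apply: bmS bJ => //; exact: le_trans cb.
move=> z /andP[xz zy]; apply: Jn_bound => //.
by rewrite (le_trans ax (ltW xz)) (le_trans (ltW zy) yc).
Qed.

(* Taylor's formula with integral remainder, for a weak derivative *)
Lemma weak_taylor f v n a : (forall x, 0 < x < b -> {for x, continuous f}) -> bm 0 b f -> li 0 b v ->
  (forall phi, test_function 0 b phi ->
     itg 0 b (fun x => f x * derive1n n.+1 phi x) = (-1) ^+ n.+1 * itg 0 b (fun x => v x * phi x)) ->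
  0 <= a <= b ->
  exists2 p : {poly R}, (size p <= n.+1)%N & forall x, 0 < x < b -> f x = p.[x] + Jn a v n.+1 x.
Proof.
move=> cf bf hv hw ab; have cJ := Jn_within a v n ab hv; have bJ := within_bm _ _ _ cJ.
have [] := weak_poly b b0 n.+1 (fun x => f x - Jn a v n.+1 x).
- by move=> x xb; apply: cvgB; [exact: cf|exact: (within_cont x xb cJ)].
- exact: bmB.
- move=> phi tp; have bp := test_bm b _ 0 b (test_derive1n b b0 n.+1 _ tp).
  rewrite (eq_itg (fun x => f x * derive1n n.+1 phi x - Jn a v n.+1 x * derive1n n.+1 phi x)); last by move=> x _; ring.
  by rewrite (itgB (bmM _ _ _ _ bf bp) (bmM _ _ _ _ bJ bp)) hw// Jn_weak// subrr.
- by move=> p sp hp; exists p => // x xb; rewrite -(hp x xb) subrK.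
Qed.

End IntegrablePrimitives.

Section AlmostEverywhere.
Context {R : realType}.
Implicit Types P Q : R -> Prop.

Lemma aeS P Q : (forall x, P x -> Q x) -> {ae mu, forall x, P x} -> {ae mu, forall x, Q x}.
Proof.
by move=> PQ; apply: filterS PQ; exact: (ae_filter_ringOfSetsType mu).
Qed.

Lemma aeI P Q : {ae mu, forall x, P x} -> {ae mu, forall x, Q x} -> {ae mu, forall x, P x /\ Q x}.
Proof.
by move=> hP hQ; apply: filterI hP hQ; exact: (ae_filter_ringOfSetsType mu).
Qed.

End AlmostEverywhere.

(** * From Sobolev norms to finite difference bounds *)

Section WeakDerivatives.
Context {R : realType} (b : R) (b0 : 0 < b).
Implicit Types (x y a c M : R) (f g v phi : R -> R).

Definition wk j f v := forall phi, test_function 0 b phi ->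
  itg 0 b (fun x => f x * derive1n j phi x) = (-1) ^+ j * itg 0 b (fun x => v x * phi x).

Lemma muT_gt0 : (0 < (mu : set R -> \bar R) setT)%E.
Proof.
apply: (@lt_le_trans _ _ (mu (`]0%R, 1%R[%classic : set R))).
  by rewrite lebesgue_measure_itv/= lte01 sube0 lte_fin ltr01.
by apply: le_measure; rewrite ?inE//; exact: measurable_itv.
Qed.

Lemma bochner_ae (T : R) (X : set (R -> R)) (nX : (R -> R) -> \bar R) (F : R -> R -> R) :
  in_Linfty_bochner T X nX F -> exists2 M : R, 0 <= M &
  {ae mu, forall t, t \in `]0, T[ -> X (F t) /\ (nX (F t) <= M%:E)%E}.
Proof.
move=> [h1 _ h2]; set G := (fun t => nX (F t)) \_ `]0, T[.
have [M M0 GM] : exists2 M : R, 0 <= M & (ess_sup mu G <= M%:E)%E.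
  move: h2; rewrite -/G; case: (ess_sup mu G) => [r _|//|_].
    by exists (Num.max r 0); rewrite ?le_max ?lexx ?orbT// lee_fin le_max lexx.
  by exists 0 => //; rewrite leNye.
exists M => //; have h3 := ess_sup_ge mu G.
apply: aeS (aeI _ _ h1 h3) => t [{}h1 {}h3] tT; split; first exact: h1.
by apply: le_trans GM; apply: le_trans h3; rewrite /G patchE mem_setE tT.
Qed.

Lemma sobolev_wd m p f M : sobolev 0 b m p f -> (sobolev_norm 0 b m p f <= M%:E)%E ->
  forall j, (j <= m)%N -> exists v,
  [/\ is_weak_derivative 0 b j f v & (Lp_norm 0 b p v <= M%:E)%E].
Proof.
move=> sf nf j jm; exists (weak_derivative 0 b j f).
have [v hv _] := sf j jm; split.
  exact: (@getPex _ [set v | is_weak_derivative 0 b j f v] (ex_intro _ v hv)).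
apply: le_trans nf; rewrite /sobolev_norm.
have jm' : (j < m.+1)%N by [].
rewrite (bigD1 (Ordinal jm'))//= leeDl// sume_ge0// => i _; exact: Lnorm_ge0.
Qed.

Lemma wd_wk j f v : is_weak_derivative 0 b j f v ->
  measurable_fun (`]0, b[%classic : set R) v /\ wk j f v.
Proof.
move=> [_ [mv _ _] h]; split => // phi tp.
by rewrite !itgE; exact: h.
Qed.

(** The essential bound is kept only through the integrals of [|v|] over subintervals, which no null
    set can disturb. *)
Lemma Linfty_li v M : 0 <= M -> measurable_fun (`]0, b[%classic : set R) v -> (Lp_norm 0 b +oo v <= M%:E)%E ->
  li 0 b v /\ forall x y, 0 <= x -> x <= y -> y <= b -> itg x y (fun z => `|v z|) <= M * (y - x).
Proof.
move=> M0 mv; rewrite /Lp_norm unlock muT_gt0 => /ess_supP vM.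
have key x y : 0 <= x -> x <= y -> y <= b ->
    (\int[mu]_(z in `]x, y[) `|(v z)%:E| <= (M * (y - x))%:E)%E.
  move=> x0 xy yb.
  have sub : `]x, y[ `<=` `]0, b[ by apply: subset_itv; rewrite bnd_simp.
  apply: (@le_trans _ _ (\int[mu]_(z in `]x, y[) (cst M%:E z))%E).
    apply: ae_ge0_le_integral => //.
    - by apply: measurableT_comp => //; apply/measurable_EFinP; apply: measurable_funS mv.
    - apply: aeS vM => z /= vz zxy; move: vz; rewrite patchE mem_setE.
      by have -> : z \in `]0, b[ by exact: sub.
  rewrite integral_cst//= lebesgue_measure_itv/= lte_fin; case: ltP => yx.
    by rewrite -EFinB -EFinM.
  by rewrite mule0 lee_fin mulr_ge0// subr_ge0.
have l : li 0 b v.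
  apply/integrableP; split; first exact/measurable_EFinP.
  by apply: (le_lt_trans (key 0 b (lexx _) (ltW b0) (lexx _))); rewrite ltry.
split=> // x y x0 xy yb; rewrite itgE /Rintegral -lee_fin fineK; first exact: key.
have hl : li x y v := liS x y x0 yb l.
by apply: integrable_fin_num => //; exact: li_norm hl.
Qed.

Lemma L2_li v M : 0 <= M -> measurable_fun (`]0, b[%classic : set R) v -> (Lp_norm 0 b 2%:E v <= M%:E)%E ->
  [/\ li 0 b v, li 0 b (fun x => v x ^+ 2) & itg 0 b (fun x => v x ^+ 2) <= M ^+ 2].
Proof.
move=> M0 mv; rewrite /Lp_norm => vM.
have i2 : (\int[mu]_(x in `]0%R, b[) (v x ^+ 2)%:E <= (M ^+ 2)%:E)%E.
  have -> : (\int[mu]_(x in `]0%R, b[) (v x ^+ 2)%:E = 'N[mu]_2%:E[EFin \o (v \_ `]0%R, b[)] `^ 2)%E.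
    rewrite poweR_Lnorm ?pnatr_eq0// [LHS]integral_mkcond; apply: eq_integral => x _.
    rewrite !patchE/=; case: ifPn => xb.
      by rewrite /= patchE xb powR_mulrn// real_normK// num_real.
    by rewrite /= patchE (negbTE xb) normr0 powR0// pnatr_eq0.
  apply: (@le_trans _ _ (M%:E `^ 2)%E).
    by apply: gt0_ler_poweR; rewrite ?in_itv/= ?Lnorm_ge0 ?leey ?lee_fin ?M0.
  by rewrite poweR_EFin powR_mulrn.
have m2 : measurable_fun (`]0, b[%classic : set R) (fun x => v x ^+ 2) by exact: measurable_funX.
have l2 : li 0 b (fun x => v x ^+ 2).
  apply/integrableP; split; first exact/measurable_EFinP.
  apply: (@le_lt_trans _ _ (M ^+ 2)%:E); last by rewrite ltry.
  apply: le_trans i2; apply: eq_ler; apply: eq_integral => x _.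
  by rewrite /= ger0_norm// sqr_ge0.
split=> //.
- have l1 : li 0 b (fun x => 1 + v x ^+ 2).
    by apply: (integrableD _ (bm_integrable (bm_cst 0 b (1 : R))) l2).
  apply: le_integrable l1 => //; first exact/measurable_EFinP.
  move=> x _ /=; rewrite lee_fin [X in _ <= X]ger0_norm ?addr_ge0 ?sqr_ge0//.
  rewrite -[v x ^+ 2]real_normK ?num_real//; have := sqr_ge0 (`|v x| - 1); have := normr_ge0 (v x); move: (`|v x|) => y; nra.
- rewrite itgE /Rintegral -lee_fin fineK//.
  by apply: integrable_fin_num => //; exact: l2.
Qed.

(** Cauchy--Schwarz for unbounded [v], through the nonnegative integral of [(|v| - m)^2] where [m]
    is the mean of [|v|]. *)
Lemma L2_L1 v x y : 0 <= x -> x <= y -> y <= b -> li 0 b v -> li 0 b (fun x => v x ^+ 2) ->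
  itg x y (fun z => `|v z|) ^+ 2 <= (y - x) * itg x y (fun z => v z ^+ 2).
Proof.
move=> x0; rewrite le_eqVlt => /orP[/eqP <-|xy] yb l1 l2.
  by rewrite !itg_ge// expr0n mulr0.
have h1 := li_norm (liS x y x0 yb l1); have h2 := liS x y x0 yb l2.
have d0 : 0 < y - x by rewrite subr_gt0.
set I := itg x y _; set S := itg x y _; pose m := I / (y - x).
have := @itg_ge0 _ x y (fun z => (`|v z| - m) ^+ 2) (fun z _ => sqr_ge0 _).
have bc : li x y (fun=> m ^+ 2) := bm_integrable (bm_cst x y (m ^+ 2)).
have bz : li x y (fun z => `|v z| * (2 * m)) := li_bmM h1 (bm_cst x y (2 * m)).
rewrite (eq_itg (fun z => v z ^+ 2 - (`|v z| * (2 * m) - m ^+ 2))); last first.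
  by move=> z _; rewrite -[v z ^+ 2]real_normK ?num_real//; ring.
rewrite (itg_liB h2 (liB bz bc)) (itg_liB bz bc) (itg_cst _ (ltW xy)).
have -> : itg x y (fun z => `|v z| * (2 * m)) = 2 * m * I.
  by rewrite -(itg_liZ _ h1); apply: eq_itg => z _; rewrite mulrC.
rewrite -/S => h.
have e : S - (2 * m * I - m ^+ 2 * (y - x)) = S - I ^+ 2 / (y - x) by rewrite /m; field; rewrite gt_eqF.
by move: h; rewrite e subr_ge0 ler_pdivrMr// mulrC.
Qed.

Lemma closure_eq f g : {within `[0, b], continuous f} -> {within `[0, b], continuous g} ->
  (forall x, 0 < x < b -> f x = g x) -> forall x, 0 <= x <= b -> f x = g x.
Proof.
move=> cf cg fg x xb; apply/eqP; rewrite -subr_eq0 -normr_le0; apply/ler_addgt0Pr => e e0; rewrite add0r.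
have /within_epsP/(_ x xb e e0)[d d0 hd] := within_sub _ _ _ _ cf cg.
have [y yb xy] : exists2 y, 0 < y < b & `|x - y| < d.
  pose e1 := Num.min (d / 2) (b / 4).
  have e10 : 0 < e1 by rewrite lt_min !divr_gt0.
  have [e11 e12] : e1 <= d / 2 /\ e1 <= b / 4 by rewrite /e1 !ge_min !lexx orbT.
  case/andP: xb => x0 x1; have [xs|xs] := leP x (b / 2).
    exists (x + e1); first by apply/andP; split; lra.
    by rewrite ltr_norml; apply/andP; split; lra.
  exists (x - e1); first by apply/andP; split; lra.
  by rewrite ltr_norml; apply/andP; split; lra.
have := hd y _ xy; rewrite (fg y yb) subrr subr0; apply.
by case/andP: yb => ? ?; rewrite !ltW.
Qed.

Definition wbound (n : nat) f M := exists v, [/\ wk n f v, li 0 b v &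
  forall x y, 0 <= x -> x <= y -> y <= b -> itg x y (fun z => `|v z|) <= M * (y - x)].

Let z0 : 0 <= (0 : R) <= b. Proof. by rewrite lexx ltW. Qed.

Lemma wtaylor f v n a : {within `[0, b], continuous f} -> wk n.+1 f v -> li 0 b v -> 0 <= a <= b ->
  exists2 p : {poly R}, (size p <= n.+1)%N & forall x, 0 <= x <= b -> f x = p.[x] + Jn a v n.+1 x.
Proof.
move=> cf hw lv ab.
have [] := weak_taylor b b0 f v n a _ (within_bm _ _ _ cf) lv hw ab.
  by move=> x xb; exact: (within_cont x xb cf).
move=> p sp hp; exists p => //; apply: closure_eq hp => //.
by apply: within_add; [exact: within_poly|exact: Jn_within].
Qed.

Lemma wbound_lip f M : {within `[0, b], continuous f} -> wbound 1 f M ->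
  forall x y, 0 <= x <= b -> 0 <= y <= b -> `|f x - f y| <= M * `|x - y|.
Proof.
move=> cf [v [hw lv vM]] x y; have [p sp hp] := wtaylor f v 0 0 cf hw lv z0.
have [c pc] : exists c, p = c%:P by exists p`_0; apply: size1_polyC.
wlog xy : x y / x <= y => [h xb yb|].
  have [/h|/ltW/h] := leP x y; first exact.
  by rewrite distrC (distrC x) => h'; exact: h'.
move=> xb yb; rewrite !hp// pc !hornerC (_ : _ - _ = - (Jn 0 v 1 y - Jn 0 v 1 x)); last by ring.
case/andP: xb yb => x0 xb /andP[y0 yb].
rewrite normrN [_ - _](J_sub b 0 v x y lv x0 xy yb) (distrC x) (ger0_norm (_ : 0 <= y - x)) ?subr_ge0//.
by apply: (le_trans (itg_li_norm (liS x y x0 yb lv))); exact: vM.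
Qed.

(** The function [F s = f (s + h) - f s] has derivative [J1 (s + h) - J1 s], bounded by [M * h]. A
    bound on finite differences, unlike one on second derivatives, passes to pointwise limits in
    time. *)
Lemma wbound_lip2 f M : {within `[0, b], continuous f} -> wbound 2 f M ->
  forall x y h, 0 < h -> 0 <= x -> x <= y -> y + h <= b ->
  `|(f (y + h) - f y) - (f (x + h) - f x)| <= M * (y - x) * h.
Proof.
move=> cf [v [hw lv vM]] x y h h0 x0 xy yh.
have [p sp hp] := wtaylor f v 1 0 cf hw lv z0.
have pq : (size p^`() <= 1)%N.
  have [->|p0] := eqVneq p 0; first by rewrite deriv0 size_poly0.
  exact: (leq_trans (lt_size_deriv p0) sp).
have [c pc] : exists c, p^`() = c%:P by exists p^`()`_0; apply: size1_polyC.
have M0 : 0 <= M.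
  have := vM 0 b (lexx _) (ltW b0) (lexx _); rewrite subr0 => h1.
  have : 0 <= M * b by apply: le_trans h1; exact: itg_ge0.
  by rewrite pmulr_lge0.
move: xy; rewrite le_eqVlt => /orP[/eqP ->|xy]; first by rewrite !subrr normr0 mulr0 mul0r.
pose F s := f (s + h) - f s; pose J1 := Jn 0 v 1.
have dF s : x < s < y -> is_derive s 1 F (J1 (s + h) - J1 s).
  move=> /andP[xs sy].
  have sb : 0 < s < b by apply/andP; split; lra.
  have shb : 0 < s + h < b by apply/andP; split; lra.
  have df z : 0 < z < b -> is_derive z 1 f (c + J1 z).
    move=> zb; pose del := Num.min z (b - z).
    have del0 : 0 < del by rewrite lt_min; case/andP: zb => ? ?; apply/andP; split; lra.
    apply: (@is_derive_ext _ _ (fun s => p.[s] + Jn 0 v 2 s) _ del) => //.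
      move=> s' ss; rewrite hp//; move: ss; rewrite /del lt_min !ltr_norml => /andP[/andP[? ?] /andP[? ?]].
      by apply/andP; split; lra.
    have d1 := is_derive_poly p z; have d2 := Jn_derive b 0 v 0 z z0 lv zb.
    rewrite (_ : (fun s => p.[s] + Jn 0 v 2 s) = (fun s => p.[s]) + Jn 0 v 2) //.
    by apply: is_derive_eq; rewrite pc hornerC.
  have d1 := df s sb.
  have e1 : is_derive s 1 (fun z : R => z + h) 1 by apply: is_derive_eq; ring.
  have d2 := is_derive1_comp (f := f) (g := fun z : R => z + h) (x := s) (df (s + h) shb) e1.
  rewrite (_ : F = (f \o (fun z : R => z + h)) - f) //.
  by apply: (is_derive_eq (is_deriveB d2 d1)); ring.
have cF : {within `[x, y], continuous F}.
  apply/within_epsP => s sxy e e0; have e2 : 0 < e / 2 by rewrite divr_gt0.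
  have sb : 0 <= s <= b by case/andP: sxy => ? ?; apply/andP; split; lra.
  have shb : 0 <= s + h <= b by case/andP: sxy => ? ?; apply/andP; split; lra.
  have /within_epsP cf' := cf.
  have [d1 d10 hd1] := cf' _ sb _ e2; have [d2 d20 hd2] := cf' _ shb _ e2.
  exists (Num.min d1 d2); first by rewrite lt_min d10.
  move=> z zxy; rewrite lt_min => /andP[z1 z2].
  have zb : 0 <= z <= b by case/andP: zxy => ? ?; apply/andP; split; lra.
  have zhb : 0 <= z + h <= b by case/andP: zxy => ? ?; apply/andP; split; lra.
  have u1 := hd1 z zb z1; have u2 : `|f (s + h) - f (z + h)| <= e / 2.
    by apply: hd2 => //; rewrite (_ : s + h - (z + h) = s - z)//; ring.
  rewrite /F (_ : _ - _ = (f (s + h) - f (z + h)) - (f s - f z)); last by ring.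
  by rewrite [e]splitr; apply: (le_trans (ler_normB _ _)); exact: lerD.
have [s sxy ->] := MVT_oo _ xy cF dF.
have yx : 0 < y - x by rewrite subr_gt0.
rewrite normrM (gtr0_norm yx) mulrAC ler_wpM2r ?(ltW yx)//.
have s0 : 0 <= s by case/andP: sxy => ? ?; lra.
have ssh : s <= s + h by rewrite lerDl ltW.
have shb : s + h <= b by case/andP: sxy => ? ?; lra.
rewrite [_ - _](J_sub b 0 v s (s + h) lv s0 ssh shb).
apply: (le_trans (itg_li_norm (liS s (s + h) s0 shb lv))).
by apply: (le_trans (vM s (s + h) s0 ssh shb)); rewrite addrAC subrr add0r.
Qed.

End WeakDerivatives.

(** * Regularity of the exact solution *)

Section Identification.
Context {R : realType} (b : R) (b0 : 0 < b) (f w g z : R -> R).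
Hypotheses (cf : {within `[0, b], continuous f}) (gf : good b f).
Hypotheses (cw : {within `[0, b], continuous w}) (cg : {within `[0, b], continuous g})
  (cz : {within `[0, b], continuous z}).
Hypotheses (dw : forall x, 0 < x < b -> is_derive x 1 w (f x))
  (dg : forall x, 0 < x < b -> is_derive x 1 g (x^-1 * g x * (f x - w x / x) ^+ 2))
  (dz : forall x, 0 < x < b -> is_derive x 1 z (g x)).
Hypotheses (w0 : w 0 = 0) (z0 : z 0 = 0) (gb : g b = 1).
Implicit Types x y : R.

Let fc x : 0 < x < b -> {for x, continuous f}. Proof. by move=> xb; exact: (within_cont x xb cf). Qed.

Lemma prim_unique F h x : {within `[0, b], continuous F} -> (forall y, 0 < y < b -> is_derive y 1 F (h y)) ->
  F 0 = 0 -> bm 0 b h -> (forall y, 0 < y < b -> {for y, continuous h}) -> 0 <= x <= b -> F x = itg 0 x h.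
Proof.
move=> cF dF F0 bh ch /andP[x0 xb].
pose D y := F y - itg 0 y h.
have cD : {within `[0, x], continuous D}.
  by apply: (withinS 0 x (lexx _) xb); apply: within_sub => //; exact: prim_within.
have dD y : 0 < y < x -> is_derive y 1 D 0.
  move=> /andP[y0 yx]; have yb : 0 < y < b by rewrite y0 (lt_le_trans yx).
  have d1 := dF y yb; have d2 := prim_derive y bh yb (ch y yb).
  have -> : D = F - (fun y => itg 0 y h) by [].
  by apply: (is_derive_eq (is_deriveB d1 d2)); rewrite subrr.
have := derive0_eq x0 cD dD; rewrite /D F0 (itg_ge 0 0)// subr0 => /eqP.
by rewrite subr_eq0 => /eqP.
Qed.

Lemma w_itg x : 0 <= x <= b -> w x = itg 0 x f.
Proof. by move=> xb; apply: prim_unique => //; exact: within_bm. Qed.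

(** The linear equation for [g] is integrated with the factor [expR (E y)], whose product with [g]
    is constant and equal to 1 at [b]. The equality holds for positive [x] and extends to the centre
    by continuity. *)
Lemma g_gg x : 0 <= x <= b -> g x = gg b f x.
Proof.
apply: (closure_eq b b0 _ _ cg (gg_within b f gf)) => {}x /andP[x0 xb].
pose q y := y^-1 * (Xf f y) ^+ 2.
have bq : bm 0 b q by exact: bm_Af.
have fb : bm 0 b f by exact: within_bm.
have cq y : 0 < y < b -> {for y, continuous q}.
  move=> yb; have /andP[y0 _] := yb.
  apply: cvgM; first by apply: cvgV; [rewrite gt_eqF|exact: cont_id].
  have cX : {for y, continuous (Xf f)} by apply: cvgB; [exact: (fc y yb)|exact: (cont_av b y fb yb)].
  rewrite /= (_ : (fun y => Xf f y ^+ 2) = (fun y => Xf f y * Xf f y)).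
    by apply: cvgM; exact: cX.
  by apply/funext => s; rewrite expr2.
pose E y := itg 0 b q - itg 0 y q.
have EA y : 0 <= y <= b -> Af b f y = E y.
  by move=> yb; rewrite /E (itg_split y yb bq) /Af /q; ring.
pose h y := g y * expR (E y).
have dE y : 0 < y < b -> is_derive y 1 E (- q y).
  move=> yb; have d1 := prim_derive y bq yb (cq y yb).
  have -> : E = (fun _ => itg 0 b q) - (fun y => itg 0 y q) by [].
  by apply: is_derive_eq; rewrite sub0r.
have dh y : 0 < y < b -> is_derive y 1 h 0.
  move=> yb; have /andP[y0 yb'] := yb; have d1 := dg y yb.
  have d2 := is_derive1_comp (f := @expR R) (g := E) (x := y) (is_derive_expR _) (dE y yb).
  have -> : h = g * (@expR R \o E) by [].
  have eX : f y - w y / y = Xf f y by rewrite XfE /av w_itg// !ltW.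
  apply: (is_derive_eq (is_deriveM d1 d2)); rewrite /GRing.scale/= eX /q; ring.
have cE : {within `[0, b], continuous E} by apply: within_sub; [exact: within_cst|exact: prim_within].
have ch : {within `[x, b], continuous h}.
  apply: (withinS x b (ltW x0) (lexx b)); apply: within_mul => //.
  apply/within_epsP => y yb e e0.
  have /cont_epsP/(_ e e0)[d d0 hd] : {for E y, continuous (@expR R)} by exact: continuous_expR.
  have /within_epsP/(_ y yb (d / 2)) := cE; case; first by rewrite divr_gt0.
  move=> d' d'0 hd'; exists d' => // s sb ys; apply: hd.
  by apply: (le_lt_trans (hd' s sb ys)); rewrite ltr_pdivrMr// ltr_pMr// ltr1n.
have dh' y : x < y < b -> is_derive y 1 h 0.
  by move=> /andP[xy yb]; apply: dh; rewrite (lt_trans x0 xy).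
have := derive0_eq (ltW xb) ch dh'; rewrite /h gb /E subrr expR0 mulr1 => h1.
rewrite /gg EA; last by rewrite !ltW.
rewrite expRN; apply: (mulIf (lt0r_neq0 (expR_gt0 (E x)))).
by rewrite mulVf// lt0r_neq0// expR_gt0.
Qed.

Lemma z_itg x : 0 <= x <= b -> z x = itg 0 x (gg b f).
Proof.
move=> xb; have bg : bm 0 b (gg b f) := bm_gg b f gf.
have e y : 0 <= y <= b -> itg 0 y g = itg 0 y (gg b f).
  by move=> /andP[y0 yb]; apply: eq_itg => s /andP[s0 sy]; apply: g_gg; rewrite (ltW s0) ltW// (lt_le_trans sy).
rewrite -e//; apply: prim_unique => //; first exact: within_bm.
by move=> y yb; exact: (within_cont y yb cg).
Qed.

End Identification.

(** * Uniformity in space of limits in time *)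

Section Equicontinuity.
Context {R : realType}.
Implicit Types (x y e d h : R) (f : R -> R).

Lemma is_derive_eps f x D : is_derive x 1 f D -> forall e, 0 < e ->
  exists2 d, 0 < d & forall h, 0 < `|h| -> `|h| < d -> `|f (x + h) - f x - D * h| <= e * `|h|.
Proof.
move=> [df fD] e e0; have := df; rewrite /derivable => /cvg_ex[l hl].
have lD : l = D by rewrite -fD; apply/esym; exact: cvg_lim hl.
move: hl; rewrite lD => /cvgrPdist_le/(_ e e0); rewrite near_withinE => /nbhs_ballP[d /= d0 hd].
exists d => // h h0 hd'; have := hd h; rewrite /ball/= sub0r normrN => /(_ hd').
rewrite -normr_gt0 => /(_ h0); rewrite /GRing.scale/= mulr1 => h1.
have hn : h != 0 by rewrite -normr_gt0.
have -> : f (x + h) - f x - D * h = - (D - h^-1 * (f (h + x) - f x)) * h.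
  by rewrite (addrC h); field.
by rewrite normrM normrN ler_wpM2r.
Qed.

Lemma eps_is_derive f x D : (forall e, 0 < e ->
  exists2 d, 0 < d & forall h, 0 < `|h| -> `|h| < d -> `|f (x + h) - f x - D * h| <= e * `|h|) ->
  is_derive x 1 f D.
Proof.
move=> H; have h : h^-1 *: (f (h *: 1 + x) - f x) @[h --> (0 : R)^'] --> D.
  apply/cvgrPdist_le => e e0; have [d d0 hd] := H e e0.
  rewrite near_withinE; apply/nbhs_ballP; exists d => //= h; rewrite /ball/= sub0r normrN => hd' hn.
  have h0 : 0 < `|h| by rewrite normr_gt0.
  have := hd h h0 hd'; rewrite /GRing.scale/= mulr1 -ler_pdivrMr// -normfV -normrM.
  have -> : (f (x + h) - f x - D * h) / h = - (D - h^-1 * (f (h + x) - f x)) by rewrite (addrC h); field.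
  by rewrite normrN.
apply: DeriveDef; first by apply/cvg_ex; exists D.
exact: cvg_lim.
Qed.

Lemma finite_common (P : nat -> R -> Prop) n :
  (forall i d d', P i d -> d' <= d -> P i d') ->
  (forall i, (i < n)%N -> exists2 d, 0 < d & P i d) -> exists2 d, 0 < d & forall i, (i < n)%N -> P i d.
Proof.
move=> mono; elim: n => [_|n IH h]; first by exists 1.
have [d d0 hd] := IH (fun i iN => h i (ltnW iN)); have [d' d'0 hd'] := h n (ltnSn n).
exists (Num.min d d'); first by rewrite lt_min d0.
move=> i; rewrite ltnS leq_eqVlt => /orP[/eqP ->|iN].
  by apply: (mono _ _ _ hd'); rewrite ge_min lexx orbT.
by apply: (mono _ _ _ (hd i iN)); rewrite ge_min lexx.
Qed.

(** For an equi-Lipschitz family, smallness at finitely many nodes suffices. The number [n] of nodes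
    is such that [L * b / n <= e / 2]. *)
Lemma equi_unif (b L : R) (A : R -> Prop) (s0 : R) (F : R -> R -> R) : 0 < b -> 0 <= L ->
  (forall s x y, A s -> 0 <= x <= b -> 0 <= y <= b -> `|F s x - F s y| <= L * `|x - y|) ->
  (forall x, 0 <= x <= b -> forall e, 0 < e -> exists2 d, 0 < d & forall s, A s -> `|s0 - s| < d -> `|F s x| <= e) ->
  forall e, 0 < e -> exists2 d, 0 < d & forall s, A s -> `|s0 - s| < d -> forall x, 0 <= x <= b -> `|F s x| <= e.
Proof.
move=> b0 L0 lF pF e e0; have e2 : 0 < e / 2 by rewrite divr_gt0.
pose n := (Num.truncn (2 * L * b / e)).+1.
have n0 : (0 : R) < n%:R by rewrite ltr0n.
pose nd i := i%:R * b / n%:R.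
have ndb i : (i < n)%N -> 0 <= nd i <= b.
  move=> iN; have h0 : 0 <= nd i by rewrite /nd divr_ge0// mulr_ge0// ltW.
  rewrite h0 /= /nd ler_pdivrMr// mulrC; apply: ler_wpM2l; first exact: ltW.
  by rewrite ler_nat ltnW.
pose P i d := forall s, A s -> `|s0 - s| < d -> `|F s (nd i)| <= e / 2.
have mono i d d' : P i d -> d' <= d -> P i d' by move=> h dd s As sd; apply: h => //; exact: lt_le_trans dd.
have ex i : (i < n)%N -> exists2 d, 0 < d & P i d by move=> iN; exact: (pF (nd i) (ndb i iN) _ e2).
have [d d0 hd] := finite_common P n mono ex.
exists d => // s As sd x xb; have /andP[x0 x1] := xb.
have [i iN ix] : exists2 i, (i < n)%N & `|x - nd i| <= b / n%:R.
  have [->|xb'] := eqVneq x b.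
    exists n.-1; first by rewrite /n.
    have -> : b - nd n.-1 = b / n%:R.
      have en : n.-1%:R = n%:R - 1 :> R by rewrite -[in RHS](ltn_predK (ltn0Sn _ : (0 < n)%N)) -natr1 addrK.
      by rewrite /nd en; move: (n%:R : R) n0 => m m0; field; rewrite gt_eqF.
    by rewrite ger0_norm// divr_ge0// ltW.
  pose y := x * n%:R / b.
  have y0 : 0 <= y by rewrite /y divr_ge0 ?mulr_ge0// ltW.
  have := truncn_itv y0 => /andP[i1 i2].
  exists (Num.truncn y).
    rewrite -(ltr_nat R); apply: (le_lt_trans i1); rewrite /y ltr_pdivrMr// mulrC ltr_pM2l//.
    by rewrite lt_neqAle xb'.
  have xy : x = y * b / n%:R by rewrite /y; field; rewrite !gt_eqF.
  have -> : x - nd (Num.truncn y) = (y - (Num.truncn y)%:R) * (b / n%:R) by rewrite {1}xy /nd; ring.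
  have bn : 0 <= b / n%:R by rewrite divr_ge0// ltW.
  rewrite normrM (ger0_norm bn) ler_piMl// ger0_norm ?subr_ge0//.
  by rewrite lerBlDr addrC natr1 ltW.
have h1 := hd i iN s As sd; have h2 := lF s x (nd i) As xb (ndb i iN).
have -> : F s x = F s (nd i) + (F s x - F s (nd i)) by ring.
apply: (le_trans (ler_normD _ _)); rewrite [leRHS]splitr; apply: lerD => //; apply: (le_trans h2).
apply: (le_trans (ler_wpM2l L0 ix)); rewrite mulrA ler_pdivrMr//.
have := truncnS_gt (2 * L * b / e); rewrite -/n ltr_pdivrMr// => /ltW h3.
by move: h3; move: (n%:R : R) => m; lra.
Qed.

End Equicontinuity.

Section AlmostAllTimes.
Context {R : realType}.
Implicit Types (x y e d h : R) (f : R -> R).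

(** An interval free of such times would be a set of positive measure inside a null set. *)
Lemma ae_dense (T : R) (P : R -> Prop) : 0 < T -> {ae mu, forall t, t \in `]0, T[ -> P t} ->
  forall t, 0 <= t <= T -> forall e, 0 < e -> exists t', [/\ 0 < t' < T, `|t - t'| < e & P t'].
Proof.
move=> T0 [A [mA A0 PA]] t /andP[t0 tT] e e0; apply: contrapT => H.
pose c := Num.max 0 (t - e); pose d := Num.min T (t + e).
have cd : c < d.
  by rewrite /c /d lt_min !gt_max T0/=; apply/andP; split; [lra|apply/andP; split; lra].
have sub : `]c, d[ `<=` A.
  move=> s; rewrite /= in_itv/= /c /d gt_max lt_min => /andP[/andP[s0 s1] /andP[s2 s3]].
  apply: PA => /= hs; apply: H; exists s; split; first by rewrite s0.
    by rewrite ltr_norml; apply/andP; split; lra.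
  by apply: hs; rewrite in_itv/= s0.
have : (mu (`]c, d[%classic : set R) <= mu A)%E by apply: le_measure; rewrite ?inE//; exact: measurable_itv.
by rewrite A0 lebesgue_measure_itv/= lte_fin cd -EFinB lee_fin subr_le0 leNgt cd.
Qed.

(** The increment of [f] over the middle half of the interval is at most [Num.sqrt b * M], so the
    derivative at some [z] there is at most [2 * Num.sqrt b * M / b]. From [z] on, the derivative
    varies by at most the L1 norm of [v2]. *)
Lemma L2_deriv_lip (b : R) f M v1 v2 : 0 < b -> 0 <= M ->
  (forall x, 0 < x < b -> {for x, continuous f}) -> bm 0 b f ->
  wk b 1 f v1 -> li 0 b v1 -> li 0 b (fun x => v1 x ^+ 2) -> itg 0 b (fun x => v1 x ^+ 2) <= M ^+ 2 ->
  wk b 2 f v2 -> li 0 b v2 -> li 0 b (fun x => v2 x ^+ 2) -> itg 0 b (fun x => v2 x ^+ 2) <= M ^+ 2 ->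
  forall x y, 0 < x < b -> 0 < y < b -> `|f x - f y| <= (2 * Num.sqrt b * M / b + Num.sqrt b * M) * `|x - y|.
Proof.
move=> b0 M0 cf bf w1 l1 s1 n1 w2 l2 s2 n2'.
have I_bd v : li 0 b v -> li 0 b (fun x => v x ^+ 2) -> itg 0 b (fun x => v x ^+ 2) <= M ^+ 2 ->
    itg 0 b (fun x => `|v x|) <= Num.sqrt b * M.
  move=> lv sv nv; apply: sqr_le_le; first by rewrite mulr_ge0// sqrtr_ge0.
  apply: (le_trans (L2_L1 b v 0 b (lexx _) (ltW b0) (lexx _) lv sv)).
  by rewrite subr0 exprMn (sqr_sqrtr (ltW b0)); apply: ler_wpM2l => //; exact: ltW.
have z0 : 0 <= (0 : R) <= b by rewrite lexx ltW.
have J_bd v x y : li 0 b v -> itg 0 b (fun x => `|v x|) <= Num.sqrt b * M ->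
    0 < x < b -> 0 < y < b -> `|J 0 v x - J 0 v y| <= Num.sqrt b * M.
  move=> lv nv; wlog xy : x y / x <= y => [h xb yb|].
    by have [/h|/ltW/h] := leP x y; [exact|rewrite distrC; exact].
  move=> /andP[x0 xb] /andP[y0 yb]; rewrite distrC (J_sub b 0 v x y lv (ltW x0) xy (ltW yb)).
  apply: (le_trans (itg_li_norm (liS x y (ltW x0) (ltW yb) lv))); apply: le_trans nv.
  by apply: (itg_li_mono x y) => //; exact: ltW.
have [p1 sp1 hp1] := weak_taylor b b0 f v1 0 0 cf bf l1 w1 z0.
have [p2 sp2 hp2] := weak_taylor b b0 f v2 1 0 cf bf l2 w2 z0.
have [c1 pc1] : exists c, p1 = c%:P by exists p1`_0; apply: size1_polyC.
have sp2' : (size p2^`() <= 1)%N.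
  have [->|p0] := eqVneq p2 0; first by rewrite deriv0 size_poly0.
  exact: (leq_trans (lt_size_deriv p0) sp2).
have [c2 pc2] : exists c, p2^`() = c%:P by exists p2^`()`_0; apply: size1_polyC.
pose V x := c2 + J 0 v2 x.
have df z : 0 < z < b -> is_derive z 1 f (V z).
  move=> zb; pose del := Num.min z (b - z).
  have del0 : 0 < del by rewrite lt_min; case/andP: zb => ? ?; apply/andP; split; lra.
  apply: (@is_derive_ext _ _ (fun s => p2.[s] + Jn 0 v2 2 s) _ del) => //.
    move=> s' ss; rewrite hp2//; move: ss; rewrite /del lt_min !ltr_norml => /andP[/andP[? ?] /andP[? ?]].
    by apply/andP; split; lra.
  have d1 := is_derive_poly p2 z; have d2 := Jn_derive b 0 v2 0 z z0 l2 zb.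
  rewrite (_ : (fun s => p2.[s] + Jn 0 v2 2 s) = (fun s => p2.[s]) + Jn 0 v2 2) //.
  by apply: is_derive_eq; rewrite pc2 hornerC.
have mvt x y : 0 < x -> x < y -> y < b -> exists2 z, x < z < y & f y - f x = V z * (y - x).
  move=> x0 xy yb; apply: (MVT_oo V xy).
    by apply: cont_within => z /andP[xz zy]; apply: cf; rewrite (lt_le_trans x0 xz) (le_lt_trans zy yb).
  by move=> z /andP[xz zy]; apply: df; rewrite (lt_trans x0 xz) (lt_trans zy yb).
have [z zi ez] := mvt (b / 4) (3 * b / 4) ltac:(lra) ltac:(lra) ltac:(lra).
have b4 : 0 < b / 4 < b by apply/andP; split; lra.
have b34 : 0 < 3 * b / 4 < b by apply/andP; split; lra.
have zb : 0 < z < b by case/andP: zi => ? ?; apply/andP; split; lra.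
have Vz : `|V z| <= 2 * Num.sqrt b * M / b.
  have h1 : `|f (3 * b / 4) - f (b / 4)| <= Num.sqrt b * M.
    rewrite !hp1// pc1 !hornerC.
    have -> : c1 + Jn 0 v1 1 (3 * b / 4) - (c1 + Jn 0 v1 1 (b / 4)) = J 0 v1 (3 * b / 4) - J 0 v1 (b / 4).
      by rewrite /Jn/=; ring.
    by apply: J_bd => //; exact: I_bd.
  move: h1; rewrite ez normrM [`|_ - b / 4|]ger0_norm; last by lra.
  have -> : 3 * b / 4 - b / 4 = b / 2 by field.
  move=> h1; rewrite ler_pdivlMr//.
  have -> : `|V z| * b = 2 * (`|V z| * (b / 2)) by field.
  by rewrite -mulrA ler_wpM2l.
have VL x : 0 < x < b -> `|V x| <= 2 * Num.sqrt b * M / b + Num.sqrt b * M.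
  move=> xb; have -> : V x = V z + (J 0 v2 x - J 0 v2 z) by rewrite /V; ring.
  by apply: (le_trans (ler_normD _ _)); apply: lerD => //; apply: J_bd => //; exact: I_bd.
move=> x y; wlog xy : x y / x < y => [h xb yb|].
  have [xy|xy|->] := ltgtP x y; first exact: h.
    by rewrite distrC (distrC x); apply: h.
  by rewrite !subrr !normr0 mulr0.
move=> /andP[x0 xb] /andP[y0 yb]; rewrite distrC (distrC x).
have [s /andP[xs sy] ->] := mvt x y x0 xy yb.
by rewrite normrM ler_wpM2r// VL// (lt_trans x0 xs) (lt_trans sy yb).
Qed.

End AlmostAllTimes.

(** * Bounds of the exact solution at all times *)

Section Regularity.
Context {R : realType} (k : nat) (b T : R) (Ub : R -> R) (u w g z : R -> R -> R).
Hypotheses (hk : (1 <= k)%N) (b0 : 0 < b) (T0 : 0 < T) (hex : exact_solution b T Ub u w g z).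
Implicit Types (t x y e d h : R).

Definition goodt M t := (forall j, (j <= k.+1)%N -> wbound b j (u t) M) /\
  (forall j, (j <= k.+1)%N -> exists v,
     [/\ wk b j (dt u t) v, li 0 b v, li 0 b (fun x => v x ^+ 2) & itg 0 b (fun x => v x ^+ 2) <= M ^+ 2]).

Lemma ae_goodt : in_Linfty_sobolev T b k.+1 +oo u -> in_Linfty_sobolev T b k.+1 2%:E (dt u) ->
  exists2 M, 0 <= M & {ae mu, forall t, t \in `]0, T[ -> goodt M t}.
Proof.
move=> /bochner_ae[M1 M10 h1] /bochner_ae[M2 M20 h2].
exists (Num.max M1 M2); first by rewrite le_max M10.
apply: aeS (aeI _ _ h1 h2) => t [{}h1 {}h2] tT.
have [s1 n1] := h1 tT; have [s2 n2] := h2 tT.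
split=> j jk.
  have [v [wv nv]] := sobolev_wd b k.+1 +oo%E (u t) M1 s1 n1 j jk.
  have [mv hv] := wd_wk b j _ v wv; have [lv bv] := Linfty_li b b0 v M1 M10 mv nv.
  exists v; split=> // x y x0 xy yb; apply: (le_trans (bv x y x0 xy yb)).
  by rewrite ler_wpM2r ?subr_ge0// le_max lexx.
have [v [wv nv]] := sobolev_wd b k.+1 2%:E (dt u t) M2 s2 n2 j jk.
have [mv hv] := wd_wk b j _ v wv; have [lv sv bv] := L2_li b v M2 M20 mv nv.
exists v; split=> //; apply: (le_trans bv); rewrite ler_sqr ?nnegrE ?le_max ?M20 ?lexx ?orbT//.
Qed.

Lemma u_near t x : 0 <= t <= T -> 0 <= x <= b -> forall e, 0 < e -> exists2 d, 0 < d &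
  forall t' x', 0 <= t' <= T -> 0 <= x' <= b -> `|t - t'| < d -> `|x - x'| < d -> `|u t x - u t' x'| <= e.
Proof.
move=> tT xb e e0; have := exact_u_continuous hex.
move=> /subspace_continuousP/(_ (t, x)) H.
have /H : (`[0, T] `*` `[0, b]) (t, x) by split; rewrite /= in_itv.
move=> /cvgrPdist_le/(_ e e0); rewrite near_withinE => /nbhs_ballP[d /= d0 hd].
exists d => // t' x' tT' xb' td xd; apply: (hd (t', x')); first by split.
by split; rewrite /= in_itv.
Qed.

Lemma u_t t x : 0 <= t <= T -> 0 <= x <= b -> forall e, 0 < e -> exists2 d, 0 < d &
  forall t', 0 <= t' <= T -> `|t - t'| < d -> `|u t x - u t' x| <= e.
Proof.
move=> tT xb e e0; have [d d0 hd] := u_near t x tT xb e e0; exists d => // t' tT' td.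
by apply: hd => //; rewrite subrr normr0.
Qed.

Lemma u_within t : 0 <= t <= T -> {within `[0, b], continuous (u t)}.
Proof.
move=> tT; apply/within_epsP => x xb e e0; have [d d0 hd] := u_near t x tT xb e e0.
by exists d => // y yb xy; apply: hd => //; rewrite subrr normr0.
Qed.

Lemma u_within_t x : 0 <= x <= b -> {within `[0, T], continuous (u^~ x)}.
Proof.
move=> xb; apply/within_epsP => t tT e e0; have [d d0 hd] := u_t t x tT xb e e0.
by exists d => // t' tT' td; apply: hd.
Qed.

Variable M : R.
Hypotheses (M0 : 0 <= M) (gd : forall t, 0 <= t <= T -> forall e, 0 < e ->
  exists t', [/\ 0 < t' < T, `|t - t'| < e & goodt M t']).

Let cl t : 0 < t < T -> 0 <= t <= T. Proof. by move=> /andP[? ?]; rewrite !ltW. Qed.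
Let clb x : 0 < x < b -> 0 <= x <= b. Proof. by move=> /andP[? ?]; rewrite !ltW. Qed.

(** The estimate holds at good times, which are dense, and involves only finitely many values of
    [u], which are continuous in time. *)
Lemma u_lip t x y : 0 <= t <= T -> 0 <= x <= b -> 0 <= y <= b -> `|u t x - u t y| <= M * `|x - y|.
Proof.
move=> tT xb yb; apply/ler_addgt0Pr => e e0; have e2 : 0 < e / 2 by rewrite divr_gt0.
have [d1 d10 h1] := u_t t x tT xb _ e2; have [d2 d20 h2] := u_t t y tT yb _ e2.
have [t' [tT' td [G _]]] := gd t tT (Num.min d1 d2) ltac:(by rewrite lt_min d10).
move: td; rewrite lt_min => /andP[t1 t2].
have h3 := wbound_lip b b0 (u t') M (u_within t' (cl _ tT')) (G 1%N isT) x y xb yb.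
have {}h1 := h1 t' (cl _ tT') t1; have {}h2 := h2 t' (cl _ tT') t2.
have -> : u t x - u t y = (u t' x - u t' y) + ((u t x - u t' x) - (u t y - u t' y)) by ring.
apply: (le_trans (ler_normD _ _)); apply: lerD => //; rewrite [leRHS]splitr.
by apply: (le_trans (ler_normB _ _)); exact: lerD.
Qed.

Lemma u_lip2 t x y h : 0 <= t <= T -> 0 < h -> 0 <= x -> x <= y -> y + h <= b ->
  `|(u t (y + h) - u t y) - (u t (x + h) - u t x)| <= M * (y - x) * h.
Proof.
move=> tT h0 x0 xy yh; apply/ler_addgt0Pr => e e0; have e2 : 0 < e / 4 by rewrite divr_gt0.
have xb : 0 <= x <= b by apply/andP; split; lra.
have yb : 0 <= y <= b by apply/andP; split; lra.
have xhb : 0 <= x + h <= b by apply/andP; split; lra.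
have yhb : 0 <= y + h <= b by apply/andP; split; lra.
have [d1 d10 h1] := u_t t x tT xb _ e2; have [d2 d20 h2] := u_t t y tT yb _ e2.
have [d3 d30 h3] := u_t t _ tT xhb _ e2; have [d4 d40 h4] := u_t t _ tT yhb _ e2.
have [t' [tT' td [G _]]] := gd t tT (Num.min (Num.min d1 d2) (Num.min d3 d4)) ltac:(by rewrite !lt_min d10 d20 d30).
move: td; rewrite !lt_min => /andP[/andP[t1 t2] /andP[t3 t4]].
have k2 : (2 <= k.+1)%N by [].
have h5 := wbound_lip2 b b0 (u t') M (u_within t' (cl _ tT')) (G 2%N k2) x y h h0 x0 xy yh.
move: (h1 t' (cl _ tT') t1) (h2 t' (cl _ tT') t2) (h3 t' (cl _ tT') t3) (h4 t' (cl _ tT') t4) h5.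
rewrite !ler_norml => /andP[? ?] /andP[? ?] /andP[? ?] /andP[? ?] /andP[? ?].
by apply/andP; split; lra.
Qed.

Lemma u_good t : 0 <= t <= T -> good b (u t).
Proof. by move=> tT; have [] := lip_good b M (u t) b0 (fun x y xb yb => u_lip t x y tT xb yb). Qed.

Lemma u_Xf t x : 0 <= t <= T -> 0 < x < b -> `|Xf (u t) x| <= M * x.
Proof. by move=> tT xb; have [_ _] := lip_good b M (u t) b0 (fun x y xb yb => u_lip t x y tT xb yb); apply. Qed.

Definition KM := M * Num.sqrt b.

Lemma u_Kf t : 0 <= t <= T -> Kf b (u t) <= KM.
Proof.
move=> tT; apply: (n2_sup b b0 _ _ (bm_qf b _ (u_good t tT)) M0) => x xb; have /andP[x1 x2] := xb.
by rewrite /qf normrM normfV (gtr0_norm x1) ler_pdivrMr// u_Xf.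
Qed.

Let it t : 0 <= t <= T -> t \in `[0, T]. Proof. by move=> tT; rewrite in_itv/= tT. Qed.
Let ib x : 0 < x < b -> x \in `]0, b[. Proof. by move=> tT; rewrite in_itv/= tT. Qed.

Lemma rg_w t x : 0 <= t <= T -> 0 <= x <= b -> w t x = itg 0 x (u t).
Proof.
move=> tT; apply: (w_itg b (u t) (w t)).
- exact: u_within.
- exact: (exact_w_continuous hex (it _ tT)).
- by move=> y yb; exact: (exact_w_equation hex (it _ tT) (ib _ yb)).
- exact: (exact_w_center hex (it _ tT)).
Qed.

Lemma rg_g t x : 0 <= t <= T -> 0 <= x <= b -> g t x = gg b (u t) x.
Proof.
move=> tT; apply: (g_gg b b0 (u t) (w t) (g t)).
- exact: u_within.
- exact: u_good.
- exact: (exact_w_continuous hex (it _ tT)).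
- exact: (exact_g_continuous hex (it _ tT)).
- by move=> y yb; exact: (exact_w_equation hex (it _ tT) (ib _ yb)).
- by move=> y yb; exact: (exact_g_equation hex (it _ tT) (ib _ yb)).
- exact: (exact_w_center hex (it _ tT)).
- exact: (exact_g_outer hex (it _ tT)).
Qed.

Lemma rg_z t x : 0 <= t <= T -> 0 <= x <= b -> z t x = itg 0 x (gg b (u t)).
Proof.
move=> tT; apply: (z_itg b b0 (u t) (w t) (g t) (z t)).
- exact: u_within.
- exact: u_good.
- exact: (exact_w_continuous hex (it _ tT)).
- exact: (exact_g_continuous hex (it _ tT)).
- exact: (exact_z_continuous hex (it _ tT)).
- by move=> y yb; exact: (exact_w_equation hex (it _ tT) (ib _ yb)).
- by move=> y yb; exact: (exact_g_equation hex (it _ tT) (ib _ yb)).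
- by move=> y yb; exact: (exact_z_equation hex (it _ tT) (ib _ yb)).
- exact: (exact_w_center hex (it _ tT)).
- exact: (exact_z_center hex (it _ tT)).
- exact: (exact_g_outer hex (it _ tT)).
Qed.

Lemma avg_z t x : 0 <= t <= T -> 0 < x <= b -> avg z t x = gt b (u t) x.
Proof. by move=> tT /andP[x0 xb]; rewrite gt_av// /av /avg rg_z// (ltW x0). Qed.

Lemma avg_w t x : 0 <= t <= T -> 0 < x <= b -> avg w t x = av (u t) x.
Proof. by move=> tT /andP[x0 xb]; rewrite /av /avg rg_w// (ltW x0). Qed.

Lemma near_b x : 0 < x < b -> exists2 d, 0 < d & forall y, `|x - y| < d -> 0 < y < b.
Proof.
move=> /andP[x0 xb]; exists (Num.min x (b - x)); first by rewrite lt_min x0 subr_gt0.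
move=> y; rewrite lt_min !ltr_norml => /andP[/andP[? ?] /andP[? ?]].
by apply/andP; split; lra.
Qed.

Definition V t x := derive1 (u t) x.

(** Only the flux is assumed differentiable in space. Dividing it by [gt b (u t)], positive and
    differentiable, shows that [u] is differentiable too, and the equation can be expanded. *)
Lemma pde t x : 0 < t < T -> 0 < x < b ->
  [/\ is_derive x 1 (u t) (V t x), is_derive t 1 (u^~ x) (dt u t x) &
    dt u t x = 2^-1 * (gt b (u t) x * V t x + GG b (u t) x * Xf (u t) x)].
Proof.
move=> tT xb; have tT' := cl _ tT; have gu := u_good t tT'.
have xb' : 0 < x <= b by case/andP: xb => -> /ltW.
have tin : t \in `]0, T[ by rewrite in_itv.
have [d1 d2 e1] := exact_u_equation hex tin (ib _ xb).
have [d d0 hd] := near_b x xb.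
have gt0 y : 0 < y < b -> gt b (u t) y != 0 by move=> yb; rewrite gt_eqF// gt_gt0// clb.
have fl y : 0 < y < b -> 2^-1 * avg z t y * u t y = 2^-1 * gt b (u t) y * u t y.
  by move=> yb; rewrite avg_z//; case/andP: yb => -> /ltW.
have dg := is_derive_gt b (u t) x gu xb.
have dfl : is_derive x 1 (fun y => 2^-1 * gt b (u t) y * u t y) (dr (fun s y => 2^-1 * avg z s y * u s y) t x).
  apply: (@is_derive_ext _ _ (fun y => 2^-1 * avg z t y * u t y) _ d) => //.
    by move=> y xy; rewrite fl//; exact: hd.
  by rewrite /dr derive1E; apply: DeriveDef.
have du : derivable (u t) x 1.
  have dV : is_derive x 1 (fun y => (gt b (u t) y)^-1) (- (gt b (u t) x) ^- 2 *: GG b (u t) x).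
    by apply: is_deriveV; exact: gt0.
  have := is_deriveM dfl dV => dM.
  have h2 : is_derive x 1 (fun y => 2 * ((2^-1 * gt b (u t) y * u t y) * (gt b (u t) y)^-1)) (2 *: _) := is_deriveZ 2 dM.
  have h3 := @is_derive_ext _ _ _ (u t) _ _ d0 _ h2.
  suff h4 : forall y, `|x - y| < d -> 2 * ((2^-1 * gt b (u t) y * u t y) * (gt b (u t) y)^-1) = u t y.
    by have := h3 h4 => h5; exact: ex_derive.
  by move=> y xy; field; exact: gt0 (hd y xy).
have du' : is_derive x 1 (u t) (V t x) by rewrite /V derive1E; apply: DeriveDef.
have dd : is_derive t 1 (u^~ x) (dt u t x) by rewrite /dt derive1E; exact: (DeriveDef d1 erefl).
split; [exact: du'|exact: dd|].
have e2 : dr (fun s y => 2^-1 * avg z s y * u s y) t x = 2^-1 * (GG b (u t) x * u t x + gt b (u t) x * V t x).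
  have h := is_deriveZ (2^-1) (is_deriveM dg du').
  have h' : is_derive x 1 (fun y => 2^-1 * gt b (u t) y * u t y) (2^-1 *: (gt b (u t) x *: V t x + u t x *: GG b (u t) x)).
    rewrite (_ : (fun y => _) = 2^-1 *: (gt b (u t) * u t))//.
    by apply/funext => y; rewrite -mulrA.
  rewrite -(@derive_val _ _ _ _ _ _ _ dfl) (@derive_val _ _ _ _ _ _ _ h') /GRing.scale/=; ring.
have e3 : dr (avg z) t x = GG b (u t) x.
  rewrite /dr derive1E; have h : is_derive x 1 (avg z t) (GG b (u t) x).
    apply: (@is_derive_ext _ _ (gt b (u t)) _ d) => // y xy.
    by have /andP[y0 yb] := hd y xy; rewrite avg_z// y0 ltW.
  exact: derive_val.
move/eqP: e1; rewrite subr_eq => /eqP ->; rewrite e2 e3 avg_w// XfE; ring.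
Qed.

Lemma V_lip t x y : 0 < t < T -> 0 < x < b -> 0 < y < b -> `|V t x - V t y| <= M * `|x - y|.
Proof.
move=> tT; wlog xy : x y / x <= y => [h xb yb|xb yb].
  by have [/h|/ltW/h] := leP x y; [exact|rewrite distrC (distrC x); exact].
apply/ler_addgt0Pr => e e0; have e2 : 0 < e / 2 by rewrite divr_gt0.
have [d1 _ _] := pde t x tT xb; have [d2 _ _] := pde t y tT yb.
have [a1 a10 h1] := is_derive_eps _ _ _ d1 _ e2; have [a2 a20 h2] := is_derive_eps _ _ _ d2 _ e2.
have /andP[y0 yb'] := yb; have /andP[x0 xb'] := xb.
pose h := Num.min (Num.min a1 a2) (b - y) / 2.
have m0 : 0 < Num.min (Num.min a1 a2) (b - y) by rewrite !lt_min a10 a20 subr_gt0.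
have h0 : 0 < h by rewrite divr_gt0.
have [l1 l2 l3] : [/\ h < a1, h < a2 & h < b - y].
  have : h < Num.min (Num.min a1 a2) (b - y) by rewrite /h; lra.
  by rewrite !lt_min => /andP[/andP[]].
have hn : `|h| = h by rewrite gtr0_norm.
have u1 := h1 h; have u2 := h2 h; rewrite hn in u1 u2.
have {}u1 := u1 h0 l1; have {}u2 := u2 h0 l2.
have u3 := u_lip2 t x y h (cl _ tT) h0 (ltW x0) xy ltac:(lra).
rewrite distrC (distrC x) (ger0_norm (_ : 0 <= y - x)) ?subr_ge0//.
rewrite -(ler_pM2r h0) -{1}hn -normrM [X in _ <= X]mulrDl.
have -> : (V t y - V t x) * h = ((u t (y + h) - u t y) - (u t (x + h) - u t x))
   - ((u t (y + h) - u t y - V t y * h) - (u t (x + h) - u t x - V t x * h)) by ring.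
apply: (le_trans (ler_normB _ _)); apply: lerD => //.
apply: (le_trans (ler_normB _ _)); have -> : e * h = e / 2 * h + e / 2 * h by field.
exact: lerD.
Qed.

Lemma V_bd t x : 0 < t < T -> 0 < x < b -> `|V t x| <= M.
Proof.
move=> tT xb; apply/ler_addgt0Pr => e e0.
have [d1 _ _] := pde t x tT xb; have [a1 a10 h1] := is_derive_eps _ _ _ d1 _ e0.
have [d d0 hd] := near_b x xb.
pose h := Num.min a1 d / 2.
have m0 : 0 < Num.min a1 d by rewrite !lt_min a10.
have h0 : 0 < h by rewrite divr_gt0.
have [l1 l2] : h < a1 /\ h < d.
  have : h < Num.min a1 d by rewrite /h; lra.
  by rewrite !lt_min => /andP[].
have hn : `|h| = h by rewrite gtr0_norm.
have u1 := h1 h; rewrite hn in u1; have {}u1 := u1 h0 l1.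
have xh : 0 < x + h < b by apply: hd; rewrite opprD addrA subrr sub0r normrN hn.
have u2 := u_lip t (x + h) x (cl _ tT) (clb _ xh) (clb _ xb).
rewrite (_ : x + h - x = h) in u2; last by ring.
rewrite hn in u2.
rewrite -(ler_pM2r h0) -{1}hn -normrM [X in _ <= X]mulrDl.
have -> : V t x * h = (u t (x + h) - u t x) - (u t (x + h) - u t x - V t x * h) by ring.
by apply: (le_trans (ler_normB _ _)); apply: lerD.
Qed.

Lemma V_cont t x : 0 < t < T -> 0 < x < b -> {for x, continuous (V t)}.
Proof.
move=> tT xb; apply/cont_epsP => e e0; have [d d0 hd] := near_b x xb.
have M1 : 0 < M + 1 by rewrite ltr_wpDl.
exists (Num.min d (e / (M + 1))); first by rewrite lt_min d0 divr_gt0.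
move=> y; rewrite lt_min => /andP[y1 y2]; apply: (le_trans (V_lip t x y tT xb (hd y y1))).
apply: (@le_trans _ _ ((M + 1) * `|x - y|)); first by rewrite ler_wpM2r// lerDl.
by rewrite mulrC -ler_pdivlMr// ltW.
Qed.

Lemma u_taylor1 t x h : 0 < t < T -> 0 < x < b -> 0 < h -> x + h < b ->
  `|u t (x + h) - u t x - V t x * h| <= M * h ^+ 2.
Proof.
move=> tT xb h0 xh; have /andP[x0 xb'] := xb; have xxh : x < x + h by rewrite ltrDl.
have [] := @MVT_oo _ x (x + h) (u t) (V t) xxh.
- by apply: (withinS x (x + h) (ltW x0) (ltW xh)); apply: u_within; exact: cl.
- move=> y /andP[y1 y2]; have yb : 0 < y < b by rewrite (lt_trans x0 y1) (lt_trans y2 xh).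
  by have [] := pde t y tT yb.
- move=> y /andP[y1 y2] ->; have yb : 0 < y < b by rewrite (lt_trans x0 y1) (lt_trans y2 xh).
  have -> : V t y * (x + h - x) - V t x * h = (V t y - V t x) * h by ring.
  rewrite normrM (gtr0_norm h0) expr2 mulrA ler_wpM2r ?(ltW h0)//.
  apply: (le_trans (V_lip t y x tT yb xb)); rewrite ler_wpM2l// ger0_norm ?subr_ge0 ?(ltW y1)//.
  by rewrite lerBlDl ltW.
Qed.

(** The difference quotient of step [h] approximates [V] within [M * h], uniformly in time, and is
    itself continuous in time. *)
Lemma V_t t x : 0 < t < T -> 0 < x < b -> forall e, 0 < e -> exists2 d, 0 < d &
  forall t', 0 < t' < T -> `|t - t'| < d -> `|V t x - V t' x| <= e.
Proof.
move=> tT xb e e0; have /andP[x0 xb'] := xb.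
pose h := Num.min (b - x) (e / (4 * (M + 1))) / 2.
have M1 : 0 < M + 1 by rewrite ltr_wpDl.
have m0 : 0 < Num.min (b - x) (e / (4 * (M + 1))) by rewrite lt_min subr_gt0 xb' divr_gt0// mulr_gt0.
have h0 : 0 < h by rewrite divr_gt0.
have [l1 l2] : h < b - x /\ h < e / (4 * (M + 1)).
  have : h < Num.min (b - x) (e / (4 * (M + 1))) by rewrite /h; lra.
  by rewrite !lt_min => /andP[].
have xh : x + h < b by lra.
have xhb : 0 <= x + h <= b by apply/andP; split; lra.
have e4 : 0 < e * h / 4 by rewrite divr_gt0// mulr_gt0.
have [d1 d10 h1] := u_t t x (cl _ tT) (clb _ xb) _ e4.
have [d2 d20 h2] := u_t t (x + h) (cl _ tT) xhb _ e4.
exists (Num.min d1 d2); first by rewrite lt_min d10.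
move=> t' tT'; rewrite lt_min => /andP[t1 t2].
have {}h1 := h1 t' (cl _ tT') t1; have {}h2 := h2 t' (cl _ tT') t2.
have q1 := u_taylor1 t x h tT xb h0 xh; have q2 := u_taylor1 t' x h tT' xb h0 xh.
have hn : `|h| = h by rewrite gtr0_norm.
rewrite -(ler_pM2r h0) -{1}hn -normrM.
have -> : (V t x - V t' x) * h = ((u t (x + h) - u t' (x + h)) - (u t x - u t' x))
  - ((u t (x + h) - u t x - V t x * h) - (u t' (x + h) - u t' x - V t' x * h)) by ring.
apply: (le_trans (ler_normB _ _)); apply: (le_trans (lerD (ler_normB _ _) (ler_normB _ _))).
apply: (le_trans (lerD (lerD h2 h1) (lerD q1 q2))).
have : M * h ^+ 2 <= e * h / 4.
  have -> : e * h / 4 = e / 4 * h by ring.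
  rewrite expr2 mulrA ler_wpM2r ?(ltW h0)//.
  apply: (@le_trans _ _ ((M + 1) * h)); first by rewrite ler_wpM2r ?(ltW h0)// lerDl.
  have -> : e / 4 = (M + 1) * (e / (4 * (M + 1))) by field; rewrite gt_eqF.
  by rewrite ler_wpM2l ?(ltW M1)// ltW.
move: (e * h) (M * h ^+ 2) => q r; lra.
Qed.

Lemma u_unif t : 0 <= t <= T -> forall e, 0 < e -> exists2 d, 0 < d &
  forall t', 0 <= t' <= T -> `|t - t'| < d -> forall x, 0 <= x <= b -> `|u t x - u t' x| <= e.
Proof.
move=> tT e e0.
have lf s x y : 0 <= s <= T -> 0 <= x <= b -> 0 <= y <= b ->
    `|(u t x - u s x) - (u t y - u s y)| <= 2 * M * `|x - y|.
  move=> sT xb yb; rewrite (_ : _ - _ = (u t x - u t y) - (u s x - u s y)); last by ring.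
  apply: (le_trans (ler_normB _ _)); rewrite -mulrA mulrDl mul1r; apply: lerD; exact: u_lip.
have M2 : 0 <= 2 * M by rewrite mulr_ge0.
exact: (equi_unif b (2 * M) (fun s => 0 <= s <= T) t (fun s x => u t x - u s x) b0 M2 lf (fun x xb => u_t t x tT xb) e e0).
Qed.

Lemma dt_bd t x : 0 < t < T -> 0 < x < b -> `|dt u t x| <= M + KM ^+ 2 * (M * b).
Proof.
move=> tT xb; have [_ _ ->] := pde t x tT xb; have tT' := cl _ tT; have gu := u_good t tT'.
have /andP[g0 g1] : 0 <= gt b (u t) x <= 1.
  have /andP[h1 ->] := gt_bd b b0 (u t) x gu (clb _ xb); rewrite andbT.
  by apply: le_trans h1; exact: expR_ge0.
have xb' : 0 < x <= b by case/andP: xb => -> /ltW.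
have /andP[G0 G1] := GG_bd b (u t) x gu xb'.
have G2 : GG b (u t) x <= KM ^+ 2.
  apply: (le_trans G1); rewrite ler_sqr ?nnegrE ?Kf_ge0 ?u_Kf//.
  by rewrite /KM mulr_ge0// sqrtr_ge0.
have X1 : `|Xf (u t) x| <= M * b.
  by apply: (le_trans (u_Xf t x tT' xb)); rewrite ler_wpM2l//; case/andP: xb => _ /ltW.
have V1 := V_bd t x tT xb.
rewrite normrM (@ger0_norm _ 2^-1)//.
have h1 : `|gt b (u t) x * V t x| <= M.
  by rewrite normrM (ger0_norm g0) -[leRHS]mul1r; apply: ler_pM.
have h2 : `|GG b (u t) x * Xf (u t) x| <= KM ^+ 2 * (M * b).
  by rewrite normrM (ger0_norm G0); apply: ler_pM.
have := ler_normD (gt b (u t) x * V t x) (GG b (u t) x * Xf (u t) x).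
have := normr_ge0 (gt b (u t) x * V t x + GG b (u t) x * Xf (u t) x).
move: h1 h2; move: (`|_ * V t x|) (`|_ * Xf _ _|) (`|_ + _|) (KM ^+ 2 * _) => *; lra.
Qed.

(** The equation expresses [dt u] through [u], [V] and the coefficients, all continuous in time; [Q]
    collects the Lipschitz constants. *)
Lemma dt_t t x : 0 < t < T -> 0 < x < b -> forall e, 0 < e -> exists2 d, 0 < d &
  forall t', 0 < t' < T -> `|t - t'| < d -> `|dt u t x - dt u t' x| <= e.
Proof.
move=> tT xb e e0; have /andP[x0 xb1] := xb; have tT' := cl _ tT.
have KM0 : 0 <= KM by rewrite /KM mulr_ge0// sqrtr_ge0.
have sb0 := sqrtr_ge0 b.
pose Q := 6 * M * KM * Num.sqrt b + 2 * KM ^+ 2 + 1.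
have Q0 : 0 < Q by rewrite /Q ltr_wpDl// addr_ge0// ?mulr_ge0 ?sqr_ge0.
have eQ : 0 < e / Q by rewrite divr_gt0.
have [d1 d10 h1] := u_unif t tT' _ eQ; have [d2 d20 h2] := V_t t x tT xb _ e0.
exists (Num.min d1 d2); first by rewrite lt_min d10.
move=> s sT; rewrite lt_min => /andP[s1 s2]; have sT' := cl _ sT.
have {}h1 := h1 s sT' s1; have {}h2 := h2 s sT s2.
have [_ _ ->] := pde t x tT xb; have [_ _ ->] := pde s x sT xb.
have g1 := u_good t tT'; have g2 := u_good s sT'.
pose n := e / Q * Num.sqrt b.
have bd : bm 0 b (fun y => u t y - u s y) := bmB _ _ _ _ (good_bm b g1) (good_bm b g2).
have nd : n2 0 b (fun y => u t y - u s y) <= n.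
  apply: (n2_sup b b0 _ _ bd (ltW eQ)) => y yb; exact: (h1 y (clb _ yb)).
have ggd y : 0 <= y <= b -> `|gg b (u t) y - gg b (u s) y| <= 2 * KM * n.
  move=> yb; apply: (le_trans (gg_lip b (u t) (u s) y g1 g2 yb)).
  have hx : n2 0 b (Xf (fun y => u t y - u s y)) <= n.
    (* Hardy's inequality on the mesh with a single element. *)
    apply: le_trans nd; apply: (hardy b 1 (fun i => i%:R * b) _ _ b0 bd).
      by split=> [|//|i]; rewrite ?mul0r ?mul1r// ltnS leqn0 => /eqP ->; rewrite mul0r mul1r.
    move=> i y'; rewrite ltnS leqn0 => /eqP ->; rewrite mul0r mul1r => yb'.
    by apply: cvgB; [exact: (within_cont y' yb' (u_within t tT'))|exact: (within_cont y' yb' (u_within s sT'))].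
  rewrite mulrC; apply: ler_pM; rewrite ?n2_ge0 ?addr_ge0 ?Kf_ge0//.
  by rewrite mulrDl mul1r; apply: lerD; exact: u_Kf.
have a1 := gt_sup b b0 (u t) (u s) _ x g1 g2 ggd (clb _ xb).
have a2 := GG_sup b (u t) (u s) _ x g1 g2 ggd xb.
have a3 : `|Xf (u t) x - Xf (u s) x| <= 2 * (e / Q).
  rewrite -(XfB b (good_bm b g1) (good_bm b g2) (ltW xb1)) XfE.
  have xb2 : 0 < x <= b by rewrite x0 ltW.
  have c1 := h1 x (clb _ xb).
  have c2 : `|av (fun y => u t y - u s y) x| <= e / Q.
    apply: (av_bound b _ x bd xb2) => y /andP[y0 yx]; apply: h1; rewrite (ltW y0) ltW//.
    exact: lt_trans xb1.
  by apply: (le_trans (ler_normB _ _)); rewrite mulrDl mul1r; exact: lerD.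
have xb' : 0 < x <= b by rewrite x0 ltW.
have /andP[gs0 gs1] : 0 <= gt b (u s) x <= 1.
  have /andP[q1 ->] := gt_bd b b0 (u s) x g2 (clb _ xb); rewrite andbT.
  by apply: le_trans q1; exact: expR_ge0.
have /andP[Gs0 Gs1] := GG_bd b (u s) x g2 xb'.
have Gs2 : GG b (u s) x <= KM ^+ 2.
  by apply: (le_trans Gs1); rewrite ler_sqr ?nnegrE ?Kf_ge0 ?u_Kf.
have v1 := V_bd t x tT xb; have X1 := u_Xf t x tT' xb.
move: a1 a2 a3 gs0 gs1 Gs0 Gs2 v1 X1 h2.
move: (gt b (u t) x) (gt b (u s) x) (GG b (u t) x) (GG b (u s) x) (Xf (u t) x) (Xf (u s) x) (V t x) (V s x).
move=> A1 A2 G1 G2 X1 X2 v1 v2 a1 a2 a3 gs0 gs1 Gs0 Gs2 hv hX h2.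
have -> : 2^-1 * (A1 * v1 + G1 * X1) - 2^-1 * (A2 * v2 + G2 * X2) =
  2^-1 * ((A1 - A2) * v1 + A2 * (v1 - v2) + (G1 - G2) * X1 + G2 * (X1 - X2)) by ring.
have t1 : `|(A1 - A2) * v1| <= 2 * KM * n * M by rewrite normrM; apply: ler_pM.
have t2 : `|A2 * (v1 - v2)| <= e by rewrite normrM (ger0_norm gs0) -[leRHS]mul1r; apply: ler_pM.
have t3 : `|(G1 - G2) * X1| <= M * (2 * (2 * KM * n)).
  rewrite normrM; apply: (le_trans (ler_wpM2l (normr_ge0 _) hX)).
  by rewrite mulrCA ler_wpM2l.
have t4 : `|G2 * (X1 - X2)| <= KM ^+ 2 * (2 * (e / Q)) by rewrite normrM (ger0_norm Gs0); apply: ler_pM.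
have sum : 2 * KM * n * M + e + M * (2 * (2 * KM * n)) + KM ^+ 2 * (2 * (e / Q)) <= 2 * e.
  have -> : 2 * KM * n * M + e + M * (2 * (2 * KM * n)) + KM ^+ 2 * (2 * (e / Q)) = e + (Q - 1) * (e / Q).
    by rewrite /n /Q; ring.
  have -> : (Q - 1) * (e / Q) = e - e / Q by field; rewrite gt_eqF.
  by have := ltW eQ; lra.
rewrite normrM (@ger0_norm _ 2^-1)//.
have := ler_normD ((A1 - A2) * v1 + A2 * (v1 - v2) + (G1 - G2) * X1) (G2 * (X1 - X2)).
have := ler_normD ((A1 - A2) * v1 + A2 * (v1 - v2)) ((G1 - G2) * X1).
have := ler_normD ((A1 - A2) * v1) (A2 * (v1 - v2)).
move: t1 t2 t3 t4 sum => t1 t2 t3 t4 sum c1 c2 c3.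
have : `|(A1 - A2) * v1 + A2 * (v1 - v2) + (G1 - G2) * X1 + G2 * (X1 - X2)| <= 2 * e.
  apply: le_trans sum; apply: (le_trans c3); apply: lerD => //; apply: (le_trans c2); apply: lerD => //.
  by apply: (le_trans c1); exact: lerD.
lra.
Qed.

Definition Ld := 2 * Num.sqrt b * M / b + Num.sqrt b * M.

Lemma dt_cont t x : 0 < t < T -> 0 < x < b -> {for x, continuous (dt u t)}.
Proof.
move=> tT xb; have tT' := cl _ tT; have gu := u_good t tT'; have [d d0 hd] := near_b x xb.
apply: (@cont_local _ (fun y => 2^-1 * (gt b (u t) y * V t y + GG b (u t) y * Xf (u t) y)) _ x d d0).
  by move=> y xy; have [_ _ ->] := pde t y tT (hd y xy).
apply: cvgM; first exact: cvg_cst.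
apply: cvgD; apply: cvgM.
- exact: (within_cont x xb (gt_within b (u t) gu)).
- exact: V_cont.
- exact: cont_GG.
- by apply: cvgB; [exact: (within_cont x xb (u_within t tT'))|exact: (cont_av b x (good_bm b gu) xb)].
Qed.

Lemma dt_bm t : 0 < t < T -> bm 0 b (dt u t).
Proof.
by move=> tT; apply: (bm_cont _ _ _ _ (fun x xb => dt_cont t x tT xb) (fun x xb => dt_bd t x tT xb)).
Qed.

Lemma dt_lip t x y : 0 < t < T -> 0 < x < b -> 0 < y < b -> `|dt u t x - dt u t y| <= Ld * `|x - y|.
Proof.
move=> tT xb yb; apply/ler_addgt0Pr => e e0; have e2 : 0 < e / 2 by rewrite divr_gt0.
have [d1 d10 h1] := dt_t t x tT xb _ e2; have [d2 d20 h2] := dt_t t y tT yb _ e2.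
have [t' [tT' td [_ G]]] := gd t (cl _ tT) (Num.min d1 d2) ltac:(by rewrite lt_min d10).
move: td; rewrite lt_min => /andP[t1 t2].
have k2 : (2 <= k.+1)%N by [].
have [v1 [w1 l1 s1 n1]] := G 1%N isT; have [v2 [w2 l2 s2 n2']] := G 2%N k2.
have h3 := L2_deriv_lip b (dt u t') M v1 v2 b0 M0 (fun x xb => dt_cont t' x tT' xb) (dt_bm t' tT')
   w1 l1 s1 n1 w2 l2 s2 n2' x y xb yb.
have {}h1 := h1 t' tT' t1; have {}h2 := h2 t' tT' t2.
have -> : dt u t x - dt u t y = (dt u t' x - dt u t' y) + ((dt u t x - dt u t' x) - (dt u t y - dt u t' y)) by ring.
apply: (le_trans (ler_normD _ _)); apply: lerD => //; rewrite [leRHS]splitr.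
by apply: (le_trans (ler_normB _ _)); exact: lerD.
Qed.

Lemma near_int x : 0 <= x <= b -> forall d, 0 < d -> exists2 y, 0 < y < b & `|x - y| < d.
Proof.
move=> /andP[x0 x1] d d0; pose e1 := Num.min (d / 2) (b / 4).
have e10 : 0 < e1 by rewrite lt_min !divr_gt0.
have [e11 e12] : e1 <= d / 2 /\ e1 <= b / 4 by rewrite /e1 !ge_min !lexx orbT.
have [xs|xs] := leP x (b / 2).
  exists (x + e1); first by apply/andP; split; lra.
  by rewrite ltr_norml; apply/andP; split; lra.
exists (x - e1); first by apply/andP; split; lra.
by rewrite ltr_norml; apply/andP; split; lra.
Qed.

Lemma near_int_cont (F : R -> R) x : {within `[0, b], continuous F} -> 0 <= x <= b -> forall d e, 0 < d -> 0 < e ->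
  exists y, [/\ 0 < y < b, `|x - y| < d & `|F x - F y| <= e].
Proof.
move=> /within_epsP cF xb d e d0 e0; have [d' d'0 hd] := cF x xb e e0.
have [y yb] := near_int x xb (Num.min d d') ltac:(by rewrite lt_min d0).
rewrite lt_min => /andP[y1 y2]; exists y; split=> //; exact: hd (clb _ yb) y2.
Qed.

Definition Lb := M + KM ^+ 2 * (M * b).

Lemma Ld0 : 0 <= Ld.
Proof. by rewrite /Ld addr_ge0 ?divr_ge0 ?mulr_ge0 ?sqrtr_ge0 ?(ltW b0). Qed.

Lemma Lb0 : 0 <= Lb.
Proof. by rewrite /Lb addr_ge0// !mulr_ge0 ?sqr_ge0 ?(ltW b0). Qed.

Lemma mvt_t (F : R -> R) (F' : R -> R) Q t1 t2 : 0 <= Q -> {within `[0, T], continuous F} ->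
  (forall t, 0 < t < T -> is_derive t 1 F (F' t)) -> (forall t, 0 < t < T -> `|F' t| <= Q) ->
  0 <= t1 <= T -> 0 <= t2 <= T -> `|F t1 - F t2| <= Q * `|t1 - t2|.
Proof.
move=> Q0 cF dF FQ; wlog t12 : t1 t2 / t1 < t2 => [H h1 h2|].
  have [t12|t12|->] := ltgtP t1 t2; first exact: H.
    by rewrite distrC (distrC t1); apply: H.
  by rewrite !subrr !normr0 mulr0.
move=> /andP[t10 t1T] /andP[t20 t2T].
have [] := @MVT_oo _ t1 t2 F F' t12.
- exact: (withinS t1 t2 t10 t2T).
- by move=> t /andP[h1 h2]; apply: dF; rewrite (le_lt_trans t10 h1) (lt_le_trans h2 t2T).
- move=> t /andP[h1 h2] e; rewrite distrC e normrM (distrC t1) ler_wpM2r//.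
  by apply: FQ; rewrite (le_lt_trans t10 h1) (lt_le_trans h2 t2T).
Qed.

Lemma u_dbd t1 t2 x : 0 <= t1 <= T -> 0 <= t2 <= T -> 0 <= x <= b ->
  `|u t1 x - u t2 x| <= Lb * `|t1 - t2|.
Proof.
move=> h1 h2 xb; apply/ler_addgt0Pr => e e0.
have cF : {within `[0, b], continuous (fun x => u t1 x - u t2 x)} by apply: within_sub; exact: u_within.
have [y [yb _ xy]] := near_int_cont _ x cF xb 1 e ltr01 e0.
have h3 : `|u t1 y - u t2 y| <= Lb * `|t1 - t2|.
  apply: (mvt_t (fun t => u t y) (fun t => dt u t y)) => //; first exact: Lb0.
  - by apply: u_within_t; exact: clb.
  - by move=> t tT; have [] := pde t y tT yb.
  - by move=> t tT; exact: dt_bd.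
have -> : u t1 x - u t2 x = (u t1 y - u t2 y) + ((u t1 x - u t2 x) - (u t1 y - u t2 y)) by ring.
by apply: (le_trans (ler_normD _ _)); exact: lerD.
Qed.

(** For interior points the mean value theorem in time reduces this to the Lipschitz bound of
    [dt u]; end points follow by continuity in space. *)
Lemma u_dlip t1 t2 x y : 0 <= t1 <= T -> 0 <= t2 <= T -> 0 <= x <= b -> 0 <= y <= b ->
  `|(u t1 x - u t2 x) - (u t1 y - u t2 y)| <= Ld * `|t1 - t2| * `|x - y|.
Proof.
move=> h1 h2 xb yb.
have cF : {within `[0, b], continuous (fun x => u t1 x - u t2 x)} by apply: within_sub; exact: u_within.
have int x' y' : 0 < x' < b -> 0 < y' < b ->
    `|(u t1 x' - u t2 x') - (u t1 y' - u t2 y')| <= Ld * `|t1 - t2| * `|x' - y'|.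
  move=> xb' yb'; rewrite (_ : _ - _ = (u t1 x' - u t1 y') - (u t2 x' - u t2 y')); last by ring.
  rewrite mulrAC; apply: (mvt_t (fun t => u t x' - u t y') (fun t => dt u t x' - dt u t y')) => //.
  - by rewrite mulr_ge0// Ld0.
  - by apply: within_sub; apply: u_within_t; exact: clb.
  - move=> t tT; have [_ d1 _] := pde t x' tT xb'; have [_ d2 _] := pde t y' tT yb'.
    exact: (is_deriveB d1 d2).
  - by move=> t tT; exact: dt_lip.
apply/ler_addgt0Pr => e e0.
pose Q := 2 + 2 * (Ld * `|t1 - t2|).
have q0 : 0 <= Ld * `|t1 - t2| by rewrite mulr_ge0// Ld0.
have Q0 : 0 < Q by rewrite /Q ltr_wpDr// mulr_ge0.
have eQ : 0 < e / Q by rewrite divr_gt0.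
have [x' [xb' xd xF]] := near_int_cont _ x cF xb _ _ eQ eQ.
have [y' [yb' yd yF]] := near_int_cont _ y cF yb _ _ eQ eQ.
have h3 := int x' y' xb' yb'.
have h4 : `|x' - y'| <= `|x - y| + 2 * (e / Q).
  rewrite (_ : x' - y' = (x - y) + ((y - y') - (x - x'))); last by ring.
  apply: (le_trans (ler_normD _ _)); rewrite lerD2l; apply: (le_trans (ler_normB _ _)).
  by rewrite mulrDl mul1r; apply: lerD; exact: ltW.
have h5 := ler_wpM2l q0 h4.
rewrite (_ : _ - _ = ((u t1 x' - u t2 x') - (u t1 y' - u t2 y')) +
  (((u t1 x - u t2 x) - (u t1 x' - u t2 x')) - ((u t1 y - u t2 y) - (u t1 y' - u t2 y')))); last by ring.
apply: (le_trans (ler_normD _ _)); apply: (le_trans (lerD (le_trans h3 h5) (ler_normB _ _))).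
apply: (le_trans (lerD (lexx _) (lerD xF yF))).
apply: eq_ler.
by rewrite /Q; field; rewrite -/Q gt_eqF.
Qed.

Lemma V_dbd t1 t2 x : 0 < t1 < T -> 0 < t2 < T -> 0 < x < b -> `|V t1 x - V t2 x| <= Ld * `|t1 - t2|.
Proof.
move=> h1 h2 xb; apply/ler_addgt0Pr => e e0; have e2 : 0 < e / 2 by rewrite divr_gt0.
have [d1 _ _] := pde t1 x h1 xb; have [d2 _ _] := pde t2 x h2 xb.
have [a1 a10 k1] := is_derive_eps _ _ _ d1 _ e2; have [a2 a20 k2] := is_derive_eps _ _ _ d2 _ e2.
have [d d0 hd] := near_b x xb.
pose h := Num.min (Num.min a1 a2) d / 2.
have m0 : 0 < Num.min (Num.min a1 a2) d by rewrite !lt_min a10 a20.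
have h0 : 0 < h by rewrite divr_gt0.
have [l1 l2 l3] : [/\ h < a1, h < a2 & h < d].
  have : h < Num.min (Num.min a1 a2) d by rewrite /h; lra.
  by rewrite !lt_min => /andP[/andP[]].
have hn : `|h| = h by rewrite gtr0_norm.
have u1 := k1 h; have u2 := k2 h; rewrite hn in u1 u2.
have {}u1 := u1 h0 l1; have {}u2 := u2 h0 l2.
have xh : 0 < x + h < b by apply: hd; rewrite opprD addrA subrr sub0r normrN hn.
have u3 := u_dlip t1 t2 (x + h) x (cl _ h1) (cl _ h2) (clb _ xh) (clb _ xb).
rewrite (_ : x + h - x = h) in u3; last by ring.
rewrite hn in u3.
rewrite -(ler_pM2r h0) -{1}hn -normrM [X in _ <= X]mulrDl.
have -> : (V t1 x - V t2 x) * h = ((u t1 (x + h) - u t2 (x + h)) - (u t1 x - u t2 x))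
   - ((u t1 (x + h) - u t1 x - V t1 x * h) - (u t2 (x + h) - u t2 x - V t2 x * h)) by ring.
apply: (le_trans (ler_normB _ _)); apply: lerD => //.
apply: (le_trans (ler_normB _ _)); have -> : e * h = e / 2 * h + e / 2 * h by field.
exact: lerD.
Qed.

(* McShane extension *)
Lemma lip_ext (f : R -> R) (L : R) : 0 <= L -> (forall x y, 0 < x < b -> 0 < y < b -> `|f x - f y| <= L * `|x - y|) ->
  exists F : R -> R, (forall x, 0 < x < b -> F x = f x) /\
    forall x y, 0 <= x <= b -> 0 <= y <= b -> `|F x - F y| <= L * `|x - y|.
Proof.
move=> L0 hf; pose S x := [set f y + L * `|x - y| | y in [set y | 0 < y < b]].
have mb : 0 < b / 2 < b by rewrite divr_gt0//= ltr_pdivrMr// ltr_pMr// ltr1n.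
have S0 x : S x !=set0 by exists (f (b / 2) + L * `|x - b / 2|); exists (b / 2).
have lbS x : has_lbound (S x).
  exists (f (b / 2) - L * `|x - b / 2|) => _ [y yb <-].
  have h1 := hf (b / 2) y mb yb; move: h1; rewrite ler_norml => /andP[_ h1].
  have h2 := ler_wpM2l L0 (ler_normD (b / 2 - x) (x - y)).
  move: h2; rewrite subrKA mulrDr (distrC (b / 2) x) => h2; lra.
have key x y : inf (S x) <= inf (S y) + L * `|x - y|.
  rewrite -lerBlDr; apply: lb_le_inf => // _ [s sb <-].
  rewrite lerBlDr; apply: (@le_trans _ _ (f s + L * `|x - s|)).
    by apply: ge_inf => //; exists s.
  have h2 := ler_wpM2l L0 (ler_normD (x - y) (y - s)).
  move: h2; rewrite subrKA mulrDr => h2; lra.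
exists (fun x => inf (S x)); split=> [x xb|x y _ _].
  apply/eqP; rewrite eq_le; apply/andP; split.
    by apply: ge_inf => //; exists x => //; rewrite subrr normr0 mulr0 addr0.
  apply: lb_le_inf => // _ [y yb <-]; have := hf x y xb yb; rewrite ler_norml => /andP[_ h1]; lra.
rewrite ler_norml; have h1 := key x y; have := key y x; rewrite (distrC y x) => h2.
by apply/andP; split; lra.
Qed.

(** The equation gives the time derivative in the open interval only. A Lipschitz extension provides
    its values at the centre and at the outer boundary, where the projections evaluate it. *)
Definition Ut t : R -> R := get [set F : R -> R | (forall x, 0 < x < b -> F x = dt u t x) /\
    forall x y, 0 <= x <= b -> 0 <= y <= b -> `|F x - F y| <= Ld * `|x - y|].

Lemma UtP t : 0 < t < T -> (forall x, 0 < x < b -> Ut t x = dt u t x) /\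
    forall x y, 0 <= x <= b -> 0 <= y <= b -> `|Ut t x - Ut t y| <= Ld * `|x - y|.
Proof.
move=> tT; have [F hF] := lip_ext _ _ Ld0 (fun x y xb yb => dt_lip t x y tT xb yb).
exact: (@getPex _ [set F : R -> R | (forall x, 0 < x < b -> F x = dt u t x) /\
    forall x y, 0 <= x <= b -> 0 <= y <= b -> `|F x - F y| <= Ld * `|x - y|] (ex_intro _ F hF)).
Qed.

Lemma Ut_within t : 0 < t < T -> {within `[0, b], continuous (Ut t)}.
Proof. by move=> tT; have [_ h] := UtP t tT; have [] := lip_good b Ld (Ut t) b0 h. Qed.

(** At an end point the difference quotient in time is compared with the one at an interior
    neighbour; by [u_dlip] they differ by at most [Ld * |x - y|]. *)
Lemma Ut_derive t x : 0 < t < T -> 0 <= x <= b -> is_derive t 1 (u^~ x) (Ut t x).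
Proof.
move=> tT xb; have /andP[t0 t1] := tT; have [hU hL] := UtP t tT.
apply: eps_is_derive => e e0; have e3 : 0 < e / 3 by rewrite divr_gt0.
have L1 : 0 < Ld + 1 by rewrite ltr_wpDl// Ld0.
have [y yb xy] := near_int x xb (e / 3 / (Ld + 1)) ltac:(by rewrite divr_gt0).
have xy' : Ld * `|x - y| <= e / 3.
  apply: (@le_trans _ _ ((Ld + 1) * `|x - y|)); first by rewrite ler_wpM2r// lerDl.
  by rewrite mulrC -ler_pdivlMr// ltW.
have [_ d2 _] := pde t y tT yb; have [d d0 hd] := is_derive_eps _ _ _ d2 _ e3.
exists (Num.min d (Num.min t (T - t))); first by rewrite !lt_min d0 t0 subr_gt0.
move=> h h0; rewrite !lt_min => /andP[hd' /andP[ht hT]].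
have th : 0 <= t + h <= T.
  by move: ht hT; rewrite !ltr_norml => /andP[? ?] /andP[? ?]; apply/andP; split; lra.
have k1 := hd h h0 hd'; have k2 := u_dlip (t + h) t x y th (cl _ tT) xb (clb _ yb).
rewrite (_ : t + h - t = h) in k2; last by ring.
have k3 := hL x y xb (clb _ yb); rewrite (hU y yb) in k3.
have -> : u (t + h) x - u t x - Ut t x * h = ((u (t + h) x - u t x) - (u (t + h) y - u t y))
   + (u (t + h) y - u t y - dt u t y * h) - (Ut t x - dt u t y) * h by ring.
apply: (le_trans (ler_normB _ _)); apply: (le_trans (lerD (ler_normD _ _) (lexx _))).
rewrite (_ : e * `|h| = e / 3 * `|h| + e / 3 * `|h| + e / 3 * `|h|); last by field.
apply: lerD; [apply: lerD => //|].
  by apply: (le_trans k2); rewrite mulrAC ler_wpM2r.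
by rewrite normrM ler_wpM2r//; exact: le_trans k3 xy'.
Qed.

Lemma Ut_unif t : 0 < t < T -> forall e, 0 < e -> exists2 d, 0 < d &
  forall t', 0 < t' < T -> `|t - t'| < d -> forall x, 0 <= x <= b -> `|Ut t x - Ut t' x| <= e.
Proof.
move=> tT e e0; have [hU hL] := UtP t tT.
have lf s x y : 0 < s < T -> 0 <= x <= b -> 0 <= y <= b ->
    `|(Ut t x - Ut s x) - (Ut t y - Ut s y)| <= 2 * Ld * `|x - y|.
  move=> sT xb yb; rewrite (_ : _ - _ = (Ut t x - Ut t y) - (Ut s x - Ut s y)); last by ring.
  have [_ hLs] := UtP s sT.
  by apply: (le_trans (ler_normB _ _)); rewrite -mulrA mulrDl mul1r; apply: lerD; [exact: hL|exact: hLs].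
have M2 : 0 <= 2 * Ld by rewrite mulr_ge0// Ld0.
apply: (equi_unif b (2 * Ld) (fun s => 0 < s < T) t (fun s x => Ut t x - Ut s x) b0 M2 lf _ e e0).
move=> x xb e' e'0; have e3 : 0 < e' / 3 by rewrite divr_gt0.
have L1 : 0 < Ld + 1 by rewrite ltr_wpDl// Ld0.
have [y yb xy] := near_int x xb (e' / 3 / (Ld + 1)) ltac:(by rewrite divr_gt0).
have xy' : Ld * `|x - y| <= e' / 3.
  apply: (@le_trans _ _ ((Ld + 1) * `|x - y|)); first by rewrite ler_wpM2r// lerDl.
  by rewrite mulrC -ler_pdivlMr// ltW.
have [d d0 hd] := dt_t t y tT yb _ e3; exists d => // s sT sd.
have k1 := hd s sT sd; have [hUs hLs] := UtP s sT.
have k2 := le_trans (hL x y xb (clb _ yb)) xy'; have k3 := le_trans (hLs x y xb (clb _ yb)) xy'.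
have -> : Ut t x - Ut s x = (Ut t x - Ut t y) + (dt u t y - dt u s y) - (Ut s x - Ut s y).
  by rewrite (hU y yb) (hUs y yb); ring.
apply: (le_trans (ler_normB _ _)); apply: (le_trans (lerD (ler_normD _ _) (lexx _))).
by rewrite (_ : e' = e' / 3 + e' / 3 + e' / 3); [apply: lerD => //; exact: lerD|field].
Qed.

Section Projections.
Variables C C' : R.
Hypotheses (C0 : 0 < C) (C'0 : 0 < C').
Hypothesis hC : forall (a c : R) (f : R -> R) (p : {poly R}) (E : R), a < c -> bm a c f -> (size p <= k.+1)%N ->
  (forall x, a <= x <= c -> `|f x - p.[x]| <= E) ->
  (forall x, a <= x <= c -> `|f x - (l2p k a c f).[x]| <= C * E /\ `|f x - (radp k a c f).[x]| <= C * E) /\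
  ((forall x y, a <= x <= c -> a <= y <= c -> `|(f x - p.[x]) - (f y - p.[y])| <= E / (c - a) * `|x - y|) ->
   forall x y, a <= x <= c -> a <= y <= c ->
     `|(f x - (l2p k a c f).[x]) - (f y - (l2p k a c f).[y])| <= C * E / (c - a) * `|x - y| /\
     `|(f x - (radp k a c f).[x]) - (f y - (radp k a c f).[y])| <= C * E / (c - a) * `|x - y|).
Hypothesis hC' : forall (a c : R) (f : R -> R) (Q : R), a < c -> bm a c f ->
  (forall x, a <= x <= c -> `|f x| <= Q) ->
  forall x, a <= x <= c ->
  [/\ `|(l2p k a c f).[x]| <= C' * Q, `|(radp k a c f).[x]| <= C' * Q,
      `|(l2p k a c f)^`().[x]| <= C' * Q / (c - a) & `|(radp k a c f)^`().[x]| <= C' * Q / (c - a)].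

(** At good times Taylor's formula provides the polynomial that [proj_approx] needs. Other times are
    limits of good ones, uniformly in space, and the projection is stable in the sup norm. *)
Lemma radp_all t (a c : R) x y : 0 <= t <= T -> 0 <= a -> a < c -> c <= b -> a <= x <= c -> a <= y <= c ->
  `|u t x - (radp k a c (u t)).[x]| <= C * (M * (c - a) ^+ k.+1) /\
  `|(u t x - (radp k a c (u t)).[x]) - (u t y - (radp k a c (u t)).[y])| <= C * (M * (c - a) ^+ k.+1) / (c - a) * `|x - y|.
Proof.
move=> tT a0 ac cb xac yac.
have ca0 : 0 < c - a by rewrite subr_gt0.
have ub s : 0 <= s <= T -> bm a c (u s).
  by move=> sT; apply: (bmS a c a0 cb); apply: within_bm; exact: u_within.
have good s : 0 < s < T -> goodt M s ->
  `|u s x - (radp k a c (u s)).[x]| <= C * (M * (c - a) ^+ k.+1) /\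
  `|(u s x - (radp k a c (u s)).[x]) - (u s y - (radp k a c (u s)).[y])| <= C * (M * (c - a) ^+ k.+1) / (c - a) * `|x - y|.
  move=> sT [G _]; have [v [hw lv bv]] := G k.+1 (leqnn _).
  have ab : 0 <= a <= b by rewrite a0 (le_trans (ltW ac)).
  have [p sp hp] := wtaylor b b0 (u s) v k a (u_within s (cl _ sT)) hw lv ab.
  have inb s' : a <= s' <= c -> 0 <= s' <= b by move=> /andP[? ?]; apply/andP; split; lra.
  have I1 := bv a c a0 (ltW ac) cb.
  have E1 x' : a <= x' <= c -> `|u s x' - p.[x']| <= M * (c - a) ^+ k.+1.
    move=> x'ac; rewrite hp ?inb// addrC addKr.
    apply: (le_trans (Jn_bound b a c v k x' a0 (ltW ac) cb lv x'ac)).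
    by rewrite exprSr mulrCA ler_wpM2l// exprn_ge0// ltW.
  have [h1 h2] := hC a c (u s) p _ ac (ub s (cl _ sT)) sp E1.
  split; first by have [] := h1 x xac.
  have E2 x' y' : a <= x' <= c -> a <= y' <= c ->
      `|(u s x' - p.[x']) - (u s y' - p.[y'])| <= M * (c - a) ^+ k.+1 / (c - a) * `|x' - y'|.
    wlog xy : x' y' / x' <= y' => [H xac' yac'|xac' yac'].
      by have [/H|/ltW/H] := leP x' y'; [exact|rewrite distrC (distrC x'); exact].
    rewrite !hp ?inb//.
    have -> : p.[x'] + Jn a v k.+1 x' - p.[x'] - (p.[y'] + Jn a v k.+1 y' - p.[y']) =
      - (Jn a v k.+1 y' - Jn a v k.+1 x') by ring.
    rewrite normrN (distrC x') (ger0_norm (_ : 0 <= y' - x')) ?subr_ge0//.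
    (* As [k >= 1], the Taylor remainder is at least a double primitive, hence Lipschitz. *)
    case: k hk => [//|k'] _; case/andP: xac' => ax xc; case/andP: yac' => ay yc.
    apply: (le_trans (Jn_lip b a c v k' x' y' a0 (ltW ac) cb lv ax xy yc)).
    rewrite ler_wpM2r ?subr_ge0//.
    have -> : M * (c - a) ^+ k'.+2 / (c - a) = (c - a) ^+ k' * (M * (c - a)) by rewrite !exprS; field; rewrite gt_eqF.
    by rewrite ler_wpM2l// exprn_ge0// ltW.
  by have [] := h2 E2 x y xac yac.
have near e : 0 < e -> exists s, [/\ 0 < s < T, goodt M s & forall x', a <= x' <= c ->
    `|(u t x' - (radp k a c (u t)).[x']) - (u s x' - (radp k a c (u s)).[x'])| <= (1 + C') * e].
  move=> e0; have [d d0 hd] := u_unif t tT e e0.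
  have [s [sT sd G]] := gd t tT d d0; exists s; split=> // x' xac'.
  have dbd x'' : a <= x'' <= c -> `|u t x'' - u s x''| <= e.
    by move=> /andP[? ?]; apply: hd => //; [exact: cl|apply/andP; split; lra].
  have [_ h1 _ _] := hC' a c (fun x => u t x - u s x) e ac (bmB _ _ _ _ (ub t tT) (ub s (cl _ sT))) dbd x' xac'.
  move: h1; rewrite (radpB k a c _ _ (ub t tT) (ub s (cl _ sT))) hornerD hornerN => h1.
  rewrite (_ : _ - _ = (u t x' - u s x') - ((radp k a c (u t)).[x'] - (radp k a c (u s)).[x'])); last by ring.
  apply: (le_trans (ler_normB _ _)); rewrite mulrDl mul1r; apply: lerD => //; exact: dbd.
have C1 : 0 < 1 + C' by rewrite addr_gt0.
split; apply/ler_addgt0Pr => e e0.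
  have [s [sT G hs]] := near (e / (1 + C')) ltac:(by rewrite divr_gt0).
  have [g1 _] := good s sT G; have := hs x xac; rewrite mulrC divfK ?gt_eqF// => h1.
  rewrite (_ : u t x - _ = (u s x - (radp k a c (u s)).[x]) + ((u t x - (radp k a c (u t)).[x]) - (u s x - (radp k a c (u s)).[x]))); last by ring.
  by apply: (le_trans (ler_normD _ _)); exact: lerD.
have [s [sT G hs]] := near (e / 2 / (1 + C')) ltac:(by rewrite !divr_gt0).
have [_ g1] := good s sT G; have := hs x xac; have := hs y yac; rewrite mulrC divfK ?gt_eqF// => h1 h2.
move: g1 h1 h2; move: (u t x - _) (u t y - _) (u s x - _) (u s y - _) => A B A' B' g1 h1 h2.
rewrite (_ : A - B = (A' - B') + ((A - A') - (B - B'))); last by ring.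
apply: (le_trans (ler_normD _ _)); apply: lerD => //; rewrite [leRHS]splitr.
by apply: (le_trans (ler_normB _ _)); exact: lerD.
Qed.

Lemma itg_li_mesh N (r : nat -> R) (f : R -> R) n : mesh b N r -> li 0 b f -> (n <= N)%N ->
  itg 0 (r n) f = \sum_(i < n) itg (r i) (r i.+1) f.
Proof.
move=> hm lf; have [r0 _ _] := hm; elim: n => [|n IH] nN; first by rewrite big_ord0 r0 itg_ge.
have /andP[n0 nb] := mesh_node b N r hm _ (ltnW nN); have /andP[m0 mb] := mesh_node b N r hm _ nN.
rewrite big_ord_recr/= -IH ?(ltnW nN)//; apply: itg_li_split.
  by rewrite n0 ltW// (mesh_lt b N r hm).
exact: (liS 0 (r n.+1) (lexx _) mb lf).
Qed.

Lemma diff_bound (A B p q E F : R) : `|A - B| <= E -> `|p - q| <= F -> `|A - p - (B - q)| <= E + F.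
Proof.
move=> h1 h2; have -> : A - p - (B - q) = (A - B) - (p - q) by ring.
by apply: (le_trans (ler_normB _ _)); exact: lerD.
Qed.

(** The derivatives of [u_t] are controlled in L2 only. On an element of length d the projection
    error is at most a multiple of d^k times the L1 norm of the top derivative; Cauchy--Schwarz and
    integration over the element bring its square to d^(2k+2) times a local L2 norm squared, and
    these add up. *)
Lemma radpt t N (r : nat -> R) : 0 < t < T -> mesh b N r ->
  n2 0 b (fun x => Ut t x - bf N r (fun i => radp k (r i) (r i.+1) (Ut t)) x) <= C * M * mesh_size N r ^+ k.+1.
Proof.
move=> tT hm; set H := mesh_size N r.
have bU s : 0 < s < T -> bm 0 b (Ut s) by move=> sT; apply: within_bm; exact: Ut_within.
have H0 : 0 <= H.
  apply: le_trans (mesh_h N r 0 (mesh_N b N r hm b0)).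
  by rewrite subr_ge0 (mesh_le b N r hm)// (mesh_N b N r hm b0).
pose D s x := Ut s x - bf N r (fun i => radp k (r i) (r i.+1) (Ut s)) x.
have bD s : 0 < s < T -> bm 0 b (D s) by move=> sT; apply: bmB; [exact: bU|exact: (bm_bf b N r hm)].
have good s : 0 < s < T -> goodt M s -> n2 0 b (D s) <= C * M * H ^+ k.+1.
  move=> sT [_ G]; have [v [hw lv sv nv]] := G k.+1 (leqnn _).
  have [hUs _] := UtP s sT.
  have hw' : wk b k.+1 (Ut s) v.
    move=> phi tp; rewrite -(hw phi tp); apply: eq_itg => x xb; by rewrite hUs.
  apply: sqr_le_le; first by rewrite !mulr_ge0 ?exprn_ge0 ?(ltW C0).
  rewrite n2_sq (itg_bf b N r hm _ (fun i x => (Ut s x - (radp k (r i) (r i.+1) (Ut s)).[x]) ^+ 2)); last 2 first.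
  - by apply: bmX; exact: bD.
  - by move=> i x iN xi; rewrite /D (bfE b N r hm _ i x iN xi).
  apply: (@le_trans _ _ (\sum_(i < N) C ^+ 2 * (H ^+ k.+1) ^+ 2 * itg (r i) (r i.+1) (fun x => v x ^+ 2))); last first.
    rewrite -mulr_sumr -(itg_li_mesh N r _ N hm sv (leqnn _)).
    have [_ rN _] := hm; rewrite rN !exprMn (mulrAC _ (M ^+ 2)) ler_wpM2l// mulr_ge0 ?sqr_ge0//.
  apply: ler_sum => -[i iN] _ /=; have ril := mesh_lt b N r hm _ iN.
  have /andP[a0 ab] := mesh_node b N r hm _ (ltnW iN); have /andP[_ cb] := mesh_node b N r hm _ iN.
  have d0 : 0 < r i.+1 - r i by rewrite subr_gt0.
  have ab' : 0 <= r i <= b by rewrite a0 ab.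
  have [p sp hp] := wtaylor b b0 (Ut s) v k (r i) (Ut_within s sT) hw' lv ab'.
  set I := itg (r i) (r i.+1) (fun z => `|v z|).
  have I0 : 0 <= I by apply: itg_ge0.
  have E1 x' : r i <= x' <= r i.+1 -> `|Ut s x' - p.[x']| <= (r i.+1 - r i) ^+ k * I.
    move=> x'ac; rewrite hp; last by case/andP: x'ac => ? ?; apply/andP; split; lra.
    rewrite addrC addKr; exact: (Jn_bound b (r i) (r i.+1) v k x' a0 (ltW ril) cb lv x'ac).
  have [h1 _] := hC (r i) (r i.+1) (Ut s) p _ ril (bm_elt b N r hm _ i iN (bU s sT)) sp E1.
  have I2 := L2_L1 b v (r i) (r i.+1) a0 (ltW ril) cb lv sv; rewrite -/I in I2.
  have be : bm (r i) (r i.+1) (fun x => (Ut s x - (radp k (r i) (r i.+1) (Ut s)).[x]) ^+ 2).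
    by apply: bmX; apply: bmB; [exact: (bm_elt b N r hm _ i iN (bU s sT))|exact: bm_poly].
  apply: (@le_trans _ _ ((C * ((r i.+1 - r i) ^+ k * I)) ^+ 2 * (r i.+1 - r i))).
    apply: le_trans (ler_norm _) _; apply: (itg_bound _ (ltW ril) be) => x /andP[x1 x2].
    rewrite normrX ler_sqr ?nnegrE ?mulr_ge0 ?exprn_ge0 ?(ltW C0) ?(ltW d0)//.
    by have [] := h1 x; rewrite ?(ltW x1) ?(ltW x2).
  have hH : r i.+1 - r i <= H by exact: mesh_h.
  have S0 : 0 <= itg (r i) (r i.+1) (fun x => v x ^+ 2) by apply: itg_ge0 => x _; exact: sqr_ge0.
  move: d0 hH I2 S0; move: (r i.+1 - r i) (itg _ _ _) => d S d0 hH I2 S0.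
  have -> : (C * (d ^+ k * I)) ^+ 2 * d = C ^+ 2 * ((d ^+ k) ^+ 2 * d * I ^+ 2) by ring.
  rewrite -[leRHS]mulrA ler_wpM2l ?sqr_ge0//.
  apply: (@le_trans _ _ ((d ^+ k) ^+ 2 * d * (d * S))).
    by rewrite ler_wpM2l// mulr_ge0 ?sqr_ge0 ?(ltW d0).
  have -> : (d ^+ k) ^+ 2 * d * (d * S) = (d ^+ k.+1) ^+ 2 * S by rewrite [d ^+ k.+1]exprS; ring.
  rewrite ler_wpM2r// ler_sqr ?nnegrE ?exprn_ge0 ?(ltW d0)//.
  by apply: lerXn2r; rewrite ?nnegrE ?(ltW d0).
apply/ler_addgt0Pr => e e0.
have sb0 := sqrtr_ge0 b.
pose Q := (1 + C') * Num.sqrt b + 1.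
have Q0 : 0 < Q by rewrite /Q ltr_wpDl// mulr_ge0// addr_ge0// ltW.
have [d d0 hd] := Ut_unif t tT (e / Q) ltac:(by rewrite divr_gt0).
have [s [sT sd G]] := gd t (cl _ tT) d d0.
have eQ0 : 0 <= e / Q by rewrite ltW// divr_gt0.
have h1 : n2 0 b (fun x => D t x - D s x) <= (1 + C') * (e / Q) * Num.sqrt b.
  apply: (sq_b_bound b b0 N r hm) => //; first by apply: bmB; exact: bD.
    by rewrite mulr_ge0// addr_ge0// ltW.
  move=> i x iN xi; have ril := mesh_lt b N r hm _ iN.
  have /andP[a0 ab] := mesh_node b N r hm _ (ltnW iN); have /andP[_ cb] := mesh_node b N r hm _ iN.
  have bt := bm_elt b N r hm _ i iN (bU t tT); have bs := bm_elt b N r hm _ i iN (bU s sT).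
  have dbd x'' : r i <= x'' <= r i.+1 -> `|Ut t x'' - Ut s x''| <= e / Q.
    by move=> /andP[? ?]; apply: hd => //; apply/andP; split; lra.
  have xi' : r i <= x <= r i.+1 by case/andP: xi => ? ?; rewrite !ltW.
  have [_ k1 _ _] := hC' _ _ (fun x => Ut t x - Ut s x) _ ril (bmB _ _ _ _ bt bs) dbd x xi'.
  move: k1; rewrite (radpB k _ _ _ _ bt bs) hornerD hornerN => k1.
  have Dx s' : D s' x = Ut s' x - (radp k (r i) (r i.+1) (Ut s')).[x].
    exact: (congr1 (fun q => Ut s' x - q) (bfE b N r hm _ i x iN xi)).
  rewrite (Dx t) (Dx s) mulrDl mul1r.
  exact: (diff_bound _ _ _ _ _ _ (dbd x xi') k1).
have e1 : n2 0 b (D t) <= n2 0 b (D s) + n2 0 b (fun x => D t x - D s x).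
  have eD : D t = (fun x => D s x + (D t x - D s x)) by apply/funext => x; exact: esym (subrKC _ _).
  rewrite {1}eD; exact: (n2D (bD s sT) (bmB _ _ _ _ (bD t tT) (bD s sT))).
apply: (le_trans e1); apply: lerD; first exact: good.
apply: (le_trans h1); rewrite (_ : (1 + C') * (e / Q) * Num.sqrt b = (Q - 1) * (e / Q)); last by rewrite /Q; ring.
have -> : (Q - 1) * (e / Q) = e - e / Q by field; rewrite gt_eqF.
by rewrite gerBl.
Qed.

End Projections.

End Regularity.

(** Everything that the evolution of the error uses about the exact solution, under a single
    constant [L] that does not depend on the mesh. *)
Record regular {R : realType} (k : nat) (b T L : R) (u V Ut : R -> R -> R) : Prop := Regular {
  rg_L : 0 <= L;
  rg_exact : forall t, 0 < t < T -> exact_at b L (u t) (V t) (Ut t);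
  rg_lip : forall t x y, 0 <= t <= T -> 0 <= x <= b -> 0 <= y <= b -> `|u t x - u t y| <= L * `|x - y|;
  rg_dbd : forall t s x, 0 <= t <= T -> 0 <= s <= T -> 0 <= x <= b -> `|u t x - u s x| <= L * `|t - s|;
  rg_dlip : forall t s x y, 0 <= t <= T -> 0 <= s <= T -> 0 <= x <= b -> 0 <= y <= b ->
    `|(u t x - u s x) - (u t y - u s y)| <= L * `|t - s| * `|x - y|;
  rg_dV : forall t s x, 0 < t < T -> 0 < s < T -> 0 < x < b -> `|V t x - V s x| <= L * `|t - s|;
  rg_dt : forall t x, 0 < t < T -> 0 <= x <= b -> is_derive t 1 (u^~ x) (Ut t x);
  rg_Utlip : forall t x y, 0 < t < T -> 0 <= x <= b -> 0 <= y <= b -> `|Ut t x - Ut t y| <= L * `|x - y|;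
  rg_radp : forall t a c x, 0 <= t <= T -> 0 <= a -> a < c -> c <= b -> a <= x <= c ->
    `|u t x - (radp k a c (u t)).[x]| <= L * (c - a) ^+ k.+1;
  rg_radp_lip : forall t a c x y, 0 <= t <= T -> 0 <= a -> a < c -> c <= b -> a <= x <= c -> a <= y <= c ->
    `|(u t x - (radp k a c (u t)).[x]) - (u t y - (radp k a c (u t)).[y])| <= L * (c - a) ^+ k * `|x - y|;
  rg_radpt : forall t N r, 0 < t < T -> mesh b N r ->
    n2 0 b (fun x => Ut t x - bf N r (fun i => radp k (r i) (r i.+1) (Ut t)) x) <= L * mesh_size N r ^+ k.+1 }.

Lemma regular_exists {R : realType} (k : nat) (b T : R) (Ub : R -> R) (u w g z : R -> R -> R) :
  (1 <= k)%N -> 0 < b -> 0 < T -> exact_solution b T Ub u w g z ->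
  in_Linfty_sobolev T b k.+1 +oo%E u -> in_Linfty_sobolev T b k.+1 2%:E (dt u) ->
  (exists L V Ut, regular k b T L u V Ut) /\
  forall t x, 0 <= t <= T -> 0 <= x <= b ->
    [/\ w t x = itg 0 x (u t), g t x = gg b (u t) x & z t x = itg 0 x (gg b (u t))].
Proof.
move=> hk b0 T0 hex hu hut; have [M M0 hae] := ae_goodt k b T u b0 hu hut.
have gd := ae_dense T (goodt k b u M) T0 hae.
split; last first.
  move=> t x tT xb; split.
  - exact: (rg_w b T Ub u w g z hex t x tT xb).
  - exact: (rg_g k b T Ub u w g z b0 hex M gd t x tT xb).
  - exact: (rg_z k b T Ub u w g z b0 hex M gd t x tT xb).
have [C C0 hC] := proj_approx (R := R) k; have [C' C'0 hC'] := proj_bound (R := R) k.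
pose Lb_ := Lb b M; pose Ld_ := Ld b M.
have Lb0' : 0 <= Lb_ := Lb0 b b0 M M0.
have Ld0' : 0 <= Ld_ := Ld0 b b0 M M0.
pose Lu := `|u 0 0| + M * b + Lb_ * T.
have Lu0 : 0 <= Lu by rewrite !addr_ge0// mulr_ge0// ltW.
have CM0 : 0 <= C * M by rewrite mulr_ge0// ltW.
pose L := M + Lb_ + Ld_ + C * M + Lu.
have [L1 L2 L3 [L4 L5]] : [/\ M <= L, Lb_ <= L, Ld_ <= L & C * M <= L /\ Lu <= L].
  by rewrite /L; split; [lra|lra|lra|split; lra].
have L0 : 0 <= L by apply: le_trans L1.
exists L, (V u), (Ut b u M).
have cl t : 0 < t < T -> 0 <= t <= T by move=> /andP[? ?]; rewrite !ltW.
have up (A B q : R) : A <= L -> 0 <= q -> B <= A * q -> B <= L * q.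
  by move=> AL q0 h; apply: (le_trans h); rewrite ler_wpM2r.
split=> //.
- move=> t tT; have [hU hL] := UtP k b T Ub u w g z hk b0 hex M M0 gd t tT; split.
  + move=> x xb; apply: le_trans L5; rewrite /Lu.
    have z0 : 0 <= (0 : R) <= b by rewrite lexx ltW.
    have T00 : 0 <= (0 : R) <= T by rewrite lexx ltW.
    have h1 := u_lip k b T Ub u w g z b0 hex M gd t x 0 (cl t tT) xb z0.
    have h2 := u_dbd k b T Ub u w g z b0 hex M M0 gd t 0 0 (cl t tT) T00 z0.
    rewrite subr0 in h1; rewrite subr0 in h2.
    have -> : u t x = u 0 0 + (u t x - u t 0) + (u t 0 - u 0 0) by ring.
    apply: (le_trans (ler_normD _ _)); apply: lerD.
      apply: (le_trans (ler_normD _ _)); rewrite lerD2l; apply: (le_trans h1).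
      by rewrite ler_wpM2l// ger0_norm; case/andP: xb.
    by apply: (le_trans h2); rewrite ler_wpM2l// ger0_norm; case/andP: (cl t tT).
  + move=> x y xb yb; apply: (up M _ _ L1 (normr_ge0 _)).
    exact: (u_lip k b T Ub u w g z b0 hex M gd t x y (cl t tT) xb yb).
  + by move=> x xb; have [] := pde k b T Ub u w g z b0 hex M gd t x tT xb.
  + by move=> x xb; exact: (V_cont k b T Ub u w g z hk b0 hex M M0 gd t x tT xb).
  + by move=> x xb; apply: (le_trans (V_bd k b T Ub u w g z b0 hex M gd t x tT xb)).
  + by move=> x xb; rewrite hU//; have [] := pde k b T Ub u w g z b0 hex M gd t x tT xb.
- by move=> t x y tT xb yb; apply: (up M) => //; exact: (u_lip k b T Ub u w g z b0 hex M gd).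
- by move=> t s x tT sT xb; apply: (up Lb_) => //; exact: (u_dbd k b T Ub u w g z b0 hex M M0 gd).
- move=> t s x y tT sT xb yb; rewrite -mulrA; apply: (up Ld_ _ _ L3 (mulr_ge0 (normr_ge0 _) (normr_ge0 _))).
  rewrite mulrA; exact: (u_dlip k b T Ub u w g z hk b0 hex M M0 gd t s x y tT sT xb yb).
- by move=> t s x tT sT xb; apply: (up Ld_) => //; exact: (V_dbd k b T Ub u w g z hk b0 hex M M0 gd).
- by move=> t x tT xb; exact: (Ut_derive k b T Ub u w g z hk b0 hex M M0 gd).
- move=> t x y tT xb yb; have [_ hL] := UtP k b T Ub u w g z hk b0 hex M M0 gd t tT.
  by apply: (up Ld_) => //; exact: hL.
- move=> t a c x tT a0 ac cb xac.
  have [h1 _] := radp_all k b T Ub u w g z hk b0 hex M M0 gd C C' C'0 hC hC' t a c x x tT a0 ac cb xac xac.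
  have c0 : 0 <= (c - a) ^+ k.+1 by rewrite exprn_ge0// subr_ge0 ltW.
  by apply: (up (C * M) _ _ L4 c0); rewrite -mulrA.
- move=> t a c x y tT a0 ac cb xac yac.
  have [_ h1] := radp_all k b T Ub u w g z hk b0 hex M M0 gd C C' C'0 hC hC' t a c x y tT a0 ac cb xac yac.
  have ca : c - a != 0 by rewrite subr_eq0 gt_eqF.
  have c0 : 0 <= (c - a) ^+ k * `|x - y| by rewrite mulr_ge0// exprn_ge0// subr_ge0 ltW.
  rewrite -mulrA; apply: (up (C * M) _ _ L4 c0).
  apply: (le_trans h1); apply: eq_ler; rewrite exprS.
  by move: ((c - a) ^+ k) (`|x - y|) => p q; field.
- move=> t N r tT hm.
  have c0 : 0 <= mesh_size N r ^+ k.+1.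
    rewrite exprn_ge0//; apply: le_trans (mesh_h N r 0 (mesh_N b N r hm b0)).
    by rewrite subr_ge0 (mesh_le b N r hm)// (mesh_N b N r hm b0).
  apply: (up (C * M) _ _ L4 c0).
  exact: (radpt k b T Ub u w g z hk b0 hex M M0 gd C C' C0 C'0 hC hC' t N r tT hm).
Qed.

(** * Evolution of the error *)

Lemma within_bsum {R : realType} (a c : R) n (F : 'I_n -> R -> R) :
  (forall i, {within `[a, c], continuous (F i)}) ->
  {within `[a, c], continuous (fun x => \sum_(i < n) F i x)}.
Proof.
elim: n F => [|n ih] F hF.
  by rewrite (_ : (fun x => _) = (fun _ => 0)); [exact: within_cst|apply/funext => x; rewrite big_ord0].
rewrite (_ : (fun x => _) = (fun x => \sum_(i < n) F (widen_ord (leqnSn n) i) x + F ord_max x)).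
  by apply: within_add; [apply: ih => i; exact: hF|exact: hF].
by apply/funext => x; rewrite big_ord_recr.
Qed.

Lemma within_ext {R : realType} (a c : R) (f g : R -> R) : (forall x, a <= x <= c -> f x = g x) ->
  {within `[a, c], continuous f} -> {within `[a, c], continuous g}.
Proof.
move=> fg /within_epsP h; apply/within_epsP => x xac e e0; have [d d0 hd] := h x xac e e0.
by exists d => // y yac xy; rewrite -!fg// hd.
Qed.

Lemma within_horner {R : realType} (a c : R) n (p : R -> {poly R}) x :
  (forall s, a <= s <= c -> (size (p s) <= n)%N) ->
  (forall j, (j < n)%N -> {within `[a, c], continuous (fun s => (p s)`_j)}) ->
  {within `[a, c], continuous (fun s => (p s).[x])}.
Proof.
move=> sp cp; apply: (within_ext _ _ (fun s => \sum_(j < n) (p s)`_j * x ^+ j)).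
  by move=> s sac; rewrite -horner_coef_wide// sp.
by apply: within_bsum => j; apply: within_mul; [exact: cp|exact: within_cst].
Qed.

Lemma within_n2sq {R : realType} (b : R) N r (hm : mesh b N r) n (E : R -> nat -> {poly R}) t0 t1 :
  (forall s i, t0 <= s <= t1 -> (i < N)%N -> (size (E s i) <= n)%N) ->
  (forall i j, (i < N)%N -> (j < n)%N -> {within `[t0, t1], continuous (fun s => (E s i)`_j)}) ->
  {within `[t0, t1], continuous (fun s => n2 0 b (bf N r (E s)) ^+ 2)}.
Proof.
move=> sE cE.
apply: (within_ext _ _ (fun s => \sum_(l < N) \sum_(i < n) \sum_(j < n)
   (E s l)`_i * (E s l)`_j * itg (r l) (r l.+1) (fun x => x ^+ i * x ^+ j))).
  move=> s sI; rewrite (n2_bf_sq b N r hm); apply: eq_bigr => -[l lN] _ /=.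
  by rewrite -itg_pq ?sE//; apply: eq_itg => x _; rewrite expr2.
apply: within_bsum => -[l lN]; apply: within_bsum => i; apply: within_bsum => j /=.
apply: within_mul; last exact: within_cst.
by apply: within_mul; apply: cE.
Qed.

Lemma is_derive_shift {R : realType} (f : R -> R) (t tau D : R) :
  is_derive (t + tau) 1 f D -> is_derive t 1 (fun s => f (s + tau)) D.
Proof.
move=> df; apply: eps_is_derive => e e0; have [d d0 hd] := is_derive_eps f _ D df e e0.
by exists d => // h h0 hd'; rewrite (_ : t + h + tau = t + tau + h); [exact: hd|ring].
Qed.

Lemma is_derive_within {R : realType} (f g : R -> R) (a c : R) :
  (forall x, a <= x <= c -> is_derive x 1 f (g x)) -> {within `[a, c], continuous f}.
Proof.
move=> df; apply: cont_within => x /df dx.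
by apply: differentiable_continuous; apply/derivable1_diffP; have [] := dx.
Qed.

(** * Differentiability in time of the projections *)

Section TimeDiff.
Context {R : realType}.
Implicit Types (F G : R -> R -> R) (f g : R -> R) (t a c : R).

(** Differentiability in time uniformly in space, so that it passes to moments and from there to the
    coefficients of both projections. *)
Definition tdiff F f t a c := [/\ bm a c f, bm a c (F t) & forall e, 0 < e -> exists2 d : R, 0 < d &
  forall h, 0 < `|h| -> `|h| < d -> bm a c (F (t + h)) /\
    forall x, a <= x <= c -> `|F (t + h) x - F t x - f x * h| <= e * `|h|].

Lemma tdiffB F G f g t a c : tdiff F f t a c -> tdiff G g t a c ->
  tdiff (fun s x => F s x - G s x) (fun x => f x - g x) t a c.
Proof.
move=> [bf1 bF hF] [bg1 bG hG]; split; [exact: bmB|exact: bmB|move=> e e0].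
have e2 : 0 < e / 2 by rewrite divr_gt0.
have [d1 d10 h1] := hF _ e2; have [d2 d20 h2] := hG _ e2.
exists (Num.min d1 d2); first by rewrite lt_min d10 d20.
move=> h h0; rewrite lt_min => /andP[hd1 hd2]; have [b1 k1] := h1 h h0 hd1; have [b2 k2] := h2 h h0 hd2.
split=> [|x xac]; first exact: bmB.
have := k1 x xac; have := k2 x xac; rewrite !ler_norml => /andP[? ?] /andP[? ?].
by apply/andP; split; lra.
Qed.

Lemma tdiff_cst F f t a c y : a <= y <= c -> tdiff F f t a c ->
  tdiff (fun s _ => F s y) (fun _ => f y) t a c.
Proof.
move=> yac [bf1 bF hF]; split; [exact: bm_cst|exact: bm_cst|move=> e e0].
have [d d0 hd] := hF e e0; exists d => // h h0 hd'; split=> [|x _]; first exact: bm_cst.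
by have [_] := hd h h0 hd'; apply.
Qed.

Lemma tdiff_at F f t a c y : a <= y <= c -> tdiff F f t a c -> is_derive t 1 (F^~ y) (f y).
Proof.
move=> yac [_ _ hF]; apply: eps_is_derive => e e0; have [d d0 hd] := hF e e0.
by exists d => // h h0 hd'; have [_] := hd h h0 hd'; apply.
Qed.

Lemma tdiff_mom F f t a c l : a < c -> tdiff F f t a c ->
  is_derive t 1 (fun s => mom a c (F s) l) (mom a c f l).
Proof.
move=> ac [bf1 bF hF]; apply: eps_is_derive => e e0.
have e2 : 0 < e / (c - a) by rewrite divr_gt0 ?subr_gt0.
have [d d0 hd] := hF _ e2; exists d => // h h0 hd'; have [bh kh] := hd h h0 hd'.
have b1 := bm_mom a c _ l bh; have b2 := bm_mom a c _ l bF; have b3 := bm_mom a c _ l bf1.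
have -> : mom a c (F (t + h)) l - mom a c (F t) l - mom a c f l * h =
  mom a c (fun x => F (t + h) x - F t x - h * f x) l.
  rewrite /mom -(itgB b1 b2) mulrC -(itgZl h b3) -itgB; last first.
    by apply: bmM; [exact: bm_cst|exact: b3].
    by apply: bmB.
  by apply: eq_itg => x _; ring.
have bb : bm a c (fun x => F (t + h) x - F t x - h * f x).
  by apply: bmB; [exact: bmB|apply: bmM; [exact: bm_cst|]].
have -> : e * `|h| = e / (c - a) * `|h| * (c - a) by field; rewrite subr_eq0 gt_eqF.
apply: (mom_bound a c _ _ l ac bb) => x /andP[ax xc]; rewrite [h * _]mulrC.
by apply: kh; rewrite !ltW.
Qed.

Lemma l2p_coef k a c f j : (l2p k a c f)`_j = \sum_(l < k.+1) mom a c f l * (bas 1 k.+1 a c l)`_j.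
Proof. by rewrite /l2p /prj coef_sum; apply: eq_bigr => l _; rewrite coefZ. Qed.

Lemma radp_coef k a c f j : (radp k a c f)`_j = (if j == 0%N then f a else 0) +
  \sum_(l < k) mom a c (fun x => f x - f a) l * (afi a c * bas 'X k a c l)`_j.
Proof.
rewrite /radp coefD coefC /prj mulr_sumr coef_sum; congr (_ + _); apply: eq_bigr => l _.
by rewrite -scalerAr coefZ.
Qed.

Lemma is_derive_mulr_cst (f : R -> R) (t D m : R) : is_derive t 1 f D ->
  is_derive t 1 (fun s => f s * m) (D * m).
Proof.
move=> df; have dm : is_derive t 1 (fun _ : R => m) 0 by exact: is_derive_cst.
have d4 := is_deriveM df dm; rewrite (_ : (fun s => f s * m) = f * (fun _ => m)); last by apply/funext.
by apply: (is_derive_eq d4); rewrite /GRing.scale/= mulr0 add0r mulrC.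
Qed.

Lemma tdiff_l2p k F f t a c j : a < c -> tdiff F f t a c ->
  is_derive t 1 (fun s => (l2p k a c (F s))`_j) (l2p k a c f)`_j.
Proof.
move=> ac h; rewrite l2p_coef (_ : (fun s => _) = (fun s => \sum_(l < k.+1) mom a c (F s) l * (bas 1 k.+1 a c l)`_j)).
  by apply: is_derive_bsum => l; apply: is_derive_mulr_cst; exact: tdiff_mom.
by apply/funext => s; rewrite l2p_coef.
Qed.

Lemma tdiff_radp k F f t a c j : a < c -> tdiff F f t a c ->
  is_derive t 1 (fun s => (radp k a c (F s))`_j) (radp k a c f)`_j.
Proof.
move=> ac h; have aI : a <= a <= c by rewrite lexx ltW.
rewrite radp_coef (_ : (fun s => (radp k a c (F s))`_j) = (fun s => (if j == 0%N then F s a else 0) +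
  \sum_(l < k) mom a c (fun x => F s x - F s a) l * (afi a c * bas 'X k a c l)`_j)); last first.
  by apply/funext => s; rewrite radp_coef.
apply: is_deriveD.
  by case: (j == 0%N); [exact: (tdiff_at _ _ _ _ _ _ aI h)|exact: is_derive_cst].
apply: is_derive_bsum => l; apply: is_derive_mulr_cst.
have h2 := tdiffB _ _ _ _ _ _ _ h (tdiff_cst _ _ _ _ _ _ aI h).
exact: (tdiff_mom _ _ _ _ _ l ac h2).
Qed.

Lemma within_radp k F a c M t0 t1 j : a < c -> 0 <= M ->
  (forall s, t0 <= s <= t1 -> bm a c (F s)) ->
  (forall s s' x, t0 <= s <= t1 -> t0 <= s' <= t1 -> a <= x <= c -> `|F s x - F s' x| <= M * `|s - s'|) ->
  {within `[t0, t1], continuous (fun s => (radp k a c (F s))`_j)}.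
Proof.
move=> ac M0 hb hF; have aI : a <= a <= c by rewrite lexx ltW.
rewrite (_ : (fun s => (radp k a c (F s))`_j) = (fun s => (if j == 0%N then F s a else 0) +
  \sum_(l < k) mom a c (fun x => F s x - F s a) l * (afi a c * bas 'X k a c l)`_j)); last first.
  by apply/funext => s; rewrite radp_coef.
have lipI x y : t0 <= x -> x <= y -> y <= t1 -> [/\ t0 <= x <= t1, t0 <= y <= t1 & `|y - x| = y - x].
  by move=> h1 h2 h3; rewrite h1 h3 (le_trans h2) ?(le_trans h1)// ger0_norm ?subr_ge0.
apply: within_add.
  case: (j == 0%N); last exact: within_cst.
  apply: (lip_within _ _ _ M) => x y h1 h2 h3; have [xI yI e] := lipI x y h1 h2 h3.
  by rewrite -e; exact: hF.
apply: within_bsum => l; apply: within_mul; last exact: within_cst.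
apply: (lip_within _ _ _ (2 * M * (c - a))) => x y h1 h2 h3; have [xI yI e] := lipI x y h1 h2 h3.
have b1 s : t0 <= s <= t1 -> bm a c (fun x => F s x - F s a).
  by move=> sI; apply: bmB; [exact: hb|exact: bm_cst].
have b1x := b1 x xI; have b1y := b1 y yI.
rewrite /mom -(itgB (bm_mom a c _ l b1y) (bm_mom a c _ l b1x)).
rewrite (eq_itg (fun z => ((F y z - F y a) - (F x z - F x a)) * (afi a c).[z] ^+ l)); last by move=> z _; ring.
have -> : 2 * M * (c - a) * (y - x) = 2 * M * (y - x) * (c - a) by ring.
apply: (mom_bound a c _ _ l ac (bmB _ _ _ _ b1y b1x)) => z /andP[az zc].
have zI : a <= z <= c by rewrite !ltW.
have := hF y x z yI xI zI; have := hF y x a yI xI aI; rewrite e !ler_norml => /andP[? ?] /andP[? ?].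
by apply/andP; split; lra.
Qed.

End TimeDiff.

Arguments rg_L {R k b T L u V Ut} _.
Arguments rg_exact {R k b T L u V Ut} _ t _.
Arguments rg_lip {R k b T L u V Ut} _ t x y _ _ _.
Arguments rg_dbd {R k b T L u V Ut} _ t s x _ _ _.
Arguments rg_dlip {R k b T L u V Ut} _ t s x y _ _ _ _.
Arguments rg_dV {R k b T L u V Ut} _ t s x _ _ _.
Arguments rg_dt {R k b T L u V Ut} _ t x _ _.
Arguments rg_Utlip {R k b T L u V Ut} _ t x y _ _ _.
Arguments rg_radp {R k b T L u V Ut} _ t a c x _ _ _ _ _.
Arguments rg_radp_lip {R k b T L u V Ut} _ t a c x y _ _ _ _ _ _.
Arguments rg_radpt {R k b T L u V Ut} _ t N r _ _.

Lemma exact_at_mono {R : realType} (b L M : R) (U V Ut : R -> R) : L <= M ->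
  exact_at b L U V Ut -> exact_at b M U V Ut.
Proof.
move=> LM [h1 h2 h3 h4 h5 h6]; split=> //.
- by move=> x xb; apply: (le_trans (h1 x xb)).
- by move=> x y xb yb; apply: (le_trans (h2 x y xb yb)); apply: ler_wpM2r.
- by move=> x xb; apply: (le_trans (h5 x xb)).
Qed.

Lemma left_closed {R : realType} (f : R -> R) (T S : R) : {within `[0, T], continuous f} ->
  0 < S <= T -> (forall s, 0 < s < S -> f s <= 0) -> f S <= 0.
Proof.
move=> /within_epsP cf /andP[S0 ST] h; rewrite leNgt; apply/negP => fS.
have SI : 0 <= S <= T by rewrite ST ltW.
have e0 : 0 < f S / 2 by rewrite divr_gt0.
have [d d0 hd] := cf S SI _ e0.
pose m := Num.min (d / 2) (S / 2).
have m0 : 0 < m by rewrite lt_min !divr_gt0.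
have m1 : m <= d / 2 by rewrite ge_min lexx.
have m2 : m <= S / 2 by rewrite ge_min lexx orbT.
have sI : 0 < S - m < S by apply/andP; split; lra.
have sI' : 0 <= S - m <= T by apply/andP; split; lra.
have sd : `|S - (S - m)| < d by rewrite (_ : S - (S - m) = m) ?gtr0_norm//; [lra|ring].
have := hd _ sI' sd; have := h _ sI; rewrite ler_norml => h1 /andP[_ h2]; lra.
Qed.

(** Continuity method at the supremum [S] of the times up to which the bound holds: the factor 1/2
    makes the inequality strict at [S], so it extends beyond. The improvement is asked at [s < t]
    only, because difference quotients in time need room to the right. *)
Lemma bootstrap {R : realType} (T : R) (phi psi : R -> R) : 0 < T ->
  {within `[0, T], continuous phi} -> {within `[0, T], continuous psi} ->
  (forall t, 0 <= t <= T -> 0 < psi t) -> phi 0 <= 0 ->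
  (forall t, 0 < t <= T -> (forall s, 0 <= s <= t -> phi s <= psi s) ->
     forall s, 0 < s < t -> phi s <= psi s / 2) ->
  forall t, 0 <= t <= T -> phi t <= psi t.
Proof.
move=> T0 cphi cpsi psi0 phi0 step.
pose A := [set t : R | 0 <= t <= T /\ forall s, 0 <= s <= t -> phi s <= psi s].
have A0 : A 0.
  split; first by rewrite lexx ltW.
  move=> s; rewrite -eq_le => /eqP <-; apply: (le_trans phi0); apply: ltW; apply: psi0.
  by rewrite lexx ltW.
have Ab : ubound A T by move=> t [/andP[]].
have hsA : has_sup A by split; [exists 0|exists T].
pose S := sup A.
have S0 : 0 <= S by apply: ub_le_sup => //; exists T.
have ST : S <= T by apply: ge_sup => //; exists 0.
have below s : 0 <= s < S -> phi s <= psi s.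
  move=> /andP[s0 sS]; have eS : 0 < S - s by rewrite subr_gt0.
  have [t [tI ht] st] := sup_adherent eS hsA; apply: ht; rewrite s0/= ltW//.
  by move: st; rewrite -/S; lra.
have cd : {within `[0, T], continuous (fun s => phi s - psi s)} by exact: within_sub.
have cd2 : {within `[0, T], continuous (fun s => phi s - psi s * 2^-1)}.
  by apply: within_sub => //; apply: within_mul => //; exact: within_cst.
have AS : A S.
  split; first by rewrite S0.
  move=> s /andP[s0]; rewrite le_eqVlt => /predU1P[->|sS]; last by apply: below; rewrite s0.
  move: S0; rewrite le_eqVlt => /predU1P[<-|S0']; first by case: A0 => _; apply; rewrite lexx.
  rewrite -subr_le0; apply: (left_closed (fun s => phi s - psi s) T S cd); first by rewrite S0' ST.
  by move=> s' /andP[h1 h2]; rewrite subr_le0 below// h2 ltW.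
have lt : phi S < psi S.
  have SI : 0 <= S <= T by rewrite S0 ST.
  have pS := psi0 S SI.
  move: (S0); rewrite le_eqVlt => /predU1P[SE|S0'].
    by rewrite -SE in pS *; exact: (le_lt_trans phi0).
  have h : phi S - psi S * 2^-1 <= 0.
    apply: (left_closed (fun s => phi s - psi s * 2^-1) T S cd2); first by rewrite S0' ST.
    move=> s sI; rewrite subr_le0; apply: (step S _ AS.2 s sI); by rewrite S0' ST.
  by lra.
move: ST; rewrite le_eqVlt => /predU1P[ST|ST].
  by move=> t tT; apply: AS.2; rewrite ST.
have SI : 0 <= S <= T by rewrite S0 ltW.
have e0 : 0 < (psi S - phi S) / 2 by rewrite divr_gt0 ?subr_gt0.
have [d d0 hd] := (within_epsP.1 cd) S SI _ e0.
pose m := Num.min (d / 2) (T - S).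
have m0 : 0 < m by rewrite lt_min divr_gt0 ?subr_gt0.
have m1 : m <= d / 2 by rewrite ge_min lexx.
have m2 : m <= T - S by rewrite ge_min lexx orbT.
have : A (S + m).
  split; first by apply/andP; split; lra.
  move=> s /andP[s0 sS]; case: (lerP s S) => sS'; first by apply: AS.2; rewrite s0.
  have sI : 0 <= s <= T by rewrite s0/=; lra.
  have sd : `|S - s| < d by rewrite ltr_norml; apply/andP; split; lra.
  by have := hd s sI sd; rewrite ler_norml => /andP[h1 h2]; lra.
move=> AS2; have : S + m <= S by apply: ub_le_sup => //; exists T.
by lra.
Qed.

(** * The evolution of the error on a fixed mesh *)

Section Dynamics.
Context {R : realType} (k : nat) (b T L : R) (u V Ut : R -> R -> R) (Ub : R -> R).
Hypotheses (k1 : (1 <= k)%N) (b0 : 0 < b) (T0 : 0 < T) (hr : regular k b T L u V Ut).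

Lemma reg_bm t a c : 0 <= t <= T -> 0 <= a -> c <= b -> bm a c (u t).
Proof.
move=> tT a0 cb; have [_ [h _] _] := lip_good b L (u t) b0 (fun x y => rg_lip hr t x y tT).
exact: bmS h.
Qed.

(** By [rg_dlip] and [rg_Utlip] the difference quotients minus [Ut t] are equi-Lipschitz in space,
    so their pointwise convergence is uniform. *)
Lemma reg_tdiff t a c : 0 < t < T -> 0 <= a -> a < c -> c <= b -> tdiff u (Ut t) t a c.
Proof.
move=> tT a0 ac cb; have /andP[t0 tT'] := tT.
have tI : 0 <= t <= T by rewrite !ltW.
have L0 := rg_L hr.
have [_ [bUt _] _] := lip_good b L (Ut t) b0 (fun x y => rg_Utlip hr t x y tT).
split; [exact: bmS bUt|exact: reg_bm|].
pose A (s : R) := s != t /\ 0 <= s <= T.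
pose F (s x : R) := (u s x - u t x) / (s - t) - Ut t x.
have lipF s x y : A s -> 0 <= x <= b -> 0 <= y <= b -> `|F s x - F s y| <= (2 * L) * `|x - y|.
  move=> [st sI] xI yI.
  have -> : F s x - F s y = ((u s x - u t x) - (u s y - u t y)) / (s - t) - (Ut t x - Ut t y).
    by rewrite /F; ring.
  apply: (le_trans (ler_normB _ _)); rewrite normrM normfV.
  have st0 : 0 < `|s - t| by rewrite normr_gt0 subr_eq0.
  have h1 : `|(u s x - u t x) - (u s y - u t y)| / `|s - t| <= L * `|x - y|.
    rewrite ler_pdivrMr// (le_trans (rg_dlip hr s t x y sI tI xI yI))//; apply: eq_ler; ring.
  by have := rg_Utlip hr t x y tT xI yI; lra.
have ptw x : 0 <= x <= b -> forall e : R, 0 < e ->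
    exists2 d : R, 0 < d & forall s, A s -> `|t - s| < d -> `|F s x| <= e.
  move=> xI e e0; have [d d0 hd] := is_derive_eps _ t _ (rg_dt hr t x tT xI) e e0.
  exists d => // s [st sI] ts.
  have st0 : 0 < `|s - t| by rewrite normr_gt0 subr_eq0.
  have := hd (s - t) st0; rewrite distrC => /(_ ts); rewrite (addrC t) subrK => h.
  have -> : F s x = (u s x - u t x - Ut t x * (s - t)) / (s - t) by rewrite /F; field; rewrite subr_eq0.
  by rewrite normrM normfV ler_pdivrMr// [`|s - t|]distrC.
move=> e e0.
have L20 : 0 <= 2 * L by rewrite mulr_ge0.
have [d d0 hd] := equi_unif b (2 * L) A t F b0 L20 lipF ptw e e0.
exists (Num.min d (Num.min t (T - t))); first by rewrite !lt_min d0 t0 subr_gt0.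
move=> h h0; rewrite !lt_min => /and3P[h1 h2 h3].
have thT : 0 <= t + h <= T.
  by move: h2 h3; rewrite !ltr_norml => /andP[? ?] /andP[? ?]; apply/andP; split; lra.
split=> [|x /andP[ax xc]]; first exact: reg_bm.
have xI : 0 <= x <= b by rewrite (le_trans a0 ax) (le_trans xc cb).
have hne : h != 0 by rewrite -normr_gt0.
have Ah : A (t + h) by split=> //; rewrite -subr_eq0 addrAC subrr add0r.
have := hd (t + h) Ah; rewrite opprD addrA subrr add0r normrN => /(_ h1 x xI).
have -> : F (t + h) x = (u (t + h) x - u t x - Ut t x * h) / h.
  by rewrite /F (_ : t + h - t = h); [field|ring].
by rewrite normrM normfV ler_pdivrMr.
Qed.

Lemma reg_tdiff_shift t tau a c : 0 < t + tau < T -> 0 <= a -> a < c -> c <= b ->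
  tdiff (fun s => u (s + tau)) (Ut (t + tau)) t a c.
Proof.
move=> tT a0 ac cb; have [h1 h2 h3] := reg_tdiff (t + tau) a c tT a0 ac cb.
split=> // e e0; have [d d0 hd] := h3 e e0; exists d => // h h0 hd'.
by rewrite addrAC; exact: hd.
Qed.

Variables (N : nat) (r : nat -> R) (s : hdg_unknowns R).
Hypotheses (hm : mesh b N r) (hs : hdg_solution k b T Ub N r s).

Let H := mesh_size N r.
Let e t := eR k r s t (u t).

Lemma elt_in i : (i < N)%N -> [/\ 0 <= r i, r i < r i.+1 & r i.+1 <= b].
Proof.
move=> iN; have /andP[h1 _] := mesh_node _ _ _ hm i (ltnW iN).
by have /andP[_ h2] := mesh_node _ _ _ hm i.+1 iN; rewrite (mesh_lt _ _ _ hm i iN).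
Qed.

Lemma in_itv_T t : 0 <= t <= T -> t \in `[0, T]. Proof. by rewrite in_itv. Qed.

Lemma size_e t i : 0 <= t <= T -> (i < N)%N -> (size (e t i) <= k.+1)%N.
Proof. by move=> /in_itv_T tT iN; exact: (size_eR k b T Ub N r s hm hs t (u t) tT i iN). Qed.

Lemma within_e i j : (i < N)%N -> (j < k.+1)%N -> {within `[0, T], continuous (fun t => (e t i)`_j)}.
Proof.
move=> iN jk; have [h1 h2 h3] := elt_in i iN.
rewrite (_ : (fun t => _) = (fun t => (radp k (r i) (r i.+1) (u t))`_j - (uh s t i)`_j)); last first.
  by apply/funext => t; rewrite /e /eR /pR coefB.
apply: within_sub; last by have [h _ _] := hdg_C1 hs iN jk.
apply: (within_radp k u _ _ L) => //; first exact: (rg_L hr).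
  by move=> t tT; exact: reg_bm.
move=> t t' x tT tT' /andP[ax xc]; apply: (rg_dbd hr) => //.
by rewrite (le_trans h1 ax) (le_trans xc h3).
Qed.

Lemma within_dgn : {within `[0, T], continuous (fun t => dgn N r (e t))}.
Proof.
apply: (within_ext _ _ (fun t => n2 0 b (bf N r (eD k r s t (u t))) ^+ 2 + n2 0 b (bf N r (jq k N r s t (u t))) ^+ 2)).
  by move=> t _; rewrite -(dgn_n2 k b N r s hm).
have ch i x : (i < N)%N -> {within `[0, T], continuous (fun t => (e t i).[x])}.
  by move=> iN; apply: (within_horner _ _ k.+1) => [t tT|j jk]; [exact: size_e|exact: within_e].
apply: within_add.
  apply: (within_n2sq b N r hm k.+1) => [t i tT iN|i j iN jk].
    by rewrite /eD (leq_trans (size_poly _ _))// (leq_trans (leq_pred _))// size_e.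
  apply: (within_ext _ _ (fun t => (e t i)`_j.+1 * j.+1%:R)).
    by move=> t _; rewrite /eD coef_deriv mulr_natr.
  apply: within_mul; last exact: within_cst.
  move: jk; rewrite ltnS leq_eqVlt => /predU1P[->|jk]; last exact: within_e.
  apply: (within_ext _ _ (fun _ => 0)); last exact: within_cst.
  by move=> t tT; rewrite nth_default// size_e.
apply: (within_n2sq b N r hm k.+1) => [t i tT iN|i j iN jk].
  by rewrite /jq (leq_trans (size_polyC_leq1 _)).
apply: (within_ext _ _ (fun t => if j == 0%N then jump N r (e t) i / (r i.+1 - r i) else 0)).
  by move=> t _; rewrite /jq coefC.
case: (j == 0%N); last exact: within_cst.
apply: within_mul; last exact: within_cst.
rewrite /jump; apply: within_sub; last exact: ch.
by case: (boolP (i.+1 < N)%N) => h; [exact: ch|exact: within_cst].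
Qed.

Lemma within_n2e : {within `[0, T], continuous (fun t => n2 0 b (bf N r (e t)) ^+ 2)}.
Proof.
apply: (within_n2sq b N r hm k.+1) => [t i tT iN|i j iN jk]; first exact: size_e.
exact: within_e.
Qed.

Lemma derive_n2e t : 0 < t < T -> is_derive t 1 (fun t => n2 0 b (bf N r (e t)) ^+ 2)
  (2 * itg 0 b (fun x => bf N r (eRt k r s t (Ut t)) x * bf N r (e t) x)).
Proof.
move=> tT; have /andP[t0 tT'] := tT; have tI : 0 <= t <= T by rewrite !ltW.
apply: (is_derive_n2sq b N r hm k.+1).
- exists (Num.min t (T - t)); first by rewrite lt_min t0 subr_gt0.
  move=> s'; rewrite lt_min !ltr_norml => /andP[/andP[h1 h2] /andP[h3 h4]] i iN.
  by apply: size_e => //; apply/andP; split; lra.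
- move=> i iN; have [h1 h2 h3] := elt_in i iN; rewrite /eRt.
  rewrite (leq_trans (size_polyD _ _))// size_polyN geq_max size_radp//=.
  by have [_] := hdg_degree hs (in_itv_T _ tI) iN.
move=> i j iN jk; have [h1 h2 h3] := elt_in i iN.
have d1 := tdiff_radp k u _ _ _ _ j h2 (reg_tdiff t _ _ tT h1 h2 h3).
have [_ _ hd] := hdg_C1 hs iN jk; have tT2 : t \in `]0, T[ by rewrite in_itv.
have d2 := hd t tT2.
rewrite (_ : (fun t => (e t i)`_j) = (fun t => (radp k (r i) (r i.+1) (u t))`_j) - (fun t => (uh s t i)`_j)).
  rewrite /eRt coefB; exact: is_deriveB d1 d2.
by apply/funext => t'; rewrite /e /eR /pR coefB.
Qed.

Let dp tau t := dP k r s (t + tau) t (u (t + tau)) (u t).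

Lemma derive_n2dp tau t : 0 < tau -> 0 < t -> t + tau < T ->
  is_derive t 1 (fun t => n2 0 b (bf N r (dp tau t)) ^+ 2)
  (2 * itg 0 b (fun x => bf N r (dT k r s (t + tau) t (Ut (t + tau)) (Ut t)) x * bf N r (dp tau t) x)).
Proof.
move=> tau0 t0 tT; have tau0' := ltW tau0.
have tI1 : 0 < t < T by apply/andP; split; lra.
have tI2 : 0 < t + tau < T by apply/andP; split; lra.
have in_T t' : 0 < t' < T -> t' \in `[0, T] by move=> /andP[h1 h2]; rewrite in_itv/= !ltW.
apply: (is_derive_n2sq b N r hm k.+1).
- exists (Num.min t (T - (t + tau))); first by rewrite lt_min t0 subr_gt0.
  move=> s'; rewrite lt_min !ltr_norml => /andP[/andP[h1 h2] /andP[h3 h4]] i iN.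
  apply: (size_dP k b T Ub N r s hm hs) => //; apply: in_T; apply/andP; split; lra.
- move=> i iN; rewrite /dT (leq_trans (size_polyD _ _))// size_polyN geq_max.
  by rewrite !(size_eT k b T Ub N r s hm hs _ _ (in_T _ _))//.
move=> i j iN jk; have [h1 h2 h3] := elt_in i iN.
have td1 := reg_tdiff t _ _ tI1 h1 h2 h3; have td2 := reg_tdiff_shift t tau _ _ tI2 h1 h2 h3.
have d1 := tdiff_l2p k _ _ _ _ _ j h2 (tdiffB _ _ _ _ _ _ _ td2 td1).
have [_ _ hd] := hdg_C1 hs iN jk.
have d2 : is_derive t 1 (fun t => (uh s t i)`_j) (uh_t s t i)`_j by apply: hd; rewrite in_itv.
have d3 : is_derive t 1 (fun t => (uh s (t + tau) i)`_j) (uh_t s (t + tau) i)`_j.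
  by apply: (is_derive_shift (fun t => (uh s t i)`_j)); apply: hd; rewrite in_itv.
have d4 := is_deriveB d1 (is_deriveB d3 d2).
have [bu1 _ _] := td1; have [bu2 _ _] := td2.
rewrite (l2pB k _ _ _ _ bu2 bu1) in d4.
rewrite (_ : (fun t => (dp tau t i)`_j) = (fun s' => (l2p k (r i) (r i.+1) (fun x => u (s' + tau) x - u s' x))`_j) -
  ((fun t => (uh s (t + tau) i)`_j) - (fun t => (uh s t i)`_j))).
  apply: (is_derive_eq d4); rewrite /dT /eT !coefB; ring.
by apply/funext => t'; rewrite /dp /dP !coefB.
Qed.

Hypothesis (hUb : forall t, 0 <= t <= T -> u t b = Ub t).
Hypothesis (hi : hdg_initial k N r u s).
Variable C : R.
Hypotheses (C0 : 0 < C) (invC : inverse_ineq k.+1 C)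
  (traceC : trace_ineq k.+1 C) (weightC : weight_ineq k.+1 C).

Let L0 : 0 <= L := rg_L hr.
Let bbf p : bm 0 b (bf N r p) := bm_bf b N r hm p.
Let gbf p : good b (bf N r p) := good_bf b N r hm p b0.
Let lg t (tT : 0 <= t <= T) := lip_good b L (u t) b0 (fun x y => rg_lip hr t x y tT).

Lemma H_ge0 : 0 <= H.
Proof.
have h := mesh_h N r 0%N (mesh_N _ _ _ hm b0).
by apply: (le_trans _ h); rewrite subr_ge0 ltW// (mesh_lt _ _ _ hm)// (mesh_N _ _ _ hm b0).
Qed.

Lemma etaR_bound t i x : 0 <= t <= T -> (i < N)%N -> r i <= x <= r i.+1 ->
  `|u t x - (pR k r (u t) i).[x]| <= L * H ^+ k.+1.
Proof.
move=> tT iN xi; have [h1 h2 h3] := elt_in i iN.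
apply: (le_trans (rg_radp hr t _ _ x tT h1 h2 h3 xi)); apply: ler_wpM2l => //.
by apply: lerXn2r; rewrite ?nnegrE ?subr_ge0 ?(ltW h2)//; [exact: H_ge0|exact: mesh_h].
Qed.

Lemma etaR_lip t i x : 0 <= t <= T -> (i < N)%N -> r i <= x <= r i.+1 ->
  `|u t x - (pR k r (u t) i).[x]| <= L * (r i.+1 - r i) ^+ k * (x - r i).
Proof.
move=> tT iN xi; have [h1 h2 h3] := elt_in i iN; have /andP[ix _] := xi.
have aI : r i <= r i <= r i.+1 by rewrite lexx ltW.
have := rg_radp_lip hr t _ _ x (r i) tT h1 h2 h3 xi aI.
by rewrite radp_left subrr subr0 (ger0_norm (_ : 0 <= x - r i)) ?subr_ge0.
Qed.

Lemma etaR_elt t i x : (i < N)%N -> r i < x < r i.+1 -> etaR k N r (u t) x = u t x - (pR k r (u t) i).[x].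
Proof. by move=> iN xi; rewrite /etaR (bfE _ _ _ hm _ i x iN xi). Qed.

(** Bound of [Kf] for u_h = u - e - (u - Pi u): the three summands come from [u], from the broken
    Hardy inequality with [dgn <= 1], and from the Gauss--Radau error. *)
Definition Kc := L * Num.sqrt b + 6 + 2 * (L * b ^+ k) * Num.sqrt b.

Lemma Kf_lin f M : bm 0 b f -> good b f -> 0 <= M ->
  (forall i x, (i < N)%N -> r i < x < r i.+1 -> `|Xf f x| <= M * x) -> Kf b f <= M * Num.sqrt b.
Proof.
move=> bf1 gf M0 h; rewrite /Kf; apply: (sq_b_bound b b0 N r hm) => //; first exact: bm_qf.
move=> i x iN xi; have xb := mesh_in _ _ _ hm i x iN xi; have /andP[x0 _] := xb; rewrite /qf normrM normfV (gtr0_norm x0) ler_pdivrMr//; exact: (h i).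
Qed.

Lemma Kf_u t : 0 <= t <= T -> Kf b (u t) <= Kc.
Proof.
move=> tT; have [_ gu hX] := lg t tT.
have hX' i x : (i < N)%N -> r i < x < r i.+1 -> `|Xf (u t) x| <= L * x by move=> iN xi; exact: hX (mesh_in _ _ _ hm i x iN xi).
apply: (le_trans (Kf_lin _ L gu.1 gu L0 hX')); rewrite /Kc.
have : 0 <= 2 * (L * b ^+ k) * Num.sqrt b by rewrite !mulr_ge0// exprn_ge0// ltW.
by move=> h; lra.
Qed.

Lemma good_etaR t : 0 <= t <= T -> good b (etaR k N r (u t)).
Proof. by move=> tT; have [_ gu _] := lg t tT; apply: goodB. Qed.

Lemma Kf_etaR t : 0 <= t <= T -> Kf b (etaR k N r (u t)) <= 2 * (L * b ^+ k) * Num.sqrt b.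
Proof.
move=> tT; have ge := good_etaR t tT; have M0 : 0 <= L * b ^+ k by rewrite mulr_ge0// exprn_ge0// ltW.
apply: Kf_lin => //; [exact: ge.1|by rewrite mulr_ge0|move=> j x jN xj].
have xb := mesh_in _ _ _ hm j x jN xj; have /andP[x0 xb'] := xb.
have pt i y : (i < N)%N -> r i < y < r i.+1 -> `|etaR k N r (u t) y| <= L * b ^+ k * y.
  move=> iN yi; have [h1 h2 h3] := elt_in i iN; have /andP[iy yi'] := yi.
  have yI : r i <= y <= r i.+1 by rewrite !ltW.
  rewrite (etaR_elt t i y iN yi) (le_trans (etaR_lip t i y tT iN yI))//.
  apply: ler_pM; rewrite ?subr_ge0 ?(ltW iy)//; last by rewrite lerBlDr lerDl.
    by rewrite mulr_ge0// exprn_ge0// subr_ge0 ltW.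
  apply: ler_wpM2l => //; apply: lerXn2r; rewrite ?nnegrE ?subr_ge0 ?(ltW h2) ?(ltW b0)//.
  by rewrite lerBlDr (le_trans h3)// lerDl.
have hav : `|av (etaR k N r (u t)) x| <= L * b ^+ k * x.
  apply: (av_mesh_bound b N r hm _ _ _ ge.1); first by apply: mulr_ge0; [exact: M0|exact: ltW].
    by move=> i y iN yi yx; exact: (le_trans (pt i y iN yi) (ler_wpM2l M0 (ltW yx))).
  by rewrite x0 ltW.
rewrite /Xf; apply: (le_trans (ler_normB _ _)); have := pt j x jN xj; lra.
Qed.

Lemma Kf_uh t : 0 <= t <= T -> dgn N r (e t) <= 1 -> Kf b (bf N r (uh s t)) <= Kc.
Proof.
move=> tT hd; have [_ gu hX] := lg t tT.
have -> : bf N r (uh s t) = (fun x => u t x - (bf N r (e t) x + etaR k N r (u t) x)).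
  apply/funext => x; have := congr1 (fun F => F x) (zet_split k N r s t (u t)).
  by rewrite /zet /e /= => <-; ring.
have -> : (fun x => u t x - (bf N r (e t) x + etaR k N r (u t) x)) =
  (fun x => (u t x - bf N r (e t) x) - etaR k N r (u t) x) by apply/funext => x; ring.
have g1 := gbf (e t); have g2 := good_etaR t tT.
have g3 : good b (fun x => u t x - bf N r (e t) x) by apply: goodB.
have h1 := KfB b g3 g2.
have h2 := KfB b gu g1.
have h3 := Kf_bf b N r hm (e t) b0.
have h4 := Kf_etaR t tT.
have h5 : Num.sqrt (dgn N r (e t)) <= 1 by rewrite -[leRHS]sqrtr1 ler_wsqrtr.
have hX' i x : (i < N)%N -> r i < x < r i.+1 -> `|Xf (u t) x| <= L * x by move=> iN xi; exact: hX (mesh_in _ _ _ hm i x iN xi).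
have h6 := Kf_lin _ L gu.1 gu L0 hX'.
by rewrite /Kc; lra.
Qed.

(** The initial datum is the Gauss--Radau projection itself, by uniqueness, so every estimate starts
    from 0. *)
Lemma e0_eq i : (i < N)%N -> e 0 i = 0.
Proof.
move=> iN; have [h1 h2 h3] := elt_in i iN; have [sz orth left] := hi i iN.
have tT : 0 <= (0 : R) <= T by rewrite lexx ltW.
have bu := reg_bm 0 (r i) (r i.+1) tT h1 h3.
apply/eqP; rewrite /e /eR subr_eq0 eq_sym; apply/eqP; apply: radp_uniq => // v sv.
by rewrite itgE; exact: orth.
Qed.

Lemma dgn_e0 : dgn N r (e 0) = 0.
Proof.
rewrite /dgn big1// => -[i iN] _ /=; rewrite /jump (e0_eq i iN) deriv0 horner0.
have -> : (if (i.+1 < N)%N then (e 0 i.+1).[r i.+1] else 0) = 0.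
  by case: (boolP (i.+1 < N)%N) => // h; rewrite e0_eq// horner0.
by rewrite subrr expr0n mul0r addr0 (eq_itg (fun _ => 0)) ?itg0// => x _; rewrite horner0 expr0n.
Qed.

Lemma n2_e0 : n2 0 b (bf N r (e 0)) = 0.
Proof.
apply/eqP; rewrite eq_le n2_ge0 andbT.
have := sq_b_bound b b0 N r hm (bf N r (e 0)) 0 (bbf _) (lexx 0); rewrite mul0r; apply.
by move=> i x iN xi; rewrite (bfE _ _ _ hm _ i x iN xi) e0_eq// horner0 normr0.
Qed.

Lemma etaR_t_bound t (phi : nat -> {poly R}) : 0 < t < T ->
  `|\sum_(i < N) itg (r i) (r i.+1) (fun x => (Ut t x - (radp k (r i) (r i.+1) (Ut t)).[x]) * (phi i).[x])| <=
  L * H ^+ k.+1 * n2 0 b (bf N r phi).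
Proof.
move=> tT; have [_ [bUt _] _] := lip_good b L (Ut t) b0 (fun x y => rg_Utlip hr t x y tT).
pose rp i := radp k (r i) (r i.+1) (Ut t).
have bd := bmB _ _ _ _ bUt (bbf rp).
rewrite -(itg_bf b N r hm (fun x => (Ut t x - bf N r rp x) * bf N r phi x) (fun i x => (Ut t x - (radp k (r i) (r i.+1) (Ut t)).[x]) * (phi i).[x])).
- apply: (le_trans (CS bd (bbf phi))); apply: ler_wpM2r; first exact: n2_ge0.
  exact: (rg_radpt hr t N r tT hm).
- exact: bmM _ _ _ _ bd (bbf phi).
- by move=> i x iN xi; rewrite !(bfE _ _ _ hm _ i x iN xi).
Qed.

(** The constant of Gronwall's inequality for the squared error; in [CE] the added 1 gives
    [CE2 <= CE ^+ 2] and avoids a square root. *)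
Definition CE2 := 2 * C1 b L Kc C * expR ((2 * C1 b L Kc C + 1) * T).
Definition CE := 1 + CE2.

Lemma Kc_ge0 : 0 <= Kc.
Proof. by rewrite /Kc !addr_ge0 ?mulr_ge0 ?exprn_ge0 ?sqrtr_ge0 ?(ltW b0). Qed.

Lemma cS_Kc_ge0 : 0 <= cS b L Kc.
Proof. by have := Kc_ge0; rewrite /cS => h; rewrite addr_ge0 ?mulr_ge0 ?sqr_ge0 ?sqrtr_ge0. Qed.

Lemma C1_Kc_ge0 : 0 <= C1 b L Kc C.
Proof.
have := Kc_ge0; have h := cS_Kc_ge0; rewrite /C1 => h'.
have s1 := sqrtr_ge0 b; have s2 := sqrtr_ge0 C; have k2 := sqr_ge0 Kc.
by rewrite !addr_ge0 ?ler01 ?(mulr_ge0 h) ?addr_ge0 ?ler01 ?mulr_ge0.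
Qed.

Lemma CE_ge0 : 0 <= CE.
Proof. by rewrite /CE addr_ge0 ?ler01// /CE2 !mulr_ge0 ?C1_Kc_ge0 ?expR_ge0. Qed.

Lemma level1_dynamic t1 : 0 <= t1 <= T -> (forall t, 0 <= t <= t1 -> dgn N r (e t) <= 1) ->
  n2 0 b (bf N r (e t1)) <= CE * H ^+ k.+1.
Proof.
move=> /andP[t10 t1T] hd; have c10 := C1_Kc_ge0.
have Hk : 0 <= H ^+ k.+1 by rewrite exprn_ge0 ?H_ge0.
have CE0 := CE_ge0.
apply: sqr_le_le; first exact: mulr_ge0.
pose c := 2 * C1 b L Kc C.
have c0 : 0 <= c by rewrite mulr_ge0.
have cw := withinS 0 t1 (lexx 0) t1T (within_n2e).
have der t : 0 < t < t1 -> is_derive t 1 (fun t => n2 0 b (bf N r (eR k r s t (u t))) ^+ 2)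
   (2 * itg 0 b (fun x => bf N r (eRt k r s t (Ut t)) x * bf N r (eR k r s t (u t)) x)).
  move=> /andP[t0 tt1]; apply: (derive_n2e).
  by rewrite t0 (lt_le_trans tt1).
have bd t : 0 < t < t1 -> 2 * itg 0 b (fun x => bf N r (eRt k r s t (Ut t)) x * bf N r (eR k r s t (u t)) x) <=
   c * (n2 0 b (bf N r (eR k r s t (u t))) ^+ 2) + (c * (H ^+ k.+1) ^+ 2) * expR ((c + 1) * t).
  move=> /andP[t0 tt1]; have tT : 0 < t < T by rewrite t0 (lt_le_trans tt1).
  have tI : 0 <= t <= T by case/andP: tT => h1 h2; rewrite !ltW.
  have dt1 : dgn N r (e t) <= 1 by apply: hd; rewrite !ltW.
  have l1 := level1 k b T Ub N r s b0 hm hs t L Kc C (u t) (V t) (Ut t) (in_itv_T t tI) (rg_exact hr t tT)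
    (hUb t tI) C0 invC (Kf_u t tI) (Kf_uh t tI dt1) (fun i x => etaR_bound t i x tI)
    (fun phi _ => etaR_t_bound t phi tT).
  apply: (le_trans l1); rewrite -/c mulrDr lerD2l -[X in X <= _]mulr1; apply: ler_wpM2l.
    by rewrite mulr_ge0 ?sqr_ge0.
  by rewrite -expR0 ler_expR mulr_ge0 ?addr_ge0 ?ler01// ltW.
(* The constant forcing has been bounded by one with exponential rate [c + 1], so the quotient in
   [gronwall] is a division by 1. *)
have cl : c < c + 1 by rewrite ltrDl.
have g := gronwall _ _ c (c * (H ^+ k.+1) ^+ 2) (c + 1) 0 t1 t10 cl cw der bd.
apply: (le_trans g); rewrite -/(e 0) n2_e0 expr0n mulr0 add0r (_ : c + 1 - c = 1); last by ring.
rewrite divr1 subr0 !mulr0 expR0 mulr1.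
have h1 : expR ((c + 1) * t1) - expR (c * t1) <= expR ((c + 1) * T).
  have : 0 <= expR (c * t1) by exact: expR_ge0.
  have : expR ((c + 1) * t1) <= expR ((c + 1) * T) by rewrite ler_expR ler_wpM2l// addr_ge0.
  by lra.
have q0 : 0 <= c * (H ^+ k.+1) ^+ 2 by rewrite mulr_ge0 ?sqr_ge0.
apply: (le_trans (ler_wpM2l q0 h1)).
have -> : c * (H ^+ k.+1) ^+ 2 * expR ((c + 1) * T) = CE2 * (H ^+ k.+1) ^+ 2 by rewrite /CE2 /c; ring.
rewrite exprMn; apply: ler_wpM2r; first exact: sqr_ge0.
have h2 : 0 <= CE2 by rewrite /CE2 !mulr_ge0 ?expR_ge0.
by rewrite /CE; nra.
Qed.

Lemma n2_zeta t : 0 <= t <= T ->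
  n2 0 b (fun x => u t x - bf N r (uh s t) x) <= n2 0 b (bf N r (e t)) + L * H ^+ k.+1 * Num.sqrt b.
Proof.
move=> tT; have be := good_etaR t tT.
rewrite (eq_n2 (fun x => bf N r (e t) x + etaR k N r (u t) x)); last first.
  move=> x _; have := congr1 (fun F => F x) (zet_split k N r s t (u t)); by rewrite /zet /e.
apply: (le_trans (n2D (bbf _) be.1)); rewrite lerD2l.
have Hk : 0 <= H ^+ k.+1 by rewrite exprn_ge0 ?H_ge0.
apply: (sq_b_bound b b0 N r hm) => //; [exact: be.1|exact: mulr_ge0|].
move=> i x iN xi; rewrite (etaR_elt t i x iN xi); apply: etaR_bound => //.
by case/andP: xi => h1 h2; rewrite !ltW.
Qed.

Variable Cp : R.
Hypotheses (Cp0 : 0 < Cp) (hCp : forall a c f (p : {poly R}) E, a < c -> bm a c f -> (size p <= k.+1)%N ->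
  (forall x, a <= x <= c -> `|f x - p.[x]| <= E) ->
  forall x, a <= x <= c -> `|f x - (l2p k a c f).[x]| <= Cp * E).

Let Y t := n2 0 b (bf N r (eT k r s t (Ut t))).
Let K := Kc.

Lemma coef_small t : 0 < t < T -> forall eps, 0 < eps -> exists2 d : R, 0 < d &
  forall i j h, (i < N)%N -> (j < k.+1)%N -> 0 < `|h| -> `|h| < d ->
  `|(dp h t i)`_j - (eT k r s t (Ut t) i)`_j * h| <= eps * `|h|.
Proof.
move=> tT eps eps0; have /andP[t0 tT'] := tT; have tI : 0 <= t <= T by rewrite !ltW.
pose P i j d := forall h : R, 0 < `|h| -> `|h| < d -> `|(dp h t i)`_j - (eT k r s t (Ut t) i)`_j * h| <= eps * `|h|.
have mono i j d d' : P i j d -> d' <= d -> P i j d' by move=> hP dd h h0 hd; apply: hP => //; apply: (lt_le_trans hd).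
have [d d0 hd] : exists2 d : R, 0 < d & forall i, (i < N)%N -> forall j, (j < k.+1)%N -> P i j d.
  apply: (@finite_common R (fun i d => forall j, (j < k.+1)%N -> P i j d)).
    by move=> i d d' h dd j jk; apply: (mono i j d d' (h j jk)).
  move=> i iN; apply: (@finite_common R (fun j d => P i j d)); first by move=> j; exact: mono.
  move=> j jk; have [h1 h2 h3] := elt_in i iN.
  have td := reg_tdiff t (r i) (r i.+1) tT h1 h2 h3.
  have d1 := tdiff_l2p k u (Ut t) t _ _ j h2 td.
  have [_ _ hd] := hdg_C1 hs iN jk; have d2 : is_derive t 1 (fun t => (uh s t i)`_j) (uh_t s t i)`_j by apply: hd; rewrite in_itv.
  have d3 := is_deriveB d1 d2.
  have [dd dd0 hdd] := is_derive_eps _ t _ d3 eps eps0.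
  exists (Num.min dd (Num.min t (T - t))); first by rewrite !lt_min dd0 t0 subr_gt0.
  move=> h h0; rewrite !lt_min => /and3P[g1 g2 g3].
  have thT : 0 <= t + h <= T by move: g2 g3; rewrite !ltr_norml => /andP[? ?] /andP[? ?]; apply/andP; split; lra.
  have := hdd h h0 g1; rewrite /= !fctE.
  have b1 := reg_bm t (r i) (r i.+1) tI h1 h3.
  have b2 := reg_bm (t + h) (r i) (r i.+1) thT h1 h3.
  rewrite /dp /dP (l2pB k _ _ _ _ b2 b1) /eT !coefB.
  by congr (`|_| <= _); ring.
by exists d => // i j h iN jk h0 hd'; exact: hd.
Qed.

(** The coefficients of the increment divided by [tau] converge to those of [eT], hence so do the
    norms. This links the two-time estimates to [Y]. *)
Lemma ratio t : 0 < t < T -> forall eps, 0 < eps -> exists2 d : R, 0 < d &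
  forall tau, 0 < tau -> tau < d -> `|n2 0 b (bf N r (dp tau t)) - tau * Y t| <= eps * tau.
Proof.
move=> tT eps eps0; have /andP[t0 tT'] := tT; have tI : 0 <= t <= T by rewrite !ltW.
pose M := (\sum_(j < k.+1) b ^+ j) * Num.sqrt b + 1.
have S0 : 0 <= \sum_(j < k.+1) b ^+ j by apply: sumr_ge0 => j _; rewrite exprn_ge0// ltW.
have M0 : 0 < M by rewrite ltr_wpDl// mulr_ge0.
have e1 : 0 < eps / M by rewrite divr_gt0.
have [d d0 hd] := coef_small t tT _ e1.
exists (Num.min d (T - t)); first by rewrite lt_min d0 subr_gt0.
move=> tau tau0; rewrite lt_min => /andP[td td2].
pose q i := tau *: eT k r s t (Ut t) i.
have sz i : (i < N)%N -> (size (dp tau t i - q i)%R <= k.+1)%N.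
  move=> iN; rewrite (leq_trans (size_polyD _ _))// size_polyN geq_max.
  have i1 : t + tau \in `[0, T] by rewrite in_itv/=; apply/andP; split; lra.
  have i2 := in_itv_T t tI.
  rewrite (size_dP k b T Ub N r s hm hs _ _ _ _ i1 i2 i iN)/=.
  by rewrite (leq_trans (size_scale_leq _ _))// (size_eT k b T Ub N r s hm hs t (Ut t) i2 i iN).
have pt i x : (i < N)%N -> r i < x < r i.+1 -> `|bf N r (dp tau t) x - bf N r q x| <= eps / M * tau * \sum_(j < k.+1) b ^+ j.
  move=> iN xi; rewrite !(bfE _ _ _ hm _ i x iN xi) -hornerN -hornerD (horner_coef_wide _ (sz i iN)).
  have /andP[x0 xb] := mesh_in _ _ _ hm i x iN xi.
  apply: (le_trans (ler_norm_sum _ _ _)); rewrite mulr_sumr; apply: ler_sum => j _.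
  rewrite normrM; apply: ler_pM => //.
    have g : 0 < `|tau| by rewrite gtr0_norm.
    have g2 : `|tau| < d by rewrite gtr0_norm.
    have := hd i j tau iN (ltn_ord j) g g2; rewrite (gtr0_norm tau0).
    have -> : (dp tau t i - q i)`_j = (dp tau t i)`_j - tau * (eT k r s t (Ut t) i)`_j.
      by rewrite [LHS]coefB; congr (_ - _); exact: coefZ.
    by congr (`|_ - _| <= _); rewrite mulrC.
  by rewrite normrX (gtr0_norm x0); apply: lerXn2r; rewrite ?nnegrE ?(ltW x0) ?(ltW b0)// ltW.
have c0 : 0 <= eps / M * tau * \sum_(j < k.+1) b ^+ j by apply: mulr_ge0 => //; apply: mulr_ge0; exact: ltW.
have h := sq_b_bound b b0 N r hm _ _ (bmB _ _ _ _ (bbf (dp tau t)) (bbf q)) c0 pt.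
have hq : n2 0 b (bf N r q) = tau * Y t.
  have hq0 := n2Z tau (bbf (eT k r s t (Ut t))); rewrite (gtr0_norm tau0) in hq0.
  rewrite /Y -hq0; apply: eq_n2 => x xb.
  by rewrite /bf /broken_fun mulr_sumr; apply: eq_bigr => i _; rewrite !patchE /q; case: ifP => _; rewrite ?mulr0// hornerZ.
have h2 : eps / M * tau * (\sum_(j < k.+1) b ^+ j) * Num.sqrt b <= eps * tau.
  have -> : eps * tau = eps / M * tau * M by field; rewrite gt_eqF.
  rewrite -[leLHS]mulrA; apply: ler_wpM2l; first by rewrite mulr_ge0// ltW.
  by rewrite /M lerDl.
have t1 := n2D (bbf q) (bmB _ _ _ _ (bbf (dp tau t)) (bbf q)).
rewrite (eq_n2 (bf N r (dp tau t))) in t1; last by move=> x _; ring.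
have t2 := n2B (bbf (dp tau t)) (bmB _ _ _ _ (bbf (dp tau t)) (bbf q)).
rewrite (eq_n2 (bf N r q)) in t2; last by move=> x _; ring.
by rewrite -hq ler_norml; apply/andP; split; lra.
Qed.

Definition LL := L + Cp * L + L * b ^+ k.-1 + (CE + L * Num.sqrt b) * b ^+ k.
Definition c4 := `|C4 b LL K C| + 1.
Definition cM1 := cM b L K C * (CE + 1).
Definition a4 := expR (c4 * T).
Definition aA := (a4 + 1) * cM1.
Definition C2 := (2 * C / am b K) ^+ 2 + ((2 + 2 * C / am b K) / am b K) ^+ 2.
(** Chosen so that [2 * C2 * c4 / (lam - c4) <= 4^-1], the share of the Volterra term in
    [psi_step]. *)
Definition lam := c4 + 8 * C2 * c4 + 1.
(** With A0 the coefficient of the direct contribution in [psi_step], [B0 = 4 * A0 + 1] satisfies A0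
    + (B0 + 1) / 4 = B0 / 2. *)
Definition B0 := 4 * (2 * C2 * aA ^+ 2 * b ^+ (2 * k).+1) + 1.
Definition psi t := B0 * H * expR (lam * t).

Let Kc0 : 0 <= K := Kc_ge0.
Let CE0 : 0 <= CE := CE_ge0.
Let H0 : 0 <= H := H_ge0.

Lemma cM_Kc_ge0 : 0 <= cM b L K C.
Proof.
have h := cS_Kc_ge0.
have s1 := sqrtr_ge0 b; have s2 := sqrtr_ge0 C; have k2 := sqr_ge0 K.
by rewrite /cM !addr_ge0 ?ler01 ?(mulr_ge0 h) ?addr_ge0 ?ler01 ?mulr_ge0.
Qed.

Lemma cM1_ge0 : 0 <= cM1. Proof. by rewrite /cM1 mulr_ge0 ?cM_Kc_ge0// addr_ge0. Qed.

Lemma c4_gt0 : 0 < c4. Proof. by rewrite /c4 ltr_wpDl. Qed.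

Lemma a4_ge1 : 1 <= a4.
Proof. by rewrite /a4 -[leLHS]expR0 ler_expR mulr_ge0 ?(ltW c4_gt0)// ltW. Qed.

Lemma C2_ge0 : 0 <= C2. Proof. by rewrite /C2 addr_ge0 ?sqr_ge0. Qed.

Lemma B0_ge1 : 1 <= B0.
Proof. 
have h1 : 0 <= b ^+ (2 * k).+1 := exprn_ge0 _ (ltW b0).
have h2 := C2_ge0; have h3 := sqr_ge0 aA.
by rewrite /B0 lerDr; apply: mulr_ge0 => //; apply: mulr_ge0 => //; apply: mulr_ge0 => //; apply: mulr_ge0.
Qed.

Lemma LL_ge : [/\ L <= LL, Cp * L <= LL, L * b ^+ k.-1 <= LL & (CE + L * Num.sqrt b) * b ^+ k <= LL].
Proof.
have h1 : 0 <= Cp * L by rewrite mulr_ge0// ltW.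
have h2 : 0 <= L * b ^+ k.-1 by rewrite mulr_ge0// exprn_ge0// ltW.
have h3 : 0 <= (CE + L * Num.sqrt b) * b ^+ k.
  by rewrite mulr_ge0 ?exprn_ge0 ?(ltW b0)// addr_ge0// mulr_ge0 ?sqrtr_ge0.
have hL := L0; by rewrite /LL; split; lra.
Qed.

Lemma Hk_le : H ^+ k.+1 <= b ^+ k * H.
Proof.
rewrite exprSr; apply: ler_wpM2r => //; apply: lerXn2r; rewrite ?nnegrE ?(ltW b0)//.
exact: mesh_size_le b0 hm.
Qed.

Lemma zeta_H t : 0 <= t <= T -> (forall t', 0 <= t' <= t -> dgn N r (e t') <= 1) ->
  n2 0 b (fun x => u t x - bf N r (uh s t) x) <= LL * H.
Proof.
move=> tT hd; have [_ _ _ l4] := LL_ge.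
have h1 := n2_zeta t tT.
have h2 := level1_dynamic t tT hd.
apply: (le_trans h1); apply: (@le_trans _ _ ((CE + L * Num.sqrt b) * H ^+ k.+1)).
  have -> : (CE + L * Num.sqrt b) * H ^+ k.+1 = CE * H ^+ k.+1 + L * H ^+ k.+1 * Num.sqrt b by ring.
  by rewrite lerD2r.
apply: (@le_trans _ _ ((CE + L * Num.sqrt b) * (b ^+ k * H))).
  by apply: ler_wpM2l Hk_le; rewrite addr_ge0// mulr_ge0 ?sqrtr_ge0.
by rewrite mulrA; apply: ler_wpM2r.
Qed.

Lemma level2_at tau t : 0 < tau -> 0 < t -> t + tau < T ->
  (forall t', 0 <= t' <= t + tau -> dgn N r (e t') <= 1) ->
  2 * itg 0 b (fun x => bf N r (dT k r s (t + tau) t (Ut (t + tau)) (Ut t)) x * bf N r (dp tau t) x) <=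
  c4 * (n2 0 b (bf N r (dp tau t)) ^+ 2 + tau ^+ 2 * (dgn N r (e t) + H)).
Proof.
move=> tau0 t0 tT hd; have tau0' := ltW tau0; have [l1 l2 l3 l4] := LL_ge.
have tI1 : 0 < t + tau < T by apply/andP; split; lra.
have tI2 : 0 < t < T by apply/andP; split; lra.
have tJ1 : 0 <= t + tau <= T by apply/andP; split; lra.
have tJ2 : 0 <= t <= T by apply/andP; split; lra.
have dd : `|t + tau - t| = tau by rewrite (_ : t + tau - t = tau) ?gtr0_norm//; ring.
have d1 : dgn N r (e (t + tau)) <= 1 by apply: hd; apply/andP; split; lra.
have d2 : dgn N r (e t) <= 1 by apply: hd; apply/andP; split; lra.
have d0 : 0 <= dgn N r (e t) by rewrite /e (dgn_n2 k b N r s hm) addr_ge0 ?sqr_ge0.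
have Ltau : L * tau <= LL * tau by apply: ler_wpM2r.
have b1 x : 0 <= x <= b -> `|u (t + tau) x - u t x| <= LL * tau.
  by move=> xb; apply: le_trans Ltau; rewrite -[in leRHS]dd; exact: (rg_dbd hr).
have b2' x y : 0 <= x <= b -> 0 <= y <= b ->
   `|(u (t + tau) x - u t x) - (u (t + tau) y - u t y)| <= L * tau * `|x - y|.
  by move=> xb yb; rewrite -[in leRHS]dd; exact: (rg_dlip hr).
have b2 x y : 0 <= x <= b -> 0 <= y <= b ->
   `|(u (t + tau) x - u t x) - (u (t + tau) y - u t y)| <= LL * tau * `|x - y|.
  by move=> xb yb; apply: (le_trans (b2' x y xb yb)); apply: ler_wpM2r.
have b3 x : 0 < x < b -> `|V (t + tau) x - V t x| <= LL * tau.
  by move=> xb; apply: le_trans Ltau; rewrite -[in leRHS]dd; exact: (rg_dV hr).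
have b4 i x : (i < N)%N -> r i <= x <= r i.+1 ->
   `|u (t + tau) x - u t x - (l2p k (r i) (r i.+1) (fun x => u (t + tau) x - u t x)).[x]| <= LL * tau * (r i.+1 - r i).
  move=> iN xi; have [h1 h2 h3] := elt_in i iN.
  have bd1 := reg_bm _ _ _ tJ1 h1 h3; have bd2 := reg_bm _ _ _ tJ2 h1 h3.
  have sz : (size (u (t + tau) (r i) - u t (r i))%:P <= k.+1)%N by rewrite (leq_trans (size_polyC_leq1 _)).
  have := hCp _ _ _ _ (L * tau * (r i.+1 - r i)) h2 (bmB _ _ _ _ bd1 bd2) sz.
  have pre y : r i <= y <= r i.+1 -> `|u (t + tau) y - u t y - (u (t + tau) (r i) - u t (r i))%:P.[y]| <= L * tau * (r i.+1 - r i).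
    move=> /andP[y1 y2]; rewrite hornerC.
    have yb : 0 <= y <= b by rewrite (le_trans h1 y1) (le_trans y2 h3).
    have ab : 0 <= r i <= b by rewrite h1 (le_trans (ltW h2) h3).
    apply: (le_trans (b2' y (r i) yb ab)); apply: ler_wpM2l; first by rewrite mulr_ge0.
    by rewrite ger0_norm ?subr_ge0// lerD2r.
  move=> /(_ pre x xi) h; apply: (le_trans h).
  have -> : Cp * (L * tau * (r i.+1 - r i)) = Cp * L * (tau * (r i.+1 - r i)) by ring.
  by rewrite -[leRHS]mulrA; apply: ler_wpM2r => //; rewrite mulr_ge0// subr_ge0 ltW.
have b5 i x : (i < N)%N -> r i <= x <= r i.+1 -> `|u t x - (pR k r (u t) i).[x]| <= LL * H * (x - r i).
  move=> iN xi; have [h1 h2 h3] := elt_in i iN; have /andP[ix _] := xi.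
  apply: (le_trans (etaR_lip t i x tJ2 iN xi)).
  apply: ler_wpM2r; first by rewrite subr_ge0.
  have h0 : 0 <= r i.+1 - r i by rewrite subr_ge0 ltW.
  have hH := mesh_h N r i iN.
  rewrite -(prednK k1) exprSr mulrA; apply: ler_pM => //.
    by rewrite mulr_ge0// exprn_ge0.
  apply: le_trans l3; apply: ler_wpM2l => //; apply: lerXn2r; rewrite ?nnegrE ?(ltW b0)//.
  by rewrite lerBlDr (le_trans h3)// lerDl.
have z1 := zeta_H (t + tau) tJ1 hd.
have hd2 t' : 0 <= t' <= t -> dgn N r (e t') <= 1 by move=> /andP[g1 g2]; apply: hd; apply/andP; split; lra.
have z2 := zeta_H t tJ2 hd2.
have D01 : 0 <= Num.sqrt (dgn N r (e t)) <= 1 by rewrite sqrtr_ge0/= -[leRHS]sqrtr1 ler_wsqrtr.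
have DD : dgn N r (eR k r s t (u t)) <= Num.sqrt (dgn N r (e t)) ^+ 2 by rewrite sqr_sqrtr.
have K1 := Kf_u (t + tau) tJ1.
have K2 := Kf_u t tJ2.
have K3 := Kf_uh (t + tau) tJ1 d1.
have K4 := Kf_uh t tJ2 d2.
have := level2 k b T Ub N r s b0 hm hs (t + tau) t tau LL K C (u (t + tau)) (V (t + tau)) (Ut (t + tau))
  (u t) (V t) (Ut t) (in_itv_T _ tJ1) (exact_at_mono b L LL _ _ _ l1 (rg_exact hr _ tI1)) (hUb _ tJ1)
  (in_itv_T _ tJ2) (exact_at_mono b L LL _ _ _ l1 (rg_exact hr _ tI2)) (hUb _ tJ2)
  tau0' C0 invC traceC K1 K2 K3 K4 b1 b2 b3 b4 b5 z1 z2 _ D01 DD.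
rewrite (sqr_sqrtr d0) => h; apply: (le_trans h); apply: ler_wpM2r.
  by apply: addr_ge0; [exact: sqr_ge0|apply: mulr_ge0; [exact: sqr_ge0|exact: addr_ge0]].
by rewrite /c4 (le_trans (ler_norm _))// lerDl.
Qed.

Lemma dgn_ge0 t : 0 <= dgn N r (e t).
Proof. by rewrite /e (dgn_n2 k b N r s hm) addr_ge0 ?sqr_ge0. Qed.

(** Its square is the contribution of the forcing in Gronwall's inequality for the increments,
    divided by [tau ^+ 2], when [dgn] stays below [psi]. *)
Definition gq t := Num.sqrt (c4 * (B0 + 1) * H / (lam - c4) * expR (lam * t)).

Lemma lam_gt : c4 < lam.
Proof.
have h1 := c4_gt0; have h2 : 0 <= 8 * C2 * c4 by rewrite mulr_ge0 ?(ltW h1)// mulr_ge0// C2_ge0.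
by rewrite /lam; lra.
Qed.

Lemma n2dp_gronwall tau t0 t1 ts : 0 < tau -> 0 < t0 -> t0 <= t1 -> t1 + tau < ts -> ts <= T ->
  (forall t, 0 <= t <= ts -> dgn N r (e t) <= psi t /\ dgn N r (e t) <= 1) ->
  n2 0 b (bf N r (dp tau t1)) <= a4 * n2 0 b (bf N r (dp tau t0)) + tau * gq t1.
Proof.
move=> tau0 t00 t01 t1s tsT hd; have clam := lam_gt; have c40 := c4_gt0.
have der t : 0 < t -> t <= t1 -> is_derive t 1 (fun t => n2 0 b (bf N r (dP k r s (t + tau) t (u (t + tau)) (u t))) ^+ 2)
  (2 * itg 0 b (fun x => bf N r (dT k r s (t + tau) t (Ut (t + tau)) (Ut t)) x *
     bf N r (dP k r s (t + tau) t (u (t + tau)) (u t)) x)).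
  by move=> h1 h2; apply: (derive_n2dp); lra.
pose Q := c4 * (B0 + 1) * H * tau ^+ 2.
have B00 := B0_ge1.
have bd t : t0 < t < t1 -> 2 * itg 0 b (fun x => bf N r (dT k r s (t + tau) t (Ut (t + tau)) (Ut t)) x *
     bf N r (dP k r s (t + tau) t (u (t + tau)) (u t)) x) <=
   c4 * (n2 0 b (bf N r (dP k r s (t + tau) t (u (t + tau)) (u t))) ^+ 2) + Q * expR (lam * t).
  move=> /andP[h1 h2].
  have l2 : 2 * itg 0 b (fun x => bf N r (dT k r s (t + tau) t (Ut (t + tau)) (Ut t)) x * bf N r (dp tau t) x) <=
     c4 * (n2 0 b (bf N r (dp tau t)) ^+ 2 + tau ^+ 2 * (dgn N r (e t) + H)).
    apply: level2_at => //; [lra|lra|move=> t' /andP[g1 g2]].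
    by have [] := hd t' _; first by apply/andP; split; lra.
  apply: (le_trans l2); rewrite mulrDr lerD2l /Q.
  have [d1 _] : dgn N r (e t) <= psi t /\ dgn N r (e t) <= 1 by apply: hd; apply/andP; split; lra.
  have e1 : 1 <= expR (lam * t).
    by rewrite -[leLHS]expR0 ler_expR mulr_ge0//; lra.
  have -> : c4 * (B0 + 1) * H * tau ^+ 2 * expR (lam * t) = c4 * (tau ^+ 2 * ((B0 + 1) * H * expR (lam * t))) by ring.
  apply: ler_wpM2l; first exact: ltW; apply: ler_wpM2l; first exact: sqr_ge0.
  have h3 : H <= H * expR (lam * t) by rewrite -[leLHS]mulr1; apply: ler_wpM2l.
  by move: d1; rewrite /psi; lra.
have cw : {within `[t0, t1], continuous (fun t => n2 0 b (bf N r (dP k r s (t + tau) t (u (t + tau)) (u t))) ^+ 2)}.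
  by apply: is_derive_within => t /andP[h1 h2]; apply: der => //; apply: (lt_le_trans t00).
have der' t : t0 < t < t1 -> is_derive t 1 (fun t => n2 0 b (bf N r (dP k r s (t + tau) t (u (t + tau)) (u t))) ^+ 2)
  (2 * itg 0 b (fun x => bf N r (dT k r s (t + tau) t (Ut (t + tau)) (Ut t)) x *
     bf N r (dP k r s (t + tau) t (u (t + tau)) (u t)) x)).
  by move=> /andP[h1 h2]; apply: der; lra.
have g := gronwall _ _ c4 Q lam t0 t1 t01 clam cw der' bd.
set X1 := n2 0 b (bf N r (dp tau t1)); set X0 := n2 0 b (bf N r (dp tau t0)).
have X00 : 0 <= X0 by exact: n2_ge0.
have g0 : 0 <= gq t1 by exact: sqrtr_ge0.
have a1 := a4_ge1.
have lc : 0 < lam - c4 by rewrite subr_gt0.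
have Q0 : 0 <= c4 * (B0 + 1) * H / (lam - c4) * expR (lam * t1).
  by rewrite !mulr_ge0 ?expR_ge0 ?invr_ge0 ?(ltW lc) ?(ltW c40)//; lra.
apply: sqr_le_le; first by rewrite addr_ge0// mulr_ge0//; lra.
have g' : X1 ^+ 2 <= a4 * X0 ^+ 2 + tau ^+ 2 * gq t1 ^+ 2.
  apply: (le_trans g); apply: lerD.
    apply: ler_wpM2r; first exact: sqr_ge0.
    by rewrite /a4 ler_expR; apply: ler_wpM2l; lra.
  rewrite sqr_sqrtr//.
  have -> : tau ^+ 2 * (c4 * (B0 + 1) * H / (lam - c4) * expR (lam * t1)) = Q / (lam - c4) * expR (lam * t1) by rewrite /Q; field; rewrite gt_eqF.
  apply: ler_wpM2l; first by rewrite /Q !mulr_ge0 ?invr_ge0 ?(ltW lc) ?(ltW c40)//; lra.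
  by rewrite gerBl mulr_ge0 ?expR_ge0.
apply: (le_trans g').
have h1 : a4 * X0 ^+ 2 <= a4 ^+ 2 * X0 ^+ 2.
  by apply: ler_wpM2r; [exact: sqr_ge0|rewrite expr2 -[leLHS]mulr1; apply: ler_wpM2l; lra].
have h2 : 0 <= a4 * X0 * (tau * gq t1) by rewrite !mulr_ge0//; lra.
have -> : (a4 * X0 + tau * gq t1) ^+ 2 = a4 ^+ 2 * X0 ^+ 2 + 2 * (a4 * X0 * (tau * gq t1)) + tau ^+ 2 * gq t1 ^+ 2 by ring.
by lra.
Qed.

(** The bound on increments is divided by [tau], small enough for [ratio] at both times and for
    [t1 + tau] to stay below [ts]. *)
Lemma Y_step t0 t1 ts : 0 < t0 -> t0 <= t1 -> t1 < ts -> ts <= T ->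
  (forall t, 0 <= t <= ts -> dgn N r (e t) <= psi t /\ dgn N r (e t) <= 1) ->
  Y t1 <= a4 * Y t0 + gq t1.
Proof.
move=> t00 t01 t1s tsT hd; have a1 := a4_ge1.
apply/ler_addgt0Pr => eps eps0.
have e1 : 0 < eps / (1 + a4) by apply: divr_gt0 => //; lra.
have tI0 : 0 < t0 < T by apply/andP; split; lra.
have tI1 : 0 < t1 < T by apply/andP; split; lra.
have [d0 d00 h0] := ratio t0 tI0 _ e1; have [d1 d10 h1] := ratio t1 tI1 _ e1.
pose tau := Num.min (d0 / 2) (Num.min (d1 / 2) ((ts - t1) / 2)).
have tau0 : 0 < tau by rewrite !lt_min !divr_gt0 ?subr_gt0.
have k0 : tau <= d0 / 2 by rewrite ge_min lexx.
have k2 : tau <= d1 / 2 by rewrite !ge_min lexx ?orbT.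
have k3 : tau <= (ts - t1) / 2 by rewrite !ge_min lexx ?orbT.
have td0 : tau < d0 by lra. have td1 : tau < d1 by lra. have tts : t1 + tau < ts by lra.
have g := n2dp_gronwall tau t0 t1 ts tau0 t00 t01 tts tsT hd.
have := h0 tau tau0 td0; have := h1 tau tau0 td1; rewrite !ler_norml => /andP[p1 _] /andP[_ p2].
have E : eps = eps / (1 + a4) * (1 + a4) by field; apply: lt0r_neq0; lra.
rewrite -(ler_pM2l tau0) {1}E.
have p3 : a4 * n2 0 b (bf N r (dp tau t0)) <= a4 * (tau * Y t0 + eps / (1 + a4) * tau) by apply: ler_wpM2l; lra.
have -> : tau * (a4 * Y t0 + gq t1 + eps / (1 + a4) * (1 + a4)) =
  a4 * (tau * Y t0 + eps / (1 + a4) * tau) + tau * gq t1 + eps / (1 + a4) * tau by ring.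
by lra.
Qed.

Let Hk0 : 0 <= H ^+ k.+1. Proof. exact: exprn_ge0. Qed.

Lemma n2_parts t : n2 0 b (bf N r (eD k r s t (u t))) <= Num.sqrt (dgn N r (e t)) /\
  n2 0 b (bf N r (jq k N r s t (u t))) <= Num.sqrt (dgn N r (e t)).
Proof.
have d0 := dgn_ge0 t.
by split; (apply: sqr_le_le; first exact: sqrtr_ge0); rewrite (sqr_sqrtr d0) /e (dgn_n2 k b N r s hm) ?lerDl ?lerDr sqr_ge0.
Qed.

Lemma Y_start t : 0 < t < T -> (forall t', 0 <= t' <= t -> dgn N r (e t') <= 1) ->
  Y t <= (1 + Num.sqrt C) * Num.sqrt (dgn N r (e t)) + cM1 * H ^+ k.+1.
Proof.
move=> tT hd; have /andP[t0 tT'] := tT; have tI : 0 <= t <= T by rewrite !ltW.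
have d1 : dgn N r (e t) <= 1 by apply: hd; rewrite lexx ltW.
have h := converse k b T Ub N r s b0 hm hs t L K C (u t) (V t) (Ut t) (in_itv_T t tI) (rg_exact hr t tT)
    (hUb t tI) C0 invC traceC (Kf_u t tI) (Kf_uh t tI d1)
    (fun i x => etaR_bound t i x tI).
have [p1 p2] := n2_parts t; have c0 := cM_Kc_ge0; have sC := sqrtr_ge0 C.
have l1 := level1_dynamic t tI hd.
apply: (le_trans h); rewrite /cM1.
have h2 : 2^-1 * Num.sqrt C * n2 0 b (bf N r (jq k N r s t (u t))) <= 2^-1 * Num.sqrt C * Num.sqrt (dgn N r (e t)).
  by apply: ler_wpM2l => //; rewrite mulr_ge0// invr_ge0.
have h3 : cM b L K C * (n2 0 b (bf N r (eR k r s t (u t))) + H ^+ k.+1) <= cM b L K C * (CE + 1) * H ^+ k.+1.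
  by rewrite -[leRHS]mulrA; apply: ler_wpM2l => //; rewrite [leRHS]mulrDl mul1r lerD2r.
have h4 : 0 <= Num.sqrt C * Num.sqrt (dgn N r (e t)) by rewrite mulr_ge0 ?sqrtr_ge0.
have h5 := sqrtr_ge0 (dgn N r (e t)).
have h6 : (1 + Num.sqrt C) * Num.sqrt (dgn N r (e t)) = Num.sqrt (dgn N r (e t)) + Num.sqrt C * Num.sqrt (dgn N r (e t)) by ring.
move: h2 h3; rewrite -/H -/K h6 -[2^-1 * _ * Num.sqrt (dgn _ _ _)]mulrA => h2 h3.
by lra.
Qed.

(** [Y_step] is started at a small positive [t0], where [Y_start] applies; as [dgn] is continuous
    and vanishes at time 0, its contribution there can be made smaller than [eps]. *)
Lemma Y_bound t1 ts : 0 < t1 -> t1 < ts -> ts <= T ->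
  (forall t, 0 <= t <= ts -> dgn N r (e t) <= psi t /\ dgn N r (e t) <= 1) ->
  Y t1 <= a4 * cM1 * H ^+ k.+1 + gq t1.
Proof.
move=> t10 t1s tsT hd; have a1 := a4_ge1; have sC := sqrtr_ge0 C.
apply/ler_addgt0Pr => eps eps0.
pose q := eps / (a4 * (1 + Num.sqrt C)).
have den : 0 < a4 * (1 + Num.sqrt C) by apply: mulr_gt0; lra.
have q0 : 0 < q by rewrite divr_gt0.
have cd := within_dgn.
have I0 : 0 <= (0 : R) <= T by rewrite lexx ltW.
have q2 : 0 < q ^+ 2 by rewrite exprn_gt0.
have [d d0 hd0] := (within_epsP.1 cd) 0 I0 _ q2.
pose t0 := Num.min (d / 2) t1.
have t00 : 0 < t0 by rewrite lt_min t10 divr_gt0.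
have t0d : t0 <= d / 2 by rewrite ge_min lexx.
have t01 : t0 <= t1 by rewrite ge_min lexx orbT.
have tI0 : 0 < t0 < T by apply/andP; split; lra.
have tI0' : 0 <= t0 <= T by apply/andP; split; lra.
have td : `|0 - t0| < d by rewrite sub0r normrN gtr0_norm//; lra.
have dsm : Num.sqrt (dgn N r (e t0)) <= q.
  have := hd0 t0 tI0' td; rewrite (dgn_e0) sub0r normrN => h.
  rewrite -(ger0_norm (ltW q0)) -sqrtr_sqr ler_wsqrtr// (le_trans _ h)// ler_norm.
  by [].
have hd' t' : 0 <= t' <= t0 -> dgn N r (e t') <= 1.
  by move=> /andP[g1 g2]; have [] := hd t' _; first by apply/andP; split; lra.
have h1 := Y_start t0 tI0 hd'; have h2 := Y_step t0 t1 ts t00 t01 t1s tsT hd.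
have h3 : (1 + Num.sqrt C) * Num.sqrt (dgn N r (e t0)) <= (1 + Num.sqrt C) * q by apply: ler_wpM2l => //; lra.
have h4 : a4 * Y t0 <= a4 * ((1 + Num.sqrt C) * q + cM1 * H ^+ k.+1) by apply: ler_wpM2l; lra.
have E : a4 * ((1 + Num.sqrt C) * q + cM1 * H ^+ k.+1) = eps + a4 * cM1 * H ^+ k.+1.
  by rewrite /q; field; rewrite !lt0r_neq0//; lra.
by lra.
Qed.

Lemma am_gt0 : 0 < am b K. Proof. exact: expR_gt0. Qed.

Lemma dgn_rho t : 0 < t < T -> dgn N r (e t) <= 1 ->
  dgn N r (e t) <= C2 * rho k b N r s t L K C (u t) (Ut t) ^+ 2.
Proof.
move=> tT d1; have /andP[t0 tT'] := tT; have tI : 0 <= t <= T by rewrite !ltW.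
have h1 := elliptic_vol k b T Ub N r s b0 hm hs t L K C (u t) (V t) (Ut t) (in_itv_T t tI) (rg_exact hr t tT)
    (hUb t tI) C0 invC weightC (Kf_u t tI) (Kf_uh t tI d1)
    (fun i x => etaR_bound t i x tI).
have h2 := elliptic_jump k b T Ub N r s b0 hm hs t L K C (u t) (V t) (Ut t) (in_itv_T t tI) (rg_exact hr t tT)
    (hUb t tI) C0 invC (Kf_u t tI) (Kf_uh t tI d1)
    (fun i x => etaR_bound t i x tI).
have a0 := am_gt0.
move: h1 h2; rewrite /e (dgn_n2 k b N r s hm).
set P := n2 0 b (bf N r (eD _ _ _ _ _)); set Q := n2 0 b (bf N r (jq _ _ _ _ _ _)).
set rh := rho _ _ _ _ _ _ _ _ _ _ _; set a := am b K => h1 h2.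
have P0 : 0 <= P := n2_ge0 _ _ _; have Q0 : 0 <= Q := n2_ge0 _ _ _.
have p1 : P <= 2 * C / a * rh by rewrite mulrAC ler_pdivlMr// mulrC.
have h3 : 2 * rh + P <= (2 + 2 * C / a) * rh by rewrite [leRHS]mulrDl lerD2l.
have p2 : Q <= (2 + 2 * C / a) / a * rh by rewrite mulrAC ler_pdivlMr// mulrC (le_trans h2).
rewrite /C2 mulrDl -!exprMn; apply: lerD; apply: lerXn2r; rewrite ?nnegrE//; [exact: (le_trans P0)|exact: (le_trans Q0)].
Qed.

(** The elliptic estimates bound [dgn] by [C2 * rho ^+ 2]. The part of [rho] with [H ^+ k.+1] is far
    below [H], and the part [gq] depends on [psi] through the factor [1 / (lam - c4)]; the choices
    of [lam] and [B0] make the sum half of [psi]. *)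
Lemma psi_step t1 ts : 0 < t1 -> t1 < ts -> ts <= T ->
  (forall t, 0 <= t <= ts -> dgn N r (e t) <= psi t /\ dgn N r (e t) <= 1) ->
  dgn N r (e t1) <= psi t1 / 2.
Proof.
move=> t10 t1s tsT hd; have tT : 0 < t1 < T by rewrite t10 (lt_le_trans t1s).
have tI : 0 <= t1 <= T by case/andP: tT => g1 g2; rewrite !ltW.
have d1 t' : 0 <= t' <= t1 -> dgn N r (e t') <= 1.
  by move=> /andP[g1 g2]; have [] := hd t' _; first by apply/andP; split; lra.
have dt1 : dgn N r (e t1) <= 1 by apply: d1; rewrite lexx ltW.
have yb := Y_bound t1 ts t10 t1s tsT hd.
have l1 := level1_dynamic t1 tI d1.
have c0 := cM_Kc_ge0; have C20 := C2_ge0; have c40 := c4_gt0; have clam := lam_gt; have B1 := B0_ge1.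
have lc : 0 < lam - c4 by rewrite subr_gt0.
have aA0 : 0 <= aA by rewrite /aA mulr_ge0 ?cM1_ge0//; have := a4_ge1; lra.
have g0 : 0 <= gq t1 := sqrtr_ge0 _.
have rb : rho k b N r s t1 L K C (u t1) (Ut t1) <= aA * H ^+ k.+1 + gq t1.
  have h3 : cM b L K C * (n2 0 b (bf N r (eR k r s t1 (u t1))) + H ^+ k.+1) <= cM1 * H ^+ k.+1.
    by rewrite /cM1 -[leRHS]mulrA; apply: ler_wpM2l => //; rewrite [leRHS]mulrDl mul1r lerD2r.
  rewrite /rho /aA; move: yb h3; rewrite /Y -/H -/K; lra.
have r0 : 0 <= rho k b N r s t1 L K C (u t1) (Ut t1).
  by rewrite /rho; apply: addr_ge0; [exact: n2_ge0|apply: mulr_ge0 => //; apply: addr_ge0 => //; exact: n2_ge0].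
apply: (le_trans (dgn_rho t1 tT dt1)).
have s0 : 0 <= aA * H ^+ k.+1 + gq t1 by apply: le_trans rb.
have sq : rho k b N r s t1 L K C (u t1) (Ut t1) ^+ 2 <= 2 * (aA * H ^+ k.+1) ^+ 2 + 2 * gq t1 ^+ 2.
  apply: (@le_trans _ _ ((aA * H ^+ k.+1 + gq t1) ^+ 2)); first by apply: lerXn2r.
  have := sqr_ge0 (aA * H ^+ k.+1 - gq t1); rewrite sqrrB sqrrD; lra.
apply: (le_trans (ler_wpM2l C20 sq)).
have E1 : 1 <= expR (lam * t1) by rewrite -[leLHS]expR0 ler_expR mulr_ge0//; lra.
have gsq : gq t1 ^+ 2 = c4 * (B0 + 1) * H / (lam - c4) * expR (lam * t1).
  by rewrite /gq sqr_sqrtr// !mulr_ge0 ?invr_ge0 ?expR_ge0 ?(ltW lc) ?(ltW c40)//; lra.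
have Hb : (H ^+ k.+1) ^+ 2 <= b ^+ (2 * k).+1 * H.
  rewrite -exprM mulnC mulnS addnC addn2 exprSr; apply: ler_wpM2r => //.
  by apply: lerXn2r; rewrite ?nnegrE ?(ltW b0)//; exact: mesh_size_le b0 hm.
pose A0 := 2 * C2 * aA ^+ 2 * b ^+ (2 * k).+1.
have A00 : 0 <= A0.
  rewrite /A0; apply: mulr_ge0; last exact: exprn_ge0 (ltW b0).
  by apply: mulr_ge0; [apply: mulr_ge0|exact: sqr_ge0].
have t1b : C2 * (2 * (aA * H ^+ k.+1) ^+ 2) <= A0 * (H * expR (lam * t1)).
  have -> : C2 * (2 * (aA * H ^+ k.+1) ^+ 2) = 2 * C2 * aA ^+ 2 * (H ^+ k.+1) ^+ 2 by ring.
  apply: (@le_trans _ _ (2 * C2 * aA ^+ 2 * (b ^+ (2 * k).+1 * H))).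
    by apply: ler_wpM2l => //; apply: mulr_ge0; [apply: mulr_ge0|exact: sqr_ge0].
  rewrite /A0 -[leRHS]mulrA; apply: ler_wpM2l; first by apply: mulr_ge0; [apply: mulr_ge0|exact: sqr_ge0].
  apply: ler_wpM2l; first exact: exprn_ge0 (ltW b0).
  by rewrite -[leLHS]mulr1; apply: ler_wpM2l.
have He : 0 <= H * expR (lam * t1) by rewrite mulr_ge0// expR_ge0.
have t2b : C2 * (2 * gq t1 ^+ 2) <= (B0 + 1) / 4 * (H * expR (lam * t1)).
  rewrite gsq.
  have -> : C2 * (2 * (c4 * (B0 + 1) * H / (lam - c4) * expR (lam * t1))) =
    2 * C2 * c4 / (lam - c4) * (B0 + 1) * (H * expR (lam * t1)) by field; rewrite gt_eqF.
  have -> : (B0 + 1) / 4 = 4^-1 * (B0 + 1) by ring.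
  apply: ler_wpM2r => //; apply: ler_wpM2r; first by lra.
  by rewrite ler_pdivrMr// /lam; lra.
have Bd : B0 = 4 * A0 + 1 by [].
have -> : psi t1 / 2 = (2 * A0 + 2^-1) * (H * expR (lam * t1)) by rewrite /psi Bd; field.
rewrite mulrDr; apply: (le_trans (lerD t1b t2b)); rewrite -mulrDl Bd.
by apply: ler_wpM2r => //; lra.
Qed.

(** The smallness of [H] keeps [psi] below 1, so the hypothesis [dgn <= 1] under which all estimates
    hold is part of what the continuity argument propagates. *)
Lemma dgn_le1 : 0 < H -> B0 * H * expR (lam * T) <= 1 -> forall t, 0 <= t <= T -> dgn N r (e t) <= 1.
Proof.
move=> Hp hH; have B1 := B0_ge1; have clam := lam_gt; have c40 := c4_gt0.
have p1 t : 0 <= t <= T -> psi t <= 1.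
  move=> /andP[h1 h2]; apply: le_trans hH; apply: ler_wpM2l; first by rewrite mulr_ge0//; lra.
  by rewrite ler_expR; apply: ler_wpM2l; lra.
suff h t : 0 <= t <= T -> dgn N r (e t) <= psi t by move=> t tT; apply: (le_trans (h t tT)); exact: p1.
apply: (bootstrap T (fun t => dgn N r (e t)) psi T0).
- exact: (within_dgn).
- apply: cont_within => x _; apply: continuousM; first exact: cst_continuous.
  apply: (@continuous_comp _ _ _ (fun x => lam * x) expR); last exact: continuous_expR.
  by apply: continuousM; [exact: cst_continuous|exact: cont_id].
- by move=> t' _; rewrite /psi !mulr_gt0 ?expR_gt0//; lra.
- by rewrite (dgn_e0).
move=> t' /andP[g1 g2] hp t1 /andP[h1 h2]; apply: (psi_step t1 t') => // t2 /andP[q1 q2].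
have hh : dgn N r (e t2) <= psi t2 by apply: hp; rewrite q1.
by split=> //; apply: (le_trans hh); apply: p1; rewrite q1 (le_trans q2).
Qed.

End Dynamics.

(** * From the L2 error to the norms of the theorem *)

Section ErrorNorms.
Context {R : realType} (b : R) (N : nat) (r : nat -> R) (hm : mesh b N r).

Lemma ae_neq (a : R) : {ae mu, forall x : R, x != a}.
Proof.
exists [set a]; split; [exact: measurable_set1|exact: lebesgue_measure_set1|].
by move=> x /= /negP; rewrite negbK => /eqP.
Qed.

Lemma ae_not_node n : {ae mu, forall x : R, forall i, (i <= n)%N -> x != r i}.
Proof.
elim: n => [|n ih].
  by apply: aeS (ae_neq (r 0%N)) => x h i; rewrite leqn0 => /eqP ->.
apply: aeS (aeI _ _ ih (ae_neq (r n.+1))) => x [h1 h2] i.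
by rewrite leq_eqVlt => /predU1P[->//|]; exact: h1.
Qed.

Lemma Linf_mesh_le (F : R -> R) M : 0 <= M ->
  (forall i x, (i < N)%N -> r i < x < r i.+1 -> `|F x| <= M) -> (Lp_norm 0 b +oo F <= M%:E)%E.
Proof.
move=> M0 FM; rewrite /Lp_norm unlock muT_gt0; apply/ess_supP.
apply: aeS (ae_not_node N) => x nx; rewrite /= patchE; case: ifPn => [|_]; last by rewrite normr0 lee_fin.
rewrite mem_setE in_itv/= => /andP[x0 xb].
have [i iN /andP[ix xi]] : exists2 i, (i < N)%N & r i <= x < r i.+1 by apply: (mesh_loc _ _ _ hm); rewrite xb ltW.
by rewrite lee_fin; apply: (FM i) => //; rewrite xi andbT lt_neqAle ix andbT eq_sym nx// ltnW.
Qed.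

Lemma mesh_normE (F : R -> R) (v : nat -> R -> R) : bm 0 b F ->
  (forall i x, (i < N)%N -> r i < x < r i.+1 -> v i x = F x) -> mesh_norm N r v = (n2 0 b F)%:E.
Proof.
move=> bF vF; rewrite /mesh_norm.
have F2 := bmX _ _ _ 2 bF.
have -> : (\sum_(i < N) \int[mu]_(x in `]r i, r i.+1[) (v i x ^+ 2)%:E)%E = (itg 0 b (fun x => F x ^+ 2))%:E.
  rewrite (itg_mesh b N r hm _ F2) -sumEFin; apply: eq_bigr => -[i iN] _ /=.
  have hF := bm_integrable (bm_elt b N r hm _ i iN F2).
  rewrite itgE /Rintegral fineK; last exact: integrable_fin_num.
  by apply: eq_integral => x; rewrite inE/= in_itv/= => xi; rewrite (vF i x iN xi).
by [].
Qed.

End ErrorNorms.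

Section ErrorBound.
Context {R : realType} (k : nat) (b T L : R) (u V Ut w g z : R -> R -> R) (Ub : R -> R).
Hypotheses (b0 : 0 < b) (hr : regular k b T L u V Ut).
Hypothesis hwgz : forall t x, 0 <= t <= T -> 0 <= x <= b ->
  [/\ w t x = itg 0 x (u t), g t x = gg b (u t) x & z t x = itg 0 x (gg b (u t))].
Variables (N : nat) (r : nat -> R) (s : hdg_unknowns R).
Hypotheses (hm : mesh b N r) (hs : hdg_solution k b T Ub N r s).

Let K := Kc k b L.

(** Each summand of the constant belongs to one norm: [Num.sqrt b] to [w] by Cauchy--Schwarz,
    [2 * K] to each of [g] and g-tilde, [2 * K * b] to [z] by integration, and 2 to u-tilde by
    Hardy's inequality for averages. *)
Lemma hdg_error_le t Z : 0 <= t <= T -> Kf b (bf N r (uh s t)) <= K ->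
  n2 0 b (fun x => u t x - bf N r (uh s t) x) <= Z ->
  (hdg_error b N r w g z s t <= ((Num.sqrt b + 2 * K * b + 4 * K + 2) * Z)%:E)%E.
Proof.
move=> tT hK hZ; have tI := in_itv_T T t tT.
pose f := bf N r (uh s t).
have [cu gu _] := lip_good b L (u t) b0 (fun x y => rg_lip hr t x y tT).
have pu : pgood b N r (u t) by split=> //; apply: (cm_cont b N r hm).
have pf : pgood b N r f := pgood_bf b N r b0 hm (uh s t).
have gf : good b f := pf.1.
have hK2 := Kf_u k b T L u V Ut b0 hr N r hm t tT.
have Z0 : 0 <= Z by apply: le_trans hZ; exact: n2_ge0.
have K0 : 0 <= K := Kc_ge0 k b T L u V Ut b0 hr.
have bz : bm 0 b (fun x => u t x - f x) by apply: bmB; [exact: gu.1|exact: gf.1].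
have KZ : 0 <= 2 * K * Z by rewrite !mulr_ge0.
have hg x : 0 <= x <= b -> `|gg b (u t) x - gg b f x| <= 2 * K * Z.
  move=> xb; apply: (le_trans (gg_sup b N r b0 hm (u t) f K x pu pf hK2 hK xb)).
  by apply: ler_wpM2l hZ; rewrite mulr_ge0.
have nd i x : (i < N)%N -> r i < x < r i.+1 -> [/\ 0 < x < b, 0 <= x <= b & r i <= x <= r i.+1].
  move=> iN xi; have xb := mesh_in _ _ _ hm i x iN xi.
  by split=> //; [case/andP: xb => h1 h2; rewrite !ltW|case/andP: xi => h1 h2; rewrite !ltW].
have bgu := bm_gg b (u t) gu; have bgf := bm_gg b f gf.
have E1 : (Lp_norm 0 b +oo (w t \- broken_fun N r (wh r s t))%R <= (Num.sqrt b * Z)%:E)%E.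
  apply: (Linf_mesh_le b N r hm) => [|i x iN xi]; first by rewrite mulr_ge0 ?sqrtr_ge0.
  have [/andP[x0 xb] xI xi'] := nd i x iN xi; have x0' := ltW x0; have xb' := ltW xb.
  rewrite /= (broken_funE _ _ _ hm _ i x iN xi) (wh_itg k b T Ub N r s b0 hm hs t tI i x iN xi').
  have [-> _ _] := hwgz t x tT xI.
  rewrite -(itgB (bmS 0 x (lexx 0) xb' gu.1) (bmS 0 x (lexx 0) xb' gf.1)).
  have bx := bmS 0 x (lexx 0) xb' bz; have b1 := bm_cst 0 x (1 : R).
  rewrite (eq_itg (fun y => (u t y - f y) * 1)); last by move=> y _; rewrite mulr1.
  apply: (le_trans (CS bx b1)); rewrite mulrC; apply: ler_pM; rewrite ?n2_ge0//.
    have n1 : n2 0 x (fun _ : R => 1) <= 1 * Num.sqrt (x - 0).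
      by apply: (n2_bound 1 x0' ler01 b1) => y _; rewrite normr1.
    by apply: (le_trans n1); rewrite mul1r subr0 ler_wsqrtr.
  exact: (le_trans (n2_sub b 0 x (lexx 0) x0' xb' bz) hZ).
have E2 : (Lp_norm 0 b +oo (z t \- broken_fun N r (zh r s t))%R <= (2 * K * b * Z)%:E)%E.
  apply: (Linf_mesh_le b N r hm) => [|i x iN xi]; first by rewrite !mulr_ge0// ltW.
  have [/andP[x0 xb] xI xi'] := nd i x iN xi; have x0' := ltW x0; have xb' := ltW xb.
  rewrite /= (broken_funE _ _ _ hm _ i x iN xi) (zh_itg k b T Ub N r s b0 hm hs t tI i x iN xi').
  have [_ _ ->] := hwgz t x tT xI.
  rewrite -(itgB (bmS 0 x (lexx 0) xb' bgu) (bmS 0 x (lexx 0) xb' bgf)).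
  have bd := bmS 0 x (lexx 0) xb' (bmB _ _ _ _ bgu bgf).
  apply: (@le_trans _ _ (2 * K * Z * (x - 0))).
    apply: (itg_bound _ x0' bd) => y /andP[y0 yx]; apply: hg; apply/andP; split; lra.
  rewrite subr0 [leRHS]mulrAC; exact: ler_wpM2l.
have E3 : (Lp_norm 0 b +oo (g t \- broken_fun N r (gh r s t))%R <= (2 * K * Z)%:E)%E.
  apply: (Linf_mesh_le b N r hm) => // i x iN xi; have [xo xI xi'] := nd i x iN xi.
  rewrite /= (broken_funE _ _ _ hm _ i x iN xi) (gh_gg k b T Ub N r s b0 hm hs t tI i x iN xi').
  have [_ -> _] := hwgz t x tT xI; exact: hg.
have E4 : (Lp_norm 0 b +oo (avg z t \- broken_fun N r (gtildeh r s t))%R <= (2 * K * Z)%:E)%E.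
  apply: (Linf_mesh_le b N r hm) => // i x iN xi; have [xo xI xi'] := nd i x iN xi.
  rewrite /= (broken_funE _ _ _ hm _ i x iN xi) (gtildeh_gt k b T Ub N r s b0 hm hs t tI i x iN xi').
  have -> : avg z t x = gt b (u t) x.
    by have [_ _ zE] := hwgz t x tT xI; rewrite /avg zE gt_av//; case/andP: xo.
  exact: (gt_sup b b0 (u t) f (2 * K * Z) x gu gf hg xI).
have E5 : (mesh_norm N r (fun i => (avg w t \- utildeh r s t i)%R) <= (2 * Z)%:E)%E.
  have hv i x : (i < N)%N -> r i < x < r i.+1 -> (avg w t \- utildeh r s t i)%R x = av (fun y => u t y - f y) x.
    move=> iN xi; have [/andP[x0 xb] xI xi'] := nd i x iN xi.
    rewrite /= (utildeh_av k b T Ub N r s b0 hm hs t tI i x iN xi' x0).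
    by have [wE _ _] := hwgz t x tT xI; rewrite /avg wE (avB b gu.1 gf.1 (ltW xb)).
  rewrite (mesh_normE b N r hm _ _ (bm_av b _ bz) hv) lee_fin.
  have pz : pgood b N r (fun y => u t y - f y) := pgoodB b N r _ _ pu pf.
  by apply: (le_trans (n2_av b N r b0 hm _ pz)); rewrite ler_pM2l.
apply: (le_trans (leeD (leeD (leeD (leeD E1 E2) E3) E4) E5)).
by rewrite -!EFinD lee_fin; apply: eq_ler; ring.
Qed.

End ErrorBound.

Theorem corollary4p5 (R : realType) (k : nat) (b T : R) (Ub : R -> R)
    (u w g z : R -> R -> R)
    (hk : (1 <= k)%N) (hb : 0 < b) (hT : 0 < T)
    (hexact : exact_solution b T Ub u w g z)
    (hu : in_Linfty_sobolev T b k.+1 +oo%E u)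
    (hut : in_Linfty_sobolev T b k.+1 2%:E (dt u)) :
  exists h0 C : R, [/\ 0 < h0, 0 < C &
    forall (N : nat) (r : nat -> R) (s : hdg_unknowns R),
      mesh b N r -> 0 < mesh_size N r <= h0 ->
      hdg_solution k b T Ub N r s -> hdg_initial k N r u s ->
      (ereal_sup [set hdg_error b N r w g z s t | t in `[0%R, T]] <=
         (C * mesh_size N r ^+ k.+1)%:E)%E].
Proof.
have [[L [V [Ut hr]]] hwgz] := regular_exists k b T Ub u w g z hk hb hT hexact hu hut.
have [C C0 hC] := inv_ineq (R := R) k.+1; have [Cp Cp0 hCp] := proj_approx (R := R) k.
have invC : inverse_ineq k.+1 C by move=> x y q xy sq; have [] := hC x y q xy sq.
have traceC : trace_ineq k.+1 C by move=> x y q xy sq; have [] := hC x y q xy sq.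
have weightC : weight_ineq k.+1 C by move=> x y q xy sq; have [] := hC x y q xy sq.
have approxC (a c : R) f (p : {poly R}) E : a < c -> bm a c f -> (size p <= k.+1)%N ->
    (forall x, a <= x <= c -> `|f x - p.[x]| <= E) ->
    forall x, a <= x <= c -> `|f x - (l2p k a c f).[x]| <= Cp * E.
  by move=> ac hf sp fp x xac; have [/(_ x xac)[]] := hCp a c f p E ac hf sp fp.
have hUb t : 0 <= t <= T -> u t b = Ub t by move=> tT; apply: (exact_u_outer hexact); rewrite in_itv.
pose D := B0 k b T L C Cp * expR (lam k b T L C Cp * T).
have B1 := B0_ge1 k b T L hb C Cp.
have D0 : 0 < D by rewrite mulr_gt0 ?expR_gt0// (lt_le_trans ltr01).
pose Kk := Kc k b L; pose Zc := CE k b T L C + L * Num.sqrt b.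
pose M := (Num.sqrt b + 2 * Kk * b + 4 * Kk + 2) * Zc.
have K0 : 0 <= Kk := Kc_ge0 k b T L u V Ut hb hr.
have Zc0 : 0 <= Zc by rewrite addr_ge0 ?(CE_ge0 k b T L u V Ut hb hr)// mulr_ge0 ?sqrtr_ge0// (rg_L hr).
have M0 : 0 <= M by rewrite mulr_ge0// !addr_ge0 ?sqrtr_ge0// !mulr_ge0// ltW.
(* The threshold is the smallness asked by [dgn_le1]; the added 1 makes the constant positive. *)
exists D^-1, (M + 1); split; [by rewrite invr_gt0|by rewrite ltr_wpDl|].
move=> N r s hm /andP[H0 Hh] hs hi.
have small : B0 k b T L C Cp * mesh_size N r * expR (lam k b T L C Cp * T) <= 1.
  by rewrite mulrAC -/D -(ler_pdivlMl _ _ D0) mulr1.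
have dgn1 t (tT : 0 <= t <= T) := dgn_le1 k b T L u V Ut Ub hk hb hT hr N r s hm hs hUb hi C C0 invC
  traceC weightC Cp Cp0 approxC H0 small t tT.
have Hk : 0 <= mesh_size N r ^+ k.+1 by rewrite exprn_ge0// ltW.
apply: ge_ereal_sup => _ [t + <-]; rewrite /= in_itv/= => tT.
have l1 : n2 0 b (bf N r (eR k r s t (u t))) <= CE k b T L C * mesh_size N r ^+ k.+1.
  apply: (level1_dynamic k b T L u V Ut Ub hb hT hr N r s hm hs hUb hi C C0 invC t tT) => t' /andP[t0 tt].
  by apply: dgn1; rewrite t0 (le_trans tt)//; case/andP: tT.
have hZ : n2 0 b (fun x => u t x - bf N r (uh s t) x) <= Zc * mesh_size N r ^+ k.+1.
  apply: (le_trans (n2_zeta k b T L u V Ut hb hr N r s hm t tT)).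
  by rewrite /Zc [leRHS]mulrDl [X in _ + X]mulrAC lerD2r.
have hK := Kf_uh k b T L u V Ut hb hr N r s hm t tT (dgn1 t tT).
apply: (le_trans (hdg_error_le k b T L u V Ut w g z Ub hb hr hwgz N r s hm hs t _ tT hK hZ)).
by rewrite lee_fin mulrA -/Kk -/M; apply: ler_wpM2r => //; rewrite lerDl.
Qed.
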